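(* Let $T$ be a diagram, with ordered crossings, of an outside tangle with boundary $P_n$. The map $\delta_T:[\![T\rangle\!\rangle\to\mathcal B\Gamma_n\otimes_{\mathcal I_n}[\![T\rangle\!\rangle$ satisfies $$(\mu_{\mathcal B\Gamma_n}\otimes\mathbb I)\,(\mathbb I\otimes\delta_T)\,\delta_T+(d_{\Gamma_n}\otimes|\mathbb I|)\,\delta_T=0,$$ where $\mu_{\mathcal B\Gamma_n}:\mathcal B\Gamma_n\otimes\mathcal B\Gamma_n\to\mathcal B\Gamma_n$ is the multiplication map.
   Context: **Cleaved links and bridges.** Let $P_n=\{(0,1),\dots,(0,2n)\}\subset\mathbb R^2$, $\overleftarrow{\mathbb H}=(-\infty,0]\times\mathbb R$ (left), $\overrightarrow{\mathbb H}=[0,\infty)\times\mathbb R$ (right). A planar matching of $P_n$ in a half-plane is a proper embedding of $n$ disjoint arcs with endpoint set $P_n$, up to isotopy of the half-plane fixing its boundary pointwise. An $n$-cleaved link $L$ is a disjoint union of embedded circles in $\mathbb R^2$, transverse to the $y$-axis and meeting it exactly in $P_n$, each circle meeting $P_n$, up to isotopy of $\mathbb R^2$ fixing the $y$-axis pointwise; equivalently a left matching $\overleftarrow L=L\cap\overleftarrow{\mathbb H}$ glued to a right matching $\overrightarrow L=L\cap\overrightarrow{\mathbb H}$. An arc of $L$ is an arc of $\overleftarrow L$ or $\overrightarrow L$; $\mathrm{cir}(L)$ is the set of circles. A decoration is a map $\sigma:\mathrm{cir}(L)\to\{+,-\}$; if $\sigma(C)=+$, $\sigma_C$ is $\sigma$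 changed to $-$ on $C$. A bridge $\gamma$ of a matching (or of $L$) is an embedded arc in the interior of one half-plane with endpoints (feet) on two distinct arcs in that half-plane and interior disjoint from them, up to isotopy preserving the matching and fixing the $y$-axis (feet may slide along arcs). It is left or right according to its half-plane (its location). $L_\gamma$ (resp. $m_\gamma$ for a matching $m$) is the result of surgery along $\gamma$, and $\gamma^\dagger$ is the bridge of $L_\gamma$ given by the co-core. $\gamma$ is a merge if its feet lie on two different circles of $L$ and a division if both lie on one circle. The support of $\gamma$ is the set of three circles of $L$ and $L_\gamma$ containing the feet of $\gamma$ and $\gamma^\dagger$. For a bridge $\gamma'\neq\gamma$ of $L$: $\gamma'\in B_\pitchfork(L,\gamma)$ if all representatives of $\gamma'$ meet $\gamma$; otherwise $\gamma'\in B_{||}(L,\gamma)$, and then $\gamma'\in B_d(L,\gamma)$ if no foot of $\gamma'$ is on an arc containing a foot of $\gamma$ (in particular if the locations differ), $\gamma'\in B_s(L,\gamma)$ (resp. $B_o(L,\gamma)$) if exactly one end of $\gamma'$ is on an arc containing a foot of $\gamma$ and it lies on the same (resp. opposite) side of that arc as $\gamma$. **The graph $\Gamma_n$.** Vertices: pairs $(L,\sigma)$. Bridge edges $e_{(\gamma;\sigma,\sigma')}:(L,\sigma)\to(L_\gamma,\sigma')$, for each bridge $\gamma$ of $L$ and each $\sigma'$ that agrees with $\sigma$ on circles outside the support and satisfies: for a merge of $C_1,C_2$ to $C$, $(+,+)\mapsto+$, $(+,-)\mapsto-$, $(-,+)\mapsto-$ (no edge for $(-,-)$); for a division of $C$ into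 $C_1,C_2$, $+\mapsto(+,-)$ or $(-,+)$ (two edges), $-\mapsto(-,-)$. Location of the edge = location of $\gamma$. Decoration edges: for each $C$ with $\sigma(C)=+$, two edges $(L,\sigma)\to(L,\sigma_C)$, one left $\overleftarrow{e_C}$ and one right $\overrightarrow{e_C}$, with support $\{C\}$. **The algebra $\mathcal B\Gamma_n$.** $\mathcal Q\Gamma_n$ is the path algebra over $\mathbb Z$ ($\alpha\beta$ = first $\alpha$, then $\beta$), with idempotents $I_{(L,\sigma)}$ (empty paths). It is bigraded by $I_{(L,\sigma)}\mapsto(0,0)$, $\overrightarrow{e_C}\mapsto(0,-1)$, $\overleftarrow{e_C}\mapsto(1,1)$, right bridge edges $\mapsto(0,-\tfrac12)$, left bridge edges $\mapsto(1,\tfrac12)$; $l(\alpha)$ is the first entry. $\mathcal B\Gamma_n$ is the quotient by: (R1) If $e_\alpha,e_\beta$ start at the same vertex and have disjoint supports, then $e_\alpha e_{\beta'}=(-1)^{l(e_\alpha)l(e_\beta)}e_\beta e_{\alpha'}$, where $e_{\alpha'}$ (resp. $e_{\beta'}$) is the edge for the same bridge or circle, with the same location and the same effect on decorations of its support, starting at the target of $e_\beta$ (resp. $e_\alpha$). (R2) For a bridge $\gamma$ (either location) merging $C_1,C_2$, both $+$, into $C$: $\overrightarrow{e_{C_1}}m=\overrightarrow{e_{C_2}}m=m\overrightarrow{e_C}$; for $\gamma$ dividing a $+$ circle $C$ into $C_1,C_2$: $\overrightarrow{e_C}f=f^1\overrightarrow{e_{C_1}}=f^2\overrightarrow{e_{C_2}}$.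 Here $m,f$ denote the appropriate edges for $\gamma$ and $f^i$ is the division edge decorating $C_i$ by $+$ and the other circle by $-$. (R3) In the same situations, with $\epsilon=+1$ if $\gamma$ is left and $\epsilon=-1$ if $\gamma$ is right: $\overleftarrow{e_{C_1}}m+\overleftarrow{e_{C_2}}m+\epsilon\,m\overleftarrow{e_C}=0$ and $\overleftarrow{e_C}f+\epsilon(f^1\overleftarrow{e_{C_1}}+f^2\overleftarrow{e_{C_2}})=0$. (R4) If $\gamma,\gamma'$ are disjoint arcs representing distinct bridges of $L$ and either at least one is right, or both are left and $\gamma'\in B_d(L,\gamma)\cup B_o(L,\gamma)$, then $e_{(\gamma;\sigma_{00},\sigma_{01})}e_{(\gamma';\sigma_{01},\sigma_{11})}=(-1)^{l(e_\gamma)l(e_{\gamma'})}e_{(\gamma';\sigma_{00},\sigma_{10})}e_{(\gamma;\sigma_{10},\sigma_{11})}$ for all decorations for which these edges exist (the same actual arcs being used in $L,L_\gamma,L_{\gamma'}$). (R5) If $\gamma,\gamma'$ are left, $\gamma\in B_s(L,\gamma')$, and $\gamma''$ is obtained by sliding the end of $\gamma$ over $\gamma'$, let $\delta$ be the common class of $\gamma',\gamma''$ in $L_\gamma$, $\zeta$ that of $\gamma,\gamma''$ in $L_{\gamma'}$, $\eta$ that of $\gamma,\gamma'$ in $L_{\gamma''}$. Then $e_\gamma e_\delta+e_{\gamma'}e_\zeta+e_{\gamma''}e_\eta=0$ for fixed initial and final decorations (terms that do not exist are omitted). (R6) If $\gamma$ is left and $\eta\in B_\pitchfork(L_\gamma,\gamma^\dagger)$,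 then $e_{(\gamma;\sigma,\sigma')}e_{(\eta;\sigma',\sigma'')}=0$. (R7) If $\gamma$ is right and $(L,\sigma)\to(L_\gamma,\sigma')\to(L,\sigma_C)$ is a path along $\gamma$ and then $\gamma^\dagger$, then $e_{(\gamma;\sigma,\sigma')}e_{(\gamma^\dagger;\sigma',\sigma_C)}=\overrightarrow{e_C}$. $\mathcal I_n$ is the subalgebra generated by the idempotents. $d_{\Gamma_n}$ is the bidegree $(1,0)$ differential determined by $d(\overleftarrow{e_C})=-\sum e_{(\gamma;\sigma,\sigma')}e_{(\gamma^\dagger;\sigma',\sigma_C)}$ (sum over all such length-two paths $(L,\sigma)\to(L_\gamma,\sigma')\to(L,\sigma_C)$ with $\gamma$ left), $d=0$ on all other edges and on idempotents, and $d(\alpha\beta)=(-1)^{l(\beta)}d(\alpha)\beta+\alpha\,d(\beta)$. **Tangles and states.** An outside tangle with boundary $P_n$ is a smooth proper embedding of $n$ intervals and finitely many circles in $[0,\infty)\times\mathbb R^2$ with boundary $\{(0,k,0):1\le k\le 2n\}$. A diagram $T$ in $\overrightarrow{\mathbb H}$ is a generic projection to the $xy$-plane with crossing information; its set of crossings is ordered. A map $\rho:\{\text{crossings}\}\to\{0,1\}$ determines a crossingless diagram $\rho(T)$, where the $0$-smoothing joins the two regions swept out by rotating the overstrand counterclockwise to the understrand, and the $1$-smoothing is the other one. For each $c$ with $\rho(c)=0$ there is an active arc $\gamma_c$, surgery along which changes the smoothing at $c$ to $1$. A resolution is $r=(\rho,\overleftarrow m)$ with $\overleftarrow m$ a left planar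 matching of $P_n$, with diagram $\overleftarrow m\#\rho(T)$. Its circles contained in the interior of $\overrightarrow{\mathbb H}$ are free; those meeting the $y$-axis are cleaved and form an $n$-cleaved link $\mathrm{cl}(r)$. A state is $(r,s)$ with $s$ a $\{+,-\}$-decoration of all circles of $r$; $\partial(r,s)=(\mathrm{cl}(r),s|_{\mathrm{cl}(r)})$. $[\![T\rangle\!\rangle$ is the free abelian group on states, with $I_{(L,\sigma)}(r,s)=(r,s)$ if $\partial(r,s)=(L,\sigma)$ and $0$ otherwise. Put $h(r)=\sum_c\rho(c)$; the bigrading of $(r,s)$ is $(h(r),q)$ with $q=h(r)+\sum_{\text{free}}(\pm1)+\tfrac12\sum_{\text{cleaved}}(\pm1)$. The signed identity is $|\mathbb I|(r,s)=(-1)^{h(r)}(r,s)$. For a crossing $c$, $I(r,c)$ is the number of crossings $c'>c$ with $\rho(c')=1$; $r_\gamma$ is the resolution after surgery on $\gamma$. **The map $\delta_T$.** $$\delta_T(r,s)=I_{\partial(r,s)}\otimes d(r,s)+\sum_{\gamma}B(\gamma)+\sum_{\gamma_c\in\mathrm{dec}(r,s)}(-1)^{I(r,c)}\overrightarrow{e_{C(\gamma_c)}}\otimes(r_{\gamma_c},s_{\gamma_c})+\sum_{C\text{ cleaved},\,s(C)=+}(-1)^{h(r)}\overleftarrow{e_C}\otimes(r,s_C).$$ (i) $d(r,s)=\sum_{\gamma_c\text{ active}}(-1)^{I(r,c)}D_{\gamma_c}(r,s)$, where $D_{\gamma_c}$ changes the smoothing at $c$ and: if it merges two free circles, $++\mapsto+$,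 $+-,-+\mapsto-$, $--\mapsto0$; if it divides a free circle, $+\mapsto(+-)+(-+)$, $-\mapsto(--)$; if both feet are on the same arc component of $\rho(T)$, the new free circle gets $-$; if one foot is on an arc and the other on a free circle $C'$, the term is the merged diagram with cleaved decorations unchanged if $s(C')=+$, and $0$ if $s(C')=-$; it is $0$ in all other cases. (ii) $\gamma$ runs over the active arcs with feet on two distinct arc components of $\rho(T)$ (right bridges) and the bridges of $\overleftarrow m$ (left bridges). With $\sigma=s|_{\mathrm{cl}(r)}$, $B(\gamma)$ is the sum over all bridge edges $e_{(\gamma;\sigma,\sigma')}$ of $(-1)^{I(r,c)}e_{(\gamma;\sigma,\sigma')}\otimes(r_\gamma,s')$ if $\gamma=\gamma_c$ is active, and of $(-1)^{h(r)}e_{(\gamma;\sigma,\sigma')}\otimes((\rho,\overleftarrow m_\gamma),s')$ if $\gamma$ is left; $s'$ equals $\sigma'$ on cleaved and $s$ on free circles. (iii) $\mathrm{dec}(r,s)$ consists of the active $\gamma_c$ such that either both feet are on the same arc in $\overrightarrow{\mathbb H}$ of a cleaved circle $C(\gamma_c)$ with decoration $+$ (then $s_{\gamma_c}$ gives $-$ to $C(\gamma_c)$ and $+$ to the new free circle), or one foot is on a $+$ cleaved circle $C(\gamma_c)$ and the other on a $-$ free circle (then $s_{\gamma_c}$ gives $-$ to the merged cleaved circle); other decorations are unchanged. *)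

(* Defs.v *)
From HB Require Import structures.
From mathcomp Require Import all_boot all_order all_algebra.
From mathcomp Require Import finmap.
From mathcomp Require Import monalg boolp.

Set Implicit Arguments.
Unset Strict Implicit.
Unset Printing Implicit Defensive.

Import GRing.Theory.
Local Open Scope ring_scope.
Local Open Scope quotient_scope.

(* A planar matching of P_n, up to isotopy, is a crossingless fixed-point-free
   involution; i : 'I_n.*2 stands for the point (0, i + 1), and the arc through
   i is the set {i, m i}. *)
Definition planar n (m : {ffun 'I_n.*2 -> 'I_n.*2}) : bool :=
  [forall i, (m i != i) && (m (m i) == i)] &&
  [forall i : 'I_n.*2, forall j : 'I_n.*2, (i < j < m i)%N ==> (i < m j < m i)%N].

Record matching n := Matching {
  mate :> {ffun 'I_n.*2 -> 'I_n.*2};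
  _ : planar mate }.
HB.instance Definition _ n := [isSub for @mate n].
HB.instance Definition _ n := [Finite of matching n by <:].

Definition under n (m : matching n) (k : 'I_n.*2) : {set 'I_n.*2} :=
  [set p : 'I_n.*2 | (k < p < m k)%N].

(* The regions of the complement of a matching are discs, so an isotopy class of
   bridges is a pair of distinct arcs on the boundary of one region, i.e. two
   arcs which no third arc separates. It is recorded by the set A of the four
   endpoints of these two arcs. With this encoding the dual bridge of A after
   surgery is again A. *)
Definition is_bridge n (m : matching n) (A : {set 'I_n.*2}) : bool :=
  [&& #|A| == 4, [forall i in A, m i \in A] &
   [forall k : 'I_n.*2, (k \notin A) && (k < m k)%N ==>
      (A \subset under m k) || [disjoint A & under m k]]].

(* Arcs of planar matchings join points of opposite parities, so the four points
   of a bridge admit exactly two admissible pairings: that of m, and the result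
   of surgery. The default value m of insubd is only taken if A is not a bridge. *)
Definition surg_fun n (m : matching n) (A : {set 'I_n.*2}) :
    {ffun 'I_n.*2 -> 'I_n.*2} :=
  [ffun i => if i \in A
     then odflt i [pick j in A | (odd j != odd i) && (j != m i)]
     else m i].
Definition surg n (m : matching n) (A : {set 'I_n.*2}) : matching n :=
  insubd m (surg_fun m A).

(* The unions of A and of B with the arcs they join meet unavoidably iff the
   blocks A and B cross; sharing an arc never forces an intersection. *)
Definition pitchfork n (A B : {set 'I_n.*2}) : bool :=
  [disjoint A & B] &&
  [exists a1 in A, exists a2 in A, exists b1 in B, exists b2 in B,
     (a1 < b1 < a2)%N && (a2 < b2)%N || (b1 < a1 < b2)%N && (b2 < a2)%N].

(* A and B share exactly one arc, and leave it on the same side. *)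
Definition same_side n (m : matching n) (A B : {set 'I_n.*2}) : bool :=
  (A != B) &&
  [exists k in A :&: B, (k < m k)%N &&
     ((A :\: B \subset under m k) == (B :\: A \subset under m k))].

(* If A and B share the arc {q, m q}, surgery along A cuts this arc at the foot
   of A; this is the bridge of surg m A induced by B when the foot of B lies on
   the piece ending at q. *)
Definition carried n (m : matching n) (A B : {set 'I_n.*2}) (q : 'I_n.*2) :
    {set 'I_n.*2} :=
  (B :\: A) :|: [set q; surg m A q].

(* D is a class in surg m A of B, where A and B share an arc. *)
Definition class_of n (m : matching n) (A B D : {set 'I_n.*2}) : bool :=
  is_bridge (surg m A) D && [exists q in A :&: B, D == carried m A B q].

(* Cleaved links: (left matching, right matching). In what follows a boolean l
   is a location: true for left, false for right. *)
Notation link n := (matching n * matching n)%type.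

Definition half n (L : link n) (l : bool) : matching n := if l then L.1 else L.2.
Definition surgL n (L : link n) (l : bool) (A : {set 'I_n.*2}) : link n :=
  if l then (surg L.1 A, L.2) else (L.1, surg L.2 A).

(* A circle is recorded by the set of points of P_n it contains. *)
Definition joined n (L : link n) : rel 'I_n.*2 :=
  fun p q => (q == L.1 p) || (q == L.2 p).
Definition circ n (L : link n) (p : 'I_n.*2) : {set 'I_n.*2} :=
  [set q | connect (joined L) p q].
Definition cir n (L : link n) : {set {set 'I_n.*2}} :=
  [set circ L p | p : 'I_n.*2].

(* There are disjoint arcs representing the distinct bridges A (at location l)
   and B (at location k) of L such that, for these arcs, B becomes B' in L_A and
   A becomes A' in L_B. If the bridges share an arc {q, m q}, the foot of B is
   on the piece ending at m q, and the foot of A on the piece ending at q. *)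
Definition disjoint_arcs n (L : link n) (l : bool) (A : {set 'I_n.*2})
    (k : bool) (B A' B' : {set 'I_n.*2}) : bool :=
  let m := half L l in
  if l != k then (A' == A) && (B' == B)
  else if [disjoint A & B] then [&& ~~ pitchfork A B, A' == A & B' == B]
  else (A != B) && [exists q in A :&: B,
         (B' == carried m A B (m q)) && (A' == carried m B A q)].

(* Vertices of Gamma_n: a decoration is a function on P_n which is constant on
   circles; true stands for +. *)
Definition decorated n (v : link n * {ffun 'I_n.*2 -> bool}) : bool :=
  [forall p, forall q, joined v.1 p q ==> (v.2 p == v.2 q)].
Record vertex n := Vertex {
  vertex_val :> link n * {ffun 'I_n.*2 -> bool};
  _ : decorated vertex_val }.
HB.instance Definition _ n := [isSub for @vertex_val n].
HB.instance Definition _ n := [Finite of vertex n by <:].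
Definition lnk n (v : vertex n) : link n := (val v).1.
Definition sgn n (v : vertex n) : {ffun 'I_n.*2 -> bool} := (val v).2.

(* (true, l, A): bridge A at location l; (false, l, C): circle C, location l.
   An edge is determined by its source, label and target. *)
Notation label n := (bool * bool * {set 'I_n.*2})%type.
Definition Br n (l : bool) (A : {set 'I_n.*2}) : label n := (true, l, A).
Definition De n (l : bool) (C : {set 'I_n.*2}) : label n := (false, l, C).
Definition left_label n (x : label n) : bool := x.1.2.

(* The points on the circles of the support. *)
Definition supp n (L : link n) (x : label n) : {set 'I_n.*2} :=
  if x.1.1 then \bigcup_(p in x.2) circ L p else x.2.

(* The last two clauses are the multiplication and the comultiplication; for a
   merge only the first one is not vacuous, for a division only the second. *)
Definition bridge_edge n (v : vertex n) (l : bool) (A : {set 'I_n.*2})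
    (w : vertex n) : bool :=
  [&& is_bridge (half (lnk v) l) A,
      lnk w == surgL (lnk v) l A,
      [forall p, (p \notin supp (lnk v) (Br l A)) ==> (sgn w p == sgn v p)],
      [forall p in A, forall q in A, (q \notin circ (lnk v) p) ==>
         (sgn v p || sgn v q) && (sgn w p == sgn v p && sgn v q)] &
      [forall p in A, forall q in A, (q \notin circ (lnk w) p) ==>
         ~~ (sgn w p && sgn w q) && (sgn v p == sgn w p || sgn w q)]].

Definition decoration_edge n (v : vertex n) (C : {set 'I_n.*2})
    (w : vertex n) : bool :=
  [&& C \in cir (lnk v), [forall p in C, sgn v p], lnk w == lnk v &
      sgn w == [ffun p => (p \notin C) && sgn v p]].

Definition is_edge n (v : vertex n) (x : label n) (w : vertex n) : bool :=
  if x.1.1 then bridge_edge v x.1.2 x.2 w else decoration_edge v x.2 w.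

Fixpoint walk n (v : vertex n) (s : seq (label n * vertex n)) : bool :=
  if s is (x, w) :: s' then is_edge v x w && walk w s' else true.

Record gpath n := GPath {
  gpath_val :> vertex n * seq (label n * vertex n);
  _ : walk gpath_val.1 gpath_val.2 }.
HB.instance Definition _ n := [isSub for @gpath_val n].
HB.instance Definition _ n := [Choice of gpath n by <:].

Definition src n (p : gpath n) : vertex n := (val p).1.
Definition steps n (p : gpath n) : seq (label n * vertex n) := (val p).2.
Definition tgt n (p : gpath n) : vertex n := last (src p) (unzip2 (steps p)).
(* The second entry of the bigrading, half-integral, plays no role here. *)
Definition ldeg n (p : gpath n) : nat := count (fun e => left_label e.1) (steps p).

Definition sg (k : nat) : int := (-1) ^+ k.

Definition QG n := {malg int[gpath n]}.
HB.instance Definition _ n := GRing.Zmodule.on (QG n).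

(* bas, lext and mulQ are locked because unification would otherwise unfold
   the representation of malg. *)
Fact QG_key : unit. Proof. by []. Qed.
Definition bas n (p : gpath n) : QG n := locked_with QG_key << p >>.
Definition lext (K : choiceType) (V : zmodType) (f : K -> V)
    (x : {malg int[K]}) : V :=
  locked_with QG_key (\sum_(k <- msupp x) f k *~ x@_k).

(* 0 if there is no such path *)
Definition pth n (v : vertex n) (s : seq (label n * vertex n)) : QG n :=
  if insub (v, s) is Some p then bas p else 0.

Definition pmul n (p q : gpath n) : QG n :=
  if tgt p == src q then pth (src p) (steps p ++ steps q) else 0.

Definition mulQ n (x y : QG n) : QG n :=
  locked_with QG_key (lext (fun p => lext (pmul p) y) x).
Definition oneQ n : QG n := \sum_(v : vertex n) pth v [::].

Lemma lextE (K : choiceType) (V : zmodType) (f : K -> V) (x : {malg int[K]}) :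
  lext f x = \sum_(k <- msupp x) f k *~ x@_k.
Proof. by rewrite /lext unlock. Qed.

Lemma lextEw (K : choiceType) (V : zmodType) (f : K -> V) (x : {malg int[K]})
  (d : {fset K}) : (msupp x `<=` d)%fset ->
  lext f x = \sum_(k <- d) f k *~ x@_k.
Proof.
move=> sd; rewrite lextE (big_fset_incl _ sd) //= => k _ /mcoeff_outdom ->.
by rewrite mulr0z.
Qed.

Lemma lextB (K : choiceType) (V : zmodType) (f : K -> V) :
  zmod_morphism (lext f).
Proof.
move=> x y; set d := (msupp x `|` msupp y `|` msupp (x - y))%fset.
have [sx sy sxy] : [/\ msupp x `<=` d, msupp y `<=` d & msupp (x - y) `<=` d]%fset.
  by split; apply/fsubsetP => k; rewrite !in_fsetU => ->; rewrite ?orbT.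
rewrite (lextEw f sx) (lextEw f sy) (lextEw f sxy).
by rewrite -sumrB; apply: eq_bigr => k _; rewrite mcoeffB mulrzBr.
Qed.
HB.instance Definition _ (K : choiceType) (V : zmodType) (f : K -> V) :=
  GRing.isZmodMorphism.Build {malg int[K]} V (lext f) (lextB f).

Lemma lextU (K : choiceType) (V : zmodType) (f : K -> V) k : lext f << k >> = f k.
Proof.
by rewrite (lextEw _ msuppU_le) big_seq_fset1 mcoeffUU.
Qed.

Lemma malg_ind (K : choiceType) (P : {malg int[K]} -> Prop) :
  P 0 -> (forall x y, P x -> P y -> P (x - y)) -> (forall k, P << k >>) ->
  forall x, P x.
Proof.
move=> P0 PB PU x.
have PN y : P y -> P (- y) by rewrite -sub0r; apply: PB.
have PD y z : P y -> P z -> P (y + z) by move=> Py Pz; rewrite -[z]opprK; apply/PB/PN.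
rewrite [x]monalgE; apply: (big_ind P) => // k _.
have PM y m : P y -> P (y *+ m).
  by move=> Py; elim: m => [|m IH] //; rewrite mulrS; apply: PD.
have -> : << x@_k *g k >> = (<< k >> : {malg int[K]}) *~ x@_k.
  by apply/malgP => j; rewrite raddfMz /= !mcoeffU; case: eqP; rewrite ?mulr1n ?intz ?mulr0n ?mul0rz.
by case: (x@_k) => m; [rewrite -pmulrn | rewrite NegzE mulrNz -pmulrn; apply: PN]; apply: PM.
Qed.

Lemma QG_ind n (P : QG n -> Prop) :
  P 0 -> (forall x y, P x -> P y -> P (x - y)) -> (forall p, P (bas p)) ->
  forall x, P x.
Proof.
move=> P0 PB PU; apply: malg_ind => // p.
by have := PU p; rewrite /bas unlock.
Qed.

Lemma lext_bas n (V : zmodType) (f : gpath n -> V) p : lext f (bas p) = f p.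
Proof. rewrite /bas unlock; exact: lextU. Qed.

Lemma mulQE n (x y : QG n) : mulQ x y = lext (fun p => lext (pmul p) y) x.
Proof. by rewrite /mulQ unlock. Qed.

Lemma mulQUU n (p q : gpath n) : mulQ (bas p) (bas q) = pmul p q.
Proof.
rewrite mulQE.
exact (etrans (lext_bas (fun p => lext (pmul p) (bas q)) p) (lext_bas (pmul p) q)).
Qed.

Lemma mulQBl n (x y z : QG n) : mulQ (x - y) z = mulQ x z - mulQ y z.
Proof. rewrite !mulQE; exact: (lextB (fun p => lext (pmul p) z)). Qed.

Lemma mulQBr n (x y z : QG n) : mulQ x (y - z) = mulQ x y - mulQ x z.
Proof.
rewrite !mulQE !lextE -sumrB; apply: eq_bigr => p _.
by rewrite (lextB (pmul p)) mulrzBl.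
Qed.

Lemma mul0Q n (x : QG n) : mulQ 0 x = 0.
Proof. by have := mulQBl 0 0 x; rewrite !subrr. Qed.
Lemma mulQ0 n (x : QG n) : mulQ x 0 = 0.
Proof. by have := mulQBr x 0 0; rewrite !subrr. Qed.

Lemma walk_cat n (v : vertex n) s t :
  walk v (s ++ t) = walk v s && walk (last v (unzip2 s)) t.
Proof. by elim: s v => //= -[x w] s IH v /=; rewrite IH andbA. Qed.

Lemma pthE n (p : gpath n) : pth (src p) (steps p) = bas p.
Proof. by rewrite /pth /src /steps -surjective_pairing valK. Qed.

Lemma pth_walk n (v : vertex n) s : walk v s ->
  exists p, [/\ pth v s = bas p, src p = v & steps p = s].
Proof.
by move=> w; exists (GPath (w : walk (v, s).1 (v, s).2)); rewrite /pth insubT.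
Qed.

Lemma tgt_cat n (p q pq : gpath n) : src pq = src p ->
  steps pq = steps p ++ steps q -> tgt p = src q -> tgt pq = tgt q.
Proof. by move=> Es Et E; rewrite /tgt Es Et /unzip2 map_cat last_cat -/(tgt p) E. Qed.

Lemma pmulE n (p q : gpath n) : tgt p = src q ->
  exists pq, [/\ pmul p q = bas pq, src pq = src p, tgt pq = tgt q &
                 steps pq = steps p ++ steps q].
Proof.
move=> E; have /pth_walk [pq [Epq Es Et]] : walk (src p) (steps p ++ steps q).
  by rewrite walk_cat (valP p) -/(tgt p) E (valP q).
by exists pq; rewrite /pmul E eqxx Epq (tgt_cat Es Et E).
Qed.

Lemma pmulA n (p q r : gpath n) :
  mulQ (bas p) (pmul q r) = mulQ (pmul p q) (bas r).
Proof.
case: (altP (tgt q =P src r)) => [Eqr|Nqr]; last first.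
  rewrite {1}/pmul (negPf Nqr) (mulQ0 (bas p)).
  case: (altP (tgt p =P src q)) => [/pmulE [pq [-> _ E _]]|Npq].
    by rewrite mulQUU /pmul E (negPf Nqr).
  by rewrite /pmul (negPf Npq) (mul0Q (bas r)).
have [qr [-> Es _ Et]] := pmulE Eqr; rewrite mulQUU.
case: (altP (tgt p =P src q)) => [Epq|Npq]; last first.
  by rewrite /pmul Es (negPf Npq) (mul0Q (bas r)).
have [pq [-> Es' E' Et']] := pmulE Epq.
by rewrite mulQUU /pmul Es E' Epq Eqr !eqxx Es' Et Et' catA.
Qed.

Lemma mulQA n : associative (@mulQ n).
Proof.
move=> x y z; elim/QG_ind: z => [|z1 z2 E1 E2|r].
- exact (etrans (congr1 (mulQ x) (mulQ0 y))
    (etrans (mulQ0 x) (esym (mulQ0 (mulQ x y))))).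
- exact (etrans (congr1 (mulQ x) (mulQBr y z1 z2))
    (etrans (mulQBr x (mulQ y z1) (mulQ y z2))
    (etrans (congr2 (fun a b => a - b) E1 E2) (esym (mulQBr (mulQ x y) z1 z2))))).
elim/QG_ind: y => [|y1 y2 E1 E2|q].
- exact (etrans (congr1 (mulQ x) (mul0Q (bas r)))
    (etrans (mulQ0 x) (esym (etrans (congr1 (fun a => mulQ a (bas r)) (mulQ0 x))
      (mul0Q (bas r)))))).
- exact (etrans (congr1 (mulQ x) (mulQBl y1 y2 (bas r)))
    (etrans (mulQBr x (mulQ y1 (bas r)) (mulQ y2 (bas r)))
    (etrans (congr2 (fun a b => a - b) E1 E2)
    (esym (etrans (congr1 (fun a => mulQ a (bas r)) (mulQBr x y1 y2))
      (mulQBl (mulQ x y1) (mulQ x y2) (bas r))))))).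
elim/QG_ind: x => [|x1 x2 E1 E2|p].
- exact (etrans (mul0Q (mulQ (bas q) (bas r)))
    (esym (etrans (congr1 (fun a => mulQ a (bas r)) (mul0Q (bas q)))
      (mul0Q (bas r))))).
- exact (etrans (mulQBl x1 x2 (mulQ (bas q) (bas r)))
    (etrans (congr2 (fun a b => a - b) E1 E2)
    (esym (etrans (congr1 (fun a => mulQ a (bas r)) (mulQBl x1 x2 (bas q)))
      (mulQBl (mulQ x1 (bas q)) (mulQ x2 (bas q)) (bas r)))))).
exact (etrans (congr1 (mulQ (bas p)) (mulQUU q r)) (etrans (pmulA p q r)
  (congr1 (fun a => mulQ a (bas r)) (esym (mulQUU p q))))).
Qed.

Lemma mulQDl n : left_distributive (@mulQ n) +%R.
Proof.
move=> x y z; have := mulQBl x (0 - y) z; have := mulQBl 0 y z.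
by rewrite (mul0Q z) !sub0r !opprK => ->; rewrite opprK.
Qed.

Lemma mulQDr n : right_distributive (@mulQ n) +%R.
Proof.
move=> x y z; have := mulQBr x y (0 - z); have := mulQBr x 0 z.
by rewrite (mulQ0 x) !sub0r !opprK => ->; rewrite opprK.
Qed.

Lemma mulQ_suml n (I : finType) (F : I -> QG n) (y : QG n) :
  mulQ (\sum_i F i) y = \sum_i mulQ (F i) y.
Proof.
exact: (big_morph (fun x => mulQ x y) (fun a b => mulQDl a b y) (mul0Q y)).
Qed.

Lemma mulQ_sumr n (I : finType) (F : I -> QG n) (x : QG n) :
  mulQ x (\sum_i F i) = \sum_i mulQ x (F i).
Proof. exact: (big_morph (mulQ x) (mulQDr x) (mulQ0 x)). Qed.

Lemma pth_nil n (v : vertex n) :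
  exists p, [/\ pth v [::] = bas p, src p = v & steps p = [::]].
Proof. exact: pth_walk. Qed.

Lemma mul1Q n : left_id (oneQ n) (@mulQ n).
Proof.
move=> x; elim/QG_ind: x => [|x y E1 E2|p]; first exact: mulQ0.
  by rewrite (mulQBr (oneQ n) x y) E1 E2.
rewrite /oneQ mulQ_suml (bigD1 (src p)) //= big1 => [|v nv].
  have [i [-> Es Et]] := pth_nil (src p).
  by rewrite mulQUU /pmul /tgt Es Et eqxx pthE addr0.
have [i [-> Es Et]] := pth_nil v.
by rewrite mulQUU /pmul /tgt Es Et /= (negPf nv).
Qed.

Lemma mulQ1 n : right_id (oneQ n) (@mulQ n).
Proof.
move=> x; elim/QG_ind: x => [|x y E1 E2|p]; first exact: mul0Q.
  by rewrite (mulQBl x y (oneQ n)) E1 E2.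
rewrite /oneQ mulQ_sumr (bigD1 (tgt p)) //= big1 => [|v nv].
  have [i [-> Es Et]] := pth_nil (tgt p).
  by rewrite mulQUU /pmul Es Et eqxx cats0 pthE addr0.
have [i [-> Es Et]] := pth_nil v.
by rewrite mulQUU /pmul Es eq_sym (negPf nv).
Qed.

HB.instance Definition _ n := GRing.Zmodule_isPzRing.Build (QG n)
  (@mulQA n) (@mul1Q n) (@mulQ1 n) (@mulQDl n) (@mulQDr n).

(* Elements of the path algebra which vanish in the quotient. Decorations are
   carried by the vertices; pth is 0 on paths which do not exist. *)
Inductive relator n : QG n -> Prop :=
| rel_disjoint_supports (v : vertex n) (x y : label n) (w1 w2 u : vertex n) of
    is_edge v x w1 & is_edge w1 y u & is_edge v y w2 & is_edge w2 x u &
    [disjoint supp (lnk v) x & supp (lnk v) y] &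
    {in supp (lnk v) x, sgn u =1 sgn w1} & {in supp (lnk v) y, sgn u =1 sgn w2} :
    relator (pth v [:: (x, w1); (y, u)]
      - pth v [:: (y, w2); (x, u)] *~ sg (left_label x * left_label y))
(* C and C' are the circles through the same foot a in L and L_gamma. The edges
   exist only for merges of two + circles and divisions of a + circle; in the
   latter case w is forced to be + on C'. *)
| rel_right_decoration (v w1 w2 u : vertex n) (l : bool) (A : {set 'I_n.*2}) (a : 'I_n.*2) of
    a \in A &
    is_edge v (De false (circ (lnk v) a)) w1 & is_edge w1 (Br l A) u &
    is_edge v (Br l A) w2 & is_edge w2 (De false (circ (lnk u) a)) u :
    relator (pth v [:: (De false (circ (lnk v) a), w1); (Br l A, u)]
      - pth v [:: (Br l A, w2); (De false (circ (lnk u) a), u)])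
(* The circles C of L and C' of L_gamma in the support are those through A. *)
| rel_left_decoration (v u : vertex n) (l : bool) (A : {set 'I_n.*2}) of
    is_bridge (half (lnk v) l) A & lnk u = surgL (lnk v) l A :
    relator (
      \sum_(C in [set circ (lnk v) a | a in A]) \sum_w
        pth v [:: (De true C, w); (Br l A, u)]
      + (\sum_(C in [set circ (lnk u) a | a in A]) \sum_w
          pth v [:: (Br l A, w); (De true C, u)]) *~ sg (~~ l))
| rel_disjoint_bridges (v w1 w2 u : vertex n) (l : bool) (A : {set 'I_n.*2})
    (k : bool) (B A' B' : {set 'I_n.*2}) of
    is_edge v (Br l A) w1 & is_edge w1 (Br k B') u &
    is_edge v (Br k B) w2 & is_edge w2 (Br l A') u &
    disjoint_arcs (lnk v) l A k B A' B' &
    ~~ [&& l, k & same_side (lnk v).1 A B] :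
    relator (pth v [:: (Br l A, w1); (Br k B', u)]
      - pth v [:: (Br k B, w2); (Br l A', u)] *~ sg (l * k))
(* With A and B the arcs {a, b} and {a, c}, the slid bridge joins b and c. *)
| rel_sliding (v u : vertex n) (A B C D Z E : {set 'I_n.*2}) of
    is_bridge (lnk v).1 A & is_bridge (lnk v).1 B & same_side (lnk v).1 A B &
    C = (A :|: B) :\: (A :&: B) &
    class_of (lnk v).1 A B D && class_of (lnk v).1 A C D &
    class_of (lnk v).1 B A Z && class_of (lnk v).1 B C Z &
    class_of (lnk v).1 C A E && class_of (lnk v).1 C B E :
    relator (\sum_w pth v [:: (Br true A, w); (Br true D, u)]
      + \sum_w pth v [:: (Br true B, w); (Br true Z, u)]
      + \sum_w pth v [:: (Br true C, w); (Br true E, u)])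
| rel_crossing_dual (v w u : vertex n) (A B : {set 'I_n.*2}) of
    is_edge v (Br true A) w & is_edge w (Br true B) u & pitchfork A B :
    relator (pth v [:: (Br true A, w); (Br true B, u)])
| rel_right_dual (v w u : vertex n) (A C : {set 'I_n.*2}) of
    is_edge v (Br false A) w & is_edge w (Br false A) u &
    is_edge v (De false C) u :
    relator (pth v [:: (Br false A, w); (Br false A, u)]
      - pth v [:: (De false C, u)]).

Inductive ideal n : QG n -> Prop :=
| ideal0 : ideal 0
| idealB x y of ideal x & ideal y : ideal (x - y)
| ideal_relator x r y of relator r : ideal (x * r * y).

Definition ideal_pred n : {pred QG n} := fun x => `[< ideal x >].

Lemma ideal_zmod n : zmod_closed (@ideal_pred n).
Proof.
split=> [|x y /asboolP Ix /asboolP Iy]; apply/asboolP; first exact: ideal0.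
exact: idealB.
Qed.
HB.instance Definition _ n :=
  GRing.isZmodClosed.Build (QG n) (@ideal_pred n) (@ideal_zmod n).

Lemma ideal_mull n (x y : QG n) : ideal y -> ideal (x * y).
Proof.
elim=> [|y1 y2 _ I1 _ I2|a r b Rr]; first by rewrite mulr0; exact: ideal0.
  by rewrite mulrBr; exact: idealB.
by rewrite !mulrA; exact: ideal_relator.
Qed.

Lemma ideal_mulr n (x y : QG n) : ideal x -> ideal (x * y).
Proof.
elim=> [|x1 x2 _ I1 _ I2|a r b Rr]; first by rewrite mul0r; exact: ideal0.
  by rewrite mulrBl; exact: idealB.
by rewrite -mulrA; exact: ideal_relator.
Qed.

Definition BG n := Quotient.quot (@ideal_pred n).
HB.instance Definition _ n := GRing.Zmodule.on (BG n).
Definition piB n (x : QG n) : BG n := \pi_(Quotient.quot (@ideal_pred n)) x.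
Definition reprB n (x : BG n) : QG n := @repr _ (Quotient.quot (@ideal_pred n)) x.
Definition mulB n (x y : BG n) : BG n := piB (reprB x * reprB y).

Lemma reprBK n (x : BG n) : piB (reprB x) = x. Proof. exact: reprK. Qed.

Lemma piB_eq n (x y : QG n) : (piB x = piB y) <-> ideal (x - y).
Proof.
split=> [E|I]; last by apply/eqP; rewrite -Quotient.idealrBE; apply/asboolP.
by apply/asboolP; move/eqP: E; rewrite -Quotient.idealrBE.
Qed.

Lemma piBD n : {morph @piB n : x y / x + y}.
Proof. exact: (raddfD \pi_(Quotient.quot (@ideal_pred n))). Qed.

Lemma piBM n (x y : QG n) : mulB (piB x) (piB y) = piB (x * y).
Proof.
have /piB_eq Ix := reprBK (piB x); have /piB_eq Iy := reprBK (piB y).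
apply/piB_eq; set x' := reprB _ in Ix *; set y' := reprB _ in Iy *.
have -> : x' * y' - x * y = (x' - x) * y' - (x * - (y' - y)).
  by rewrite mulrBl mulrN mulrBr opprK addrA subrK.
by apply: idealB; [apply: ideal_mulr | rewrite mulrN -sub0r; apply/idealB/ideal_mull; first exact: ideal0].
Qed.

Lemma mulBA n : associative (@mulB n).
Proof. by move=> x y z; rewrite -[x]reprBK -[y]reprBK -[z]reprBK !piBM mulrA. Qed.
Lemma mul1B n : left_id (piB 1) (@mulB n).
Proof. by move=> x; rewrite -[x]reprBK piBM mul1r. Qed.
Lemma mulB1 n : right_id (piB 1) (@mulB n).
Proof. by move=> x; rewrite -[x]reprBK piBM mulr1. Qed.
Lemma mulBDl n : left_distributive (@mulB n) +%R.
Proof.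
by move=> x y z; rewrite -[x]reprBK -[y]reprBK -[z]reprBK -piBD !piBM mulrDl piBD.
Qed.
Lemma mulBDr n : right_distributive (@mulB n) +%R.
Proof.
by move=> x y z; rewrite -[x]reprBK -[y]reprBK -[z]reprBK -piBD !piBM mulrDr piBD.
Qed.
HB.instance Definition _ n := GRing.Zmodule_isPzRing.Build (BG n)
  (@mulBA n) (@mul1B n) (@mulB1 n) (@mulBDl n) (@mulBDr n).

Definition idem n (v : vertex n) : BG n := piB (pth v [::]).
(* 0 if there is no such edge *)
Definition edge n (v : vertex n) (x : label n) (w : vertex n) : BG n :=
  piB (pth v [:: (x, w)]).

(* The properties determining d_Gamma. The products of two bridge edges with the
   same label A are the paths along a bridge and then along its dual. *)
Definition is_dGamma n (d : BG n -> BG n) : Prop :=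
  [/\ forall a b, d (a + b) = d a + d b,
      forall v, d (idem v) = 0,
      forall v l A w, d (edge v (Br l A) w) = 0 /\ d (edge v (De false A) w) = 0,
      forall v C w, is_edge v (De true C) w ->
        d (edge v (De true C) w) =
          - \sum_A \sum_u edge v (Br true A) u * edge u (Br true A) w &
      forall a (p : gpath n),
        d (a * piB (bas p)) =
          (d a * piB (bas p)) *~ sg (ldeg p) + a * d (piB (bas p))].

(* Ends of the edges of a diagram: boundary points, and four ends at each of the
   c crossings. The ends at a crossing are numbered counterclockwise, the ends 0
   and 2 being those of the understrand. *)
Notation ends n c := ('I_n.*2 + 'I_c * 'I_4)%type.

(* Counterclockwise rotation at the vertices of the planar map obtained by
   shrinking the left half-plane to a vertex. *)
Definition rot_end n c (x : ends n c) : ends n c :=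
  match x with
  | inl i => inl (ordS i)
  | inr (k, j) => inr (k, ordS j)
  end.

(* A diagram in the right half-plane, as a combinatorial map of genus 0; the
   order of the crossings is that of 'I_ncr. Closed components without crossings
   are only counted. The relative position of the connected components of the
   diagram is not recorded, nothing below depends on it. *)
Record diagram n := Diagram {
  ncr : nat;
  nloops : nat;
  glue : {ffun ends n ncr -> ends n ncr};
  glueK : involutive glue;
  glue_neq : forall x, glue x != x;
  glue_planar :  (* V + F = E + 2 C *)
    (fcard (@rot_end n ncr) predT + fcard (@rot_end n ncr \o glue) predT =
     fcard glue predT +
     (n_comp (fun x y => (y == glue x) || (y == rot_end x)) predT).*2)%N }.

(* The overstrand turned counterclockwise sweeps the regions between the ends 1
   and 2 and between 3 and 0; so the 0-smoothing joins 0 to 1 and 2 to 3, and the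
   1-smoothing joins 1 to 2 and 3 to 0. *)
Definition smooth_end (b : bool) (j : 'I_4) : 'I_4 :=
  if odd j (+) b then ord_pred j else ordS j.

(* Connected ends lie on the same component of rho(T). *)
Definition strand n (D : diagram n) (rho : {ffun 'I_(ncr D) -> bool}) :
    rel (ends n (ncr D)) :=
  fun x y => (y == glue D x) ||
    (if x is inr (k, j) then y == inr (k, smooth_end (rho k) j) else false).

(* Connected ends lie on the same circle of m # rho(T). *)
Definition closed_strand n (D : diagram n) (rho : {ffun 'I_(ncr D) -> bool})
    (m : matching n) : rel (ends n (ncr D)) :=
  fun x y => strand rho x y || (if x is inl i then y == inl (m i) else false).

Record state_data n (D : diagram n) := StateData {
  smoothing : {ffun 'I_(ncr D) -> bool};
  lmatch : matching n;
  rmatch : matching n;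
  esign : {ffun ends n (ncr D) -> bool};
  lsign : {ffun 'I_(nloops D) -> bool} }.

Definition state_tuple n (D : diagram n) (x : state_data D) :=
  (smoothing x, lmatch x, rmatch x, esign x, lsign x).
Definition tuple_state n (D : diagram n) t : state_data D :=
  let: (r, l, m, e, s) := t in StateData r l m e s.
Lemma state_tupleK n (D : diagram n) : cancel (@state_tuple n D) (@tuple_state n D).
Proof. by case. Qed.
HB.instance Definition _ n (D : diagram n) :=
  Finite.copy (state_data D) (can_type (@state_tupleK n D)).

(* rmatch is the matching of P_n by the arcs of rho(T), hence is determined by
   the smoothing; the decoration is a function on the ends, constant on circles,
   and a function on the circles without crossings. *)
Definition is_state n (D : diagram n) (x : state_data D) : bool :=
  [forall i, connect (strand (smoothing x)) (inl i) (inl (rmatch x i))] &&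
  [forall p, forall q, closed_strand (smoothing x) (lmatch x) p q ==>
     (esign x p == esign x q)].
Record state n (D : diagram n) := State {
  state_val :> state_data D;
  _ : is_state state_val }.
HB.instance Definition _ n (D : diagram n) := [isSub for @state_val n D].
HB.instance Definition _ n (D : diagram n) := [Finite of state D by <:].

Definition bd_data n (D : diagram n) (x : state D) :
    link n * {ffun 'I_n.*2 -> bool} :=
  ((lmatch x, rmatch x), [ffun i => esign x (inl i)]).
Lemma bd_decorated n (D : diagram n) (x : state D) : decorated (bd_data x).
Proof.
have /andP [/forallP cR /forallP cS] := valP x.
have step p q : closed_strand (smoothing x) (lmatch x) p q -> esign x p = esign x q.
  by move=> pq; have /forallP /(_ q) := cS p; rewrite pq => /eqP.
apply/forallP => p; apply/forallP => q; apply/implyP => pq; rewrite !ffunE; apply/eqP.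
case/orP: pq => /eqP -> /=.
  by apply: step; rewrite /closed_strand eqxx orbT.
case/connectP: (cR p) => s; elim: s (inl p : ends _ _) => [|z s IH] y /=.
  by move=> _ ->.
case/andP=> yz ps E; rewrite -(IH z ps E); apply: step.
by rewrite /closed_strand yz.
Qed.

Definition bd n (D : diagram n) (x : state D) : vertex n := Vertex (bd_decorated x).

Definition hdeg n (D : diagram n) (x : state D) : nat :=
  #|[set k | smoothing x k]|.
Definition later n (D : diagram n) (x : state D) (c : 'I_(ncr D)) : nat :=
  #|[set k : 'I_(ncr D) | (c < k)%N && smoothing x k]|.

(* The feet of the active arc at c: ends on its two sides. After surgery they are
   again on the two strands at c. *)
Definition foot1 n (D : diagram n) (c : 'I_(ncr D)) : ends n (ncr D) :=
  inr (c, inord 0).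
Definition foot2 n (D : diagram n) (c : 'I_(ncr D)) : ends n (ncr D) :=
  inr (c, inord 2).

Definition same_strand n (D : diagram n) (x : state D) : rel (ends n (ncr D)) :=
  connect (strand (smoothing x)).
Definition same_circle n (D : diagram n) (x : state D) : rel (ends n (ncr D)) :=
  connect (closed_strand (smoothing x) (lmatch x)).
Definition free n (D : diagram n) (x : state D) (p : ends n (ncr D)) : bool :=
  [forall i : 'I_n.*2, ~~ same_strand x p (inl i)].
Definition active n (D : diagram n) (x : state D) (c : 'I_(ncr D)) : bool :=
  ~~ smoothing x c.

Definition resolves n (D : diagram n) (x : state D) (c : 'I_(ncr D))
    (y : state D) : bool :=
  [&& smoothing y == [ffun k => (k == c) || smoothing x k],
      lmatch y == lmatch x & lsign y == lsign x].

(* Same decoration on the circles of x without foot at c. *)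
Definition agree_off n (D : diagram n) (x : state D) (c : 'I_(ncr D))
    (y : state D) : bool :=
  [forall p : ends n (ncr D), [|| same_circle x (foot1 c) p, same_circle x (foot2 c) p |
                esign y p == esign x p]].

Definition agree_free n (D : diagram n) (x y : state D) : bool :=
  (lsign y == lsign x) && [forall p, free x p ==> (esign y p == esign x p)].

(* y is a term of D_(gamma_c)(x). The feet are on different components of rho(T)
   in the first case, on one free circle in the second, and on one arc otherwise;
   then exactly one of the feet of the dual arc is on the new free circle. *)
Definition in_D n (D : diagram n) (x : state D) (c : 'I_(ncr D))
    (y : state D) : bool :=
  let p := foot1 c in let q := foot2 c in
  let s := esign x in let s' := esign y in
  [&& resolves x c y, agree_off x c y &
   if ~~ same_strand x p q then
     match free x p, free x q with
     | true, true => (s p || s q) && (s' p == s p && s q)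
     | true, false => s p && (s' q == s q)
     | false, true => s q && (s' p == s p)
     | false, false => false
     end
   else if free x p then ~~ (s' p && s' q) && (s p == s' p || s' q)
   else if free y p then ~~ s' p && (s' q == s q)
   else ~~ s' q && (s' p == s p)].

Definition right_bridge n (D : diagram n) (x : state D) (c : 'I_(ncr D)) : bool :=
  let p := foot1 c in let q := foot2 c in
  [&& active x c, ~~ same_strand x p q, ~~ free x p & ~~ free x q].
Definition right_arcs n (D : diagram n) (x : state D) (c : 'I_(ncr D)) :
    {set 'I_n.*2} :=
  [set i | same_strand x (foot1 c) (inl i) || same_strand x (foot2 c) (inl i)].

(* C(gamma_c), the cleaved circle with a foot at c, for c in dec(x) *)
Definition foot_circle n (D : diagram n) (x : state D) (c : 'I_(ncr D)) :
    {set 'I_n.*2} :=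
  [set i | same_circle x (if free x (foot1 c) then foot2 c else foot1 c)
             (inl i)].

(* gamma_c is in dec(x), and y is (r_gamma, s_gamma) *)
Definition in_dec n (D : diagram n) (x : state D) (c : 'I_(ncr D))
    (y : state D) : bool :=
  let p := foot1 c in let q := foot2 c in
  let s := esign x in let s' := esign y in
  [&& resolves x c y, agree_off x c y &
   if same_strand x p q then
     [&& ~~ free x p, s p &
       if free y p then s' p && ~~ s' q else s' q && ~~ s' p]
   else match free x p, free x q with
     | true, false => [&& s q, ~~ s p & ~~ s' q]
     | false, true => [&& s p, ~~ s q & ~~ s' p]
     | _, _ => false
     end].

Definition states n (D : diagram n) := {ffun state D -> int}.
HB.instance Definition _ n (D : diagram n) := GRing.Zmodule.on (states D).

(* As the states y are a basis of the I-module [[T>>, B (x)_I [[T>> is the direct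
   sum of the B I_(bd y). It is represented inside the functions from states to B;
   tens a y stands for a (x) y. *)
Definition Bstates n (D : diagram n) := {ffun state D -> BG n}.
HB.instance Definition _ n (D : diagram n) := GRing.Zmodule.on (Bstates D).

Definition tens n (D : diagram n) (a : BG n) (y : state D) : Bstates D :=
  [ffun z => if z == y then a * idem (bd y) else 0].

Definition delta_gen n (D : diagram n) (x : state D) : Bstates D :=
  \sum_(c | active x c) \sum_(y : state D | in_D x c y)
     tens (idem (bd x)) y *~ sg (later x c)
  + \sum_(c | right_bridge x c) \sum_(y : state D | resolves x c y && agree_free x y)
     tens (edge (bd x) (Br false (right_arcs x c)) (bd y)) y *~ sg (later x c)
  + \sum_(A | is_bridge (lmatch x) A)
    \sum_(y : state D | [&& smoothing y == smoothing x, lmatch y == surg (lmatch x) A &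
                  agree_free x y])
     tens (edge (bd x) (Br true A) (bd y)) y *~ sg (hdeg x)
  + \sum_(c | active x c) \sum_(y : state D | in_dec x c y)
     tens (edge (bd x) (De false (foot_circle x c)) (bd y)) y *~ sg (later x c)
  + \sum_(C in cir (lnk (bd x)) | [forall p in C, sgn (bd x) p])
    \sum_(y : state D | [&& smoothing y == smoothing x, lmatch y == lmatch x,
                  agree_free x y &
                  sgn (bd y) == [ffun p => (p \notin C) && sgn (bd x) p]])
     tens (edge (bd x) (De true C) (bd y)) y *~ sg (hdeg x).

Definition delta n (D : diagram n) (f : states D) : Bstates D :=
  \sum_(x : state D) delta_gen x *~ f x.

(* (mu (x) id)(id (x) delta): a (x) x is sent to the sum of (a b) (x) y over the
   terms b (x) y of delta(x). *)
Definition mu_delta n (D : diagram n) (F : Bstates D) : Bstates D :=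
  \sum_(x : state D) [ffun y => F x * delta_gen x y].

(* d (x) |id|, where |id| is the signed identity *)
Definition d_sgn n (D : diagram n) (d : BG n -> BG n) (F : Bstates D) :
    Bstates D :=
  [ffun y => d (F y) *~ sg (hdeg y)].

(* Main.v *)
(* delta_T is the sum of a part delta_R coming from the crossings, whose
   coefficients are idempotents, right decorations and right bridges, and of a
   part delta_L which does not change the right half. Edges of Gamma_n and the
   maps D_gamma are governed by the same rule: surgery of an equivalence relation
   along two feet changes decorations by the multiplication or comultiplication
   of the Frobenius algebra Z[X]/X^2, and two surgeries commute; this is a finite
   check.
   (1) delta_R^2 = 0: for two crossings, both orders have the same number of
   intermediate states, and all the products of coefficients are equal, by (R1),
   (R2), (R4) and (R7); the signs are opposite.
   (2) delta_R delta_L + delta_L delta_R = 0, as right edges commute with the sum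
   of the left edges.
   (3) delta_L^2 = - d delta_L: the left decorations anticommute with each other
   and, by (R3), with the left bridges; the products of two left bridges cancel by
   (R4), (R5) and (R6), except for a bridge followed by its dual, which gives d.
   The diagram enters only through its strands. Planarity, in the form of Euler's
   formula for the combinatorial map, is used in a discrete Jordan theorem: wires
   joining the darts of a vertex do not cross. Hence the strands form a planar
   matching, and the four ends at a crossing are never joined to opposite ends;
   this leaves seven configurations at each crossing. *)
From mathcomp Require Import all_boot all_order all_algebra all_fingroup.
From mathcomp Require Import zify boolp.
Require Import Defs.

Set Implicit Arguments.
Unset Strict Implicit.
Unset Printing Implicit Defensive.

(** * Surgery of equivalence relations *)

(** Intermediate vertices are never matched one by one: if every product of one family equals every
    product of the other, equal cardinalities give equal sums ([eq_sum_card]). The cardinalities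
    come from surgery of equivalence relations, stated so that merges and divisions need not be told
    apart. What makes links fit this pattern is parity: arcs join points of opposite parities, so a
    surgery multiplies the return permutation along the circles by a transposition, and never turns
    one circle into one circle. Paths of two left bridges are sorted by their end matchings, which
    determine the second bridge from the first. Three arcs reconnected cyclically offer two or three
    first bridges; this is the difference between opposite and same side in (R4) and (R5). For right
    edges, a product of two is brought to a normal form that depends on its end vertices only, and
    just the squares of bridges remain. For mixed terms, a crossing acts on the cleaved part as a
    matrix indexed by vertices and fixed by the right-hand data, so a few such matrices must commute
    with the matrix of left edges. *)

Definition merged (P : Type) (e : rel P) (p q : P) : rel P :=
  fun x y => e x y || ((e p x || e q x) && (e p y || e q y)).

(** Symmetric in [e] and [e'], so that a merge and the inverse division are one notion. The
    exclusive condition says that surgery never turns one class into one class. *)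
Record surgery (P : Type) (e e' : rel P) (p q : P) : Prop := Surgery {
  surg_eqv : equivalence_rel e;
  surg_eqv' : equivalence_rel e';
  surg_xor : e p q != e' p q;
  surg_merged : merged e p q =2 merged e' p q }.

Section Eqv.
Variables (P : Type) (e : rel P).
Hypothesis E : equivalence_rel e.
Lemma eqv_refl x : e x x. Proof. by have [] := E x x x. Qed.
Lemma eqv_left x y : e x y -> e x =1 e y.
Proof. by move=> xy z; have [_ ->] := E x y z. Qed.
Lemma eqv_sym x y : e x y = e y x.
Proof.
by apply/idP/idP => h; move: (eqv_left h); [move/(_ x)|move/(_ y)]; rewrite eqv_refl.
Qed.
Lemma eqv_right x y z : e x y -> e z x = e z y.
Proof. by move=> /eqv_left h; rewrite eqv_sym h eqv_sym. Qed.
End Eqv.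

Lemma surgery_sym (P : Type) (e e' : rel P) p q :
  surgery e e' p q -> surgery e' e p q.
Proof. by case=> E E' X M; split=> //; rewrite // eq_sym. Qed.

Section SurgeryTheory.
Variables (P : Type) (e e' : rel P) (p q : P).
Hypothesis S : surgery e e' p q.
Let E := surg_eqv S.
Let E' := surg_eqv' S.

Lemma surgery_union x : e p x || e q x = e' p x || e' q x.
Proof.
have := surg_merged S p x; rewrite /merged (eqv_refl E) (eqv_refl E') /=.
by case: (e p x); case: (e' p x) => //=.
Qed.

Lemma surgery_off x y : ~~ e p x -> ~~ e q x -> e x y = e' x y.
Proof.
move=> npx nqx; have := surg_merged S x y; rewrite /merged -(surgery_union x).
by rewrite (negPf npx) (negPf nqx) /= !orbF.
Qed.


End SurgeryTheory.

(** * Decorations under surgery *)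

Section Decorations.
Variable P : finType.
Implicit Types (e : rel P) (f g h : {ffun P -> bool}).

Definition constant_on e f := [forall x, forall y, e x y ==> (f x == f y)].

Lemma constant_onP e f : reflect (forall x y, e x y -> f x = f y) (constant_on e f).
Proof.
apply: (iffP forallP) => [h x y xy|h x].
  by have /forallP/(_ y)/implyP/(_ xy)/eqP := h x.
by apply/forallP => y; apply/implyP => /h ->.
Qed.

(** [b] tells whether the feet lie on one circle before the surgery. With + as 1 and - as X, the
    branches list the nonzero matrix entries of the comultiplication and of the multiplication of
    Z[X]/X^2, all of which are 1. *)
Definition mult_rule (b : bool) (fp fq gp gq : bool) :=
  if b then ~~ (gp && gq) && (fp == gp || gq) else (fp || fq) && (gp == fp && fq).

Definition edgeK e e' p q f g :=
  [&& constant_on e f, constant_on e' g,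
      [forall x, ~~ e p x ==> ~~ e q x ==> (g x == f x)] &
      mult_rule (e p q) (f p) (f q) (g p) (g q)].

(** Multiplication by X on the circle through [t]. *)
Definition lower e t f g :=
  [&& constant_on e f, f t & g == [ffun x => ~~ e t x && f x]].
End Decorations.

(* Two surgeries only involve the restrictions of the relations and decorations
   to the four feet: their commutation is a finite check, run on relations on
   four points encoded by six bits. *)
Definition bits6 := (bool * bool * bool * (bool * bool * bool))%type.
Definition bits_rel (b : bits6) (i j : nat) : bool :=
  let: (b01, b02, b03, (b12, b13, b23)) := b in
  match i, j with
  | 0, 1 | 1, 0 => b01 | 0, 2 | 2, 0 => b02 | 0, 3 | 3, 0 => b03
  | 1, 2 | 2, 1 => b12 | 1, 3 | 3, 1 => b13 | 2, 3 | 3, 2 => b23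
  | _, _ => true
  end.
Definition bits_dec (b : bool * bool * (bool * bool)) (i : nat) : bool :=
  let: (b0, b1, (b2, b3)) := b in
  match i with 0 => b0 | 1 => b1 | 2 => b2 | _ => b3 end.

Definition all4 (p : nat -> bool) := [&& p 0, p 1, p 2 & p 3].
Definition trans4 (e : rel nat) :=
  all4 (fun i => all4 (fun j => all4 (fun k => e i j ==> e i k ==> e j k))).
Definition surgery4 (e e' : rel nat) p q :=
  (e p q != e' p q) && all4 (fun i => all4 (fun j => merged e p q i j == merged e' p q i j)).
Definition constant4 (e : rel nat) (f : nat -> bool) :=
  all4 (fun i => all4 (fun j => e i j ==> (f i == f j))).

(** The middle decoration of a path equals [f] off the classes of p and q, hence it is determined by
    its values [a] and [b] there. *)
Definition ext4 (T : Type) (e1 : rel T) (p q : T) (f : T -> bool) (a b : bool) (x : T) :=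
  if e1 p x then a else if e1 q x then b else f x.

(** Everything about a path that is visible at the four feet. The first clause makes the pair (a, b)
    unique when the first surgery joins p and q. *)
Definition ok4 (T : Type) (e e1 : rel T) p q r s (f h : T -> bool) a b :=
  let g := ext4 e1 p q f a b in
  [&& e1 p q ==> (a == b), mult_rule (e p q) (f p) (f q) (g p) (g q),
      mult_rule (e1 r s) (g r) (g s) (h r) (h s),
      ~~ e1 r p ==> ~~ e1 s p ==> (h p == g p) &
      ~~ e1 r q ==> ~~ e1 s q ==> (h q == g q)].

Definition count4 (T : Type) (e e1 : rel T) p q r s (f h : T -> bool) : nat :=
  let c a b := ok4 e e1 p q r s f h a b : nat in
  c true true + c true false + (c false true + c false false).

Definition bits1 := [:: true; false].
Definition all_bits6 : seq bits6 :=
  [seq (x, y) | x <- [seq (x, y) | x <- [seq (x, y) | x <- bits1, y <- bits1], y <- bits1],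
                y <- [seq (x, y) | x <- [seq (x, y) | x <- bits1, y <- bits1], y <- bits1]].
Definition all_bits4 :=
  [seq (x, y) | x <- [seq (x, y) | x <- bits1, y <- bits1], y <- [seq (x, y) | x <- bits1, y <- bits1]].
Definition eqvs4 := [seq b <- all_bits6 | trans4 (bits_rel b)].

(** The tests alternate with the quantifiers, so that relations which do not fit are discarded
    before the inner enumerations. *)
Definition square_check :=
  all (fun b0 => let e0 := bits_rel b0 in
  all (fun b1 => let e1 := bits_rel b1 in if surgery4 e0 e1 0 1 then
  all (fun b2 => let e2 := bits_rel b2 in if surgery4 e0 e2 2 3 then
  all (fun b3 => let e3 := bits_rel b3 in
    if surgery4 e1 e3 2 3 && surgery4 e2 e3 0 1 then
    all (fun f => if constant4 e0 (bits_dec f) then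
    all (fun h => if constant4 e3 (bits_dec h) then
      count4 e0 e1 0 1 2 3 (bits_dec f) (bits_dec h) ==
       count4 e0 e2 2 3 0 1 (bits_dec f) (bits_dec h) else true)
    all_bits4 else true) all_bits4 else true) eqvs4 else true) eqvs4 else true) eqvs4) eqvs4.

Lemma square_checkT : square_check = true.
Proof. by vm_compute. Qed.

Lemma square_checkP b0 b1 b2 b3 f h :
  let e0 := bits_rel b0 in let e1 := bits_rel b1 in
  let e2 := bits_rel b2 in let e3 := bits_rel b3 in
  b0 \in eqvs4 -> b1 \in eqvs4 -> b2 \in eqvs4 -> b3 \in eqvs4 ->
  surgery4 e0 e1 0 1 -> surgery4 e0 e2 2 3 -> surgery4 e1 e3 2 3 -> surgery4 e2 e3 0 1 ->
  constant4 e0 (bits_dec f) -> constant4 e3 (bits_dec h) ->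
  count4 e0 e1 0 1 2 3 (bits_dec f) (bits_dec h) =
  count4 e0 e2 2 3 0 1 (bits_dec f) (bits_dec h).
Proof.
move=> e0 e1 e2 e3 m0 m1 m2 m3 s1 s2 s3 s4 c0 c3.
have mem4 (b : bool * bool * (bool * bool)) : b \in all_bits4.
  by case: b => [[[] []] [[] []]].
have H0 := allP square_checkT b0 m0; cbv beta zeta in H0.
have H1 := allP H0 b1 m1; cbv beta zeta in H1; rewrite s1 in H1.
have H2 := allP H1 b2 m2; cbv beta zeta in H2; rewrite s2 in H2.
have H3 := allP H2 b3 m3; cbv beta zeta in H3; rewrite s3 s4 in H3.
have H4 := allP H3 f (mem4 f); cbv beta zeta in H4; rewrite c0 in H4.
have H5 := allP H4 h (mem4 h); cbv beta zeta in H5; rewrite c3 in H5.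
exact/eqP.
Qed.

Section FourPoints.
Variables (P : Type) (pt : nat -> P).
Implicit Type e : rel P.

Definition bits_of e : bits6 :=
  (e (pt 0) (pt 1), e (pt 0) (pt 2), e (pt 0) (pt 3),
   (e (pt 1) (pt 2), e (pt 1) (pt 3), e (pt 2) (pt 3))).


Lemma bits_relE e i j : equivalence_rel e -> i < 4 -> j < 4 ->
  bits_rel (bits_of e) i j = e (pt i) (pt j).
Proof.
move=> E; case: i => [|[|[|[|]]]] //; case: j => [|[|[|[|]]]] //= _ _;
by [rewrite (eqv_refl E) | rewrite (eqv_sym E)].
Qed.

Lemma bits_eqv e : equivalence_rel e -> bits_of e \in eqvs4.
Proof.
move=> E; rewrite mem_filter; apply/andP; split.
  rewrite /trans4 /all4 !bits_relE //.
  have T i j k : e (pt i) (pt j) ==> e (pt i) (pt k) ==> e (pt j) (pt k).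
    by apply/implyP => ij; rewrite (eqv_left E ij) implybb.
  by rewrite !T.
by rewrite /bits_of; do 6!case: (e _ _).
Qed.

Lemma bits_surgery e e' i j : surgery e e' (pt i) (pt j) -> i < 4 -> j < 4 ->
  surgery4 (bits_rel (bits_of e)) (bits_rel (bits_of e')) i j.
Proof.
move=> S i4 j4; have [E E' X M] := S.
have MM k l : k < 4 -> l < 4 ->
    merged (bits_rel (bits_of e)) i j k l == merged (bits_rel (bits_of e')) i j k l.
  by move=> k4 l4; have := M (pt k) (pt l); rewrite /merged !bits_relE // => ->.
by rewrite /surgery4 !bits_relE // X /all4 !MM.
Qed.

Lemma bits_constant e (f : P -> bool) : (forall x y, e x y -> f x = f y) ->
  equivalence_rel e ->
  constant4 (bits_rel (bits_of e))
    (bits_dec (f (pt 0), f (pt 1), (f (pt 2), f (pt 3)))).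
Proof.
move=> C E; rewrite /constant4 /all4 !bits_relE //=.
have CC x y : e x y ==> (f x == f y) by apply/implyP => /C ->.
by rewrite !CC.
Qed.
End FourPoints.

Lemma square_count (P : Type) (e00 e01 e10 e11 : rel P) p q r s (f h : P -> bool) :
  surgery e00 e01 p q -> surgery e00 e10 r s -> surgery e01 e11 r s ->
  surgery e10 e11 p q ->
  (forall x y, e00 x y -> f x = f y) -> (forall x y, e11 x y -> h x = h y) ->
  count4 e00 e01 p q r s f h = count4 e00 e10 r s p q f h.
Proof.
move=> S1 S2 S3 S4 Cf Ch.
pose pt n := match n with 0 => p | 1 => q | 2 => r | _ => s end.
pose B := bits_of pt.
have E00 := surg_eqv S1; have E01 := surg_eqv' S1; have E10 := surg_eqv' S2.
have E11 := surg_eqv' S3.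
pose dec4 (g : P -> bool) := (g p, g q, (g r, g s)).
have := @square_checkP (B e00) (B e01) (B e10) (B e11) (dec4 f) (dec4 h)
  (bits_eqv pt E00) (bits_eqv pt E01) (bits_eqv pt E10) (bits_eqv pt E11)
  (@bits_surgery _ pt _ _ 0 1 S1 isT isT) (@bits_surgery _ pt _ _ 2 3 S2 isT isT)
  (@bits_surgery _ pt _ _ 2 3 S3 isT isT) (@bits_surgery _ pt _ _ 0 1 S4 isT isT)
  (@bits_constant _ pt _ _ Cf E00) (@bits_constant _ pt _ _ Ch E11).
rewrite /count4 /ok4 /ext4 /bits_rel /B /bits_of /bits_dec /dec4 /pt.
rewrite !(eqv_refl E01) !(eqv_refl E10).
(* The bits read each pair of feet in increasing order, while [count4] asks for some pairs in the
   other order. *)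
rewrite (eqv_sym E01 r p) (eqv_sym E01 s p) (eqv_sym E01 r q) (eqv_sym E01 s q).
rewrite (eqv_sym E10 p r) (eqv_sym E10 p s) (eqv_sym E10 q r) (eqv_sym E10 q s).
by move=> ->.
Qed.

(** * Counting the middle decorations of two successive surgeries *)

Section PathCard.
Variables (P : finType) (e e1 e2 : rel P) (p q r s : P).
Hypotheses (S1 : surgery e e1 p q) (S2 : surgery e1 e2 r s).
Variables f h : {ffun P -> bool}.
Let E := surg_eqv S1.
Let E1 := surg_eqv' S1.
Let E2 := surg_eqv' S2.

Let glob := [forall x, ~~ e p x ==> ~~ e q x ==> ~~ e r x ==> ~~ e s x ==> (h x == f x)].
Let ext a b := [ffun x => ext4 e1 p q f a b x].

Lemma path_sound g : edgeK e e1 p q f g -> edgeK e1 e2 r s g h ->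
  [/\ constant_on e f, constant_on e2 h, glob, ok4 e e1 p q r s f h (g p) (g q) &
      g = ext (g p) (g q)].
Proof.
case/and4P=> Cf /constant_onP Cg /forallP Og Mg /and4P [_ Ch /forallP Oh Mh].
have Eg x : g x = ext4 e1 p q f (g p) (g q) x.
  rewrite /ext4; case: ifP => [/Cg -> //|npx]; case: ifP => [/Cg -> //|nqx].
  have := surgery_union S1 x; rewrite npx nqx => /norP [n1 n2].
  by have := Og x; rewrite n1 n2 => /eqP.
split=> //; first 1 last.
- rewrite /ok4 -!Eg Mg Mh /= !(fun x => Oh x) !andbT.
  by apply/implyP => /Cg ->.
- by apply/ffunP => x; rewrite ffunE.
apply/forallP => x; apply/implyP => npx; apply/implyP => nqx.
apply/implyP => nrx; apply/implyP => nsx.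
have := Og x; rewrite npx nqx /= => /eqP <-; have := Oh x.
by rewrite (eqv_sym E1 r) (eqv_sym E1 s) -!(surgery_off S1) // (eqv_sym E x) nrx (eqv_sym E x) nsx.
Qed.

Lemma path_complete a b : constant_on e f -> constant_on e2 h -> glob ->
  ok4 e e1 p q r s f h a b ->
  edgeK e e1 p q f (ext a b) /\ edgeK e1 e2 r s (ext a b) h.
Proof.
move=> Cf Ch G; case/and5P => ab M1 M2 Op Oq.
have Cext : constant_on e1 (ext a b).
  apply/constant_onP => x y xy; rewrite !ffunE /ext4.
  rewrite !(eqv_right E1 _ xy); case: ifP => // npy; case: ifP => // nqy.
  have := surgery_union S1 y; rewrite npy nqy => /norP [n1 n2].
  have [n3 n4] : ~~ e1 p x /\ ~~ e1 q x by rewrite !(eqv_right E1 _ xy) npy nqy.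
  have := surgery_union S1 x; rewrite (negPf n3) (negPf n4) => /norP [n5 n6].
  by apply: (constant_onP _ _ Cf); rewrite (surgery_off S1).
split; apply/and4P; split=> //; rewrite ?ffunE //.
  apply/forallP => x; apply/implyP => npx; apply/implyP => nqx.
  have := surgery_union S1 x; rewrite (negPf npx) (negPf nqx) => /esym/norP [n1 n2].
  by rewrite ffunE /ext4 (negPf n1) (negPf n2).
apply/forallP => x; apply/implyP => nrx; apply/implyP => nsx.
(* [ok4] compares [h] with the middle decoration at p and q only. Away from r and s both are
   constant on the classes of [e1], which carries the comparison to x. *)
have hx t : e1 t x -> ~~ e1 r t ==> ~~ e1 s t ==> (h t == ext4 e1 p q f a b t) ->
    h x == ext a b x.
  move=> tx; rewrite !(eqv_right E1 _ tx) nrx nsx /= => /eqP.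
  rewrite /ext4 !(eqv_right E1 _ tx) => ht.
  have -> : h x = h t.
    apply: (constant_onP _ _ Ch); rewrite -(surgery_off S2) //.
    by rewrite (eqv_sym E1).
  rewrite ht ffunE /ext4; case: ifP => // n1; case: ifP => // n2.
  have := surgery_union S1 x; rewrite n1 n2 => /norP [n3 n4].
  apply/eqP/(constant_onP _ _ Cf); rewrite (eqv_sym E) (surgery_off S1) //.
  by rewrite (eqv_sym E1).
case: (boolP (e1 p x)) => [px|npx]; first exact: (hx p).
case: (boolP (e1 q x)) => [qx|nqx]; first exact: (hx q).
rewrite ffunE /ext4 (negPf npx) (negPf nqx).
have := surgery_union S1 x; rewrite (negPf npx) (negPf nqx) => /norP [n1 n2].
have/forallP/(_ x) := G; rewrite n1 n2 (eqv_sym E r) (eqv_sym E s).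
by rewrite !(surgery_off S1 _ n1 n2) (eqv_sym E1 _ r) (eqv_sym E1 _ s) nrx nsx.
Qed.

Lemma ext_fst a b : ok4 e e1 p q r s f h a b -> ext a b p = a.
Proof. by rewrite ffunE /ext4 (eqv_refl E1). Qed.
Lemma ext_snd a b : ok4 e e1 p q r s f h a b -> ext a b q = b.
Proof.
case/and5P => ab _ _ _ _; rewrite ffunE /ext4 (eqv_refl E1).
by case: ifP ab => // _ /eqP.
Qed.

(** The values at p and q parametrize the middle decorations. The count is thus read off the four
    feet, up to a factor that is symmetric in the two surgeries. *)
Lemma path_card :
  #|[set g | edgeK e e1 p q f g && edgeK e1 e2 r s g h]| =
  (constant_on e f && constant_on e2 h && glob) * count4 e e1 p q r s f h.
Proof.
case: (boolP (_ && _)) => [/andP [/andP [Cf Ch] G]|nG]; last first.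
  apply/eqP; rewrite cards_eq0; apply/eqP/setP => g; rewrite !inE; apply/negP.
  by case/andP => /path_sound H /H [Cf Ch G _ _]; rewrite Cf Ch G in nG.
rewrite mul1n.
pose OK := [set ab : bool * bool | ok4 e e1 p q r s f h ab.1 ab.2].
have -> : [set g | edgeK e e1 p q f g && edgeK e1 e2 r s g h] =
    [set ext ab.1 ab.2 | ab in OK].
  apply/setP => g; rewrite inE; apply/andP/imsetP => [[K1 K2]|[[a b]]].
    have [_ _ _ ok gE] := path_sound K1 K2.
    by exists (g p, g q); rewrite ?inE.
  by rewrite inE => ok ->; apply: path_complete.
rewrite card_in_imset => [|[a b] [a' b']]; last first.
  rewrite !inE /= => o1 o2 E12; congr (_, _).
    by rewrite -(ext_fst o1) E12 (ext_fst o2).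
  by rewrite -(ext_snd o1) E12 (ext_snd o2).
rewrite -sum1dep_card big_mkcond /=.
rewrite -(pair_bigA _ (fun a b => if ok4 e e1 p q r s f h a b then 1 else 0)) /=.
by rewrite !big_bool /count4; do 4!case: ok4.
Qed.
End PathCard.

Lemma edge_square_card (P : finType) (e00 e01 e10 e11 : rel P) p q r s
    (f h : {ffun P -> bool}) :
  surgery e00 e01 p q -> surgery e00 e10 r s -> surgery e01 e11 r s ->
  surgery e10 e11 p q ->
  #|[set g | edgeK e00 e01 p q f g && edgeK e01 e11 r s g h]| =
  #|[set g | edgeK e00 e10 r s f g && edgeK e10 e11 p q g h]|.
Proof.
move=> S1 S2 S3 S4; rewrite (path_card S1 S3) (path_card S2 S4).
case: (boolP (constant_on e00 f)) => //= /constant_onP Cf.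
case: (boolP (constant_on e11 h)) => //= /constant_onP Ch.
rewrite (square_count S1 S2 S3 S4 Cf Ch); congr (nat_of_bool _ * _).
by apply: eq_forallb => x; do 4!case: (e00 _ x).
Qed.

(** * Lowering a circle commutes with surgery *)

Section Lower.
Variables (P : finType) (e e' : rel P) (p q t : P).
Hypothesis S : surgery e e' p q.
Variables f h : {ffun P -> bool}.
Let E := surg_eqv S.
Let E' := surg_eqv' S.
Let low := [ffun x => ~~ e t x && f x].
Let raise := [ffun x => e' t x || h x].

Lemma lower_constant : constant_on e f -> constant_on e low.
Proof.
move=> /constant_onP C; apply/constant_onP => x y xy.
by rewrite !ffunE (eqv_right E _ xy) (C _ _ xy).
Qed.

Let raise_constant : constant_on e' h -> constant_on e' raise.
Proof.
move=> /constant_onP C; apply/constant_onP => x y xy.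
by rewrite !ffunE (eqv_right E' _ xy) (C _ _ xy).
Qed.

(** Lowering before the surgery forces the middle decoration [low], lowering after it forces
    [raise]. So commutation amounts to the equivalence of two existence conditions, which only
    involve p, q and t. *)
Lemma lower_edge_iff :
  f t && edgeK e e' p q low h && constant_on e f =
  edgeK e e' p q f raise && (h == [ffun x => ~~ e' t x && h x]) && constant_on e' h.
Proof.
have off x : ~~ e p x -> ~~ e q x -> e t x = e' t x.
  by move=> px qx; rewrite (eqv_sym E) (eqv_sym E'); apply: (surgery_off S).
have H1 := surgery_union S t; have X := surg_xor S.
(* The consequences of transitivity at p, q, t; with them the remaining cases are propositional. *)
have [T1 T2 T3] : [/\ e p q -> e p t = e q t, e p t -> e p q = e q t & e q t -> e p q = e p t].
  split=> [h1|h1|h1]; first exact: (eqv_left E).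
    by rewrite (eqv_sym E p q) (eqv_right E _ h1).
  by rewrite (eqv_right E _ h1).
have [T1' T2' T3'] : [/\ e' p q -> e' p t = e' q t, e' p t -> e' p q = e' q t & e' q t -> e' p q = e' p t].
  split=> [h1|h1|h1]; first exact: (eqv_left E').
    by rewrite (eqv_sym E' p q) (eqv_right E' _ h1).
  by rewrite (eqv_right E' _ h1).
have etp : e t p = e p t by rewrite (eqv_sym E).
have etq : e t q = e q t by rewrite (eqv_sym E).
have etp' : e' t p = e' p t by rewrite (eqv_sym E').
have etq' : e' t q = e' q t by rewrite (eqv_sym E').
apply/idP/idP.
- case/andP=> /andP [ft /and4P [Cl Ch /forallP O M]] Cf; have /constant_onP C := Cf.
  have /constant_onP C' := Ch.
  have FT x y : e x y -> f x = f y by apply: C.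
  move: (FT p t) (FT q t) (FT p q) (C' p t) (C' q t) (C' p q).
  rewrite ft => F1 F2 F3 G1 G2 G3.
  have Ot : ~~ e p t -> ~~ e q t -> ~~ h t.
    by move=> n1 n2; have := O t; rewrite n1 n2 ffunE (eqv_refl E) /= => /eqP ->.
  have ht : ~~ h t.
    move: M; rewrite !ffunE etp etq /mult_rule.
    by move: H1 X T1 T2 T3 T1' T2' T3' F1 F2 F3 G1 G2 G3 Ot;
     case: (e p q); case: (e p t); case: (e q t); case: (e' p q); case: (e' p t); case: (e' q t);
     rewrite ?eqxx //= => _ _; do ?[move/(_ isT)]; case: (f p); case: (f q); case: (h p); case: (h q); case: (h t) => //=; intuition.
  rewrite Ch andbT; apply/andP; split; last first.
    apply/eqP/ffunP => x; rewrite ffunE; case: (boolP (e' t x)) => //= tx.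
    by rewrite -(C' _ _ tx); apply: negbTE.
  apply/and4P; split=> //; first exact: raise_constant.
    apply/forallP => x; apply/implyP => px; apply/implyP => qx.
    have := O x; rewrite px qx /= !ffunE -off // => /eqP ->.
    by case: (boolP (e t x)) => //= /C <-; rewrite ft.
  move: M ht; rewrite !ffunE etp etq etp' etq' /mult_rule.
  by move: H1 X T1 T2 T3 T1' T2' T3' F1 F2 F3 G1 G2 G3 Ot;
     case: (e p q); case: (e p t); case: (e q t); case: (e' p q); case: (e' p t); case: (e' q t);
     rewrite ?eqxx //= => _ _; do ?[move/(_ isT)]; case: (f p); case: (f q); case: (h p); case: (h q); case: (h t) => //=; intuition.
case/andP=> /andP [/and4P [Cf Cr /forallP O M] /eqP Eh] Ch; have /constant_onP C := Cf.
have /constant_onP C' := Ch.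
have ht : h t = false by rewrite Eh ffunE (eqv_refl E').
move: (C p t) (C q t) (C p q) (C' p t) (C' q t) (C' p q).
rewrite ht => F1 F2 F3 G1 G2 G3.
have ft : f t.
  have Ot : ~~ e p t -> ~~ e q t -> f t.
    by move=> n1 n2; have := O t; rewrite n1 n2 ffunE (eqv_refl E') /= => /eqP <-.
  move: M; rewrite !ffunE etp' etq' /mult_rule.
  by move: H1 X T1 T2 T3 T1' T2' T3' F1 F2 F3 G1 G2 G3 Ot;
     case: (e p q); case: (e p t); case: (e q t); case: (e' p q); case: (e' p t); case: (e' q t);
     rewrite ?eqxx //= => _ _; do ?[move/(_ isT)]; case: (f p); case: (f q); case: (h p); case: (h q); case: (f t) => //=; intuition.
rewrite Cf ft /= andbT; apply/and4P; split=> //; first exact: lower_constant.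
  apply/forallP => x; apply/implyP => px; apply/implyP => qx.
  have := O x; rewrite px qx /= !ffunE -off // => /eqP <-.
  by rewrite Eh ffunE -off //; case: (e t x).
move: M; rewrite !ffunE etp etq etp' etq' /mult_rule; move: F1 F2; rewrite ft.
by move: H1 X T1 T2 T3 T1' T2' T3' F3 G1 G2 G3;
     case: (e p q); case: (e p t); case: (e q t); case: (e' p q); case: (e' p t); case: (e' q t);
     rewrite ?eqxx //= => _ _; do ?[move/(_ isT)]; case: (f p); case: (f q); case: (h p); case: (h q); case: (f t) => //=; intuition.
Qed.

Lemma lower_edge_card :
  #|[set g | lower e t f g && edgeK e e' p q g h]| =
  #|[set g | edgeK e e' p q f g && lower e' t g h]|.
Proof.
transitivity (f t && edgeK e e' p q low h && constant_on e f : nat).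
  case: (boolP (_ && _)) => [/andP [/andP [ft K] C]|N].
    apply: etrans (cards1 low); apply: eq_card => g; rewrite !inE /lower C ft /=.
    by case: eqP => //= ->.
  apply/eqP; rewrite cards_eq0; apply/eqP/setP => g; rewrite !inE /lower.
  apply: contraNF N => /andP [/and3P [C ft /eqP gE] K].
  by rewrite C ft andbT  -(gE : g = low).
rewrite lower_edge_iff.
case: (boolP (_ && _)) => [/andP [/andP [K hE] C]|N].
  apply/esym/(etrans _ (cards1 raise))/eq_card => g; rewrite !inE /lower.
  apply/idP/eqP => [/andP [_ /and3P [/constant_onP Cg gt /eqP hg]]|->].
    apply/ffunP => x; rewrite ffunE hg ffunE.
    by case: (boolP (e' t x)) => //= /Cg <-; rewrite gt.
  have [_ Cr _ _] := and4P K; rewrite K Cr ffunE (eqv_refl E') /=.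
  rewrite {1}(eqP hE); apply/eqP/ffunP => x; rewrite !ffunE.
  by case: (e' t x).
apply/esym/eqP; rewrite cards_eq0; apply/eqP/setP => g; rewrite !inE /lower.
apply: contraNF N => /andP [K /and3P [/constant_onP Cg gt /eqP hg]].
have Ch : constant_on e' h.
  apply/constant_onP => x y xy; rewrite hg !ffunE (eqv_right E' _ xy).
  by rewrite (Cg _ _ xy).
have <- : g = raise.
  apply/ffunP => x; rewrite ffunE hg ffunE.
  by case: (boolP (e' t x)) => //= /Cg <-; rewrite gt.
rewrite K Ch andbT; apply/eqP/ffunP => x; rewrite hg !ffunE.
by case: (e' t x).
Qed.
End Lower.

(** Comultiplying and then multiplying is multiplication by 2X; multiplying and then comultiplying
    is multiplication by the sum of X on either factor. So each path lowers exactly one + circle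
    through a foot. *)
Lemma edge_back (P : finType) (e e' : rel P) (p q : P) (f g h : {ffun P -> bool}) :
  surgery e e' p q -> edgeK e e' p q f g -> edgeK e' e p q g h ->
  exists t, ((t == p) || (t == q)) && lower e t f h.
Proof.
move=> S /and4P [Cf /constant_onP Cg /forallP O1 M1] /and4P [_ /constant_onP Ch /forallP O2 M2].
have /constant_onP C := Cf; have E := surg_eqv S; have E' := surg_eqv' S.
have off x : ~~ e p x -> ~~ e q x -> h x = f x.
  move=> px qx; have := O1 x; rewrite px qx /= => /eqP <-.
  have := surgery_union S x; rewrite (negPf px) (negPf qx) => /esym/norP [n1 n2].
  by have := O2 x; rewrite n1 n2 => /eqP.
have key t : f t -> e p t || e q t -> h t = false ->
    (forall x, (e p x || e q x) && ~~ e t x -> h x = f x) -> lower e t f h.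
  move=> ft _ ht H; rewrite /lower Cf ft; apply/eqP/ffunP => x; rewrite ffunE.
  case: (boolP (e t x)) => [/Ch <- //|ntx] /=.
  case: (boolP (e p x || e q x)) => [pqx|/norP [? ?]]; last exact: off.
  by apply: H; rewrite pqx ntx.
move: M1 M2 (surg_xor S); rewrite /mult_rule; case: (boolP (e p q)) => pq.
  case: (boolP (e' p q)) => // npq' M1 M2 _.
  exists p; rewrite eqxx /=; apply: key; rewrite ?(eqv_refl E) //.
  - by move: M1 M2; case: (f p); case: (g p); case: (g q).
  - by move: M1 M2; case: (h p); case: (f p); case: (g p); case: (g q).
  by move=> x; rewrite -(eqv_left E pq) orbb andbN.
case: (boolP (e' p q)) => // pq' /andP [M1 M1'] /andP [M2 M2'] _.
(* Merge, then division. If [h] is still + at p, the circle of q was lowered; otherwise it was that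
   of p when [f] is + there, and else that of q. *)
have [hp|hp] := boolP (h p).
  exists q; rewrite eqxx orbT /=; apply: key; rewrite ?(eqv_refl E) ?orbT //.
  - by move: M1 M1' M2 M2'; rewrite (Cg _ _ pq') hp; case: (f p); case: (f q); case: (g q); case: (h q).
  - by move: M1 M1' M2 M2'; rewrite (Cg _ _ pq') hp; case: (f p); case: (f q); case: (g q); case: (h q).
  move=> x; case: (boolP (e q x)) => [|_]; rewrite ?andbF // orbF andbT => px.
  rewrite -(C _ _ px) -(Ch _ _ px) hp.
  by move: M1 M1' M2 M2'; rewrite (Cg _ _ pq') hp; case: (f p); case: (f q); case: (g q); case: (h q).
have [fp|fp] := boolP (f p).
  exists p; rewrite eqxx /=; apply: key; rewrite ?(eqv_refl E) //; first exact: negbTE.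
  move=> x; case: (boolP (e p x)) => [|_]; rewrite ?andbF // andbT => qx.
  rewrite -(C _ _ qx) -(Ch _ _ qx).
  by move: M1 M1' M2 M2'; rewrite (Cg _ _ pq') (negPf hp) fp; case: (f q); case: (g q); case: (h q).
exists q; rewrite eqxx orbT /=; apply: key; rewrite ?(eqv_refl E) ?orbT //.
- by move: M1; rewrite (negPf fp).
- by move: M1 M1' M2 M2'; rewrite (Cg _ _ pq') (negPf hp) (negPf fp); case: (f q); case: (g q); case: (h q).
move=> x; case: (boolP (e q x)) => [|_]; rewrite ?andbF // orbF andbT => px.
by rewrite -(C _ _ px) -(Ch _ _ px) (negPf hp) (negPf fp).
Qed.

(** * Planar matchings *)

(* For x distinct from p and q: x lies between p and q. *)
Definition sep (p q x : nat) : bool := (p < x) (+) (q < x).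

Lemma sep_add p q r x : sep p r x = sep p q x (+) sep q r x.
Proof. by rewrite /sep; do 3!case: (_ < x). Qed.
Lemma sep_sym p q x : sep p q x = sep q p x.
Proof. exact: addbC. Qed.

Lemma sep_dual p q x y : p != x -> p != y -> q != x -> q != y ->
  (sep p q x == sep p q y) = (sep x y p == sep x y q).
Proof.
rewrite /sep => px py qx qy.
have F a b : a != b -> (b < a) = ~~ (a < b) by lia.
by rewrite (F p x) // (F p y) // (F q x) // (F q y) //; do 4!case: (_ < _).
Qed.

Lemma sep_between (x k y l : nat) :
  sep k l x = sep k l y -> x < k < y -> l != x -> l != y -> x < l < y.
Proof.
move=> + /andP [xk ky]; rewrite /sep ky [k < x]ltnNge (ltnW xk) /= => E h1 h2.
by move: E h1 h2; case: (ltngtP l x); case: (ltngtP l y) => //=; lia.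
Qed.

Lemma sep_of (x y z : nat) : (x < z < y) || (y < z < x) -> sep x y z.
Proof. by rewrite /sep; case: (ltngtP x z); case: (ltngtP y z) => //=; lia. Qed.

(** Between two points of one kind, primed or not, lies one of the other kind, so the kinds
    alternate cyclically. Then a pairing of unlike points has no crossing. *)
Lemma sep_repair a a' b b' : uniq [:: a; a'; b; b'] ->
  sep a a' b = sep a a' b' -> sep a b a' || sep a b b' -> sep a' b' a || sep a' b' b ->
  sep a b' b = sep a b' a'.
Proof.
rewrite /= !inE !negb_or -!andbA => /and5P [n1 n2 n3 n4 /and3P [n5 n6 _]]; rewrite /sep.
have F (x y : nat) : x != y -> (y < x) = ~~ (x < y) by lia.
rewrite (F a a') // (F a' b) // (F a b') // (F a' b') // (F b b') //.
have t (x y z : nat) : x != y -> y != z -> x != z ->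
    ((x < y) && (y < z) ==> (x < z)) && (~~ (x < y) && ~~ (y < z) ==> ~~ (x < z)).
  by move=> h1 h2 h3; lia.
move: (t _ _ _ n1 n4 n2) (t _ _ _ n1 n5 n3) (t _ _ _ n2 n6 n3) (t _ _ _ n4 n6 n5).
by do 6!case: (_ < _).
Qed.

Lemma involution_even (T : finType) (f : T -> T) (X : {set T}) :
  {in X, forall x, [/\ f x \in X, f x != x & f (f x) = x]} -> ~~ odd #|X|.
Proof.
have [k] := ubnP #|X|; elim: k X => // k IH X ltX fX.
have [->|[x xX]] := set_0Vmem X; first by rewrite cards0.
have [fxX nfx ffx] := fX x xX.
rewrite (cardsD1 x) xX (cardsD1 (f x)) !inE nfx fxX !oddD /= ?negbK.
apply: IH => [|y].
  by move: ltX; rewrite (cardsD1 x) xX (cardsD1 (f x)) !inE nfx fxX /=; lia.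
rewrite !inE => /and3P [yfx yx yX]; have [fyX nfy ffy] := fX y yX.
split=> //; rewrite fyX andbT; apply/andP; split.
  by apply: contra yx => /eqP /(congr1 f); rewrite ffy ffx => ->.
by apply: contra yfx => /eqP <-; rewrite ffy.
Qed.

Lemma card_set4 (T : finType) (a b c d : T) :
  uniq [:: a; b; c; d] -> #|[set a; b; c; d]| = 4.
Proof. by move=> /card_uniqP E; apply: etrans E; apply: eq_card => x; rewrite !inE !orbA. Qed.

Lemma card_interval N (s t : 'I_N) : s < t -> #|[set k : 'I_N | s < k < t]| = t - s.+1.
Proof.
move=> st.
have lt_card (u : nat) : u <= N -> #|[set k : 'I_N | k < u]| = u.
  by move=> uN; rewrite -sum1dep_card (big_ord_narrow uN) sum1_card card_ord.
have := lt_card t (ltnW (ltn_ord t)); rewrite -(cardsID [set k : 'I_N | k < s.+1]).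
have -> : [set k : 'I_N | k < t] :&: [set k : 'I_N | k < s.+1] = [set k : 'I_N | k < s.+1].
  by apply/setP => k; rewrite !inE; lia.
have -> : [set k : 'I_N | k < t] :\: [set k : 'I_N | k < s.+1] = [set k : 'I_N | s < k < t].
  by apply/setP => k; rewrite !inE; lia.
by rewrite lt_card; [lia | exact: ltn_ord].
Qed.

Section Matchings.
Variable n : nat.
Local Notation I := 'I_n.*2.
Implicit Types (m : matching n) (A B : {set I}) (i j k x y : I).

Lemma mateK m : involutive m.
Proof.
by move=> i; case/andP: (valP m) => /forallP /(_ i) /andP [_ /eqP].
Qed.
Lemma mate_neq m i : m i != i.
Proof. by case/andP: (valP m) => /forallP /(_ i) /andP [-> _]. Qed.
Lemma mate_inj m : injective m. Proof. exact: inv_inj (@mateK m). Qed.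
Lemma mate_eq m i j : (m i == j) = (i == m j).
Proof. by rewrite -(inj_eq (@mate_inj m)) mateK. Qed.

(** [planar] reads an arc from its left end only; [sep] allows either end, which saves case
    distinctions later on. *)
Lemma planarP (f : {ffun I -> I}) :
  reflect [/\ involutive f, forall i, f i != i &
             forall i j, j != i -> j != f i -> sep i (f i) j = sep i (f i) (f j)]
          (planar f).
Proof.
apply: (iffP andP) => [[/forallP h1 /forallP h2]|[fK fN h]].
  have fK : involutive f by move=> i; have /andP [_ /eqP] := h1 i.
  have fN i : f i != i by have /andP [] := h1 i.
  have h i j : i < j < f i -> i < f j < f i.
    by move=> ij; have /forallP /(_ j) /implyP /(_ ij) := h2 i.
  have hh i j : i < f i -> j != i -> j != f i -> sep i (f i) j = sep i (f i) (f j).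
    move=> ii ji jfi; rewrite /sep.
    have fji : f j != i by apply: contra jfi => /eqP <-; rewrite fK.
    have fjfi : f j != f i by rewrite (inj_eq (inv_inj fK)).
    by move: (h i j) (h i (f j)) ji jfi fji fjfi; rewrite fK -!val_eqE /=; lia.
  split=> // i j ji jfi; case: (ltngtP i (f i)) => [lt|gt|/val_inj/esym/eqP].
  - exact: hh.
  - rewrite !(sep_sym i); rewrite -{2 4}[i]fK; apply: hh; rewrite ?fK //.
  by rewrite (negPf (fN i)).
split; apply/forallP => i; first by rewrite fN fK /=.
apply/forallP => j; apply/implyP => ij.
have ji : j != i by rewrite -val_eqE /=; lia.
have jfi : j != f i by rewrite -val_eqE /=; lia.
have := h i j ji jfi.
have fji : f j != i by apply: contra jfi => /eqP <-; rewrite fK.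
have fjfi : f j != f i by rewrite (inj_eq (inv_inj fK)).
by move: fji fjfi; rewrite /sep -!val_eqE /=; lia.
Qed.

Lemma mate_sep m i j : j != i -> j != m i -> sep i (m i) j = sep i (m i) (m j).
Proof. by have /planarP [_ _] := valP m; apply. Qed.

(** The points strictly between i and j are paired among themselves, so there is an even number of
    them. *)
Lemma gap_parity m i j : i < j -> (forall k, i < k < j -> i < m k < j) ->
  odd i != odd j.
Proof.
move=> ij H.
have : ~~ odd #|[set k : I | i < k < j]|.
  apply: (@involution_even _ m) => k; rewrite inE => /H h.
  by rewrite inE h mate_neq mateK.
by rewrite card_interval //; lia.
Qed.

Lemma mate_parity m i : odd (m i) = ~~ odd i.
Proof.
suff H k : k < m k -> odd (m k) = ~~ odd k.
  case: (ltngtP i (m i)) => [/H //|lt|/val_inj/esym/eqP]; last by rewrite (negPf (mate_neq m i)).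
  by have := H (m i); rewrite mateK => /(_ lt) ->; rewrite negbK.
move=> kk; have : odd k != odd (m k); last by case: (odd k); case: (odd (m k)).
apply: (@gap_parity m) => // j kj.
have jk : j != k by rewrite -val_eqE /=; lia.
have jmk : j != m k by rewrite -val_eqE /=; lia.
have mjk : m j != k by rewrite mate_eq.
have mjmk : m j != m k by rewrite (inj_eq (@mate_inj m)).
by have := mate_sep jk jmk; move: mjk mjmk; rewrite /sep -!val_eqE /=; lia.
Qed.

Lemma mem_under m k x : k < m k -> x != k -> x != m k -> (x \in under m k) = sep k (m k) x.
Proof. by rewrite inE /sep -!val_eqE /=; lia. Qed.

Lemma is_bridgeP m A :
  reflect [/\ #|A| = 4, forall i, i \in A -> m i \in A &
     forall k x y, k \notin A -> x \in A -> y \in A -> sep k (m k) x = sep k (m k) y]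
  (is_bridge m A).
Proof.
have ne k x : k \notin A -> x \in A -> x != k by move=> kA; apply: contraTneq => ->.
apply: (iffP and3P) => [[/eqP c4 /forall_inP cl /forallP H]|[c4 cl H]].
  split=> // k x y kA xA yA.
  have mkA : m k \notin A by apply: contra kA => /cl; rewrite mateK.
  have HH j : j \notin A -> m j \notin A -> j < m j -> sep j (m j) x = sep j (m j) y.
    move=> jA mjA lt; have := H j; rewrite jA lt /= => /orP [/subsetP S|D].
      by rewrite -!mem_under ?ne // !S.
    rewrite -!mem_under ?ne //.
    by rewrite !(disjointFr D).
  case: (ltngtP k (m k)) => [lt|gt|/val_inj/esym/eqP]; last by rewrite (negPf (mate_neq m k)).
    exact: HH.
  rewrite !(sep_sym k); have := HH (m k) mkA; rewrite mateK; exact.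
split; [exact/eqP | exact/forall_inP | apply/forallP => k; apply/implyP => /andP [kA lt]].
have mkA : m k \notin A by apply: contra kA => /cl; rewrite mateK.
have [x xA] : exists x, x \in A by apply/set0Pn; rewrite -cards_eq0 c4.
apply/orP; case: (boolP (x \in under m k)) => xu; [left|right].
  apply/subsetP => y yA; rewrite mem_under ?ne // -(H k x y) //.
  by rewrite -mem_under ?ne.
rewrite disjoints_subset; apply/subsetP => y yA; rewrite inE mem_under ?ne // -(H k x y) //.
by rewrite -mem_under ?ne.
Qed.

(* A consists of the arcs through a and b, which are surgered to the arcs
   {a, m b} and {b, m a}. *)
Definition quad m A a b := [/\ A = [set a; m a; b; m b], odd a = odd b & a != b].

Lemma quad_neq m A a b : quad m A a b ->
  [/\ a != m a, a != b, a != m b & [/\ b != m a, b != m b & m a != m b]].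
Proof.
case=> _ o ab; have ne x y : odd x != odd y -> x != y :> I by apply: contraNneq => ->.
have N (x : bool) : x != ~~ x by case: x.
by split=> //; last split; rewrite ?(inj_eq (@mate_inj m)) //; apply: ne; rewrite mate_parity ?o.
Qed.

Lemma quadP m A x : #|A| = 4 -> (forall i, i \in A -> m i \in A) -> x \in A ->
  exists y, quad m A x y.
Proof.
move=> c4 cl xA.
have [y] : exists y, y \in A :\ x :\ m x.
  apply/set0Pn; rewrite -cards_eq0.
  have := cardsD1 x A; rewrite xA; have := cardsD1 (m x) (A :\ x).
  by rewrite !inE mate_neq cl // c4 /= => -> h; apply/eqP => h2; rewrite h2 in h.
rewrite !inE => /and3P [ymx yx yA].
have main z : z \in A -> z != x -> z != m x -> odd x = odd z -> quad m A x z.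
  move=> zA zx zmx o; split; rewrite // 1?eq_sym //.
  apply/esym/eqP; rewrite eqEcard; apply/andP; split.
    by apply/subsetP => t; rewrite !inE => /orP [/orP [/orP []|]|] /eqP ->; rewrite ?cl.
  rewrite c4 card_set4 //= !inE !negb_or andbT.
  rewrite eq_sym mate_neq (eq_sym x) zx (eq_sym (m x) z) zmx.
  rewrite -(mate_eq m) eq_sym zmx (inj_eq (@mate_inj m)) eq_sym zx.
  by rewrite eq_sym mate_neq.
(* If y has the wrong parity, its mate has the right one. *)
case: (boolP (odd x == odd y)) => [/eqP o|no]; first by exists y; apply: main.
exists (m y); apply: main; rewrite ?cl //.
- by rewrite mate_eq.
- by rewrite (inj_eq (@mate_inj m)).
by rewrite mate_parity; move: no; case: (odd x); case: (odd y).
Qed.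

Lemma quad_sym m A a b : quad m A a b -> quad m A b a.
Proof.
by case=> -> o ab; split; rewrite // 1?eq_sym //; apply/setP => x; rewrite !inE; do 4!case: eqP.
Qed.
Lemma quad_mate m A a b : quad m A a b -> quad m A (m a) (m b).
Proof.
case=> -> o ab; split; rewrite ?mateK ?mate_parity ?o ?(inj_eq (@mate_inj m)) //.
by apply/setP => x; rewrite !inE; do 4!case: eqP.
Qed.
Lemma quad_mem m A a b : quad m A a b -> [/\ a \in A, m a \in A, b \in A & m b \in A].
Proof. by case=> -> _ _; rewrite !inE !eqxx ?orbT. Qed.
Lemma quad_card m A a b : quad m A a b -> #|A| = 4.
Proof.
move=> q; have [] := quad_neq q; have [-> _ _] := q.
move=> n1 n2 n3 [n4 n5 n6].
by rewrite card_set4 //= !inE !negb_or n1 n2 n3 (eq_sym _ b) n4 n6 n5.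
Qed.
Lemma quad_in m A a b x : quad m A a b -> x \in A -> [\/ x = a, x = m a, x = b | x = m b].
Proof.
case=> -> _ _; rewrite !inE => /orP [/orP [/orP []|]|] /eqP ->;
by [constructor 1|constructor 2|constructor 3|constructor 4].
Qed.

Lemma quad_closed m A a b i : quad m A a b -> i \in A -> m i \in A.
Proof.
by move=> q iA; have [h1 h2 h3 h4] := quad_mem q; case: (quad_in q iA) => ->; rewrite ?mateK.
Qed.

Lemma surg_fun_quad m A a b i : quad m A a b -> i \in A -> surg_fun m A i =
  if (i == a) || (i == m a) then m (if i == a then b else m b) else m (if i == b then a else m a).
Proof.
move=> q iA; have [n1 n2 n3 [n4 n5 n6]] := quad_neq q.
have [a1 a2 a3 a4] := quad_mem q; have [_ o _] := q.
have key x y : quad m A x y -> surg_fun m A x = m y.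
  move=> q'; have [x1 x2 x3 x4] := quad_mem q'; have [_ o' xy] := q'.
  rewrite ffunE x1; case: pickP => [j /and3P [jA oj jm] /=|/(_ (m y))].
    case: (quad_in q' jA) => E //; move: oj jm; rewrite E ?eqxx ?o' ?eqxx //.
  by rewrite x4 mate_parity o' (inj_eq (@mate_inj m)) (eq_sym y) xy; case: (odd y).
case: (quad_in q iA) => ->; rewrite ?eqxx ?orbT /=.
- exact: key.
- by rewrite eq_sym (negPf n1) (key _ _ (quad_mate q)).
- by rewrite eq_sym (negPf n2) (negPf n4) (key _ _ (quad_sym q)).
rewrite eq_sym (negPf n3) eq_sym (negPf n6) eq_sym (negPf n5).
exact: (key _ _ (quad_mate (quad_sym q))).
Qed.

Lemma surg_fun_at m A a b : quad m A a b -> surg_fun m A a = m b.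
Proof. by move=> q; have [aA _ _ _] := quad_mem q; rewrite (surg_fun_quad q) // eqxx. Qed.

(** Arcs outside A do not separate points of A, so only the two new arcs could cross each other.
    Parities alternate along the four points of A, and [sep_repair] applies. *)
Lemma surg_fun_planar m A : is_bridge m A -> planar (surg_fun m A).
Proof.
move=> /is_bridgeP [c4 cl H].
have off i : i \notin A -> surg_fun m A i = m i by rewrite ffunE => /negPf ->.
have inA x : x \in A -> exists2 y, quad m A x y & surg_fun m A x = m y.
  by move=> /(quadP c4 cl) [y q]; exists y; rewrite ?(surg_fun_at q).
have mA x : (m x \in A) = (x \in A) by apply/idP/idP => /cl; rewrite ?mateK.
have sA x : (surg_fun m A x \in A) = (x \in A).
  case: (boolP (x \in A)) => [/inA [y q ->]|nx]; last by rewrite off // mA (negPf nx).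
  by have [_ _ _ ->] := quad_mem q.
have ne k x : k \notin A -> x \in A -> x != k by move=> kA; apply: contraTneq => ->.
apply/planarP; split.
- move=> x; case: (boolP (x \in A)) => [/inA [y q ->]|nx]; last first.
    by rewrite (off _ nx) off ?mA // mateK.
  by rewrite (surg_fun_at (quad_mate (quad_sym q))) mateK.
- move=> x; case: (boolP (x \in A)) => [/inA [y q ->]|nx]; last by rewrite off // mate_neq.
  by have [_ _ n3 _] := quad_neq q; rewrite eq_sym.
move=> i j ji jsi.
case: (boolP (i \in A)) => [iA|nA]; last first.
  rewrite (off _ nA); rewrite (off _ nA) in jsi.
  case: (boolP (j \in A)) => [jA|nj]; last by rewrite (off _ nj) mate_sep.
  by apply: H; rewrite ?sA.
case: (boolP (j \in A)) => [jA|nj]; last first.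
  rewrite (off _ nj); have sj : m j \notin A by rewrite mA.
  apply/eqP; have siA : surg_fun m A i \in A by rewrite sA.
  by rewrite sep_dual ?(H j i (surg_fun m A i)) ?eqxx // (ne _ _ nj, ne _ _ sj).
have [k q E] := inA i iA; rewrite E in jsi *.
have [a1 a2 a3 a4] := quad_mem q; have [n1 n2 n3 [n4 n5 n6]] := quad_neq q.
have [EA o _] := q.
(* If no point of A lay between x and y, every arc starting in the gap would stay there, since it
   cannot separate x from y; [gap_parity] would then give different parities. *)
have between x y : x \in A -> y \in A -> odd x = odd y -> x < y ->
    exists2 z, z \in A & x < z < y.
  move=> xA yA oxy xy; apply/exists_inP; apply: contraT; rewrite negb_exists_in => /forall_inP N.
  suff : odd x != odd y by rewrite oxy eqxx.
  apply: (@gap_parity m _ _ xy) => l xly.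
  have lA : l \notin A by apply: contraL xly => /N.
  have lmA : m l \notin A by rewrite mA.
  by apply: (sep_between (H l x y lA xA yA) xly); rewrite eq_sym; apply: ne.
have bt x y : x \in A -> y \in A -> odd x = odd y -> x != y ->
    exists2 z, z \in A & (x < z < y) || (y < z < x).
  move=> xA yA oxy nxy; case: (ltngtP x y) => [lt|lt|/val_inj E']; last by rewrite E' eqxx in nxy.
    by have [z zA h] := between x y xA yA oxy lt; exists z; rewrite ?h.
  by have [z zA h] := between y x yA xA (esym oxy) lt; exists z; rewrite ?h ?orbT.
have S := @mate_sep m i k; rewrite (eq_sym k i) n2 n4 in S; move/(_ isT isT): S => S.
have oo : odd (m i) = odd (m k) by rewrite !mate_parity o.
have core : sep i (m k) k = sep i (m k) (m i).
  apply: (sep_repair _ S).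
  - rewrite (map_inj_uniq val_inj [:: i; m i; k; m k]) /= !inE !negb_or.
    by rewrite n1 n2 n3 (eq_sym _ k) n4 n6 n5.
  - have [z zA] := bt i k a1 a3 o n2.
    by case: (quad_in q zA) => -> hz; apply/orP;
      [move: hz; rewrite ltnn andbF|left; apply: sep_of|move: hz; rewrite ltnn andbF|right; apply: sep_of].
  have [z zA] := bt (m i) (m k) a2 a4 oo n6.
  by case: (quad_in q zA) => -> hz; apply/orP;
    [left; apply: sep_of|move: hz; rewrite ltnn andbF|right; apply: sep_of|move: hz; rewrite ltnn andbF].
case: (quad_in q jA) ji jsi => ->; rewrite ?eqxx // => _ _.
  by rewrite (surg_fun_at (quad_mate q)) mateK core.
by rewrite (surg_fun_at (quad_sym q)) core.
Qed.
End Matchings.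

(** * Surgery on matchings and paths of two surgeries *)

Section Surgeries.
Variable n : nat.
Local Notation I := 'I_n.*2.
Implicit Types (m mu : matching n) (A B : {set I}) (i j k x y a b c : I).

Lemma matchingP m m' : (forall i, m i = m' i) -> m = m'.
Proof. by move=> H; apply/val_inj/ffunP. Qed.

Lemma surgE m A i : is_bridge m A -> surg m A i = surg_fun m A i.
Proof. by move=> /surg_fun_planar P; rewrite /surg -[mate _]/(val _) val_insubd P. Qed.

Lemma surg_off m A i : i \notin A -> surg m A i = m i.
Proof.
rewrite /surg -[mate _]/(val _) val_insubd => nA; case: ifP => // _.
by rewrite ffunE (negPf nA).
Qed.

Lemma bridge_card m A : is_bridge m A -> #|A| = 4. Proof. by case/is_bridgeP. Qed.
Lemma bridge_closed m A i : is_bridge m A -> (m i \in A) = (i \in A).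
Proof. by case/is_bridgeP => _ cl _; apply/idP/idP => /cl; rewrite ?mateK. Qed.
Lemma bridge_quad m A x : is_bridge m A -> x \in A -> exists y, quad m A x y.
Proof. by case/is_bridgeP => c4 cl _; apply: quadP. Qed.

Lemma surg_quad m A a b : is_bridge m A -> quad m A a b ->
  [/\ surg m A a = m b, surg m A (m b) = a, surg m A b = m a & surg m A (m a) = b].
Proof.
move=> br q; have [aA maA bA mbA] := quad_mem q; rewrite !surgE //.
rewrite (surg_fun_at q) (surg_fun_at (quad_sym q)) (surg_fun_at (quad_mate q)).
by rewrite (surg_fun_at (quad_mate (quad_sym q))) !mateK.
Qed.

Lemma quad_surg m A a b : is_bridge m A -> quad m A a b -> quad (surg m A) A a b.
Proof.
move=> br q; have [e1 e2 e3 e4] := surg_quad br q; have [EA o ab] := q.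
by split; rewrite // e1 e3 EA; apply/setP => x; rewrite !inE; do 4!case: eqP.
Qed.

Lemma surg_neq m A i : is_bridge m A -> i \in A -> surg m A i != m i.
Proof.
move=> br iA; have [y q] := bridge_quad br iA; have [-> _ _ _] := surg_quad br q.
by have [_ _ _ [_ _ n6]] := quad_neq q; rewrite eq_sym.
Qed.

(** An arc outside A belongs to both matchings, so it separates neither the ends of an arc of [m]
    nor those of an arc of [m']. On A the arcs of both form one cycle through all four points. *)
Lemma diff_bridge m m' A : #|A| = 4 -> (forall i, i \in A -> m i \in A) ->
  (forall i, i \in A -> m' i \in A) -> (forall i, i \in A -> m i != m' i) ->
  (forall i, i \notin A -> m i = m' i) -> is_bridge m A /\ surg m A = m'.
Proof.
move=> c4 cl cl' ne off.
have m'q x y : quad m A x y -> m' x = m y.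
  move=> q; have [xA _ _ _] := quad_mem q; have [_ o _] := q.
  case: (quad_in q (cl' x xA)) => // E.
  - by have := mate_neq m' x; rewrite E eqxx.
  - by have := ne x xA; rewrite E eqxx.
  by have := mate_parity m' x; rewrite E o; case: (odd y).
have br : is_bridge m A.
  apply/is_bridgeP; split=> // k.
  have nk x : k \notin A -> x \in A -> (x != k) && (x != m k).
    move=> kA xA; apply/andP; split; first by apply: contraNneq kA => <-.
    by apply: contraNneq kA => E; have := cl x xA; rewrite E mateK.
  have S1 x : k \notin A -> x \in A -> sep k (m k) x = sep k (m k) (m x).
    by move=> kA xA; have /andP [h1 h2] := nk x kA xA; apply: mate_sep.
  have S2 x : k \notin A -> x \in A -> sep k (m k) x = sep k (m k) (m' x).
    by move=> kA xA; have /andP [] := nk x kA xA; rewrite off // => h1 h2; apply: mate_sep.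
  move=> x y kA xA yA; have [z q] := quadP c4 cl xA.
  have [_ mxA zA mzA] := quad_mem q.
  have E : sep k (m k) x = sep k (m k) z by rewrite (S1 z) // (S2 x) // (m'q _ _ q).
  by case: (quad_in q yA) => ->; rewrite // -S1.
split=> //; apply: matchingP => i; case: (boolP (i \in A)) => iA; last by rewrite surg_off // off.
by have [y q] := quadP c4 cl iA; have [-> _ _ _] := surg_quad br q; rewrite (m'q _ _ q).
Qed.

Lemma surgK m A : is_bridge m A ->
  is_bridge (surg m A) A /\ surg (surg m A) A = m.
Proof.
move=> br; apply: diff_bridge; first exact: bridge_card br.
- move=> i iA; have [y q] := bridge_quad br iA; have [-> _ _ _] := surg_quad br q.
  by have [] := quad_mem q.
- by move=> i; rewrite bridge_closed.
- by move=> i; apply: surg_neq.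
by move=> i /surg_off ->.
Qed.

(** The bridge can be recovered from the matchings before and after surgery. Hence, for given end
    matchings, the first bridge of a path determines the second. *)
Definition diffm m m' := [set i | m i != m' i].

Lemma diffmC m m' : diffm m m' = diffm m' m.
Proof. by apply/setP => i; rewrite !inE eq_sym. Qed.

Lemma surg_diff m A : is_bridge m A -> diffm m (surg m A) = A.
Proof.
move=> br; apply/setP => i; rewrite inE eq_sym.
by case: (boolP (i \in A)) => [/(surg_neq br)|/surg_off ->]; rewrite ?eqxx.
Qed.

Lemma surg_inj m A B : is_bridge m A -> is_bridge m B -> surg m A = surg m B -> A = B.
Proof. by move=> /surg_diff {2}<- /surg_diff {2}<- ->. Qed.

Lemma surg_bridge_diff m mu A : is_bridge m A -> surg m A = mu -> A = diffm m mu.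
Proof. by move=> br <-; rewrite surg_diff. Qed.

Definition arcs m a b := [set a; m a; b; m b].

Lemma arcs_sym m a b : arcs m a b = arcs m b a.
Proof. by apply/setP => x; rewrite !inE; do 4!case: eqP. Qed.

(* The endpoints of three arcs of m which are cyclically reconnected in mu. *)
Definition tri m mu a b c :=
  [/\ uniq [:: a; b; c], odd a = odd b /\ odd b = odd c,
      [/\ mu a = m b, mu b = m c & mu c = m a] &
      forall i, i \notin arcs m a b -> i \notin arcs m b c -> mu i = m i].

Lemma tri_rot m mu a b c : tri m mu a b c -> tri m mu b c a.
Proof.
case=> U [o1 o2] [e1 e2 e3] off; split=> //.
- by move: U; rewrite /= !inE !negb_or => /and3P [/andP [? ?] ? _]; rewrite eq_sym; apply/and3P; split; rewrite // 1?eq_sym //; apply/andP; split; rewrite // eq_sym.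
- by rewrite -o2 o1.
move=> i h1 h2; apply: off => //.
by move: h1 h2; rewrite !inE !negb_or -!andbA => /and4P [-> -> _ _] /and4P [_ _ -> ->].
Qed.

Lemma tri_neq m mu a b c : tri m mu a b c ->
  [/\ a != b, b != c, c != a & [/\ m a != m b, m b != m c & m c != m a]].
Proof.
case=> /= + _ _ _; rewrite !inE !negb_or => /and3P [/andP [h1 h2] h3 _].
by rewrite !(inj_eq (@mate_inj _ m)) (eq_sym c).
Qed.

Lemma tri_parity m mu a b c : tri m mu a b c ->
  [/\ a != m b, a != m c, b != m a & [/\ b != m c, c != m a & c != m b]].
Proof.
case=> _ [o1 o2] _ _; have ne x y : odd x != odd y -> x != y :> I by apply: contraNneq => ->.
by do 2?split; apply: ne; rewrite mate_parity ?o1 ?o2; case: (odd c).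
Qed.

Lemma tri_mate m mu a b c : tri m mu a b c ->
  [/\ mu (m b) = a, mu (m c) = b & mu (m a) = c].
Proof. by case=> _ _ [e1 e2 e3] _; rewrite -e1 -e2 -e3 !mateK. Qed.

Lemma tri_quad m mu a b c : tri m mu a b c -> quad m (arcs m a b) a b.
Proof. by move=> t; have [n1 _ _ _] := tri_neq t; have [_ [o _] _ _] := t; split. Qed.

Lemma tri_neqm m mu a b c : tri m mu a b c -> m <> mu.
Proof.
move=> t E; have [_ _ [e _ _] _] := t; have [_ _ _ [n1 _ _]] := tri_neq t.
by move: n1; rewrite -e E eqxx.
Qed.

(** If B neither equals A nor is disjoint from it, B joins one of the two new arcs on A to an arc
    which the first surgery left alone; the three arcs involved are reconnected cyclically. *)
Lemma two_step_cases m A B : is_bridge m A -> is_bridge (surg m A) B ->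
  [\/ B = A, [disjoint A & B] |
      exists a b c, [/\ tri m (surg (surg m A) B) a b c, A = arcs m a b & B = [set b; m a; c; m c]]].
Proof.
move=> br br'; have [EAB|nAB] := eqVneq B A; first by constructor 1.
have [D|ndis] := boolP [disjoint A & B]; first by constructor 2.
constructor 3; have [b0 b0A b0B] : exists2 b0, b0 \in A & b0 \in B.
  by move: ndis; rewrite -setI_eq0 => /set0Pn [z]; rewrite inE => /andP [h1 h2]; exists z.
have [c cB cA] : exists2 c, c \in B & c \notin A.
  apply/exists_inP; rewrite -[X in is_true X]negbK negb_exists_in; apply: contra nAB => /forall_inP H.
  rewrite eqEcard (bridge_card br) (bridge_card br') leqnn andbT.
  by apply/subsetP => z /H; rewrite negbK.
(* Of the two ends of the new arc, the one with the parity of c is taken. *)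
have [b bA [bB o]] : exists2 b, b \in A & b \in B /\ odd b = odd c.
  have [o|no] := eqVneq (odd b0) (odd c); first by exists b0.
  exists (surg m A b0); first by rewrite (bridge_closed _ (proj1 (surgK br))).
  by rewrite bridge_closed // mate_parity; split=> //; move: no; case: (odd b0); case: (odd c).
have [a q] := bridge_quad br bA; have [e1 e2 e3 e4] := surg_quad br q.
have [EA o' ba] := q.
have sc : surg m A c = m c by rewrite surg_off.
have bc : b != c by apply: contraNneq cA => <-.
have ac : a != c by apply: contraNneq cA => <-; have [] := quad_mem q.
have [c' q'] := bridge_quad br' bB.
have EB : B = [set b; m a; c; m c].
  apply/esym/eqP; rewrite eqEcard (bridge_card br') card_set4; last first.
    rewrite /= !inE !negb_or bc; have [_ _ n3 _] := quad_neq q; rewrite n3 /=.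
    have ne x y : odd x != odd y -> x != y :> I by apply: contraNneq => ->.
    by rewrite (inj_eq (@mate_inj _ m)) ac (eq_sym c) mate_neq !ne // mate_parity -?o -?o' o; case: (odd c).
  rewrite leqnn andbT; apply/subsetP => x; rewrite !inE.
  by case/orP => [/orP [/orP []|]|] /eqP -> //; rewrite -?e1 -?sc bridge_closed.
have q2 : quad (surg m A) B b c by split; rewrite // EB e1 sc.
have [f1 f2 f3 f4] := surg_quad br' q2; rewrite sc e1 in f1 f2 f3 f4.
exists a, b, c; split=> //; last by rewrite EA [RHS]arcs_sym.
split.
- by rewrite /= !inE negb_or (eq_sym a) ba ac bc.
- by rewrite -o' o.
- split=> //; rewrite surg_off ?e3 // EB !inE !negb_or.
  have [n1 n2 n3 [n4 n5 n6]] := quad_neq q.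
  rewrite eq_sym n2 n5 ac; apply: contraNneq cA => E.
  by rewrite -(bridge_closed _ br) -E; have [] := quad_mem q.
move=> i h1 h2; rewrite surg_off; last first.
  by move: h1 h2; rewrite EB !inE !negb_or -!andbA => /and4P [_ -> -> _] /and4P [_ _ -> ->].
by rewrite surg_off // EA -[[set _; _; _; _]]/(arcs m b a) arcs_sym.
Qed.

(** Every pair of the three arcs which is a bridge starts a path to [mu]: after it only four points
    are left to be moved, and [diff_bridge] applies. *)
Lemma tri_second m mu a b c : tri m mu a b c -> is_bridge m (arcs m a b) ->
  is_bridge (surg m (arcs m a b)) [set b; m a; c; m c] /\
  surg (surg m (arcs m a b)) [set b; m a; c; m c] = mu.
Proof.
move=> t br; have q := tri_quad t; have [e1 e2 e3 e4] := surg_quad br q.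
have [n1 n2 n3 [n4 n5 n6]] := tri_neq t; have [k1 k2 k3 [k4 k5 k6]] := tri_parity t.
have [_ _ [u1 u2 u3] off] := t; have [w1 w2 w3] := tri_mate t.
have cA : c \notin arcs m a b by rewrite !inE !negb_or n3 k5 eq_sym n2 k6.
have sc : surg m (arcs m a b) c = m c by rewrite surg_off.
have smc : surg m (arcs m a b) (m c) = c.
  by rewrite surg_off ?mateK // (bridge_closed _ br).
apply: diff_bridge.
- apply: card_set4; rewrite /= !inE !negb_or k3 n2 k4 (eq_sym _ c) k5 eq_sym n6.
  by rewrite (eq_sym c) mate_neq.
- move=> i; rewrite !inE => /orP [/orP [/orP []|]|] /eqP ->;
  by rewrite ?e3 ?e4 ?sc ?smc ?eqxx ?orbT.
- move=> i; rewrite !inE => /orP [/orP [/orP []|]|] /eqP ->;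
  by rewrite ?u2 ?w3 ?u3 ?w2 ?eqxx ?orbT.
- move=> i; rewrite !inE => /orP [/orP [/orP []|]|] /eqP ->;
  by rewrite ?e3 ?e4 ?sc ?smc ?u2 ?w3 ?u3 ?w2 // eq_sym.
move=> i; rewrite !inE !negb_or -!andbA => /and4P [h1 h2 h3 h4].
have [->|ia] := eqVneq i a; first by rewrite e1 u1.
have [->|imb] := eqVneq i (m b); first by rewrite e2 w1.
have iA : i \notin arcs m a b by rewrite !inE !negb_or ia h2 h1.
by rewrite surg_off // off // !inE !negb_or h1 imb h3.
Qed.

(** No point of the first bridge returns to its old mate, so the bridge lies among the six endpoints
    and consists of two of the three arcs. *)
Lemma tri_first m mu a b c A B : tri m mu a b c -> is_bridge m A ->
  is_bridge (surg m A) B -> surg (surg m A) B = mu ->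
  [\/ A = arcs m a b, A = arcs m b c | A = arcs m c a].
Proof.
move=> t br br' E.
have AS x : x \in A -> mu x != m x.
  move=> xA; case: (two_step_cases br br').
  - by move=> EB; case: (tri_neqm t); rewrite -E EB (proj2 (surgK br)).
  - by move=> D; rewrite -E surg_off ?surg_neq // (disjointFr D).
  move=> [a' [b' [c' [t' EA _]]]]; rewrite E in t'; move: xA; rewrite EA.
  have [n1 n2 n3 [n4 n5 n6]] := tri_neq t'.
  have [_ _ [u1 u2 u3] _] := t'; have [w1 w2 w3] := tri_mate t'.
  by rewrite !inE => /orP [/orP [/orP []|]|] /eqP ->; rewrite ?u1 ?w1 ?u2 ?w3 ?mateK // eq_sym.
have [x0 x0A] : exists x, x \in A by apply/set0Pn; rewrite -cards_eq0 (bridge_card br).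
have [x [xA o]] : exists x, x \in A /\ odd x = odd a.
  have [o|no] := eqVneq (odd x0) (odd a); first by exists x0.
  by exists (m x0); rewrite bridge_closed // mate_parity; split=> //; move: no; case: (odd x0); case: (odd a).
have [y q] := bridge_quad br xA; have [_ _ yA _] := quad_mem q.
have [EA oy xy] := q; have [_ [o1 o2] _ off] := t.
have inS z : z \in A -> odd z = odd a -> [\/ z = a, z = b | z = c].
  move=> zA oz; have [->|za] := eqVneq z a; first by constructor 1.
  have [->|zb] := eqVneq z b; first by constructor 2.
  have [->|zc] := eqVneq z c; first by constructor 3.
  have ne (w : I) : odd w != odd z -> z != w by apply: contraNneq => ->.
  case/eqP: (AS z zA); apply: off; rewrite !inE !negb_or ?za ?zb ?zc /=.
    by rewrite !ne // mate_parity oz -?o1; case: (odd a).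
  by rewrite !ne // mate_parity oz -?o2 -?o1; case: (odd a).
have main : A = arcs m x y by [].
have oya : odd y = odd a by rewrite -oy.
have [Ex|Ex|Ex] := inS x xA o; have [Ey|Ey|Ey] := inS y yA oya; move: main xy;
  rewrite Ex Ey ?eqxx // => main _;
  by [constructor 1; rewrite main // arcs_sym|constructor 2; rewrite main // arcs_sym|constructor 3; rewrite main // arcs_sym].
Qed.
End Surgeries.

Lemma sep_minmax (p q x : nat) : x != p -> x != q ->
  sep p q x = (minn p q < x < maxn p q).
Proof. by rewrite /sep; case: (ltngtP p x); case: (ltngtP q x) => //=; lia. Qed.

(** Of three arcs without crossings, at most one separates the other two. *)
Lemma sep_three (a a' b b' c c' : nat) : uniq [:: a; a'; b; b'; c; c'] ->
  sep a a' b = sep a a' b' -> sep a a' c = sep a a' c' ->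
  sep b b' a = sep b b' a' -> sep b b' c = sep b b' c' ->
  sep c c' a = sep c c' a' ->
  (sep a a' b == sep a a' c) || (sep b b' c == sep b b' a).
Proof.
have M (p q : nat) : (p <= q /\ minn p q = p /\ maxn p q = q) \/
  (q <= p /\ minn p q = q /\ maxn p q = p) by lia.
rewrite /= !inE !negb_or -!andbA.
case/and5P=> _ u1 u2 u3 /and5P [u4 u5 u6 u7 /and5P [u8 _ u9 v1 /and4P [v2 v3 _ _]]].
rewrite !sep_minmax //; try by rewrite eq_sym.
move: u1 u2 u5 u6; clear u3 u4 u7 u8 u9 v1 v2 v3.
case: (M a a') => [] [h1 [-> ->]]; case: (M b b') => [] [h2 [-> ->]]; case: (M c c') => [] [h3 [-> ->]]; clear M; lia.
Qed.

(** * Three arcs reconnected cyclically *)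

Section Triples.
Variable n : nat.
Local Notation I := 'I_n.*2.
Implicit Types (m mu : matching n) (A B : {set I}) (i j k x y a b c : I).

Definition hexa m a b c := arcs m a b :|: arcs m b c.

Lemma hexa_rot m a b c : hexa m a b c = hexa m b c a.
Proof.
apply/setP => x; rewrite !inE.
by do 6!(case: eqP => _; rewrite ?orbT ?orbF //).
Qed.

(** Under this condition, only the third arc can prevent two of the three arcs from being a
    bridge. *)
Definition outer m a b c := forall k x y, k \notin hexa m a b c ->
  x \in hexa m a b c -> y \in hexa m a b c -> sep k (m k) x = sep k (m k) y.

Lemma outer_rot m a b c : outer m a b c -> outer m b c a.
Proof. by rewrite /outer hexa_rot. Qed.

Lemma tri_outer m mu a b c : tri m mu a b c -> is_bridge m (arcs m a b) -> outer m a b c.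
Proof.
move=> t br; have [br' _] := tri_second t br.
have [_ _ H] := is_bridgeP _ _ br; have [_ _ H'] := is_bridgeP _ _ br'.
have key k x : k \notin hexa m a b c -> x \in hexa m a b c -> sep k (m k) x = sep k (m k) b.
  rewrite inE negb_or => /andP [k1 k2].
  have kB : k \notin [set b; m a; c; m c].
    by move: k1 k2; rewrite !inE !negb_or -!andbA => /and4P [_ -> -> _] /and4P [_ _ -> ->].
  rewrite inE => /orP [xA|xB]; first by apply: H; rewrite // !inE eqxx ?orbT.
  have [xx|nx] := eqVneq x (m b); first by apply: H; rewrite ?xx // !inE eqxx ?orbT.
  have := H' k x b kB; rewrite surg_off //; apply; last by rewrite !inE eqxx.
  by move: xB nx; rewrite !inE => /orP [/orP [/orP []|]|] ->; rewrite ?orbT.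
by move=> k x y kS xS yS; rewrite (key k x) // (key k y).
Qed.

(** All inequalities among the six endpoints, in both orientations, packed as one rewriting rule
    that decides membership in the sets below. *)
Lemma tri_ne m mu a b c : tri m mu a b c ->
  let ne x y := ((x == y = false) * (y == x = false))%type in
  (ne a b * ne b c * ne c a * ne (m a) (m b) * ne (m b) (m c) * ne (m c) (m a) *
   (ne a (m a) * ne b (m b) * ne c (m c) * ne a (m b) * ne a (m c) * ne b (m a) *
    ne b (m c) * ne c (m a) * ne c (m b)))%type.
Proof.
move=> t ne; have [n1 n2 n3 [n4 n5 n6]] := tri_neq t.
have [k1 k2 k3 [k4 k5 k6]] := tri_parity t.
by do !split; apply/negbTE; rewrite ?mate_neq // eq_sym ?mate_neq.
Qed.

Lemma tri_bridge m mu a b c : tri m mu a b c -> outer m a b c ->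
  is_bridge m (arcs m b c) = (sep a (m a) b == sep a (m a) c).
Proof.
move=> t O; have q := tri_quad (tri_rot t); have [n1 n2 n3 [n4 n5 n6]] := tri_neq t.
have [k1 k2 k3 [k4 k5 k6]] := tri_parity t.
have aN : a \notin arcs m b c by rewrite !inE !negb_or n1 k1 eq_sym n3 k2.
have e1 : sep a (m a) (m b) = sep a (m a) b by rewrite -mate_sep // eq_sym.
have e2 : sep a (m a) (m c) = sep a (m a) c by rewrite -mate_sep.
apply/idP/idP => [br|/eqP E].
  by have [_ _ H] := is_bridgeP _ _ br; have [h1 _ h2 _] := quad_mem q; apply/eqP/H.
apply/is_bridgeP; split=> [|i|k x y kN xA yA].
- exact: quad_card q.
- exact: quad_closed q.
have eA z : z \in arcs m b c -> sep a (m a) z = sep a (m a) b.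
  by case/(quad_in q) => ->; rewrite ?e1 ?e2 -?E.
have [->|ka] := eqVneq k a; first by rewrite !eA.
have [->|kma] := eqVneq k (m a); first by rewrite mateK !(sep_sym (m a)) !eA.
apply: O; rewrite !inE; first by move: kN; rewrite !inE !negb_or ka kma => /andP [/andP [/andP [-> ->] ->] ->].
  by move: xA; rewrite !inE => ->; rewrite orbT.
by move: yA; rewrite !inE => ->; rewrite orbT.
Qed.

Lemma tri_two m mu a b c : tri m mu a b c -> outer m a b c ->
  is_bridge m (arcs m b c) || is_bridge m (arcs m c a).
Proof.
move=> t O; rewrite (tri_bridge t O) (tri_bridge (tri_rot t) (outer_rot O)).
have [n1 n2 n3 [n4 n5 n6]] := tri_neq t.
have [k1 k2 k3 [k4 k5 k6]] := tri_parity t.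
apply: (@sep_three _ _ _ (m b) _ (m c)); try by apply: mate_sep; rewrite // eq_sym.
have ne := tri_ne t; rewrite /= in ne.
by rewrite (map_inj_uniq val_inj [:: a; m a; b; m b; c; m c]) /= !inE !ne.
Qed.

(** Two bridges leave the shared arc on the same side exactly if that arc does not separate their
    other arcs, that is, if one end can be slid over the other bridge. *)
Lemma tri_same_side m mu a b c : tri m mu a b c -> outer m a b c ->
  same_side m (arcs m a b) (arcs m c a) = is_bridge m (arcs m b c).
Proof.
move=> t O; rewrite (tri_bridge t O).
have [n1 n2 n3 [n4 n5 n6]] := tri_neq t.
have [k1 k2 k3 [k4 k5 k6]] := tri_parity t.
have e1 : sep a (m a) (m b) = sep a (m a) b by rewrite -mate_sep // eq_sym.
have e2 : sep a (m a) (m c) = sep a (m a) c by rewrite -mate_sep.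
have ne := tri_ne t; rewrite /= in ne.
have EI : arcs m a b :&: arcs m c a = [set a; m a].
  apply/setP => x; rewrite !inE.
  case: (x =P a) => [->|_]; first by rewrite !ne ?eqxx.
  case: (x =P m a) => [->|_]; first by rewrite !ne ?eqxx.
  case: (x =P b) => [->|_]; first by rewrite !ne ?eqxx.
  by case: (x =P m b) => [->|_]; first by rewrite !ne ?eqxx.
have ED1 : arcs m a b :\: arcs m c a = [set b; m b].
  apply/setP => x; rewrite !inE; case: (x =P b) => [->|_]; first by rewrite !ne ?eqxx ?orbT.
  case: (x =P m b) => [->|_]; first by rewrite !ne ?eqxx ?orbT.
  by do 4!case: eqP.
have ED2 : arcs m c a :\: arcs m a b = [set c; m c].
  apply/setP => x; rewrite !inE; case: (x =P c) => [->|_]; first by rewrite !ne ?eqxx ?orbT.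
  case: (x =P m c) => [->|_]; first by rewrite !ne ?eqxx ?orbT.
  by do 4!case: eqP.
have nAB : arcs m a b != arcs m c a.
  by apply/eqP => /setP/(_ b); rewrite !inE !ne eqxx.
rewrite /same_side nAB EI ED1 ED2 /=.
have sub k x : k < m k -> (k == a) || (k == m a) -> x != a -> x != m a -> m x != a -> m x != m a ->
    ([set x; m x] \subset under m k) = sep a (m a) x.
  move=> lt ka h1 h2 h3 h4; have E : sep a (m a) x = sep a (m a) (m x) by rewrite -mate_sep.
  rewrite subUset !sub1set.
  by case/orP: ka => /eqP Ek; rewrite Ek ?mateK in lt *; rewrite !mem_under ?mateK // ?(sep_sym (m a)) -E andbb.
have sub2 k : k < m k -> (k == a) || (k == m a) ->
    ([set b; m b] \subset under m k) == ([set c; m c] \subset under m k) = (sep a (m a) b == sep a (m a) c).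
  by move=> lt ka; rewrite !(sub k) // 1?eq_sym //.
apply/exists_inP/idP => [[k]|H].
  by rewrite !inE => ka /andP [lt]; rewrite sub2.
have [lt|gt|/val_inj/esym/eqP] := ltngtP a (m a); last by rewrite (negPf (mate_neq m a)).
  by exists a; rewrite ?inE ?eqxx // lt sub2 ?eqxx.
by exists (m a); rewrite ?inE ?eqxx ?orbT // mateK gt sub2 ?mateK ?eqxx ?orbT.
Qed.

(** Identifies the second bridges of [tri_second] with those that [disjoint_arcs] and [class_of]
    prescribe. The shared arc is {a, m a}, and the two feet lie on different pieces of it. *)
Lemma tri_carried m mu a b c : tri m mu a b c ->
  is_bridge m (arcs m a b) -> is_bridge m (arcs m c a) ->
  [set b; m a; c; m c] = carried m (arcs m a b) (arcs m c a) (m a) /\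
  [set a; m c; b; m b] = carried m (arcs m c a) (arcs m a b) a.
Proof.
move=> t br1 br2; have [n1 n2 n3 [n4 n5 n6]] := tri_neq t.
have [k1 k2 k3 [k4 k5 k6]] := tri_parity t.
have [_ _ _ e4] := surg_quad br1 (tri_quad t).
have [_ _ e3 _] := surg_quad br2 (tri_quad (tri_rot (tri_rot t))).
have ne := tri_ne t; rewrite /= in ne.
rewrite /carried e3 e4; split; apply/setP => x; rewrite !inE.
  case: (x =P c) => [->|_]; first by rewrite !ne ?eqxx ?orbT.
  case: (x =P m c) => [->|_]; first by rewrite !ne ?eqxx ?orbT.
  by do 4!case: eqP.
case: (x =P b) => [->|_]; first by rewrite !ne ?eqxx ?orbT.
case: (x =P m b) => [->|_]; first by rewrite !ne ?eqxx ?orbT.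
by do 4!case: eqP.
Qed.
End Triples.

(** * Classification of two-step paths between matchings *)

Section TwoSteps.
Variable n : nat.
Local Notation I := 'I_n.*2.
Implicit Types (m mu : matching n) (A B : {set I}) (i j k x y a b c : I).

Lemma pitchfork_sep A B : pitchfork A B ->
  exists a1 a2 b1 b2, [/\ a1 \in A, a2 \in A, b1 \in B & b2 \in B] /\
    sep a1 a2 b1 != sep a1 a2 b2.
Proof.
case/andP=> _ /exists_inP [a1 h1 /exists_inP [a2 h2 /exists_inP [b1 h3 /exists_inP [b2 h4 H]]]].
exists a1, a2, b1, b2; split=> //; rewrite /sep; case/orP: H => /andP [/andP [l1 l2] l3].
  by rewrite l1 (ltn_trans (ltn_trans l1 l2) l3) l3 ltnNge (ltnW l2).
by rewrite l2 ltnNge (ltnW l1) ltnNge (ltnW (ltn_trans l1 (ltn_trans l2 l3))) ltnNge (ltnW l3).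
Qed.

Lemma sep_pitchfork A B a1 a2 b1 b2 : [disjoint A & B] -> a1 \in A -> a2 \in A ->
  b1 \in B -> b2 \in B -> sep a1 a2 b1 != sep a1 a2 b2 -> pitchfork A B.
Proof.
move=> D h1 h2 h3 h4.
wlog lt : a1 a2 h1 h2 / a1 < a2.
  move=> H S; have [lt|gt|E] := ltngtP a1 a2; first exact: (H a1 a2).
    by apply: (H a2 a1) => //; rewrite !(sep_sym a2).
  by move: S; rewrite /sep E !addbb.
have ne x y : x \in A -> y \in B -> y != x :> nat.
  by move=> xA yB; apply: contraTneq xA => /val_inj <-; rewrite (disjointFl D).
wlog S1 : b1 b2 h3 h4 / sep a1 a2 b1.
  move=> H S; case: (boolP (sep a1 a2 b1)) => S1; first exact: (H b1 b2).
  apply: (H b2 b1) => //; last by rewrite eq_sym.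
  by move: S; rewrite (negPf S1); case: (sep a1 a2 b2).
rewrite S1; case: (boolP (sep a1 a2 b2)) => // + _.
move: S1; rewrite !sep_minmax ?ne // (minn_idPl (ltnW lt)) (maxn_idPr (ltnW lt)) => /andP [l1 l2].
rewrite negb_and -!leqNgt => l3; rewrite /pitchfork D /=.
case/orP: l3 => l3.
  have l4 : b2 < a1 by rewrite ltn_neqAle l3 ne.
  apply/exists_inP; exists a1 => //; apply/exists_inP; exists a2 => //.
  apply/exists_inP; exists b2 => //; apply/exists_inP; exists b1 => //.
  by rewrite l4 l1 l2 orbT.
have l4 : a2 < b2 by rewrite ltn_neqAle l3 eq_sym ne.
apply/exists_inP; exists a1 => //; apply/exists_inP; exists a2 => //.
apply/exists_inP; exists b1 => //; apply/exists_inP; exists b2 => //.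
by rewrite l1 l2 l4.
Qed.

(** Only the arcs of A itself are present in [m] but not after surgery. If one of them separated
    points of B, then A and B would cross. *)
Lemma nonpitch_bridge m A B : is_bridge m A -> is_bridge (surg m A) B ->
  [disjoint A & B] -> ~~ pitchfork A B ->
  [/\ is_bridge m B, is_bridge (surg m B) A & surg (surg m B) A = surg (surg m A) B].
Proof.
move=> brA brB D nP; have [c4 cl H] := is_bridgeP _ _ brB.
have offA x : x \in B -> surg m A x = m x by move=> xB; rewrite surg_off // (disjointFl D).
have br : is_bridge m B.
  apply/is_bridgeP; split=> // [i iB|k x y kB xB yB]; first by rewrite -offA ?cl.
  have [kA|kA] := boolP (k \in A); last by have := H k x y kB xB yB; rewrite surg_off.
  have mkA : m k \in A by rewrite bridge_closed.
  by apply/eqP; apply: contraNT nP => S; apply: (sep_pitchfork D kA mkA xB yB).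
have D' : [disjoint B & A] by rewrite disjoint_sym.
have offB x : x \in A -> surg m B x = m x by move=> xB; rewrite surg_off // (disjointFl D').
suff [] : is_bridge (surg m B) A /\ surg (surg m B) A = surg (surg m A) B by split.
have [cA clA _] := is_bridgeP _ _ brA; apply: diff_bridge => // i iA.
- by rewrite offB ?clA.
- by rewrite surg_off ?(disjointFr D) // (bridge_closed _ (proj1 (surgK brA))).
- by rewrite offB // surg_off ?(disjointFr D) // eq_sym surg_neq.
have [iB|iB] := boolP (i \in B); last by rewrite !surg_off.
rewrite !surgE //; have [y q] := bridge_quad br iB; rewrite (surg_fun_at q).
have [_ _ yB _] := quad_mem q.
suff q' : quad (surg m A) B i y by rewrite (surg_fun_at q') offA.
by have [EB o iy] := q; split; rewrite // !offA.
Qed.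

(** Consecutive points of A are joined by an arc of [m] or of [surg m A], and neither kind separates
    points of B. By additivity of [sep], no two points of A do. *)
Lemma both_nonpitch m A B : is_bridge m A -> is_bridge m B ->
  is_bridge (surg m A) B -> [disjoint A & B] -> ~~ pitchfork A B.
Proof.
move=> brA brB brB' D; apply/negP => /pitchfork_sep [a1 [a2 [b1 [b2 [[h1 h2 h3 h4] /negP]]]]].
have [_ _ HB] := is_bridgeP _ _ brB; have [_ _ HB'] := is_bridgeP _ _ brB'.
have nB x : x \in A -> x \notin B by move=> xA; rewrite (disjointFr D).
(* Points of A of opposite parities are the ends of an arc, before or after the surgery. *)
have opp p q : p \in A -> q \in A -> odd p != odd q -> sep p q b1 = sep p q b2.
  move=> pA qA o; have [y Q] := bridge_quad brA pA; have [_ oy _] := Q.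
  case: (quad_in Q qA) => E.
  - by move: o; rewrite E eqxx.
  - by rewrite E; apply: HB; rewrite ?nB.
  - by move: o; rewrite E oy eqxx.
  by have [e _ _ _] := surg_quad brA Q; rewrite E -e; apply: HB'; rewrite ?nB.
apply; apply/eqP; have [o|] := eqVneq (odd a1) (odd a2); last exact: opp.
have mA : m a1 \in A by rewrite bridge_closed.
rewrite !(sep_add a1 (m a1) a2) (opp a1 (m a1)) ?(opp (m a1) a2) // mate_parity -?o;
by case: (odd a1).
Qed.

Definition second m mu A := diffm (surg m A) mu.

Lemma second_eq m mu A B : is_bridge (surg m A) B -> surg (surg m A) B = mu ->
  B = second m mu A.
Proof. exact: surg_bridge_diff. Qed.

Lemma tri_second_eq m mu a b c : tri m mu a b c -> is_bridge m (arcs m a b) ->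
  second m mu (arcs m a b) = [set b; m a; c; m c].
Proof. by move=> t br; have [br' E] := tri_second t br; rewrite -(second_eq br' E). Qed.

(** Disjoint surgeries do not interfere, so what the first path does at A is still visible at the
    end. Hence the second path acts there too, and not by B, as it would then have A = B. *)
Lemma two_step_components m A B A' B' :
  is_bridge m A -> is_bridge (surg m A) B' -> is_bridge m B -> is_bridge (surg m B) A' ->
  surg (surg m A) B' = surg (surg m B) A' -> [disjoint A & B'] -> [disjoint B & A'] ->
  A != B -> A \subset A'.
Proof.
move=> brA brB' brB brA' E D D' nAB; apply/subsetP => x xA.
have Ex : surg (surg m A) B' x = surg m A x by rewrite surg_off // (disjointFr D).
have [xB|xB] := boolP (x \in B); last first.
  have : surg (surg m A) B' x != m x by rewrite Ex surg_neq.
  rewrite E; case: (boolP (x \in A')) => // xA'.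
  by rewrite !surg_off ?eqxx.
have Ex' : surg (surg m B) A' x = surg m B x by rewrite surg_off // (disjointFr D').
have [y qA] := bridge_quad brA xA; have [z qB] := bridge_quad brB xB.
case/eqP: nAB; have [-> _ _] := qA; have [-> _ _] := qB.
have [e1 _ _ _] := surg_quad brA qA; have [e2 _ _ _] := surg_quad brB qB.
by suff /mate_inj -> : m y = m z by []; rewrite -e1 -e2 -Ex -Ex' E.
Qed.

Lemma tri_rot_first m mu a b c A B : tri m mu a b c -> is_bridge m A ->
  is_bridge (surg m A) B -> surg (surg m A) B = mu ->
  exists a' b' c', [/\ tri m mu a' b' c', A = arcs m a' b' & B = [set b'; m a'; c'; m c']].
Proof.
move=> t brA brB E.
have [EA|EA|EA] := tri_first t brA brB E; rewrite EA in brA brB E.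
- by exists a, b, c; rewrite (second_eq brB E) (tri_second_eq t).
- have t' := tri_rot t; exists b, c, a.
  by rewrite (second_eq brB E) (tri_second_eq t').
have t' := tri_rot (tri_rot t); exists c, a, b.
by rewrite (second_eq brB E) (tri_second_eq t').
Qed.

Lemma quad_off m m' A a b : (forall x, x \in A -> m' x = m x) -> quad m A a b ->
  quad m' A a b.
Proof.
move=> E q; have [aA _ bA _] := quad_mem q; have [EA o ab] := q.
by split; rewrite // !E.
Qed.

(** Besides the geometric condition of (R4), it provides feet that serve for a bridge both before
    and after the other surgery, as [edge_square_card] requires. *)
Lemma two_step_disjoint_arcs (L : link n) (l : bool) A B A' B' :
  let m := half L l in
  is_bridge m A -> is_bridge (surg m A) B' -> is_bridge m B -> is_bridge (surg m B) A' ->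
  surg (surg m A) B' = surg (surg m B) A' -> surg (surg m A) B' <> m -> A != B ->
  disjoint_arcs L l A l B A' B' /\
  exists a b c d, [/\ quad m A a b, quad (surg m B) A' a b, quad m B c d &
                     quad (surg m A) B' c d].
Proof.
move=> m brA brB' brB brA' E nE nAB; rewrite /disjoint_arcs eqxx /= -/m.
have sub_eq C C' (M M' : matching n) : is_bridge M C -> is_bridge M' C' -> C \subset C' -> C = C'.
  by move=> b1 b2 S; apply/eqP; rewrite eqEcard S (bridge_card b1) (bridge_card b2) /=.
case: (two_step_cases brA brB') => [EB|D|[a [b [c [t EA EB]]]]].
- by case: nE; rewrite EB (proj2 (surgK brA)).
- case: (two_step_cases brB brA') => [EA|D'|[a [b [c [t _ _]]]]].
  + by case: nE; rewrite E EA (proj2 (surgK brB)).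
  + have EA : A = A'.
      exact: (sub_eq _ _ _ _ brA brA' (two_step_components brA brB' brB brA' E D D' nAB)).
    have EB : B = B'.
      rewrite eq_sym in nAB.
      exact: (sub_eq _ _ _ _ brB brB' (two_step_components brB brA' brA brB' (esym E) D' D nAB)).
    subst A' B'; rewrite D (both_nonpitch brA brB brB' D) !eqxx; split=> //.
    have ex C M : is_bridge M C -> exists a b, quad M C a b.
      move=> br; have [x xC] : exists x, x \in C.
        by apply/set0Pn; rewrite -cards_eq0 (bridge_card br).
      by have [y] := bridge_quad br xC; exists x, y.
    have [a [b qA]] := ex _ _ brA; have [c [d qB]] := ex _ _ brB.
    exists a, b, c, d; split=> //; [apply: quad_off qA|apply: quad_off qB] => x xC.
      by rewrite surg_off // (disjointFr D).
    by rewrite surg_off // (disjointFl D).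
  rewrite -E in t; have [a' [b' [c' [_ EA EB]]]] := tri_rot_first t brA brB' erefl.
  by move/pred0P/(_ b'): D; rewrite /= EA EB !inE !eqxx !orbT.
have key x y z : tri m (surg (surg m A) B') x y z -> is_bridge m (arcs m x y) ->
    is_bridge m (arcs m z x) -> (arcs m x y) != (arcs m z x) /\ x \in arcs m x y :&: arcs m z x.
  move=> t' b1 b2; split; last by rewrite !inE !eqxx !orbT.
  apply/eqP => /setP/(_ y); have := tri_ne t'; rewrite /= => ne.
  by rewrite !inE !ne eqxx.
have dis x y z : ~~ [disjoint arcs m x y & arcs m z x].
  by apply/pred0Pn; exists x; rewrite /= !inE !eqxx !orbT.
have dis' x y z : ~~ [disjoint arcs m z x & arcs m x y] by rewrite disjoint_sym dis.
rewrite nAB; have [EB'|EB'|EB'] := tri_first t brB brA' (esym E).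
- by rewrite EA EB' eqxx in nAB.
- have t' := tri_rot t; rewrite EA EB' in brA brB *.
  have q1 := tri_quad t; have q2 := tri_quad t'.
  have [_ _ f3 f4] := surg_quad brA q1; have [e1 e2 e3 e4] := surg_quad brB q2.
  rewrite (negPf (dis' _ _ _)) /=; have [c1 c2] := tri_carried t' brB brA.
  have EA' : A' = [set c; m b; a; m a].
    rewrite -(tri_second_eq t' brB); rewrite EB' in brA' E; exact: (second_eq brA' (esym E)).
  split; last first.
    (* On the shared arc {b, m b} the foot of A is placed near [m b] and that of B near b, where
       each remains after the other surgery. *)
    exists (m b), (m a), b, c; split=> //; first by apply/quad_sym/quad_mate.
      split; last by rewrite eq_sym; have [] := quad_neq (quad_mate q1).
        rewrite EA' e4; have [h1 h2 h3 h4] := surg_quad brB q2.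
        rewrite surg_off ?mateK //; first by apply/setP => x; rewrite !inE; do 4!case: eqP.
        have := tri_ne t; rewrite /= => ne; by rewrite !inE !ne.
      by rewrite !mate_parity; have [_ -> _] := q1.
    split; last by have [] := tri_neq t.
      rewrite EB f3 surg_off; last by have := tri_ne t; rewrite /= => ne; rewrite !inE !ne.
      by [].
    by have [_ [_ ->] _ _] := t.
  apply/exists_inP; exists (m b); first by rewrite !inE !eqxx !orbT.
  rewrite EA' mateK -c1 eqxx andbT EB -c2; apply/eqP/setP => x; rewrite !inE.
  by do 4!case: eqP.
have t' := tri_rot (tri_rot t); rewrite EA EB' in brA brB *.
rewrite (negPf (dis _ _ _)) /=; have [c1 c2] := tri_carried t brA brB.
have q1 := tri_quad t; have q2 := tri_quad t'.
have [_ _ f3 f4] := surg_quad brA q1; have [e1 e2 e3 e4] := surg_quad brB q2.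
have EA' : A' = [set a; m c; b; m b].
  rewrite -(tri_second_eq t' brB); rewrite EB' in brA' E; exact: (second_eq brA' (esym E)).
split; last first.
  (* The shared arc is now {a, m a}: the foot of A is near a, that of B near [m a]. *)
  exists a, b, (m a), (m c); split=> //; last 2 first.
  - exact/quad_mate/quad_sym.
  - split; last by rewrite eq_sym; have [] := quad_neq (quad_mate q2).
      rewrite EB f4 surg_off ?mateK; first by apply/setP => x; rewrite !inE; do 4!case: eqP.
      by have := tri_ne t; rewrite /= => ne; rewrite !inE !ne.
    by rewrite !mate_parity; have [_ -> _] := q2.
  split; last by have [] := tri_neq t.
    rewrite EA' e3 surg_off //.
    by have := tri_ne t; rewrite /= => ne; rewrite !inE !ne.
  by have [_ [-> _] _ _] := t.
apply/exists_inP; exists a; first by rewrite !inE !eqxx !orbT.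
by rewrite EA' EB -c1 -c2 !eqxx.
Qed.

Definition two_step m mu A :=
  [&& is_bridge m A, is_bridge (surg m A) (second m mu A) &
      surg (surg m A) (second m mu A) == mu].

(** Disjoint bridges can be exchanged unless they cross, which gives one or two first bridges. For
    three arcs, [tri_two] leaves two or three. The cases with a path are those of (R6), (R4) and
    (R5). *)
Lemma two_step_spec m mu : m <> mu ->
  [\/ two_step m mu =1 pred0,
      exists2 A, two_step m mu =1 pred1 A & pitchfork A (second m mu A),
      exists A B, [/\ A != B, two_step m mu =1 pred2 A B & ~~ same_side m A B] |
      exists a b c, [/\ tri m mu a b c, same_side m (arcs m a b) (arcs m c a) &
        two_step m mu =1 [pred A | [|| A == arcs m a b, A == arcs m b c | A == arcs m c a]]]].
Proof.
move=> nE; have [A0 /and3P [brA brB /eqP E]|N] := pickP (two_step m mu); last by constructor 1.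
set B0 := second m mu A0 in brB E.
case: (two_step_cases brA brB) => [EB|D|[a [b [c [t EA EB]]]]].
- by case: nE; rewrite -E EB (proj2 (surgK brA)).
(* Any other path performs the same two disjoint surgeries in the opposite order. *)
- have only A : two_step m mu A -> A != A0 -> A = B0.
    move=> /and3P [brA1 brB1 /eqP E1] nA.
    have D1 : [disjoint A & second m mu A].
      case: (two_step_cases brA1 brB1) => [EB|D1|[a [b [c [t _ _]]]]]; last 1 first.
      - rewrite E1 in t; have [a' [b' [c' [_ EA EB]]]] := tri_rot_first t brA brB E.
        by move/pred0P/(_ b'): D; rewrite /= EA EB !inE !eqxx !orbT.
      - by case: nE; rewrite -E1 EB (proj2 (surgK brA1)).
      exact: D1.
    apply/eqP; rewrite eqEcard (bridge_card brA1) (bridge_card brB) leqnn andbT.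
    by apply: (two_step_components brA1 brB1 brA brB); rewrite // E1 E.
  have A0S : two_step m mu A0 by rewrite /two_step brA brB E eqxx.
  have [P|nP] := boolP (pitchfork A0 B0).
    constructor 2; exists A0 => // A; apply/idP/eqP => [S|-> //].
    have [//|nA] := eqVneq A A0; have EA := only A S nA.
    have /and3P [brA1 _ _] := S; rewrite EA in brA1.
    by have := both_nonpitch brA brA1 brB D; rewrite P.
  have [b1 b2 b3] := nonpitch_bridge brA brB D nP.
  have nAB : A0 != B0.
    apply/eqP => EAB; have /set0Pn [x xA] : A0 != set0 by rewrite -cards_eq0 (bridge_card brA).
    by move/pred0P/(_ x): D; rewrite /= -EAB xA.
  constructor 3; exists A0, B0; split=> // [A|]; last first.
    apply/negP => /andP [_ /exists_inP [k]].
    by move: D; rewrite -setI_eq0 => /eqP ->; rewrite inE.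
  apply/idP/idP => [S|/pred2P [-> //|->]].
    by rewrite /=; have [//|nA] := eqVneq A A0; rewrite (only A S nA) eqxx.
  rewrite /two_step b1; have <- := second_eq b2 (etrans b3 E).
  by rewrite b2 b3 E eqxx.
rewrite E in t; rewrite EA in brA; have O := tri_outer t brA.
have S x y z : tri m mu x y z -> two_step m mu (arcs m x y) = is_bridge m (arcs m x y).
  move=> t'; rewrite /two_step; case: (boolP (is_bridge _ _)) => //= br.
  by have [b1 b2] := tri_second t' br; rewrite (tri_second_eq t' br) b1 b2 eqxx.
have t1 := tri_rot t; have t2 := tri_rot t1; have O1 := outer_rot O; have O2 := outer_rot O1.
have All A : two_step m mu A -> [|| A == arcs m a b, A == arcs m b c | A == arcs m c a].
  case/and3P=> h1 h2 /eqP h3; have [->|->|->] := tri_first t h1 h2 h3; by rewrite eqxx ?orbT.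
have ne1 x y z : tri m mu x y z -> arcs m x y != arcs m z x.
  move=> t'; apply/eqP => /setP/(_ y); have := tri_ne t'; rewrite /= => ne.
  by rewrite !inE !ne eqxx.
have SS := tri_same_side t O; have SS1 := tri_same_side t1 O1; have SS2 := tri_same_side t2 O2.
have ssym A B : same_side m A B = same_side m B A.
  by rewrite /same_side eq_sym setIC; congr andb; apply: eq_existsb => k; rewrite (eq_sym (_ \subset _)).
have [br1|br1] := boolP (is_bridge m (arcs m b c)); have [br2|br2] := boolP (is_bridge m (arcs m c a)).
- constructor 4; exists a, b, c; split=> // [|A]; first by rewrite SS.
  apply/idP/idP => [/All //|/or3P [] /eqP ->]; by rewrite ?(S _ _ _ t) ?(S _ _ _ t1) ?(S _ _ _ t2).
- constructor 3; exists (arcs m a b), (arcs m b c); split; last by rewrite ssym SS1.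
    by rewrite eq_sym; exact: (ne1 _ _ _ t1).
  move=> A; apply/idP/idP => [SA|/pred2P [] ->]; rewrite ?(S _ _ _ t) ?(S _ _ _ t1) //.
  rewrite /=; case/or3P: (All A SA) => /eqP EA'; rewrite EA' ?eqxx ?orbT //.
  by move: SA; rewrite EA' (S _ _ _ t2) (negPf br2).
- constructor 3; exists (arcs m a b), (arcs m c a); split; [exact: ne1 t| |by rewrite SS].
  move=> A; apply/idP/idP => [SA|/pred2P [] ->]; rewrite ?(S _ _ _ t) ?(S _ _ _ t2) //.
  rewrite /=; case/or3P: (All A SA) => /eqP EA'; rewrite EA' ?eqxx ?orbT //.
  by move: SA; rewrite EA' (S _ _ _ t1) (negPf br1).
by have := tri_two t O; rewrite (negPf br1) (negPf br2).
Qed.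
End TwoSteps.

(** * Circles of cleaved links *)

Section Connect.
Variable T : finType.
Implicit Types (r : rel T) (p q x y : T).

Lemma connect_eqv r : symmetric r -> equivalence_rel (connect r).
Proof.
move=> S x y z; split; first exact: connect0.
by move=> xy; exact: (same_connect (sym_connect_sym S) xy).
Qed.

Lemma merged_eqv (e : rel T) p q : equivalence_rel e -> equivalence_rel (merged e p q).
Proof.
move=> E x y z; split; first by rewrite /merged (eqv_refl E).
rewrite /merged => /orP [xy|/andP [px py]].
  by rewrite !(eqv_left E xy) !(eqv_right E _ xy).
rewrite px py /=.
have H t : e p t || e q t -> e t z -> e p z || e q z.
  by move=> h tz; rewrite -(eqv_right E p tz) -(eqv_right E q tz).
apply/idP/idP => /orP [h|->]; rewrite ?orbT //; by rewrite (H _ _ h) ?orbT // px.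
Qed.

Lemma connect_merged r r' p q : symmetric r ->
  (forall x y, r' x y -> merged (connect r) p q x y) ->
  forall x y, merged (connect r') p q x y -> merged (connect r) p q x y.
Proof.
move=> S H; have E := merged_eqv p q (connect_eqv S).
have C x y : connect r' x y -> merged (connect r) p q x y.
  case/connectP=> s; elim: s x => [|z s IH] x /=; first by move=> _ ->; exact: (eqv_refl E).
  by case/andP=> /H xz ps Ey; rewrite (eqv_left E xz); apply: IH.
have PQ z : connect r' p z || connect r' q z -> merged (connect r) p q p z.
  case/orP => [/C //|/C qz]; rewrite -(eqv_right E _ qz).
  by rewrite /merged !connect0 !orbT.
move=> x y /orP [/C //|/andP [/PQ px /PQ py]].
by rewrite -(eqv_left E px).
Qed.

(** The merged relations are equivalences, so their inclusions need only be checked on single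
    steps. *)
Lemma surgery_connect r r' p q : symmetric r -> symmetric r' ->
  (forall x y, r' x y -> merged (connect r) p q x y) ->
  (forall x y, r x y -> merged (connect r') p q x y) ->
  connect r p q != connect r' p q -> surgery (connect r) (connect r') p q.
Proof.
move=> S S' H H' X; split=> //; [exact: connect_eqv|exact: connect_eqv|].
by move=> x y; apply/idP/idP; apply: connect_merged.
Qed.
End Connect.

(** The orbit count formula is used for [s] and for the product, since the transposition undoes
    itself; both can hold only if exactly one of the permutations joins p and q. *)
Lemma porbit_tperm_xor (T : finType) (s : {perm T}) (p q : T) : p != q ->
  (q \in porbit s p) != (q \in porbit (tperm p q * s)%g p).
Proof.
move=> pq; rewrite !(porbit_sym _ q).
move: (porbits_mul_tperm s p q) (porbits_mul_tperm (tperm p q * s)%g p q).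
rewrite /= mulgA tperm2 mul1g pq.
move: #|porbits s| #|porbits (_ * _)%g| => u v.
by case: (p \in porbit s q); case: (p \in porbit _ q) => //=; lia.
Qed.

(** * Cycles alternating between two involutions *)

Section Alternating.
Variables (T : finType) (al al' be : T -> T) (col : T -> bool) (p q : T).
Hypotheses (alK : involutive al) (beK : involutive be).
Hypotheses (col_al : forall x, col (al x) = ~~ col x) (col_be : forall x, col (be x) = ~~ col x).
Hypotheses (colp : col p) (colq : col q) (pq : p != q).

Let step (f : T -> T) x := if col x then be (f x) else x.

Let step_inj (f : T -> T) : involutive f -> (forall x, col (f x) = ~~ col x) ->
  injective (step f).
Proof.
move=> fK cf x y; rewrite /step; case: (boolP (col x)) => cx; case: (boolP (col y)) => cy //.
- by move/(inv_inj beK)/(inv_inj fK).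
- by move=> E; rewrite -E col_be cf negbK cx in cy.
by move=> E; rewrite E col_be cf negbK cy in cx.
Qed.

Let alternating_rel f := [rel x y : T | (y == f x) || (y == be x)].

(** From a coloured point, [f] followed by [be] leads to the next coloured point of its cycle;
    [step] is the identity on the other colour to be a permutation of the whole type. *)
Lemma alternating_porbit (f : T -> T) (fK : involutive f)
    (cf : forall x, col (f x) = ~~ col x) x y : col x -> col y ->
  connect (alternating_rel f) x y = (y \in porbit (perm (step_inj fK cf)) x).
Proof.
move=> cx cy; set s := perm _.
have sE z : col z -> s z = be (f z) by rewrite permE /step => ->.
apply/idP/idP.
  case/connectP=> u pu Ey.
  have inO z t : z \in porbit s x -> (t == s z) || (z == s t) -> t \in porbit s x.
    move=> zx zt; rewrite -eq_porbit_mem in zx; rewrite -(eqP zx).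
    case/orP: zt => /eqP ->; first by rewrite -[s]expg1 mem_porbit.
    by rewrite porbit_sym -[s]expg1 mem_porbit.
  (* A point of the other colour is represented by its coloured neighbour under [f]. *)
  suff gen : forall t, path (alternating_rel f) t u ->
      (if col t then t else f t) \in porbit s x ->
      (if col (last t u) then last t u else f (last t u)) \in porbit s x.
    by have := gen x pu; rewrite -Ey cx cy; apply; apply: porbit_id.
  elim: {pu Ey}u => [|z u IH] t //= /andP [tz pu] ht; apply: IH => //.
  case/orP: tz => /eqP ->; first by rewrite cf fK; case: (col t) ht.
  rewrite col_be; case: (boolP (col t)) ht => ct ht /=; apply: (inO _ _ ht).
    by rewrite (sE (f (be t))) ?cf ?col_be ?ct // fK beK eqxx orbT.
  by rewrite sE ?cf // fK eqxx.
case/porbitP => i ->.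
have H z : col z -> connect (alternating_rel f) z (s z) /\ col (s z).
  move=> cz; rewrite sE // col_be cf negbK cz; split=> //.
  by apply: (connect_trans (y := f z)); apply: connect1; rewrite /= eqxx ?orbT.
suff [] : connect (alternating_rel f) x ((s ^+ i)%g x) /\ col ((s ^+ i)%g x) by [].
elim: i => [|i [IH1 IH2]]; first by rewrite expg0 perm1.
have [h1 h2] := H _ IH2; rewrite expgSr permM; split=> //.
exact: connect_trans IH1 h1.
Qed.

(** Exchanging the partners of p and q composes the return permutation with the transposition of p
    and q, which joins or splits orbits. *)
Lemma alternating_xor (al'K : involutive al') (col_al' : forall x, col (al' x) = ~~ col x) :
  al' p = al q -> al' q = al p -> (forall x, col x -> x != p -> x != q -> al' x = al x) ->
  connect (alternating_rel al) p q != connect (alternating_rel al') p q.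
Proof.
move=> Ep Eq E; rewrite (alternating_porbit alK col_al) // (alternating_porbit al'K col_al') //.
suff -> : perm (step_inj al'K col_al') = (tperm p q * perm (step_inj alK col_al))%g.
  exact: porbit_tperm_xor.
apply/permP => x; rewrite permM ![perm (step_inj _ _) _]permE /step.
have [->|xp] := eqVneq x p; first by rewrite tpermL colp colq Ep.
have [->|xq] := eqVneq x q; first by rewrite tpermR colp colq Eq.
by rewrite tpermD 1?eq_sym //; case: ifP => // cx; rewrite E.
Qed.
End Alternating.

(** * Bridge and decoration edges as edges of relations *)

Section Links.
Variable n : nat.
Local Notation I := 'I_n.*2.
Implicit Types (L : link n) (l : bool) (A B C : {set I}) (a b p q x y : I) (v w u : vertex n).

Lemma joined_half L l p q :
  joined L p q = (q == half L l p) || (q == half L (~~ l) p).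
Proof. by rewrite /joined /half; case: l => //=; rewrite orbC. Qed.

Lemma joined_sym L : symmetric (joined L).
Proof. by move=> p q; rewrite /joined -[q == L.1 p]mate_eq -[q == L.2 p]mate_eq !(eq_sym _ p). Qed.

Definition linkeq L := connect (joined L).

Lemma linkeq_eqv L : equivalence_rel (linkeq L).
Proof. exact: connect_eqv (joined_sym L). Qed.

Lemma mem_circ L p q : (q \in circ L p) = linkeq L p q.
Proof. by rewrite inE. Qed.

Lemma half_surgL L l A : half (surgL L l A) l = surg (half L l) A.
Proof. by case: l. Qed.
Lemma half_surgL_other L l k A : l != k -> half (surgL L l A) k = half L k.
Proof. by case: l; case: k. Qed.

Lemma surgLK L l A : is_bridge (half L l) A -> surgL (surgL L l A) l A = L.
Proof. by case: L l => m m' [] /= br; rewrite (proj2 (surgK br)). Qed.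

Lemma linkeq_mate L l p : linkeq L p (half L l p).
Proof. by apply: connect1; rewrite (joined_half L l) eqxx. Qed.

Lemma linkeq_quad L l A a b p : quad (half L l) A a b -> p \in A ->
  linkeq L a p || linkeq L b p.
Proof.
move=> q /(quad_in q) [] ->; rewrite ?linkeq_mate ?(eqv_refl (linkeq_eqv L)) ?orbT //.
Qed.

Let half_merged L l A a b : is_bridge (half L l) A -> quad (half L l) A a b ->
  forall x y, joined (surgL L l A) x y -> merged (linkeq L) a b x y.
Proof.
move=> br q x y; rewrite (joined_half _ l) half_surgL.
rewrite half_surgL_other; last by case: (l).
case/orP=> /eqP ->; last by rewrite /merged linkeq_mate.
case: (boolP (x \in A)) => xA; last by rewrite surg_off // /merged linkeq_mate.
have sA : surg (half L l) A x \in A by rewrite (bridge_closed _ (proj1 (surgK br))).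
by rewrite /merged (linkeq_quad q xA) (linkeq_quad q sA) orbT.
Qed.

(** Parity colours the points of each circle alternately, and the feet a and b have equal colour by
    [quad]. So surgery is the exchange of partners in [alternating_xor]. *)
Lemma link_surgery L l A a b : is_bridge (half L l) A -> quad (half L l) A a b ->
  surgery (linkeq L) (linkeq (surgL L l A)) a b.
Proof.
move=> br q; apply: surgery_connect; try exact: joined_sym.
- exact: half_merged br q.
- have [br' _] := surgK br; have q' := quad_surg br q; rewrite -half_surgL in br' q'.
  by move=> x y; rewrite -{1}(surgLK br); apply: half_merged br' q' x y.
have [_ o ab] := q; have [e1 e2 e3 e4] := surg_quad br q.
rewrite (@eq_connect _ (joined L) _ (joined_half L l)).
rewrite (@eq_connect _ (joined (surgL L l A)) _ (joined_half _ l)).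
rewrite half_surgL half_surgL_other; last by case: (l).
apply: (@alternating_xor _ _ _ _ (fun x => odd x == odd a)) => //.
- exact: mateK.
- exact: mateK.
- by move=> x; rewrite mate_parity; case: (odd x); case: (odd a).
- by move=> x; rewrite mate_parity; case: (odd x); case: (odd a).
- by rewrite o.
- exact: mateK.
- by move=> x; rewrite mate_parity; case: (odd x); case: (odd a).
move=> x /eqP ox xa xb; rewrite surg_off //; apply/negP => /(quad_in q) [] E.
- by rewrite E eqxx in xa.
- by move: ox; rewrite E mate_parity; case: (odd a).
- by rewrite E eqxx in xb.
by move: ox; rewrite E mate_parity o; case: (odd b).
Qed.

Lemma sgn_constant v : constant_on (linkeq (lnk v)) (sgn v).
Proof.
apply/constant_onP => x y /connectP [s ps ->]; elim: s x ps => //= z s IH x /andP [xz ps].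
rewrite -(IH z ps); have /forallP/(_ x)/forallP/(_ z)/implyP/(_ xz)/eqP := valP v; exact.
Qed.

Lemma sgn_eq v x y : linkeq (lnk v) x y -> sgn v x = sgn v y.
Proof. exact: (constant_onP _ _ (sgn_constant v)). Qed.

Lemma vertexP v w : lnk v = lnk w -> sgn v = sgn w -> v = w.
Proof.
move=> E1 E2; apply: val_inj; rewrite [val v]surjective_pairing [val w]surjective_pairing.
by congr pair.
Qed.

Lemma vertex_exists L (g : {ffun I -> bool}) : constant_on (linkeq L) g ->
  exists v, lnk v = L /\ sgn v = g.
Proof.
move=> /constant_onP C; have D : decorated (L, g).
  apply/forallP => p; apply/forallP => q; apply/implyP => pq.
  by apply/eqP/C/connect1.
by exists (Vertex D).
Qed.

Lemma card_vertex L (P : pred {ffun I -> bool}) :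
  #|[set w : vertex n | (lnk w == L) && P (sgn w)]| =
  #|[set g | constant_on (linkeq L) g && P g]|.
Proof.
have <- : [set sgn w | w in [set w : vertex n | (lnk w == L) && P (sgn w)]] =
    [set g | constant_on (linkeq L) g && P g].
  apply/setP => g; rewrite inE; apply/imsetP/andP => [[w]|[C Pg]].
    by rewrite inE => /andP [/eqP <- Pw] ->; rewrite sgn_constant.
  by have [w [Lw sw]] := vertex_exists C; exists w; rewrite // inE Lw sw eqxx.
rewrite card_in_imset // => w w'; rewrite !inE => /andP [/eqP h _] /andP [/eqP h' _] E.
by apply: vertexP; rewrite // h h'.
Qed.

(** Each point of A is on an arc with a or b, so the rule may be tested at these two points. Where a
    and b are on one circle, the corresponding clause of [bridge_edge] is vacuous. *)
Lemma bridge_edgeE v l A w a b : quad (half (lnk v) l) A a b ->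
  bridge_edge v l A w =
  [&& is_bridge (half (lnk v) l) A, lnk w == surgL (lnk v) l A &
      edgeK (linkeq (lnk v)) (linkeq (lnk w)) a b (sgn v) (sgn w)].
Proof.
move=> q; rewrite /bridge_edge; case: (boolP (is_bridge _ _)) => //= br.
have [Ew|//] := eqVneq; rewrite /edgeK !sgn_constant /=.
have S := link_surgery br q; rewrite -Ew in S.
have E := surg_eqv S; have E' := surg_eqv' S; have X := surg_xor S.
have [aA maA bA mbA] := quad_mem q.
have q' : quad (half (lnk w) l) A a b by rewrite Ew half_surgL; exact: quad_surg br q.
congr andb.
  apply: eq_forallb => p.
  suff -> : (p \in supp (lnk v) (Br l A)) = linkeq (lnk v) a p || linkeq (lnk v) b p.
    by rewrite negb_or; case: (linkeq _ a p); case: (linkeq _ b p).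
  apply/bigcupP/idP => [[c cA]|].
    rewrite mem_circ => cp; case/orP: (linkeq_quad q cA) => h.
      by rewrite (eqv_left E h) cp.
    by rewrite (eqv_left E h) cp orbT.
  by case/orP => h; [exists a|exists b]; rewrite // mem_circ.
rewrite /mult_rule; case: ifP => ab; rewrite ab in X.
  have e'ab : linkeq (lnk w) a b = false by case: (linkeq (lnk w) a b) X.
  have all p r : p \in A -> r \in A -> linkeq (lnk v) p r.
    move=> pA rA; have H z : z \in A -> linkeq (lnk v) a z.
      by move/(linkeq_quad q); rewrite -(eqv_left E ab) orbb.
    by rewrite -(eqv_left E (H p pA)) H.
  have -> : [forall p in A, forall r in A, (r \notin circ (lnk v) p) ==>
      (sgn v p || sgn v r) && (sgn w p == sgn v p && sgn v r)].
    by apply/forall_inP => p pA; apply/forall_inP => r rA; rewrite mem_circ all.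
  apply/forall_inP/idP => [H|H p pA].
    by have /forall_inP/(_ b bA) := H a aA; rewrite mem_circ e'ab.
  apply/forall_inP => r rA; apply/implyP; rewrite mem_circ => npr.
  have svp : sgn v p = sgn v a by apply/sgn_eq/all.
  case/orP: (linkeq_quad q' pA) => hp; case/orP: (linkeq_quad q' rA) => hr.
  - by rewrite -(eqv_left E' hp) hr in npr.
  - by rewrite svp -(sgn_eq hp) -(sgn_eq hr).
  - by rewrite svp -(sgn_eq hp) -(sgn_eq hr) [sgn w b && _]andbC [sgn w b || _]orbC.
  by rewrite -(eqv_left E' hp) hr in npr.
have e'ab : linkeq (lnk w) a b by case: (linkeq (lnk w) a b) X.
have all p r : p \in A -> r \in A -> linkeq (lnk w) p r.
  move=> pA rA; have H z : z \in A -> linkeq (lnk w) a z.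
    by move/(linkeq_quad q'); rewrite -(eqv_left E' e'ab) orbb.
  by rewrite -(eqv_left E' (H p pA)) H.
have -> : [forall p in A, forall r in A, (r \notin circ (lnk w) p) ==>
    ~~ (sgn w p && sgn w r) && (sgn v p == sgn w p || sgn w r)].
  by apply/forall_inP => p pA; apply/forall_inP => r rA; rewrite mem_circ all.
rewrite andbT; apply/forall_inP/idP => [H|H p pA].
  by have /forall_inP/(_ b bA) := H a aA; rewrite mem_circ ab.
apply/forall_inP => r rA; apply/implyP; rewrite mem_circ => npr.
have swp : sgn w p = sgn w a by apply/sgn_eq/all.
case/orP: (linkeq_quad q pA) => hp; case/orP: (linkeq_quad q rA) => hr.
- by rewrite -(eqv_left E hp) hr in npr.
- by rewrite swp -(sgn_eq hp) -(sgn_eq hr).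
- by rewrite swp -(sgn_eq hp) -(sgn_eq hr) [sgn v b && _]andbC [sgn v b || _]orbC.
by rewrite -(eqv_left E hp) hr in npr.
Qed.

Lemma decoration_edgeE v a w :
  decoration_edge v (circ (lnk v) a) w =
  (lnk w == lnk v) && lower (linkeq (lnk v)) a (sgn v) (sgn w).
Proof.
rewrite /decoration_edge /lower sgn_constant imset_f //= andbCA; congr andb.
congr andb; last by congr (_ == _); apply/ffunP => p; rewrite !ffunE mem_circ.
apply/forall_inP/idP => [H|va p]; first by apply: H; rewrite mem_circ (eqv_refl (linkeq_eqv _)).
by rewrite mem_circ => /sgn_eq <-.
Qed.
End Links.

(** * Planar maps *)

Section Classes.
Local Open Scope group_scope.
Variable T : finType.

Definition num_classes (e : rel T) := #|[set [set y | e x y] | x : T]|.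

Lemma eq_num_classes (e e' : rel T) : e =2 e' -> num_classes e = num_classes e'.
Proof.
by move=> E; congr #|pred_of_set _|; apply: eq_imset => x; apply/setP => y; rewrite !inE E.
Qed.

Lemma num_classes_split (e e' : rel T) u v : surgery e e' u v -> e u v ->
  num_classes e' = (num_classes e).+1.
Proof.
move=> S uv; have E := surg_eqv S; have E' := surg_eqv' S.
have nuv : ~~ e' u v by have := surg_xor S; rewrite uv; case: (e' u v).
pose R := [set [set y | e x y] | x in [set x | ~~ e u x]].
have inE' x : ~~ e u x -> [set y | e' x y] = [set y | e x y].
  move=> nux; apply/setP => y; rewrite !inE (surgery_off S) //.
  by rewrite -(eqv_left E uv).
have nR (e1 : rel T) z : e1 z z -> e u z -> [set y | e1 z y] \notin R.
  move=> zz uz; apply/imsetP => -[x]; rewrite inE => nux /setP/(_ z).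
  by rewrite !inE zz => /esym; rewrite (eqv_sym E) => zx; rewrite (eqv_right E _ zx) in uz; rewrite uz in nux.
have -> : num_classes e = #|[set y | e u y] |: R|.
  apply: eq_card => A; rewrite !inE; apply/imsetP/orP => [[x _ ->]|[/eqP ->|/imsetP [x _ ->]]].
  - case: (boolP (e u x)) => ux; [left|right; apply/imsetP; exists x; rewrite ?inE //].
    by apply/eqP/setP => y; rewrite !inE (eqv_left E ux).
  - by exists u.
  by exists x.
have -> : num_classes e' = #|[set y | e' u y] |: ([set y | e' v y] |: R)|.
  apply: eq_card => A; rewrite !inE; apply/imsetP/or3P => [[x _ ->]|].
    case: (boolP (e u x)) => ux; last by constructor 3; apply/imsetP; exists x; rewrite ?inE // inE'.
    have : e' u x || e' v x by rewrite -(surgery_union S) ux.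
    case/orP => h; [constructor 1|constructor 2]; apply/eqP/setP => y;
    by rewrite !inE (eqv_left E' h).
  case=> [/eqP ->|/eqP ->|/imsetP [x]]; [by exists u|by exists v|].
  by rewrite inE => nux ->; exists x; rewrite // inE'.
rewrite !cardsU1 !inE negb_or !nR ?(eqv_refl E) ?(eqv_refl E') //= andbT.
have -> : [set y | e' u y] != [set y | e' v y].
  by apply/eqP => /setP/(_ v); rewrite !inE (eqv_refl E') (negPf nuv).
by rewrite addnA.
Qed.

Lemma card_porbits_tperm (s : {perm T}) a b : a != b ->
  if b \in porbit s a then #|porbits (tperm a b * s)| = #|porbits s|.+1
  else #|porbits s| = #|porbits (tperm a b * s)|.+1.
Proof.
move=> ab; have := porbits_mul_tperm s a b; rewrite /= ab (porbit_sym s b).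
by case: ifP => _ /=; lia.
Qed.
End Classes.

(** * The genus inequality and a discrete Jordan theorem *)

Section Maps.
Local Open Scope group_scope.
Variable D : finType.
Implicit Types (s f : {perm D}) (a b x y : D).

Definition dart_rel s f : rel D :=
  fun x y => [|| y == s x, x == s y, y == f x | x == f y].
Definition dart_conn s f := connect (dart_rel s f).

Lemma dart_rel_sym s f : symmetric (dart_rel s f).
Proof. by move=> x y; rewrite /dart_rel orbCA; congr [|| _, _ | _]; rewrite orbC. Qed.
Lemma dart_conn_eqv s f : equivalence_rel (dart_conn s f).
Proof. exact: connect_eqv (dart_rel_sym s f). Qed.
Lemma dart_conn_s s f x : dart_conn s f x (s x).
Proof. by apply: connect1; rewrite /dart_rel eqxx. Qed.
Lemma dart_conn_f s f x : dart_conn s f x (f x).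
Proof. by apply: connect1; rewrite /dart_rel eqxx !orbT. Qed.

Lemma dart_conn_porbit s f (t : {perm D}) x y : (forall z, dart_conn s f z (t z)) ->
  y \in porbit t x -> dart_conn s f x y.
Proof.
move=> H /porbitP [i ->]; elim: i => [|i IH]; first by rewrite expg0 perm1 (eqv_refl (dart_conn_eqv s f)).
by rewrite expgSr permM -(eqv_right (dart_conn_eqv s f) _ (H _)).
Qed.

Lemma dart_conn_face s f x y : y \in porbit (f * s) x -> dart_conn s f x y.
Proof.
apply: dart_conn_porbit => z; rewrite permM; have E := dart_conn_eqv s f.
by rewrite -(eqv_right E _ (dart_conn_s s f _)) dart_conn_f.
Qed.

(** Vertices, edges and faces of a hypermap. For a fixed-point-free involution [f] the number of
    darts is twice the number of edges, and equality with [euler_bound] is Euler's formula V - E + F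
    = 2C. *)
Definition euler s f := #|porbits s| + #|porbits f| + #|porbits (f * s)|.
Definition euler_bound s f := #|D| + (num_classes (dart_conn s f)).*2.

(** Cutting a vertex is a transposition for the face permutation as well, so for distinct a and b it
    changes the number of faces by one. *)
Lemma face_tperm s f a b : f * (tperm a b * s) = tperm (f^-1 a) (f^-1 b) * (f * s).
Proof. by rewrite -tpermJ conjgE invgK !mulgA mulgKV. Qed.

Lemma dart_conn_split s f a b : b \in porbit s a ->
  merged (dart_conn (tperm a b * s) f) a b =2 dart_conn s f.
Proof.
move=> ab; have E := dart_conn_eqv s f; set s' := tperm a b * s.
have cab : dart_conn s f a b by apply: dart_conn_porbit ab; exact: dart_conn_s.
have M x y : merged (dart_conn s f) a b x y = dart_conn s f x y.
  rewrite /merged; case: (boolP (dart_conn s f x y)) => //= n.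
  rewrite -!(eqv_left E cab) !orbb; apply/negbTE; apply: contra n => /andP [ax ay].
  by rewrite -(eqv_left E ax).
have E' := dart_conn_eqv s' f; have EM := merged_eqv a b E'.
have s'E x : x != a -> x != b -> s' x = s x by move=> xa xb; rewrite permM tpermD // eq_sym.
have s'a : s' a = s b by rewrite permM tpermL.
have s'b : s' b = s a by rewrite permM tpermR.
have MM x y : dart_conn s' f x y -> merged (dart_conn s' f) a b x y by rewrite /merged => ->.
have Mab : merged (dart_conn s' f) a b a b by rewrite /merged !(eqv_refl E') !orbT.
have s1 x : dart_conn s f x (s' x).
  have [->|xa] := eqVneq x a; first by rewrite s'a (eqv_left E cab) dart_conn_s.
  have [->|xb] := eqVneq x b; first by rewrite s'b -(eqv_left E cab) dart_conn_s.
  by rewrite s'E // dart_conn_s.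
have s2 x : merged (dart_conn s' f) a b x (s x).
  have [->|xa] := eqVneq x a; first by rewrite (eqv_left EM Mab) -s'b MM // dart_conn_s.
  have [->|xb] := eqVneq x b; first by rewrite -(eqv_left EM Mab) -s'a MM // dart_conn_s.
  by rewrite -s'E // MM // dart_conn_s.
move=> x y; rewrite -M; apply/idP/idP; apply: connect_merged => //; try exact: dart_rel_sym.
- move=> {}x {}y /or4P [] /eqP -> //; rewrite M ?s1 ?dart_conn_f // (eqv_sym E) ?s1 ?dart_conn_f //.
- move=> {}x {}y /or4P [] /eqP -> //; rewrite ?s2 ?(MM _ _ (dart_conn_f _ _ _)) //;
  by rewrite (eqv_sym EM) ?s2 ?(MM _ _ (dart_conn_f _ _ _)).
Qed.

(* Cutting a vertex in two at the corners following a and b. *)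
Lemma split_cases s f a b (s' := tperm a b * s) : a != b -> b \in porbit s a ->
  #|porbits s'| = #|porbits s|.+1 /\
  ([/\ dart_conn s' f a b, num_classes (dart_conn s' f) = num_classes (dart_conn s f) &
       if s b \in porbit (f * s) (s a) then #|porbits (f * s')| = #|porbits (f * s)|.+1
       else #|porbits (f * s)| = #|porbits (f * s')|.+1] \/
   [/\ ~~ dart_conn s' f a b, num_classes (dart_conn s' f) = (num_classes (dart_conn s f)).+1 &
       #|porbits (f * s')| = #|porbits (f * s)|.+1]).
Proof.
move=> ab sab; split; first by have := card_porbits_tperm s ab; rewrite sab.
have nf : f^-1 a != f^-1 b by rewrite (inj_eq perm_inj).
have face (t : {perm D}) : (t b \in porbit (f * t) (t a)) = (f^-1 b \in porbit (f * t) (f^-1 a)).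
  have h x : porbit (f * t) (t x) = porbit (f * t) (f^-1 x).
    have -> : t x = ((f * t) ^+ 1) (f^-1 x) by rewrite expg1 permM permKV.
    exact: porbit_perm.
  by rewrite h porbit_sym h porbit_sym.
have F := card_porbits_tperm (f * s) nf; rewrite -face_tperm -/s' in F.
have M := dart_conn_split f sab; rewrite -/s' in M.
have E' := dart_conn_eqv s' f; have E := dart_conn_eqv s f.
case: (boolP (dart_conn s' f a b)) => c; [left|right]; split=> //.
- apply: eq_num_classes => x y; rewrite -M /merged.
  case: (boolP (dart_conn s' f x y)) => //= n; apply/esym/negbTE; apply: contra n.
  by rewrite -!(eqv_left E' c) !orbb => /andP [ax ay]; rewrite -(eqv_left E' ax).
- by rewrite face.
- apply: (@num_classes_split _ _ _ a b).
  have cab : dart_conn s f a b by apply: dart_conn_porbit sab; exact: dart_conn_s.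
  split=> //; first by rewrite cab (negPf c).
    move=> x y; rewrite M /merged -!(eqv_left E cab) !orbb.
    case: (boolP (dart_conn s f x y)) => //= n; apply/negbTE; apply: contra n => /andP [ax ay].
    by rewrite -(eqv_left E ax).
  by apply: dart_conn_porbit sab; exact: dart_conn_s.
(* Had the cut united two faces, its corners would share a face afterwards and so be connected. *)
move: F; case: ifP => // nface F.
have F2 := card_porbits_tperm (f * s') nf; rewrite -face_tperm in F2.
have ss : tperm a b * s' = s by rewrite mulgA tperm2 mul1g.
rewrite ss in F2; move: F2; case: ifP => [h|_ F2]; last by rewrite F in F2; lia.
case/negP: c; apply: (@eq_trans _ _ (dart_conn s' f (f^-1 a) (f^-1 b))).
  have fa x : dart_conn s' f (f^-1 x) x by have := dart_conn_f s' f (f^-1 x); rewrite permKV.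
  by rewrite (eqv_left E' (fa a)) (eqv_right E' _ (fa b)).
exact: dart_conn_face.
Qed.

(** Each cut adds a vertex, and the three cases of [split_cases] show that the defect does not grow.
    Cutting until [s] is the identity leaves defect zero. *)
Lemma euler_le s f : euler s f <= euler_bound s f.
Proof.
have [k] := ubnP (#|D| - #|porbits s|); elim: k s => // k IH s lts.
have [u su|fix_s] := pickP (fun u => s u != u); last first.
  have -> : s = 1 by apply/permP => x; rewrite perm1; exact/eqP/negbFE/fix_s.
  rewrite /euler /euler_bound mulg1.
  have -> : #|porbits (1 : {perm D})| = #|D|.
    rewrite /porbits card_imset // => x y /setP/(_ x); rewrite porbit_id => /esym/porbitP [i].
    by rewrite expg1n perm1.
  have -> : num_classes (dart_conn 1 f) = #|porbits f|; last by lia.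
  have cls x : [set y | dart_conn 1 f x y] = porbit f x.
    apply/setP => y; rewrite inE.
    apply/idP/idP => [|h]; last by apply: dart_conn_porbit h => z; exact: dart_conn_f.
    case/connectP=> p; elim/last_ind: p y => [|p z IHp] y /=; first by move=> _ ->; rewrite porbit_id.
    rewrite rcons_path last_rcons => /andP [px h] ->; have := IHp _ px erefl.
    move: h; rewrite /dart_rel !perm1 => /or4P [] /eqP E; rewrite -eq_porbit_mem => /eqP <-.
    + by rewrite E porbit_id.
    + by rewrite E porbit_id.
    + by rewrite E -{1}[f]expg1 mem_porbit.
    by rewrite porbit_sym E -{1}[f]expg1 mem_porbit.
  by congr #|pred_of_set _|; apply: eq_imset.
(* The cut at u and its predecessor turns u into a vertex of its own. *)
have su' : s^-1 u != u by apply: contra su => /eqP {1}<-; rewrite permKV.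
have uv : u != s^-1 u by rewrite eq_sym.
have same : s^-1 u \in porbit s u by rewrite porbit_sym -{1}[u](permKV s) -{1}[s]expg1 mem_porbit.
have [V] := split_cases f uv same; set s' := tperm _ _ * s in V *.
have VD : #|porbits s'| <= #|D|.
  exact: leq_imset_card.
have := IH s'; rewrite /euler /euler_bound V.
have ltk : #|D| - (#|porbits s|).+1 < k by lia.
move/(_ ltk) => L; case=> [[_ C F]|[_ C F]]; rewrite ?C ?F in L *; last by lia.
by move: F L; case: ifP => _; lia.
Qed.

(** If the corners lie on one face and the cut did not disconnect, a vertex and a face would be
    gained without changing the bound, against [euler_le]. *)
Lemma jordan s f a b (s' := tperm a b * s) : euler s f = euler_bound s f ->
  a != b -> b \in porbit s a ->
  euler s' f = euler_bound s' f /\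
  (s b \in porbit (f * s) (s a) -> ~~ dart_conn s' f a b).
Proof.
move=> EU ab sab; have L := euler_le s' f.
have [V] := split_cases f ab sab; rewrite -/s' in V *.
move: EU L; rewrite /euler /euler_bound V.
move=> EU L [[c C F]|[c C F]]; rewrite C ?F in L *.
  move: F L; case: ifP => face F L; first by lia.
  by split=> //; lia.
by split=> //; lia.
Qed.
End Maps.

Section NonCrossing.
Local Open Scope group_scope.
Variables (D : finType) (s f : {perm D}).
Hypothesis planar : euler s f = euler_bound s f.
Variables (i : D) (a b c k : nat).
Let O := porbit s i.
Let pt t := (s ^+ t) i.
Hypotheses (ab : 0 < a < b) (bc : b < c).
Hypothesis pt_inj : forall t u, t <= c -> u <= c -> pt t = pt u -> t = u.
Hypothesis wire_end : f (((f * s) ^+ k) i) = pt b.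
Hypothesis wire_off : forall t, 0 < t <= k -> ((f * s) ^+ t) i \notin O.

(* The darts of the vertex O are i, .., pt a, .., pt b, .., pt c, ..
   A relation avoiding O cannot join both i to pt b by a wire and pt a to pt c. *)
Definition off_rel : rel D := fun x y =>
  [|| y == f x, x == f y, (x \notin O) && (y == s x) | (y \notin O) && (x == s y)].

Lemma off_rel_sub (s' : {perm D}) : (forall x, x \notin O -> s' x = s x) ->
  forall x y, connect off_rel x y -> dart_conn s' f x y.
Proof.
move=> E; suff st x y : off_rel x y -> dart_conn s' f x y by exact: connect_sub st.
have Eq := dart_conn_eqv s' f.
case/or4P=> [/eqP ->|/eqP ->|/andP [nx /eqP ->]|/andP [ny /eqP ->]].
- exact: dart_conn_f.
- by rewrite (eqv_sym Eq) dart_conn_f.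
- by rewrite -E // dart_conn_s.
by rewrite (eqv_sym Eq) -E // dart_conn_s.
Qed.

(** The vertex is cut into three: i alone, the darts from pt 1 to pt b, and the darts from pt (b +
    1) on. The wire joins the first two parts, and [jordan] separates the third from i; a connection
    from pt a to pt c would join it again. *)
Lemma no_crossing : ~ connect off_rel (pt a) (pt c).
Proof.
move=> H; set i' := pt b; have ptO t : pt t \in O by exact: mem_porbit.
have sO x : (s x \in O) = (x \in O).
  by rewrite -!eq_porbit_mem -[s x]/((s ^+ 1) x) porbit_perm.
have spt t : s (pt t) = pt t.+1 by rewrite /pt expgSr permM.
have i0 : pt 0 = i by rewrite /pt expg0 perm1.
have iO : i \in O by rewrite -i0.
have ptne t u : t < u -> u <= c -> pt t != pt u.
  move=> tu uc; apply/eqP => /pt_inj E; move: (tu); rewrite E ?ltnn //.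
  exact: leq_trans (ltnW tu) uc.
have [a0 ab'] := andP ab; have b0 : 0 < b by exact: ltn_trans ab'.
have ii' : i != i'.
  by rewrite -i0 ptne // ltnW.
pose s1 := tperm i i' * s.
have s1i : s1 i = s i' by rewrite permM tpermL.
have s1i' : s1 i' = s i by rewrite permM tpermR.
have s1E x : x != i -> x != i' -> s1 x = s x by move=> h1 h2; rewrite permM tpermD // eq_sym.
have offne x : x \notin O -> (x != i) && (x != i').
  by move=> nx; apply/andP; split; apply: contraNneq nx => ->; rewrite ?iO ?ptO.
have s1off x : x \notin O -> s1 x = s x by move=> /offne /andP [h1 h2]; exact: s1E.
have wire (s' : {perm D}) : (forall x, x \notin O -> s' x = s x) -> dart_conn s' f i i'.
  move=> E; have Eq := dart_conn_eqv s' f.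
  suff W t : t <= k -> dart_conn s' f i (((f * s) ^+ t) i).
    by rewrite /i' -wire_end -(eqv_right Eq _ (dart_conn_f _ _ _)) W.
  elim: t => [|t IH] tk; first by rewrite expg0 perm1 (eqv_refl Eq).
  have := wire_off (t := t.+1); rewrite tk => /(_ isT); rewrite expgSr permM permM sO => nO.
  rewrite -E // -(eqv_right Eq _ (dart_conn_s _ _ _)) -(eqv_right Eq _ (dart_conn_f _ _ _)).
  by apply: IH; exact: ltnW.
have [planar1 J1] := jordan planar ii' (ptO b).
rewrite -/s1 in planar1 J1.
(* The wire survives this cut, so nothing is disconnected, and by [jordan] the two corners lie on
   different faces. The cut unites these faces. *)
have nface : s i' \notin porbit (f * s) (s i) by apply/negP => /J1; rewrite (wire s1 s1off).
(* The last dart of the part of O that still contains i; the second cut splits i off from this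
   part. *)
pose e := s1^-1 i.
have s1e : s1 e = i by rewrite permKV.
have si'i : s i' != i by rewrite spt -i0 eq_sym ptne.
have ie : i != e by apply/eqP => E; move: si'i; rewrite -s1i {1}E s1e eqxx.
have eO : e \in O.
  by apply: contraT => ne; move: iO; rewrite -{1}s1e s1off // sO (negPf ne).
have same : e \in porbit s1 i by rewrite porbit_sym -{1}s1e -{1}[s1]expg1 mem_porbit.
have [_ J2] := jordan planar1 ie same.
pose s2 := tperm i e * s1; rewrite -/s2 in J2.
have s2E x : x != i -> x != e -> s2 x = s1 x by move=> h1 h2; rewrite permM tpermD // eq_sym.
have s2off x : x \notin O -> s2 x = s x.
  move=> nx; have /andP [h1 h2] := offne _ nx; rewrite s2E ?s1E //.
  by apply: contraNneq nx => ->.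
have : ~~ dart_conn s2 f i e.
  apply: J2; rewrite s1e s1i.
  (* The wire runs along one face, from i around to [s i]. *)
  have f1 : porbit (f * s1) (s i) = porbit (f * s1) i.
    have -> : s i = ((f * s1) ^+ k.+1) i; last exact: porbit_perm.
    have W t : t <= k -> ((f * s1) ^+ t) i = ((f * s) ^+ t) i.
      elim: t => [|t IH] tk; first by rewrite !expg0.
      rewrite !expgSr permM [RHS]permM IH 1?ltnW // (permM f s1) (permM f s) s1off //.
      by have := wire_off (t := t.+1); rewrite tk => /(_ isT); rewrite expgSr permM permM sO.
    by rewrite expgSr permM W // (permM f s1) wire_end s1i'.
  rewrite -eq_porbit_mem eq_sym -f1 eq_porbit_mem porbit_sym.
  have nf : f^-1 i != f^-1 i' by rewrite (inj_eq perm_inj).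
  have face (t : {perm D}) x : porbit (f * t) (t x) = porbit (f * t) (f^-1 x).
    have -> : t x = ((f * t) ^+ 1) (f^-1 x) by rewrite expg1 permM permKV.
    exact: porbit_perm.
  have face2 (t : {perm D}) x y : (f^-1 y \in porbit (f * t) (t x)) = (t y \in porbit (f * t) (t x)).
    by rewrite -!eq_porbit_mem (face t y).
  have := porbit_tperm_xor (f * s) nf; rewrite -face_tperm -/s1 -!face !face2 (negPf nface) s1i s1i'.
  by case: (s i \in _).
case/negP; have Eq := dart_conn_eqv s2 f.
have s2e : s2 e = s i' by rewrite permM tpermR s1i.
rewrite (eqv_right Eq _ (dart_conn_s s2 f e)) s2e spt.
have ne_pt t : 0 < t < c -> t != b -> s2 (pt t) = pt t.+1.
  case/andP=> t0 tc tb; have h1 : pt t != i by rewrite -i0 eq_sym ptne // ltnW.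
  have h2 : pt t != i'.
    move: tb; rewrite neq_ltn => /orP [] h; first by rewrite ptne // ltnW.
    by rewrite eq_sym ptne // ltnW.
  have h3 : s1 (pt t) = pt t.+1 by rewrite s1E // spt.
  rewrite s2E //; apply/eqP => E; have := @ptne 0 t.+1 isT tc.
  by rewrite -h3 E s1e i0 eqxx.
have walk t u : 0 < t -> t <= u -> u <= c -> (forall v, t <= v < u -> v != b) ->
    dart_conn s2 f (pt t) (pt u).
  move=> t0; elim: u => [|u IH] tu uc N; first by move: (leq_trans t0 tu).
  move: tu; rewrite leq_eqVlt => /predU1P [->|tu]; first by rewrite (eqv_refl Eq).
  have tu' : t <= u by [].
  rewrite -(ne_pt u); first last.
  - by apply: N; rewrite tu' ltnSn.
  - by rewrite uc (leq_trans t0 tu').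
  rewrite -(eqv_right Eq _ (dart_conn_s _ _ _)); apply: IH => //; first exact: ltnW.
  by move=> v /andP [h1 h2]; apply: N; rewrite h1 ltnW.
have c1 : dart_conn s2 f i i' by exact: wire s2 s2off.
have i'e : i' != e.
  apply/eqP => E; have := @ptne 0 1%N isT (leq_trans b0 (ltnW bc)).
  by rewrite -(spt 0) i0 -s1i' E s1e eqxx.
have c2 : dart_conn s2 f i' (pt 1%N).
  have -> : pt 1%N = s2 i' by rewrite (s2E _ _ i'e) 1?eq_sym // s1i' -i0 spt.
  exact: dart_conn_s.
have c3 : dart_conn s2 f (pt 1%N) (pt a).
  apply: walk => //; first exact: leq_trans (ltnW ab') (ltnW bc).
  by move=> v /andP [_ h]; rewrite neq_ltn (ltn_trans h ab').
have c4 : dart_conn s2 f (pt a) (pt c) by exact: off_rel_sub H.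
have c5 : dart_conn s2 f (pt b.+1) (pt c).
  by apply: walk => // v /andP [h _]; rewrite neq_ltn h orbT.
rewrite (eqv_left Eq c1) (eqv_left Eq c2) (eqv_left Eq c3) (eqv_left Eq c4).
by rewrite (eqv_sym Eq).
Qed.
End NonCrossing.

(** * Wires: alternating paths between fixed points *)

Section Wires.
Variables (D : finType) (f be : D -> D).
Hypotheses (fK : involutive f) (beK : involutive be) (f_neq : forall x, f x != x).

Definition wire_rel : rel D := fun x y => (y == f x) || (y == be x).
Lemma wire_rel_sym : symmetric wire_rel.
Proof.
by move=> x y; rewrite /wire_rel (eq_sym y) (eq_sym y) (can2_eq fK fK) (can2_eq beK beK) !(eq_sym x).
Qed.

Let phi x := be (f x).

(** The orbit of [phi] from e stops at the first fixed point of [be]. Besides the other end, the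
    number of steps is recorded, because the planarity argument follows the wire along a face. *)
Lemma wire_exists e : be e = e -> exists e',
  [/\ be e' = e', e' != e, connect wire_rel e e',
      forall y, be y = y -> connect wire_rel e y -> y = e \/ y = e' &
      exists k, f (iter k phi e) = e' /\ forall t, 0 < t <= k -> be (iter t phi e) != iter t phi e].
Proof.
move=> be_e; have phi_inj : injective phi by move=> x y /(inv_inj beK)/(inv_inj fK).
have ex : exists k, be (f (iter k phi e)) == f (iter k phi e).
  have [N N0 EN] : exists2 N, 0 < N & iter N phi e = e.
    by exists (fingraph.order phi e); [exact: fingraph.order_gt0 | exact: fingraph.iter_order].
  exists N.-1; case: N N0 EN => // N _; rewrite iterS => E.
  have E' : be (f (iter N phi e)) = e by [].
  by have := beK (f (iter N phi e)); rewrite E' be_e => h; apply/eqP; rewrite -[RHS]h.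
pose k := ex_minn ex; have end_k : be (f (iter k phi e)) = f (iter k phi e).
  by rewrite /k; case: ex_minnP => m /eqP.
have min_k t : t < k -> be (f (iter t phi e)) != f (iter t phi e).
  rewrite /k; case: ex_minnP => m _ H tm; apply/negP => /H; lia.
have nfix t : 0 < t <= k -> be (iter t phi e) != iter t phi e.
  case: t => // t tk; have := min_k t tk; apply: contra => /eqP E.
  by apply/eqP/(can_inj beK); exact: E.
exists (f (iter k phi e)); split=> //.
- apply/eqP => E.
  (* A wire returning to e would be its own reverse; its middle would be a fixed point of [f], or
     one of [be] before the end. *)
  have refl t : t <= k -> f (iter (k - t) phi e) = iter t phi e.
    elim: t => [|t IH] tk; first by rewrite subn0.
    have Ek : k - t = (k - t.+1).+1 by lia.
    have := IH (ltnW tk); rewrite Ek iterS => h.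
    by rewrite iterS {2}/phi -h fK /phi beK.
  have := refl k./2; rewrite leq_half_double => h0.
  have kk := odd_double_half k.
  have h := h0 _; move: h => /(_ (ltac:(lia))) h.
  case: (odd k) kk => kk.
    have E2 : k - k./2 = k./2.+1 by lia.
    rewrite E2 in h; have lt : k./2 < k by lia.
    by have := min_k _ lt; rewrite -[be _]/(iter k./2.+1 phi e) -h fK eqxx.
  have E2 : k - k./2 = k./2 by lia.
  by rewrite E2 in h; have := f_neq (iter k./2 phi e); rewrite h eqxx.
- have W t : connect wire_rel e (iter t phi e).
    elim: t => [|t IH]; first exact: connect0.
    apply: connect_trans IH _; rewrite iterS; apply: (connect_trans (y := f (iter t phi e)));
    by apply: connect1; rewrite /wire_rel eqxx ?orbT.
  by apply: connect_trans (W k) _; apply: connect1; rewrite /wire_rel eqxx.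
- have closed y : connect wire_rel e y -> exists2 t, t <= k & y = iter t phi e \/ y = f (iter t phi e).
    case/connectP=> p; elim/last_ind: p y => [|p z IH] y /=; first by move=> _ ->; exists 0; [|left].
    rewrite rcons_path last_rcons => /andP [pp h] ->.
    have [t tk [] E] := IH _ pp erefl; rewrite E in h; case/orP: h => /eqP ->.
    + by exists t; [|right].
    + case: t tk {E} => [|t] tk; first by exists 0; [|left; rewrite /= be_e].
      by exists t; [exact: ltnW|right; rewrite iterS /phi beK].
    + by exists t; [|left; rewrite fK].
    have [Et|nt] := eqVneq t k; first by exists t; [|right; rewrite Et end_k].
    by exists t.+1; [lia|left].
  move=> y yfix /closed [t tk [] E]; rewrite E in yfix *.
    case: t tk yfix {E} => [|t] tk yfix; first by left.
    by have := nfix t.+1; rewrite tk yfix eqxx => /(_ isT).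
  have [->|nt] := eqVneq t k; first by right.
  by have := min_k t; rewrite yfix eqxx => /(_ _)/negP; case; lia.
by exists k.
Qed.
End Wires.

(** * Strands of smoothed diagrams *)

Section Counting.
Variable T : finType.

Lemma n_comp_classes (r : rel T) : connect_sym r ->
  n_comp r predT = num_classes (connect r).
Proof.
move=> S; pose F x := [set y | connect r x y].
have E : [set F x | x : T] = [set F x | x in roots r].
  apply/setP=> A; apply/imsetP/imsetP => [[x _ ->]|[x _ ->]]; last by exists x.
  exists (fingraph.root r x); first exact: roots_root.
  apply/setP => y; rewrite !inE; apply: (same_connect S); exact: connect_root.
rewrite /num_classes -/F E card_in_imset.
  by apply: eq_card => x; rewrite !inE andbT.
move=> x y rx ry /setP/(_ y); rewrite !inE connect0 -(root_connect S).
by move=> /eqP; rewrite (eqP rx) (eqP ry).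
Qed.

Lemma fconnect_porbit (s : {perm T}) (g : T -> T) x y : g =1 s ->
  fconnect g x y = (y \in porbit s x).
Proof.
move=> gs; rewrite (eq_fconnect gs); apply/idP/porbitP => [/iter_findex <-|[i ->]].
  by exists (findex s x y); rewrite permX.
by rewrite permX fconnect_iter.
Qed.

Lemma fcard_porbits (s : {perm T}) (g : T -> T) : g =1 s -> fcard g predT = #|porbits s|.
Proof.
move=> gs; rewrite n_comp_classes; last first.
  by apply: fconnect_sym => x y; rewrite !gs => /perm_inj.
congr #|pred_of_set _|; apply: eq_imset => x; apply/setP => y.
by rewrite inE (fconnect_porbit _ _ gs).
Qed.

Lemma fcard_involution (g : T -> T) : involutive g -> (forall x, g x != x) ->
  (fcard g predT).*2 = #|T|.
Proof.
move=> gK g_neq; rewrite -muln2; apply: (@fcard_order_set _ g (inv_inj gK) 2 predT).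
  apply/subsetP => x _; rewrite inE /fingraph.order -[2]/(true.+1) -(g_neq x).
  rewrite -(card2 (g x) x); apply/eqP; apply: eq_card => y; rewrite !inE.
  apply/idP/orP => [/iter_findex <-|[] /eqP ->]; [|exact: fconnect1|exact: connect0].
  elim: findex => [|i IH]; first by right.
  by rewrite iterS; case: IH => /eqP ->; [right; rewrite gK|left].
by move=> x y _.
Qed.
End Counting.

(** * Smoothing crossings by cutting vertices *)

Section CutDiagram.
Variables (n : nat) (D : diagram n).
Notation c := (ncr D).
Notation E := (ends n c).
Implicit Types (rho : {ffun 'I_c -> bool}) (S : {set 'I_c}).

Definition glue_perm : {perm E} := perm (inv_inj (@glueK n D)).

Lemma glue_permE x : glue_perm x = glue D x. Proof. exact: permE. Qed.

Lemma smooth_endK b : involutive (smooth_end b).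
Proof. by move=> j; apply/val_inj; case: b; case: j => [[|[|[|[|]]]]]. Qed.

(** A smoothed crossing becomes two vertices with two darts each, on which the rotation is the
    involution [smooth_end]. *)
Definition cut_rot rho S (x : E) : E :=
  match x with
  | inl i => inl (ordS i)
  | inr (k, j) => inr (k, if k \in S then smooth_end (rho k) j else ordS j)
  end.

Lemma cut_rot_inj rho S : injective (cut_rot rho S).
Proof.
have ordS_inj m : injective (@ordS m) := can_inj (@ordSK m).
have pair_inr u v : inr u = inr v :> E -> u = v by case.
move=> [i|[k j]] [i'|[k' j']] //= H.
  have inlK u v : inl u = inl v :> E -> u = v by case.
  by rewrite (ordS_inj _ _ _ (inlK _ _ H)).
have H' := pair_inr _ _ H; have Ek := congr1 fst H'; have := congr1 snd H'; rewrite /= in Ek *; rewrite -Ek; case: ifP => _ Ej.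
  by rewrite (inv_inj (@smooth_endK _) Ej).
by rewrite (ordS_inj _ _ _ Ej).
Qed.

Definition rot_perm rho S : {perm E} := perm (@cut_rot_inj rho S).

Lemma diagram_euler rho : euler (rot_perm rho set0) glue_perm = euler_bound (rot_perm rho set0) glue_perm.
Proof.
have rotE : @rot_end n c =1 rot_perm rho set0 by case=> [i|[k j]]; rewrite permE //= inE.
have glueE : glue D =1 glue_perm by move=> x; rewrite glue_permE.
have phiE : @rot_end n c \o glue D =1 (glue_perm * rot_perm rho set0)%g.
  by move=> x; rewrite permM -glueE -rotE.
have := glue_planar D; rewrite (fcard_porbits rotE) (fcard_porbits glueE) (fcard_porbits phiE).
have := fcard_involution (@glueK n D) (@glue_neq n D); rewrite (fcard_porbits glueE).
set r := fun x y => _; have rE : connect r =2 dart_conn (rot_perm rho set0) glue_perm.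
  move=> x y; apply/idP/idP; apply: connect_sub => {}x {}y.
    case/orP => /eqP ->; rewrite ?glueE ?rotE; [exact: dart_conn_f|exact: dart_conn_s].
  have rr z : connect r z (rot_end z) by apply: connect1; rewrite /r eqxx orbT.
  have rg z : connect r z (glue D z) by apply: connect1; rewrite /r eqxx.
  have back z : connect r (rot_end z) z.
    have : fconnect (@rot_end n c) (rot_end z) z.
      rewrite fconnect_sym ?fconnect1 // => u v; rewrite !rotE; exact: perm_inj.
    by apply: connect_sub => u v /eqP <-.
  case/or4P=> /eqP ->; rewrite -?rotE -?glueE //.
  by rewrite -{2}[y](@glueK n D).
have rsym : connect_sym r by move=> x y; rewrite !rE (eqv_sym (dart_conn_eqv _ _)).
rewrite (n_comp_classes rsym) (eq_num_classes rE) /euler /euler_bound.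
have arith (a b d e k : nat) : b.*2 = e -> a + d = b + k -> a + b + d = e + k by lia.
by move=> h1 h2; exact: arith h1 h2.
Qed.

Lemma cut_euler rho S : euler (rot_perm rho S) glue_perm = euler_bound (rot_perm rho S) glue_perm.
Proof.
have [N] := ubnP #|S|; elim: N S => // N IH S; rewrite ltnS => lts.
have [->|[k kS]] := set_0Vmem S; first exact: diagram_euler.
have ltS : #|S :\ k| < N by move: lts; rewrite (cardsD1 k) kS; lia.
have pl := IH _ ltS; set s := rot_perm _ (S :\ k) in pl.
(* Exchanging the images of two opposite ends turns the 4-cycle at the crossing into two 2-cycles;
   which opposite pair is taken decides the smoothing. *)
pose a : 'I_4 := if rho k then ord0 else Ordinal (isT : 1 < 4); pose b : 'I_4 := ordS (ordS a).
have ab : inr (k, a) != inr (k, b) :> E.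
  have ab : a != b by rewrite /b /a; case: (rho k).
  by apply: contraNneq ab => -[->].
have sE j : s (inr (k, j)) = inr (k, ordS j) by rewrite permE /= !inE eqxx.
have same : inr (k, b) \in porbit s (inr (k, a)).
  by have := mem_porbit s 2 (inr (k, a)); rewrite expgS expg1 permM !sE.
have [Q _] := jordan pl ab same.
suff -> : rot_perm rho S = (tperm (inr (k, a)) (inr (k, b)) * s)%g by [].
apply/permP => x; rewrite permM permE; case: tpermP => [->|->|].
- rewrite sE /= kS; congr (inr (_, _)); apply/val_inj; rewrite /b /a.
  by case: (rho k).
- rewrite sE /= kS; congr (inr (_, _)); apply/val_inj; rewrite /b /a.
  by case: (rho k).
case: x => [i|[k' j]] na nb; rewrite permE //=; congr (inr (_, _)); rewrite !inE.
have [Ek|//] := eqVneq k' k; rewrite Ek kS in na nb *; apply/val_inj => /=.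
have {}na : j != a by apply: contra_notN na => /eqP ->.
have {}nb : j != b by apply: contra_notN nb => /eqP ->.
move: na nb; rewrite -!val_eqE /b /a /smooth_end; case: (rho k) => /=;
by case: j => [[|[|[|[|]]]]].
Qed.

End CutDiagram.

(** * Wires of a partly smoothed diagram do not cross *)

Section CutWires.
Variables (n : nat) (D : diagram n).
Notation c := (ncr D).
Notation E := (ends n c).
Variables (rho : {ffun 'I_c -> bool}) (S : {set 'I_c}).

(** Its fixed points are the loose ends of wires: boundary points and the ends at crossings outside
    S. *)
Definition cut_end (x : E) : E :=
  if x is inr (k, j) then if k \in S then inr (k, smooth_end (rho k) j) else x else x.

Lemma cut_endK : involutive cut_end.
Proof.
by case=> [i|[k j]] //=; case: ifP => kS /=; rewrite kS // smooth_endK.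
Qed.

Lemma smooth_end_neq b j : smooth_end b j != j.
Proof. by case: b; case: j => [[|[|[|[|]]]]]. Qed.

Lemma cut_end_inr k j : (cut_end (inr (k, j)) == inr (k, j)) = (k \notin S).
Proof.
rewrite /=; case: ifP => _; last exact: eqxx.
by apply: contraNF (smooth_end_neq (rho k) j) => /eqP [->].
Qed.

Definition wire : rel E := connect (wire_rel (glue D) cut_end).

Lemma wire_eqv : equivalence_rel wire.
Proof. exact: connect_eqv (wire_rel_sym (@glueK n D) cut_endK). Qed.
Lemma wire_glue x : wire x (glue D x).
Proof. by apply: connect1; rewrite /wire_rel eqxx. Qed.
Lemma wire_cut x : wire x (cut_end x).
Proof. by apply: connect1; rewrite /wire_rel eqxx orbT. Qed.

Lemma wire_other x : cut_end x = x ->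
  exists y, [/\ cut_end y = y, y != x & wire x y].
Proof.
move=> fx; have [y [fy yx xy _ _]] := wire_exists (@glueK n D) cut_endK (@glue_neq n D) fx.
by exists y.
Qed.

Lemma wire_unique x y z : cut_end x = x -> cut_end y = y -> cut_end z = z ->
  wire x y -> wire x z -> y != x -> z != x -> y = z.
Proof.
move=> fx fy fz xy xz yx zx.
have [x' [_ _ _ U _]] := wire_exists (@glueK n D) cut_endK (@glue_neq n D) fx.
have [Ey|->] := U _ fy xy; first by rewrite Ey eqxx in yx.
by have [Ez|->//] := U _ fz xz; rewrite Ez eqxx in zx.
Qed.

Let s := rot_perm rho S.
Let f := glue_perm D.

Lemma rot_fixed x : cut_end x = x -> cut_end (s x) = s x.
Proof.
case: x => [i _|[k j] /eqP]; first by rewrite /s permE.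
rewrite cut_end_inr => kS; have -> : s (inr (k, j)) = inr (k, ordS j) by rewrite /s permE /= (negPf kS).
by apply/eqP; rewrite cut_end_inr.
Qed.

Lemma porbit_fixed x y : cut_end x = x -> y \in porbit s x -> cut_end y = y.
Proof.
move=> fx /porbitP [i ->]; elim: i => [|i IH]; first by rewrite expg0 perm1.
by rewrite expgSr permM; exact: rot_fixed.
Qed.

Lemma rot_cut x : cut_end x != x -> s x = cut_end x.
Proof.
case: x => [i|[k j]]; first by rewrite eqxx.
by rewrite cut_end_inr negbK /s permE /= => ->.
Qed.

(** At a vertex with two darts the next dart of a face is the other one, so the face permutation
    follows the wire. *)
Lemma wire_face e k : (forall t, 0 < t <= k ->
    let x := iter t (fun x => cut_end (glue D x)) e in cut_end x != x) ->
  forall t, t <= k -> ((f * s) ^+ t)%g e = iter t (fun x => cut_end (glue D x)) e.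
Proof.
move=> H; elim=> [|t IH] tk; first by rewrite expg0 perm1.
rewrite expgSr permM IH; last exact: ltnW.
rewrite permM /f glue_permE iterS; set x := iter t _ e.
apply: rot_cut; have := H t.+1; rewrite tk => /(_ isT) /=; rewrite -/x.
by rewrite cut_endK eq_sym.
Qed.

Lemma wire_off_rel e x y : cut_end e = e -> wire x y -> connect (off_rel s f e) x y.
Proof.
move=> fe; apply: connect_sub => {}x {}y /orP [] /eqP ->.
  by apply: connect1; rewrite /off_rel /f glue_permE eqxx.
have [->|nx] := eqVneq (cut_end x) x; first exact: connect0.
apply: connect1; rewrite /off_rel -(rot_cut nx) eqxx andbT.
by rewrite (contra_notN (porbit_fixed fe)) ?orbT //; apply/eqP.
Qed.

Lemma cut_no_crossing e a b d (pt := fun t => (s ^+ t)%g e) :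
  cut_end e = e -> 0 < a < b -> b < d ->
  (forall t u, t <= d -> u <= d -> pt t = pt u -> t = u) ->
  wire e (pt b) -> ~ connect (off_rel s f e) (pt a) (pt d).
Proof.
move=> fe ab bd inj w.
have [e' [_ _ _ U [k [Ek off]]]] := wire_exists (@glueK n D) cut_endK (@glue_neq n D) fe.
have Eb : pt b = e'.
  have [|Eb|//] := U (pt b) _ w; first by apply: (porbit_fixed fe); exact: mem_porbit.
  have := inj b 0 (ltnW bd) isT; rewrite Eb /pt expg0 perm1 => /(_ erefl) b0.
  by rewrite b0 andbF in ab.
have W := wire_face off.
apply: (@no_crossing _ s f (cut_euler _ _) e a b d k ab bd inj).
  by rewrite W // /f glue_permE Ek.
move=> t tk; have /andP [_ tk'] := tk; rewrite W //.
by apply/negP => /(porbit_fixed fe) /eqP; rewrite (negPf (off t tk)).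
Qed.

Lemma rot_outer (p q : 'I_n.*2) d : q = p + d :> nat -> (s ^+ d)%g (inl p) = inl q.
Proof.
elim: d q => [|d IH] q Eq.
  by rewrite expg0 perm1; congr inl; apply/val_inj; rewrite /= Eq addn0.
have lt : p + d < n.*2 by rewrite (leq_trans _ (ltnW (ltn_ord q))) // Eq addnS.
rewrite expgSr permM (IH (Ordinal lt)) // /s permE /=; congr inl; apply/val_inj => /=.
have Eq' : (p + d).+1 = q by rewrite Eq addnS.
have h : (p + d).+1 < n.*2 by rewrite Eq'.
exact: etrans (modn_small h) Eq'.
Qed.

Lemma outer_no_crossing (p q r t : 'I_n.*2) : p < q < r -> r < t ->
  wire (inl p) (inl r) -> wire (inl q) (inl t) -> False.
Proof.
case/andP=> pq qr rt w1 w2; have fe : cut_end (inl p) = inl p by [].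
have pr := ltn_trans pq qr; have pt := ltn_trans pr rt.
have P (x : 'I_n.*2) : p < x -> inl x = (s ^+ (x - p))%g (inl p).
  by move=> px; rewrite (rot_outer (q := x)) // subnKC // ltnW.
have := wire_off_rel fe w2; rewrite (P q pq) (P t pt).
apply: (@cut_no_crossing (inl p) (q - p) (r - p) (t - p)) => //.
- by rewrite subn_gt0 pq ltn_sub2r.
- by rewrite ltn_sub2r.
- move=> u v Hu Hv.
  have lt w : w <= t - p -> p + w < n.*2.
    by move=> h; rewrite (leq_ltn_trans _ (ltn_ord t)) // -leq_subRL // ltnW.
  rewrite (@rot_outer p (Ordinal (lt u Hu)) u) // (@rot_outer p (Ordinal (lt v Hv)) v) //.
  by case=> /addnI.
by rewrite -(P r pr).
Qed.

(** All boundary points lie on the outer vertex, which may be used freely when e belongs to a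
    crossing. *)
Lemma off_outer e p q : (forall i, inl i \notin porbit s e) ->
  connect (off_rel s f e) (inl p) (inl q).
Proof.
move=> ne; have H d (u v : 'I_n.*2) : v = u + d :> nat ->
    connect (off_rel s f e) (inl u) (inl v) /\ connect (off_rel s f e) (inl v) (inl u).
  elim: d v => [|d IH] v Ev.
    have -> : v = u by apply/val_inj; rewrite /= Ev addn0.
    by split; exact: connect0.
  have lt : u + d < n.*2 by rewrite (leq_trans _ (ltnW (ltn_ord v))) // Ev addnS.
  have [c1 c2] := IH (Ordinal lt) erefl.
  have st : s (inl (Ordinal lt)) = inl v.
    by have := @rot_outer (Ordinal lt) v 1; rewrite expg1; apply; rewrite Ev addnS addn1.
  split; [apply: connect_trans c1 _|apply: connect_trans _ c2]; apply: connect1;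
  by rewrite /off_rel st eqxx !ne ?andbT ?orbT.
case: (leqP p q) => pq.
  exact: (proj1 (H _ p q (esym (subnKC pq)))).
exact: (proj2 (H _ q p (esym (subnKC (ltnW pq))))).
Qed.

Variable k : 'I_c.
Hypothesis only_cut : forall k', (k' \in S) = (k' != k).

Lemma cut_fixedP x : cut_end x = x -> (exists i, x = inl i) \/ exists j, x = inr (k, j).
Proof.
case: x => [i|[k' j] /eqP]; first by left; exists i.
by rewrite cut_end_inr only_cut negbK => /eqP ->; right; exists j.
Qed.

Lemma cut_fixed j : cut_end (inr (k, j)) = inr (k, j).
Proof. by apply/eqP; rewrite cut_end_inr only_cut eqxx. Qed.

(** If two opposite ends were joined, the other two would be joined to each other or both to the
    boundary, hence connected through the outer vertex; this contradicts [cut_no_crossing]. *)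
Lemma no_opposite j : ~ wire (inr (k, j)) (inr (k, ordS (ordS j))).
Proof.
move=> w; set e : E := inr (k, j).
have fe := cut_fixed j; have sE i : s (inr (k, i)) = inr (k, ordS i).
  by rewrite /s permE /= only_cut eqxx.
have ptE t : (s ^+ t)%g e = inr (k, iter t (@ordS 4) j).
  by elim: t => [|t IH]; rewrite ?expg0 ?perm1 // expgSr permM IH sE.
have ne i : inl i \notin porbit s e by apply/porbitP => -[t]; rewrite ptE.
(* Counted from e around the crossing, positions 0 and 2 are joined by the wire, and 1 and 3 remain
   to be connected. *)
have := @cut_no_crossing e 1 2 3 fe isT isT; rewrite !ptE; case => //.
  move=> t u; rewrite !ptE => ht hu []; rewrite /= => h.
  case: j ht hu h {w fe e ptE ne} => [[|[|[|[|]]]]] // hj; case: t => [|[|[|[|]]]] //; by case: u => [|[|[|[|]]]].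
set B : E := inr (k, ordS j); set A : E := inr (k, ordS (ordS (ordS j))); rewrite /= -/A -/B.
have nB (i : 'I_4) : ordS i != i by case: i => [[|[|[|[|]]]]].
have nB2 (i : 'I_4) : ordS (ordS i) != i by case: i => [[|[|[|[|]]]]].
have nB3 (i : 'I_4) : ordS (ordS (ordS i)) != i by case: i => [[|[|[|[|]]]]].
have cover (i : 'I_4) : [|| i == j, i == ordS j, i == ordS (ordS j) | i == ordS (ordS (ordS j))].
  by case: j {w fe e ptE ne A B} => [[|[|[|[|]]]]] // hj; case: i => [[|[|[|[|]]]]].
have inj_end (i i' : 'I_4) : (inr (k, i) == inr (k, i') :> E) = (i == i').
  by apply/eqP/eqP => [[]//|->].
have far i i' : i != j -> i != ordS (ordS j) -> i' != i -> wire (inr (k, i)) (inr (k, i')) ->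
    i' != j /\ i' != ordS (ordS j).
  move=> ij ij2 i'i wi; have W := wire_eqv; split; apply/eqP => Ei'; rewrite Ei' in wi i'i.
    rewrite (eqv_sym W) in wi.
    have := wire_unique fe (cut_fixed i) (cut_fixed (ordS (ordS j))) wi w.
    by rewrite !inj_end ij nB2 => /(_ isT isT)/eqP; rewrite inj_end (negPf ij2).
  rewrite (eqv_sym W) in wi; have w' := w; rewrite (eqv_sym W) in w'.
  have := wire_unique (cut_fixed (ordS (ordS j))) (cut_fixed i) fe wi w'.
  by rewrite !inj_end ij2 eq_sym nB2 => /(_ isT isT)/eqP; rewrite inj_end (negPf ij).
have other i : i != j -> i != ordS (ordS j) -> wire B A \/ exists p, wire (inr (k, i)) (inl p).
  move=> ij ij2; have [y [fy yi w']] := wire_other (cut_fixed i).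
  have [[p Ep]|[i' Ei']] := cut_fixedP fy; first by right; exists p; rewrite -Ep.
  left; rewrite Ei' in w' yi; have i'i : i' != i by apply: contra yi => /eqP ->.
  have [h1 h2] := far _ _ ij ij2 i'i w'.
  move: (cover i) (cover i'); rewrite (negPf ij) (negPf ij2) (negPf h1) (negPf h2) /= => /orP [] /eqP E1 /orP [] /eqP E2;
    rewrite E1 E2 ?eqxx // in w' i'i *.
  by rewrite (eqv_sym wire_eqv).
have nB1 : ordS j != ordS (ordS j) by rewrite eq_sym nB.
have [wAB|[p wp]] := other (ordS j) (nB j) nB1; first exact: wire_off_rel fe wAB.
have [wAB|[q wq]] := other _ (nB3 j) (nB _); first exact: wire_off_rel fe wAB.
apply: connect_trans (wire_off_rel fe wp) _; apply: connect_trans (off_outer p q ne) _.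
by apply: wire_off_rel fe _; rewrite (eqv_sym wire_eqv).
Qed.
End CutWires.

Section Strands.
Variables (n : nat) (D : diagram n).
Notation c := (ncr D).
Notation E := (ends n c).
Implicit Types (rho : {ffun 'I_c -> bool}) (i j : 'I_n.*2).

Definition ss rho : rel E := connect (strand rho).
Definition fr rho (p : E) := [forall i, ~~ ss rho p (inl i)].

Lemma ss_wire rho : ss rho =2 wire rho setT.
Proof.
move=> x y; apply/idP/idP; apply: connect_sub => {}x {}y.
  case/orP => [/eqP ->|]; first exact: wire_glue.
  case: x => // -[k j] /eqP ->; have := @wire_cut n D rho setT (inr (k, j)).
  by rewrite /= inE.
case/orP => /eqP ->; first by apply: connect1; rewrite /strand eqxx.
case: x => [i|[k j]]; first exact: connect0.
by apply: connect1; rewrite /strand /= inE eqxx orbT.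
Qed.

Lemma ss_eqv rho : equivalence_rel (ss rho).
Proof. by move=> x y z; rewrite !ss_wire; exact: wire_eqv. Qed.

Lemma ss_boundary_unique rho i j k : ss rho (inl i) (inl j) -> ss rho (inl i) (inl k) ->
  j != i -> k != i -> j = k.
Proof.
rewrite !ss_wire => ij ik nj nk.
have inlK (u v : 'I_n.*2) : (inl u == inl v :> E) = (u == v) by apply/eqP/eqP => [[]|->].
by have := @wire_unique n D rho setT (inl i) (inl j) (inl k) erefl erefl erefl ij ik; rewrite !inlK => /(_ nj nk) [].
Qed.

(** A wire has exactly two ends, so each boundary point has one partner; [outer_no_crossing] makes
    the pairing planar. *)
Lemma rmatch_exists rho :
  exists m : matching n, forall i j, ss rho (inl i) (inl j) = (j == i) || (j == m i).
Proof.
have S := ss_eqv rho.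
pose m : {ffun 'I_n.*2 -> 'I_n.*2} := [ffun i => odflt i [pick j | (j != i) && ss rho (inl i) (inl j)]].
have mP i : m i != i /\ ss rho (inl i) (inl (m i)).
  rewrite ffunE; case: pickP => [j /andP []//|H].
  have [y [fy yi w]] := @wire_other n D rho setT (inl i) erefl.
  case: y fy yi w => [j|[k j] /eqP]; last by rewrite cut_end_inr inE.
  by move=> _ ji w; have := H j; rewrite ss_wire w andbT => /negbFE /eqP Ej; rewrite Ej eqxx in ji.
have mU i j : ss rho (inl i) (inl j) -> j != i -> j = m i.
  by move=> ij ji; have [h1 h2] := mP i; exact: ss_boundary_unique ij h2 ji h1.
have mK i : m (m i) = i.
  by have [h1 h2] := mP i; rewrite -(mU (m i) i) // 1?(eqv_sym S) // eq_sym.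
have pm : planar m.
  apply/andP; split; first by apply/forallP => i; rewrite (mP i).1 mK eqxx.
  apply/forallP => i; apply/forallP => j; apply/implyP => /andP [ij jm].
  have mji : m j != i by apply: contraTneq jm => /(congr1 m); rewrite mK => ->; rewrite ltnn.
  have mjm : m j != m i by apply: contraTneq ij => /(congr1 m); rewrite !mK => ->; rewrite ltnn.
  have W u : wire rho setT (inl u) (inl (m u)) by rewrite -ss_wire; exact: (mP u).2.
  have W' u : wire rho setT (inl (m u)) (inl u) by rewrite -{2}[u]mK.
  move: mji mjm; rewrite -!val_eqE /= !neq_ltn => /orP [lt _|->].
    by case: (@outer_no_crossing n D rho setT (m j) i j (m i)); rewrite ?lt ?ij.
  move=> /orP [-> //|lt].
  by case: (@outer_no_crossing n D rho setT i j (m i) (m j)); rewrite ?lt ?ij.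
exists (Matching pm) => i j /=; apply/idP/orP => [h|[/eqP ->|/eqP ->]].
- by case: (eqVneq j i) => ji; [left|right; rewrite (mU i j h ji)].
- exact: (eqv_refl S).
by have [] := mP i.
Qed.
End Strands.

(** * Loops at a single crossing *)

Section CrossingLoops.
Variables (n : nat) (D : diagram n).
Notation c := (ncr D).
Notation E := (ends n c).
Variable k : 'I_c.
Implicit Types (rho : {ffun 'I_c -> bool}) (i j : 'I_4) (p q : 'I_n.*2).

Definition port j : E := inr (k, j).
Definition across j : 'I_4 := ordS (ordS j).

Lemma port_eq i j : (port i == port j) = (i == j).
Proof. by apply/eqP/eqP => [[]//|->]. Qed.
Lemma across_neq j : across j != j.
Proof. by case: j => [[|[|[|[|]]]]]. Qed.
Lemma acrossK : involutive across.
Proof. by move=> j; apply/val_inj; case: j => [[|[|[|[|]]]]]. Qed.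
Lemma smooth_across b j : smooth_end b (smooth_end (~~ b) j) = across j.
Proof. by apply/val_inj; case: b; case: j => [[|[|[|[|]]]]]. Qed.
Lemma smooth_neqb b j : smooth_end (~~ b) j != smooth_end b j.
Proof. by case: b; case: j => [[|[|[|[|]]]]]. Qed.
Lemma smooth_across_neg b j : smooth_end (~~ b) (across j) = smooth_end b j.
Proof. by apply/val_inj; case: b; case: j => [[|[|[|[|]]]]]. Qed.
Lemma smooth_cover b i j : [|| i == j, i == across j, i == smooth_end b j | i == smooth_end (~~ b) j].
Proof. by case: b; case: j => [[|[|[|[|]]]]] //; case: i => [[|[|[|[|]]]]]. Qed.

Lemma strand_sym rho : symmetric (@strand n D rho).
Proof.
suff H x y : strand rho x y -> strand rho y x by move=> x y; apply/idP/idP; exact: H.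
case/orP => [/eqP ->|]; first by rewrite /strand glueK eqxx.
case: x => // -[l j] /eqP ->; by rewrite /strand /= smooth_endK eqxx orbT.
Qed.

Variable rho : {ffun 'I_c -> bool}.
Notation b := (rho k).
Notation W := (wire rho [set~ k]).
(* W follows the diagram cut open at the crossing k; a loop is a component which
   closes up under the smoothing a of k. *)
Definition loop (a : bool) j := W (port j) (port (smooth_end a j)).

Let only_cut k' : (k' \in [set~ k]) = (k' != k). Proof. by rewrite !inE. Qed.
Let WE := wire_eqv rho [set~ k].
Let SE := ss_eqv rho.

Lemma port_fixed j : cut_end rho [set~ k] (port j) = port j.
Proof. exact: cut_fixed only_cut j. Qed.

(** By [no_opposite], a wire that returns to the crossing arrives at an adjacent port, which is the
    partner under one of the two smoothings. *)
Lemma port_other j : [\/ loop b j, loop (~~ b) j | exists p, W (port j) (inl p)].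
Proof.
have [y [fy yj w]] := wire_other (port_fixed j).
have [[p Ep]|[i Ei]] := cut_fixedP only_cut fy; first by constructor 3; exists p; rewrite -Ep.
rewrite Ei -/(port i) port_eq in yj w.
have := smooth_cover b i j; rewrite (negPf yj) /= => /or3P [/eqP E1|/eqP E1|/eqP E1].
- by rewrite E1 in w; case: (no_opposite only_cut w).
- by constructor 1; rewrite /loop -E1.
by constructor 2; rewrite /loop -E1.
Qed.

Lemma loop_sym a j : loop a (smooth_end a j) = loop a j.
Proof. by rewrite /loop smooth_endK (eqv_sym WE). Qed.

Lemma loop_port a i j : loop a j -> W (port j) (port i) -> i = j \/ i = smooth_end a j.
Proof.
move=> l w; case: (eqVneq i j) => ij; [by left|right].
have := wire_unique (port_fixed j) (port_fixed i) (port_fixed (smooth_end a j)) w l.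
by rewrite !port_eq ij smooth_end_neq => /(_ isT isT)/eqP; rewrite port_eq => /eqP.
Qed.

Lemma loop_boundary a p j : loop a j -> ~~ W (port j) (inl p).
Proof.
move=> l; apply/negP => w.
have := @wire_unique _ _ _ _ (port j) (inl p) (port (smooth_end a j)) (port_fixed _) erefl (port_fixed _) w l.
by rewrite port_eq smooth_end_neq => /(_ isT isT).
Qed.

Lemma wire_strand x y : W x y -> ss rho x y.
Proof.
apply: connect_sub => {}x {}y /orP [] /eqP ->; first by apply: connect1; rewrite /strand eqxx.
case: x => [i|[k' j]]; first exact: connect0.
rewrite /=; case: ifP => _; last exact: connect0.
by apply: connect1; rewrite /strand /= eqxx orbT.
Qed.

Lemma strand_port j : ss rho (port j) (port (smooth_end b j)).
Proof. by apply: connect1; rewrite /strand /= eqxx orbT. Qed.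

Lemma strand_closed (P : pred E) : (forall x y, P x -> W x y -> P y) ->
  (forall j, P (port j) -> P (port (smooth_end b j))) -> forall x y, P x -> ss rho x y -> P y.
Proof.
move=> HW Hp x y Px /connectP [s ps ->]; elim: s x Px ps => //= z s IH x Px /andP [xz ps].
apply: IH ps => //; case/orP: xz => [/eqP ->|]; first by apply: HW Px (wire_glue _ _ _).
case: x Px => // -[k' j] Px /eqP ->; have [Ek|nk] := eqVneq k' k.
  by rewrite Ek in Px *; exact: Hp.
apply: HW Px _; have := wire_cut rho [set~ k] (inr (k', j)).
by rewrite /= only_cut nk.
Qed.

Lemma loop_strand j z : loop b j -> ss rho (port j) z = W (port j) z.
Proof.
move=> l; apply/idP/idP; last exact: wire_strand.
apply: (strand_closed (P := W (port j))); last exact: (eqv_refl WE).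
  by move=> x y px xy; rewrite -(eqv_right WE _ xy).
move=> i /(loop_port l) [] ->; rewrite ?smooth_endK //; exact: (eqv_refl WE).
Qed.

Lemma loop_free j : loop b j -> fr rho (port j).
Proof. by move=> l; apply/forallP => i; rewrite loop_strand //; exact: loop_boundary l. Qed.

Lemma across_neq_smooth a j : across j != smooth_end a j.
Proof. by case: a; case: j => [[|[|[|[|]]]]]. Qed.

Lemma loop_apart j : loop b j -> ~~ ss rho (port j) (port (across j)).
Proof.
move=> l; rewrite loop_strand //; apply/negP => /(loop_port l) [] /eqP; apply/negP.
  exact: across_neq.
exact: across_neq_smooth.
Qed.

Lemma loop_excl a j : loop a j -> ~~ loop (~~ a) j && ~~ loop (~~ a) (across j).
Proof.
move=> l; apply/andP; split; apply/negP => l'.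
  case: (loop_port l l') => /eqP; first by rewrite (negPf (smooth_end_neq _ _)).
  by rewrite (negPf (smooth_neqb _ _)).
have E1 : smooth_end (~~ a) (across j) = smooth_end a j.
  by rewrite -(smooth_across (~~ a)) negbK smooth_endK.
rewrite /loop E1 (eqv_sym WE) -(eqv_left WE l) in l'.
case: (loop_port l l') => /eqP; first by rewrite (negPf (across_neq _)).
by rewrite (negPf (across_neq_smooth _ _)).
Qed.

Lemma loop_join j : loop (~~ b) j -> ss rho (port j) (port (across j)).
Proof.
by move=> l; rewrite (eqv_left SE (wire_strand l)) -(smooth_across b); exact: strand_port.
Qed.

Lemma loop_join' j : loop (~~ b) (across j) -> ss rho (port j) (port (across j)).
Proof. by move/loop_join; rewrite acrossK (eqv_sym SE). Qed.

Lemma boundary_not_free x p : ss rho x (inl p) -> ~~ fr rho x.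
Proof. by move=> w; apply/negP => /forallP/(_ p); rewrite w. Qed.

(** A free strand closes up at the foot itself, or it passes through all four ports, when the other
    smoothing would produce two loops. *)
Lemma port_free j : fr rho (port j) = loop b j || (loop (~~ b) j && loop (~~ b) (across j)).
Proof.
case: (boolP (loop b j)) => [/loop_free //|nl] /=.
have [/(negP nl) //|l|[i w]] := port_other j; last first.
  rewrite (negPf (boundary_not_free (wire_strand w))).
  by case: (boolP (loop (~~ b) j)) => // h; move: (loop_boundary i h); rewrite w.
rewrite l /=; have [l'|l'|[i w]] := port_other (across j).
- by have := loop_excl l; rewrite negbK l' andbF.
- rewrite l'; apply/forallP => i; apply/negP => H.
  suff : W (port j) (inl i) || W (port (across j)) (inl i).
    by rewrite (negPf (loop_boundary i l)) (negPf (loop_boundary i l')).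
  apply: (strand_closed (P := fun x => W (port j) x || W (port (across j)) x)) H.
  + by move=> x y h xy; rewrite -!(eqv_right WE _ xy).
  + move=> {}i _; have := smooth_cover b (smooth_end b i) j.
    case/or4P=> /eqP ->; rewrite ?(eqv_refl WE) ?orbT //; last by rewrite [W _ _]l.
    by rewrite -smooth_across_neg [W (port (across j)) _]l' orbT.
  by rewrite (eqv_refl WE).
have -> : loop (~~ b) (across j) = false.
  by apply/negbTE; apply/negP => h; move: (loop_boundary i h); rewrite w.
apply/negbTE/(@boundary_not_free _ i).
by rewrite (eqv_left SE (loop_join l)); exact: wire_strand.
Qed.

(** Without loops, three ports lead to three different boundary points. A strand containing opposite
    ports would have all three, but it has only two ends. *)
Lemma port_joined j : ss rho (port j) (port (across j)) =
  loop (~~ b) j || loop (~~ b) (across j).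
Proof.
case: (boolP (loop (~~ b) j)) => [/loop_join //|n1] /=.
case: (boolP (loop (~~ b) (across j))) => [/loop_join' //|n2]; apply/negbTE.
case: (boolP (loop b j)) => [/loop_apart //|n3].
case: (boolP (loop b (across j))) => [/loop_apart|n4]; first by rewrite acrossK (eqv_sym SE).
pose j1 := smooth_end b j; have E1 : smooth_end (~~ b) j1 = across j.
  by have := smooth_across (~~ b) j; rewrite negbK.
have n5 : ~~ loop b j1 by rewrite loop_sym.
have n6 : ~~ loop (~~ b) j1 by rewrite -loop_sym E1.
have [[p w] [q w1] [r w2]] : [/\ exists p, W (port j) (inl p),
    exists p, W (port j1) (inl p) & exists p, W (port (across j)) (inl p)].
  split.
  - by case: (port_other j) => [/(negP n3)|/(negP n1)|].
  - by case: (port_other j1) => [/(negP n5)|/(negP n6)|].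
  by case: (port_other (across j)) => [/(negP n4)|/(negP n2)|].
have ne x y u v : W x (inl u) -> W y (inl v) -> ~~ W x y -> u != v.
  move=> xu yv; apply: contra => /eqP Euv; rewrite -Euv in yv.
  by rewrite -(eqv_right WE _ xu) in yv; rewrite (eqv_sym WE).
have pq := ne _ _ _ _ w w1 n3; have qr : q != r by apply: (ne _ _ _ _ w1 w2); rewrite -E1.
have pr : p != r by apply: (ne _ _ _ _ w w2); apply/negP/(no_opposite only_cut).
apply/negP => H; move: qr; rewrite (@ss_boundary_unique _ _ rho p q r) ?eqxx // 1?[_ == p]eq_sym //.
  rewrite -(eqv_left SE (wire_strand w)) -(eqv_right SE _ (wire_strand w1)).
  exact: strand_port.
by rewrite -(eqv_left SE (wire_strand w)) -(eqv_right SE _ (wire_strand w2)).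
Qed.
End CrossingLoops.

Section RightMatching.
Variables (n : nat) (D : diagram n) (rho : {ffun 'I_(ncr D) -> bool}) (m : matching n).
Hypothesis mP : forall i, ss rho (inl i) (inl (m i)).

Lemma ss_boundary i j : ss rho (inl i) (inl j) = (j == i) || (j == m i).
Proof.
have SE := ss_eqv rho.
apply/idP/orP => [h|[] /eqP ->]; [|exact: (eqv_refl SE)|exact: mP].
case: (eqVneq j i) => ji; [by left|right].
by apply/eqP; apply: ss_boundary_unique h (mP i) ji _; rewrite mate_neq.
Qed.
End RightMatching.

(** * Changing the smoothing at one crossing *)

Section ChangeCrossing.
Variables (n : nat) (D : diagram n).
Notation c := (ncr D).
Notation E := (ends n c).
Variables (k : 'I_c) (rho rho' : {ffun 'I_c -> bool}).
Hypothesis off : forall l, l != k -> rho' l = rho l.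

(** With k uncut its smoothing does not matter, so the loops for both smoothings can be read off
    either state. *)
Lemma wire_change : wire rho [set~ k] =2 wire rho' [set~ k].
Proof.
apply: eq_connect => x y; rewrite /wire_rel; congr (_ || (_ == _)).
case: x => // -[l j] /=; rewrite !inE; case: eqP => //= /eqP lk.
by rewrite off.
Qed.

Lemma loop_change a j : loop k rho' a j = loop k rho a j.
Proof. by rewrite /loop wire_change. Qed.

Let p1 j : E := port k j.
Let SE := ss_eqv rho.

Lemma port_merged j i : merged (ss rho) (p1 j) (p1 (across j)) (p1 j) (p1 i).
Proof.
rewrite /merged (eqv_refl SE) /=.
have := smooth_cover (rho k) i j => /or4P [] /eqP ->.
- by rewrite (eqv_refl SE).
- by rewrite (eqv_refl SE) !orbT.
- by rewrite strand_port.
by rewrite -smooth_across_neg negbK strand_port !orbT.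
Qed.

Lemma strand_step_merged j x y : strand rho' x y -> merged (ss rho) (p1 j) (p1 (across j)) x y.
Proof.
have ME := merged_eqv (p1 j) (p1 (across j)) SE.
case/orP => [/eqP ->|].
  by rewrite /merged /ss connect1 // /strand eqxx.
case: x => // -[l i] /eqP ->; have [->|lk] := eqVneq l k.
  by rewrite -(eqv_left ME (port_merged j i)) port_merged.
by rewrite /merged /ss connect1 // /strand /= off // eqxx orbT.
Qed.
End ChangeCrossing.

Section ChangeCrossing2.
Variables (n : nat) (D : diagram n).
Notation c := (ncr D).
Notation E := (ends n c).
Variables (k : 'I_c) (rho rho' : {ffun 'I_c -> bool}).
Hypothesis off : forall l, l != k -> rho' l = rho l.
Hypothesis change : rho' k = ~~ rho k.
Variable j : 'I_4.
Let p := port k j.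
Let q := port k (across j).
Let SE := ss_eqv rho.
Let SE' := ss_eqv rho'.
Let off' l : l != k -> rho l = rho' l. Proof. by move/off. Qed.

Lemma strand_merged : merged (ss rho) p q =2 merged (ss rho') p q.
Proof.
move=> x y; apply/idP/idP; apply: connect_merged; try exact: strand_sym.
  by move=> {}x {}y; apply: strand_step_merged.
by move=> {}x {}y; apply: strand_step_merged.
Qed.

Lemma strand_union x : ss rho p x || ss rho q x = ss rho' p x || ss rho' q x.
Proof.
have := strand_merged p x; rewrite /merged (eqv_refl SE) (eqv_refl SE') /=.
by case: (ss rho p x); case: (ss rho' p x) => //=.
Qed.

Lemma strand_off x y : ~~ (ss rho p x || ss rho q x) -> ss rho x y = ss rho' x y.
Proof.
move=> nx; have := strand_merged x y; rewrite /merged -(strand_union x) (negPf nx) /=.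
by rewrite !orbF.
Qed.

Variables (m m' : matching n).
Hypothesis mP : forall i, ss rho (inl i) (inl (m i)).
Hypothesis mP' : forall i, ss rho' (inl i) (inl (m' i)).

Lemma rmatch_same : ss rho' p q || fr rho' p || fr rho' q -> m = m'.
Proof.
move=> H; apply: matchingP => i; apply/eqP.
have : ss rho' (inl i) (inl (m i)); last first.
  by rewrite (ss_boundary mP') (negPf (mate_neq _ _)).
have := strand_merged (inl i) (inl (m i)); rewrite /merged mP /=.
case: (boolP (ss rho' (inl i) _)) => //= nn /esym /andP [] h1 h2; case/negP: nn; move: h1 h2.
case/orP: H => [/orP [h|/forallP h]|/forallP h].
- by rewrite -!(eqv_left SE' h) !orbb => h1 h2; rewrite -(eqv_left SE' h1).
- by rewrite !(negPf (h _)) /= => h1 h2; rewrite -(eqv_left SE' h1).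
by rewrite !(negPf (h _)) !orbF => h1 h2; rewrite -(eqv_left SE' h1).
Qed.

(** The hypotheses exclude all loops at k, so every port leads to the boundary. All four ends change
    partners, and [diff_bridge] recognizes a surgery. *)
Lemma rmatch_surgery (A := [set i | ss rho p (inl i) || ss rho q (inl i)]) :
  ~~ ss rho' p q -> ~~ fr rho' p -> ~~ fr rho' q ->
  exists a b, [/\ is_bridge m A, surg m A = m', quad m A a b,
    ss rho p (inl a) && ss rho' p (inl a) & ss rho q (inl b) && ss rho' q (inl b)].
Proof.
move=> npq'; move: (npq'); rewrite port_joined !port_free change !(loop_change off) negbK acrossK.
rewrite !negb_or => /andP [n1 n2] /andP [n3 _] /andP [n4 _].
have WE := wire_eqv rho [set~ k].
have B i : ~~ loop k rho (rho k) i -> ~~ loop k rho (~~ rho k) i ->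
    exists2 a, ss rho (port k i) (inl a) & ss rho' (port k i) (inl a) /\ wire rho [set~ k] (port k i) (inl a).
  move=> l1 l2; have [/(negP l1)|/(negP l2)|[a w]] // := port_other k rho i.
  exists a; first exact: wire_strand w.
  by split=> //; rewrite (wire_change off) in w; exact: wire_strand w.
(* Under the new smoothing the port opposite to i is joined to the former partner of i, so it ends
   where the old strand of i ended. *)
have far i a : ~~ loop k rho (rho k) i -> ~~ loop k rho (~~ rho k) (across i) ->
    wire rho [set~ k] (port k i) (inl a) -> ss rho' (port k (across i)) (inl (m a)).
  move=> l1 l2 w; pose i1 := smooth_end (rho k) i.
  have l3 : ~~ loop k rho (rho k) i1 by rewrite loop_sym.
  have l4 : ~~ loop k rho (~~ rho k) i1.
    by rewrite -loop_sym; have := smooth_across (~~ rho k) i; rewrite negbK => ->.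
  have [a1 h1 [h2 w1]] := B _ l3 l4; have -> : m a = a1.
    have : ss rho (inl a) (inl a1).
      rewrite -(eqv_left SE (wire_strand w)) -(eqv_right SE _ (wire_strand w1)).
      exact: strand_port.
    rewrite (ss_boundary mP) => /orP [/eqP E1|/eqP //].
    by case/negP: l1; rewrite E1 -(eqv_right WE _ w) in w1; rewrite /loop (eqv_sym WE).
  rewrite -(eqv_right SE' _ h2); have := strand_port k rho' (across i).
  by rewrite change smooth_across_neg.
have npq : ~~ ss rho p q by rewrite port_joined (negPf n3).
have [a pa [pa' wa]] := B _ n1 n3; have [b qb [qb' wb]] := B _ n2 n4.
have Ap i : ss rho p (inl i) = (i == a) || (i == m a).
  by rewrite (eqv_left SE pa) (ss_boundary mP).
have Aq i : ss rho q (inl i) = (i == b) || (i == m b).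
  by rewrite (eqv_left SE qb) (ss_boundary mP).
have disj i : ss rho p (inl i) -> ~~ ss rho q (inl i).
  by move=> pi; apply: contra npq; rewrite (eqv_left SE pi) (eqv_sym SE).
have Am i : (m i \in A) = (i \in A).
  by rewrite !inE -!(eqv_right SE _ (mP i)).
have Am' i : (m' i \in A) = (i \in A).
  by rewrite !inE !strand_union -!(eqv_right SE' _ (mP' i)).
have EA : A = [set a; m a; b; m b].
  by apply/setP => i; rewrite !inE Ap Aq !orbA.
have c4 : #|A| = 4.
  have ab : a != b by apply: contraNneq (disj a pa) => ->.
  have amb : a != m b by apply: contraNneq (disj a pa) => E1; rewrite Aq -E1 eqxx orbT.
  have mab : m a != b by rewrite mate_eq.
  rewrite EA card_set4 //=; rewrite !inE !negb_or.
  rewrite (eq_sym a) mate_neq ab amb mab (inj_eq (@mate_inj _ m)) ab.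
  by rewrite eq_sym mate_neq.
have mm i : i \in A -> m i != m' i.
  move=> iA; apply/eqP => Ei.
  have H u v : ss rho' u (inl a) -> ss rho' v (inl (m a)) -> m a = m' a -> ss rho' u v.
    by move=> h1 h2 E1; rewrite (eqv_right SE' _ h2) E1 -(eqv_right SE' _ (mP' a)).
  have H2 u v : ss rho' u (inl b) -> ss rho' v (inl (m b)) -> m b = m' b -> ss rho' u v.
    by move=> h1 h2 E1; rewrite (eqv_right SE' _ h2) E1 -(eqv_right SE' _ (mP' b)).
  have fa := far j a n1 n4 wa; have := far (across j) b n2; rewrite acrossK => /(_ n3 wb) fb.
  have N1 : m a != m' a by apply/eqP => /(H p q pa' fa); rewrite (negPf npq').
  have N2 : m b != m' b by apply/eqP => /(H2 q p qb' fb); rewrite (eqv_sym SE') (negPf npq').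
  have back u : m (m u) = m' (m u) -> m u = m' u by rewrite mateK => /(congr1 m'); rewrite mateK => ->.
  move: iA Ei; rewrite EA !inE => /orP [/orP [/orP []|]|] /eqP -> E1.
  - by rewrite E1 eqxx in N1.
  - by rewrite (back _ E1) eqxx in N1.
  - by rewrite E1 eqxx in N2.
  by rewrite (back _ E1) eqxx in N2.
have [br sg] : is_bridge m A /\ surg m A = m'.
  apply: diff_bridge => // i; rewrite ?Am ?Am' //.
  rewrite !inE => ni; have := mP i; rewrite strand_off // (ss_boundary mP').
  by rewrite (negPf (mate_neq _ _)) => /eqP.
exists a, b; split=> //; rewrite ?pa ?qb //.
have fa := far j a n1 n4 wa; split=> //; last by apply: contraNneq (disj a pa) => ->.
have : ss rho' (inl b) (inl (m a)) by rewrite -(eqv_left SE' qb').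
rewrite (ss_boundary mP') => /orP [/eqP E1|/eqP E1].
  by have := disj (m a); rewrite Ap eqxx orbT E1 qb => /(_ isT).
by have := mate_parity m a; rewrite E1 mate_parity; case: (odd a); case: (odd b).
Qed.
End ChangeCrossing2.

(** * States *)

Section Closed.
Variables (n : nat) (D : diagram n).
Notation c := (ncr D).
Notation E := (ends n c).
Implicit Types (rho : {ffun 'I_c -> bool}) (m : matching n).

Definition sc rho m : rel E := connect (closed_strand rho m).

Lemma closed_strand_sym rho m : symmetric (@closed_strand n D rho m).
Proof.
move=> x y; rewrite /closed_strand strand_sym; congr orb.
case: x => [i|x]; case: y => [j|y] //.
have inlK (u v : 'I_n.*2) : (inl u == inl v :> E) = (u == v) by apply/eqP/eqP => [[]|->].
by rewrite !inlK -[j == m i]mate_eq eq_sym.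
Qed.

Lemma sc_eqv rho m : equivalence_rel (sc rho m).
Proof. exact: connect_eqv (closed_strand_sym rho m). Qed.

Lemma ss_sc rho m x y : ss rho x y -> sc rho m x y.
Proof. by apply: connect_sub => {}x {}y h; apply: connect1; rewrite /closed_strand h. Qed.

Lemma sc_mate rho m i : sc rho m (inl i) (inl (m i)).
Proof. by apply: connect1; rewrite /closed_strand eqxx orbT. Qed.

Lemma free_eq rho x y : ss rho x y -> fr rho x = fr rho y.
Proof. by move=> xy; apply: eq_forallb => i; rewrite (eqv_left (ss_eqv rho) xy). Qed.

Lemma sc_free rho m x y : fr rho x -> sc rho m x y = ss rho x y.
Proof.
move=> fx; apply/idP/idP; last exact: ss_sc.
case/connectP=> s; elim/last_ind: s y => [|s z IH] y /=; first by move=> _ ->; exact: (eqv_refl (ss_eqv rho)).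
rewrite rcons_path last_rcons => /andP [ps h] ->; have xw := IH _ ps erefl.
move: h xw; set w := last x s; case/orP => [h xw|]; first by apply: connect_trans xw (connect1 h).
by case: w => // i _ xi; move/forallP/(_ i): fx; rewrite xi.
Qed.

Section WithRight.
Variables (rho : {ffun 'I_c -> bool}) (m m' : matching n).
Hypothesis mP : forall i, ss rho (inl i) (inl (m' i)).

Lemma sc_boundary i j : sc rho m (inl i) (inl j) = linkeq (m, m') i j.
Proof.
apply/idP/idP; last first.
  case/connectP=> s; elim: s i => [|z s IH] i /=; first by move=> _ ->; exact: connect0.
  case/andP=> iz ps Ej; apply: connect_trans (IH z ps Ej); case/orP: iz => /eqP -> /=.
    exact: sc_mate.
  by apply: ss_sc; exact: mP.
have LE := linkeq_eqv (m, m').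
have back u v : ss rho (inl u) (inl v) -> linkeq (m, m') u v.
  rewrite (ss_boundary mP) => /orP [] /eqP ->; first exact: (eqv_refl LE).
  exact: (linkeq_mate (m, m') false).
(* Each point reached has a boundary point on its strand, which stays on the circle of i in the
   link. *)
suff H y : sc rho m (inl i) y -> exists2 u, ss rho y (inl u) & linkeq (m, m') i u.
  by case/H=> u ju iu; rewrite (eqv_right LE _ (back _ _ ju)).
case/connectP=> s; elim/last_ind: s y => [|s z IH] y /=.
  by move=> _ ->; exists i; [exact: (eqv_refl (ss_eqv rho))|exact: (eqv_refl LE)].
rewrite rcons_path last_rcons => /andP [ps h] ->; have [u wu iu] := IH _ ps erefl.
move: h wu; set w := last _ s; case/orP => [h wu|].
  exists u => //; rewrite (eqv_sym (ss_eqv rho)) (eqv_right (ss_eqv rho) (y := w)); first by rewrite (eqv_sym (ss_eqv rho)).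
  by rewrite (eqv_sym (ss_eqv rho)); exact: connect1.
case: w => // v /eqP -> vu; exists (m v); first exact: (eqv_refl (ss_eqv rho)).
rewrite -(eqv_right LE _ (linkeq_mate (m, m') true v)) (eqv_right LE _ (back _ _ vu)) //.
Qed.

Lemma sc_notfree x y : ~~ fr rho x -> fr rho y -> ~~ sc rho m x y.
Proof.
move=> nx fy; rewrite (eqv_sym (sc_eqv rho m)) sc_free //.
by apply: contra nx => /free_eq <-.
Qed.
End WithRight.

Section Change.
Variables (k : 'I_c) (rho rho' : {ffun 'I_c -> bool}).
Hypothesis off : forall l, l != k -> rho' l = rho l.
Hypothesis change : rho' k = ~~ rho k.
Variable j : 'I_4.
Let p : E := port k j.
Let q : E := port k (across j).

(* The bits record the loops at the two feet for either smoothing. *)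
Lemma crossing_bits : exists a a2 d d2 : bool,
  [/\ ~~ ((a || a2) && (d || d2)), (ss rho p q = d || d2) * (ss rho' p q = a || a2),
      (fr rho p = a || (d && d2)) * (fr rho q = a2 || (d && d2)) &
      (fr rho' p = d || (a && a2)) * (fr rho' q = d2 || (a && a2))].
Proof.
exists (loop k rho (rho k) j), (loop k rho (rho k) (across j)),
  (loop k rho (~~ rho k) j), (loop k rho (~~ rho k) (across j)); split.
- apply/negP => /andP [] /orP [] /loop_excl /andP [h1 h2] /orP [] l;
  by rewrite ?acrossK l ?eqxx // in h1 h2.
- by rewrite !port_joined change negbK !(loop_change off).
- by rewrite !port_free acrossK; split=> //; congr orb; rewrite andbC.
by rewrite !port_free acrossK change negbK !(loop_change off); split=> //; congr orb; rewrite andbC.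
Qed.

Variables (m : matching n).

(** A loop for one smoothing puts the feet on different components there, one of them free, and
    joins them for the other smoothing. Without loops the change is a bridge surgery, and
    [link_surgery] applies. *)
Lemma closed_surgery : surgery (sc rho m) (sc rho' m) p q.
Proof.
have off' l : l != k -> rho l = rho' l by move/off.
have step (r1 r2 : {ffun 'I_c -> bool}) : (forall l, l != k -> r2 l = r1 l) ->
    forall x y, closed_strand r2 m x y -> merged (sc r1 m) p q x y.
  move=> o x y /orP [/(strand_step_merged o j)|].
    rewrite /merged => /orP [/(ss_sc m) -> //|/andP [h1 h2]]; apply/orP; right.
    by apply/andP; split; [case/orP: h1|case/orP: h2] => /(ss_sc m) ->; rewrite ?orbT.
  by case: x => // i /eqP ->; rewrite /merged sc_mate.
apply: surgery_connect; try exact: closed_strand_sym; try exact: step.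
rewrite -!/(sc _ _); have [mr Hr] := rmatch_exists rho; have [mr' Hr'] := rmatch_exists rho'.
have P i : ss rho (inl i) (inl (mr i)) by rewrite Hr eqxx orbT.
have P' i : ss rho' (inl i) (inl (mr' i)) by rewrite Hr' eqxx orbT.
have apart r x y : ~~ ss r x y -> fr r x || fr r y -> sc r m x y = false.
  move=> nxy /orP [] f; first by rewrite sc_free // (negPf nxy).
  by rewrite (eqv_sym (sc_eqv r m)) sc_free // (eqv_sym (ss_eqv r)) (negPf nxy).
have [a [a2 [d [d2 [ex [s1 s1'] [f1 f2] [f1' f2']]]]]] := crossing_bits.
case: (boolP (d || d2)) => dd.
  have -> : sc rho m p q by apply: ss_sc; rewrite s1.
  by rewrite apart // ?s1' ?f1' ?f2'; move: ex dd; case: (a); case: (a2); case: (d); case: (d2).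
case: (boolP (a || a2)) => aa.
  have -> : sc rho' m p q by apply: ss_sc; rewrite s1'.
  by rewrite apart // ?s1 ?f1 ?f2; move: ex aa; case: (a); case: (a2); case: (d); case: (d2).
have nn : [/\ ~~ ss rho' p q, ~~ fr rho' p & ~~ fr rho' q].
  by rewrite s1' f1' f2'; move: dd aa; case: (a); case: (a2); case: (d); case: (d2).
case: nn => n1 n2 n3.
have [u [v [br sg qd /andP [pu pu'] /andP [qv qv']]]] := rmatch_surgery off change P P' n1 n2 n3.
have tr r : ss r p (inl u) -> ss r q (inl v) -> sc r m p q = sc r m (inl u) (inl v).
  move=> h1 h2; have SC := sc_eqv r m.
  by rewrite (eqv_left SC (ss_sc m h1)) (eqv_right SC _ (ss_sc m h2)).
rewrite !tr // (sc_boundary _ P) (sc_boundary _ P').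
have := surg_xor (@link_surgery n (m, mr) false _ _ _ br qd).
by rewrite /surgL /= sg.
Qed.
End Change.
End Closed.

Section States.
Variables (n : nat) (D : diagram n).
Notation c := (ncr D).
Notation E := (ends n c).
Implicit Types (x y z : state D) (k : 'I_c) (i : 'I_n.*2).

Lemma rmatch_strand x i : same_strand x (inl i) (inl (rmatch x i)).
Proof. by have /andP [/forallP H _] := valP x; exact: H. Qed.

Lemma esign_constant x : constant_on (same_circle x) (esign x).
Proof.
apply/constant_onP => p q /connectP [s ps ->]; elim: s p ps => //= z s IH p /andP [pz ps].
rewrite -(IH z ps); have /andP [_ /forallP/(_ p)/forallP/(_ z)] := valP x.
by rewrite pz => /eqP.
Qed.

Lemma esign_eq x p q : same_circle x p q -> esign x p = esign x q.
Proof. exact: (constant_onP _ _ (esign_constant x)). Qed.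
Lemma esign_strand x p q : same_strand x p q -> esign x p = esign x q.
Proof. by move=> pq; apply: esign_eq; exact: ss_sc. Qed.

Lemma rmatch_unique x y : smoothing x = smoothing y -> rmatch x = rmatch y.
Proof.
move=> E1; apply: matchingP => i; apply/eqP; have := rmatch_strand x i.
rewrite /same_strand E1 -/(ss _) (ss_boundary (rmatch_strand y)).
by rewrite (negPf (mate_neq _ _)).
Qed.

Lemma stateP x y : smoothing x = smoothing y -> lmatch x = lmatch y ->
  esign x = esign y -> lsign x = lsign y -> x = y.
Proof.
move=> e1 e2 e3 e4; have e5 := rmatch_unique e1; apply: val_inj => /=.
case: (state_val x) (state_val y) e1 e2 e3 e4 e5 => [a1 a2 a3 a4 a5] [b1 b2 b3 b4 b5] /=.
by move=> -> -> -> -> ->.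
Qed.

Lemma state_exists rho m (g : {ffun E -> bool}) (l : {ffun 'I_(nloops D) -> bool}) :
  constant_on (sc rho m) g ->
  exists x, [/\ smoothing x = rho, lmatch x = m, esign x = g & lsign x = l].
Proof.
move=> /constant_onP C; have [m' H] := rmatch_exists rho.
have P : is_state (StateData rho m m' g l).
  apply/andP; split; first by apply/forallP => i; rewrite -/(ss _) H eqxx orbT.
  apply/forallP => p; apply/forallP => q; apply/implyP => pq.
  by apply/eqP/C/connect1.
by exists (State P).
Qed.

Lemma lnk_bd x : lnk (bd x) = (lmatch x, rmatch x). Proof. by []. Qed.
Lemma sgn_bd x i : sgn (bd x) i = esign x (inl i). Proof. by rewrite /sgn /= ffunE. Qed.

Lemma circle_boundary x i j : same_circle x (inl i) (inl j) = linkeq (lnk (bd x)) i j.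
Proof. exact: (sc_boundary _ (rmatch_strand x)). Qed.


Lemma foot2E k : foot2 k = port k (across (inord 0)).
Proof. by congr (inr (_, _)); apply/val_inj; rewrite /= !inordK. Qed.

Lemma not_free x p : ~~ free x p -> exists i, same_strand x p (inl i).
Proof. by rewrite negb_forall => /existsP [i]; rewrite negbK; exists i. Qed.

Section Resolve.
Variables (x y : state D) (k : 'I_c).
Hypotheses (act : active x k) (res : resolves x k y).
Let p := foot1 k.
Let q := foot2 k.

Lemma res_off l : l != k -> smoothing y l = smoothing x l.
Proof. by case/and3P: res => /eqP -> _ _ lk; rewrite ffunE (negPf lk). Qed.
Lemma res_change : smoothing y k = ~~ smoothing x k.
Proof. by case/and3P: res => /eqP -> _ _; rewrite ffunE eqxx; move: act; rewrite /active => ->. Qed.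
Lemma res_lmatch : lmatch y = lmatch x. Proof. by case/and3P: res => _ /eqP. Qed.
Lemma res_lsign : lsign y = lsign x. Proof. by case/and3P: res => _ _ /eqP. Qed.

Lemma res_bits : exists a a2 d d2 : bool,
  [/\ ~~ ((a || a2) && (d || d2)), (same_strand x p q = d || d2) * (same_strand y p q = a || a2),
      (free x p = a || (d && d2)) * (free x q = a2 || (d && d2)) &
      (free y p = d || (a && a2)) * (free y q = d2 || (a && a2))].
Proof. by have := crossing_bits res_off res_change (inord 0); rewrite -foot2E. Qed.

Lemma res_rmatch : same_strand y p q || free y p || free y q -> rmatch y = rmatch x.
Proof.
rewrite /p /q foot2E => H.
exact/esym/(rmatch_same res_off (rmatch_strand x) (rmatch_strand y) H).
Qed.

Lemma res_surg : ~~ same_strand y p q -> ~~ free y p -> ~~ free y q ->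
  exists a b, [/\ is_bridge (rmatch x) (right_arcs x k), surg (rmatch x) (right_arcs x k) = rmatch y,
    quad (rmatch x) (right_arcs x k) a b, same_strand x p (inl a) && same_strand y p (inl a) &
    same_strand x q (inl b) && same_strand y q (inl b)].
Proof.
have := rmatch_surgery res_off res_change (rmatch_strand x) (rmatch_strand y) (j := inord 0).
by rewrite -foot2E.
Qed.


Lemma res_union t : same_strand x p t || same_strand x q t = same_strand y p t || same_strand y q t.
Proof. by have := strand_union res_off (inord 0) t; rewrite -foot2E. Qed.

Lemma res_strand_off t u : ~~ (same_strand x p t || same_strand x q t) ->
  same_strand x t u = same_strand y t u.
Proof. by have := @strand_off _ _ k _ _ res_off (inord 0) t u; rewrite -foot2E. Qed.

Lemma res_free t : ~~ (same_strand x p t || same_strand x q t) -> free x t = free y t.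
Proof. by move=> h; apply: eq_forallb => i; rewrite res_strand_off. Qed.

Definition agree_strands := [forall t, ~~ (same_strand x p t || same_strand x q t) ==>
  free x t ==> (esign y t == esign x t)].
Definition agree_boundary := [forall i, [|| same_circle x p (inl i), same_circle x q (inl i) |
  sgn (bd y) i == sgn (bd x) i]].

(** Free strands are seen by the state only and boundary points by the vertex; the split lets the
    second part be compared with edges of Gamma. *)
Lemma agree_off_split : agree_off x k y = agree_strands && agree_boundary.
Proof.
have SC := sc_eqv (smoothing x) (lmatch x); have SE := ss_eqv (smoothing x).
apply/forallP/andP => [H|[/forallP H1 /forallP H2] t].
  split; apply/forallP => t.
    apply/implyP => nt; apply/implyP => ft.
    have f u : same_circle x u t = same_strand x u t.
      by rewrite [LHS](eqv_sym SC) [LHS](sc_free _ _ ft) [LHS](eqv_sym SE).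
    by have := H t; rewrite !f; case/norP: nt => /negPf -> /negPf ->.
  by rewrite !sgn_bd; exact: H.
case: (boolP (same_circle x (foot1 k) t)) => //= n1; case: (boolP (same_circle x (foot2 k) t)) => //= n2.
have nt : ~~ (same_strand x p t || same_strand x q t).
  by apply/norP; split; [apply: contra n1|apply: contra n2]; exact: ss_sc.
case: (boolP (free x t)) => [ft|/not_free [i ti]].
  by have := H1 t; rewrite nt ft.
have ti' : same_strand y t (inl i) by rewrite -res_strand_off.
have e u : same_circle x u (inl i) = same_circle x u t := esym (eqv_right SC u (ss_sc _ ti)).
by have := H2 i; rewrite !sgn_bd (esign_strand ti) (esign_strand ti') !e (negPf n1) (negPf n2).
Qed.
End Resolve.

End States.

Import GRing.Theory.
Local Open Scope ring_scope.

(** * Relations between products of edges *)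

Section Sums.
Variable V : zmodType.

(** Every allowed term of one sum equals every allowed term of the other, so all of them are equal
    and only their numbers matter. *)
Lemma eq_sum_card (T : finType) (P Q : pred T) (F G : T -> V) :
  (forall w, ~~ P w -> F w = 0) -> (forall w, ~~ Q w -> G w = 0) ->
  #|[set w | P w]| = #|[set w | Q w]| ->
  (forall w w', P w -> Q w' -> F w = G w') -> \sum_w F w = \sum_w G w.
Proof.
move=> F0 G0 E FG.
have S (R : pred T) (H : T -> V) c : (forall w, ~~ R w -> H w = 0) ->
    (forall w, R w -> H w = c) -> \sum_w H w = c *+ #|[set w | R w]|.
  move=> H0 Hc; rewrite (bigID R) /= [X in _ + X]big1 ?addr0; last by move=> w /H0.
  have -> : \sum_(w | R w) H w = \sum_(w | R w) c by apply: eq_bigr => w /Hc.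
  by rewrite sumr_const; congr (_ *+ _); apply: eq_card => w; rewrite inE.
have [w0 P0|N] := pickP P; last first.
  rewrite !big1 // => w _; last by rewrite F0 // N.
  rewrite G0 //; apply/negP => Qw.
  have : #|[set w | Q w]| = 0%N.
    by rewrite -E; apply/eqP; rewrite cards_eq0; apply/eqP/setP => z; rewrite !inE N.
  by move/eqP; rewrite cards_eq0 => /eqP/setP/(_ w); rewrite !inE Qw.
have : #|[set w | Q w]| != 0%N by rewrite -E -lt0n card_gt0; apply/set0Pn; exists w0; rewrite inE.
rewrite -lt0n card_gt0 => /set0Pn [w1]; rewrite inE => Q1.
rewrite (S P F (G w1)) // => [|w Pw]; last exact: FG.
by rewrite (S Q G (G w1)) ?E // => w Qw; rewrite -(FG w0 w P0 Qw) (FG w0 w1).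
Qed.

Lemma antisym_sum (T : finType) (F : T -> T -> V) :
  (forall i, F i i = 0) -> (forall i j, F i j = - F j i) -> \sum_i \sum_j F i j = 0.
Proof.
move=> F0 FN; pose lt (i j : T) := (enum_rank i < enum_rank j)%N.
have -> : \sum_i \sum_j F i j = \sum_i \sum_(j | lt i j) F i j + \sum_i \sum_(j | lt j i) F i j.
  rewrite -big_split; apply: eq_bigr => i _ /=.
  rewrite (bigD1 i) //= F0 add0r (bigID (lt i)) /=; congr (_ + _); apply: eq_bigl => j.
    rewrite andbC; case: (boolP (lt i j)) => //= h.
    by apply: contraTneq h => ->; rewrite /lt ltnn.
  rewrite /lt -leqNgt ltn_neqAle; congr andb.
  by rewrite val_eqE (inj_eq enum_rank_inj).
rewrite [X in _ + X](exchange_big_dep predT) //= -big_split big1 // => i _ /=.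
by rewrite -big_split big1 //= => j _; rewrite (FN j i) subrr.
Qed.
Lemma split_sum (T : finType) (F G : T -> V) (P Q D : pred T) (s : int) :
  \sum_(i | P i) F i + (\sum_(i | Q i) G i) *~ s = 0 ->
  (forall i, ~~ P i -> ~~ D i -> F i = 0) -> (forall i, ~~ Q i -> ~~ D i -> G i = 0) ->
  (forall i, D i -> ~~ P i) -> (forall i, D i -> ~~ Q i) ->
  (forall i, D i -> F i + G i *~ s = 0) ->
  \sum_i F i + (\sum_i G i) *~ s = 0.
Proof.
move=> E F0 G0 DP DQ FG.
have S (R : pred T) (H : T -> V) : (forall i, ~~ R i -> ~~ D i -> H i = 0) ->
    (forall i, D i -> ~~ R i) -> \sum_i H i = \sum_(i | R i) H i + \sum_(i | D i) H i.
  move=> H0 DR; rewrite (bigID R) /=; congr (_ + _).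
  rewrite big_mkcond [RHS]big_mkcond; apply: eq_bigr => i _.
  case: (boolP (R i)) => r; case: (boolP (D i)) => d //=; last exact: H0.
  by rewrite (negPf (DR i d)) in r.
rewrite (S P F) // (S Q G) // mulrzDl addrACA E add0r mulrz_suml -big_split.
by apply: big1.
Qed.
End Sums.

Lemma mulz_sg0 (V : zmodType) (z : V) : z *~ sg 0 = z.
Proof. by rewrite /sg expr0 mulr1z. Qed.
Lemma mulz_sg1 (V : zmodType) (z : V) : z *~ sg 1 = - z.
Proof. by rewrite /sg expr1 mulrN1z. Qed.
Lemma mulz_sgD (V : zmodType) (z : V) (i j : nat) : (z *~ sg i) *~ sg j = z *~ sg (i + j).
Proof. by rewrite -mulrzA /sg exprD. Qed.

Section Relations.
Variable n : nat.
Local Notation I := 'I_n.*2.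
Implicit Types (L : link n) (l k : bool) (A B C : {set I}) (a b p q t : I) (v w u : vertex n).
Implicit Types (x y : label n).

Lemma piB0 : piB (0 : QG n) = 0.
Proof. by apply: (addrI (piB 0)); rewrite -piBD !addr0. Qed.
Lemma piBN (x : QG n) : piB (- x) = - piB x.
Proof. by apply: (addrI (piB x)); rewrite -piBD !subrr piB0. Qed.
Lemma piB_mulz (x : QG n) (z : int) : piB (x *~ z) = piB x *~ z.
Proof.
have N (k : nat) : piB (x *+ k) = piB x *+ k.
  by elim: k => [|k IH]; rewrite ?mulr0n ?piB0 // !mulrS piBD IH.
by case: z => k; rewrite ?NegzE ?mulrNz -!pmulrn ?piBN N.
Qed.
Lemma piB_sum (T : Type) (r : seq T) (P : pred T) (F : T -> QG n) :
  piB (\sum_(i <- r | P i) F i) = \sum_(i <- r | P i) piB (F i).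
Proof. exact: (big_morph (@piB n) (@piBD n) piB0). Qed.

Lemma relator_piB (x : QG n) : relator x -> piB x = 0.
Proof.
move=> R; rewrite -piB0; apply/piB_eq; rewrite subr0.
by rewrite -[x]mul1r -[1 * x]mulr1; apply: ideal_relator.
Qed.

Lemma pth0 v s : ~~ walk v s -> pth v s = 0 :> QG n.
Proof. by move=> nw; rewrite /pth insubN. Qed.

Lemma pth_mul v s w (t : seq (label n * vertex n)) : last v (unzip2 s) = w -> pth v s * pth w t = pth v (s ++ t) :> QG n.
Proof.
move=> Ew; case: (boolP (walk v s)) => [ws|nw]; last first.
  by rewrite (pth0 nw) mul0r pth0 // walk_cat (negPf nw).
case: (boolP (walk w t)) => [wt|nw]; last first.
  by rewrite (pth0 nw) mulr0 pth0 // walk_cat Ew (negPf nw) andbF.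
have [p [-> Es Et]] := pth_walk ws; have [q [-> Es' Et']] := pth_walk wt.
have E : tgt p = src q by rewrite /tgt Es Et Ew Es'.
have -> : bas p * bas q = pmul p q :> QG n by exact: mulQUU.
by rewrite /pmul E eqxx Es Et Et'.
Qed.

Lemma edge_mul v x w y u : edge v x w * edge w y u = piB (pth v [:: (x, w); (y, u)]).
Proof.
rewrite /edge -[_ * _]/(mulB _ _) piBM; congr piB.
exact: (@pth_mul v [:: (x, w)] w [:: (y, u)] erefl).
Qed.

Lemma edge0 v x w : ~~ is_edge v x w -> edge v x w = 0.
Proof. by move=> ne; rewrite /edge pth0 ?piB0 //= (negPf ne). Qed.

Lemma edge_mul0 v x w y u : ~~ (is_edge v x w && is_edge w y u) ->
  edge v x w * edge w y u = 0.
Proof. by rewrite negb_and => /orP [/edge0 ->|/edge0 ->]; rewrite ?mul0r ?mulr0. Qed.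

Lemma edge_idem v x w : edge v x w * idem w = edge v x w.
Proof.
rewrite /edge /idem -[_ * _]/(mulB _ _) piBM; congr piB.
exact: (@pth_mul v [:: (x, w)] w [::] erefl).
Qed.
Lemma idem_edge v x w : idem v * edge v x w = edge v x w.
Proof.
rewrite /edge /idem -[_ * _]/(mulB _ _) piBM; congr piB.
exact: (@pth_mul v [::] v [:: (x, w)] erefl).
Qed.
Lemma idem_idem v : idem v * idem v = idem v.
Proof.
rewrite /idem -[_ * _]/(mulB _ _) piBM; congr piB.
exact: (@pth_mul v [::] v [::] erefl).
Qed.

Lemma relator_swap v x y x' y' w1 w2 u (k : nat) :
  relator (pth v [:: (x, w1); (y, u)] - pth v [:: (y', w2); (x', u)] *~ sg k) ->
  edge v x w1 * edge w1 y u = (edge v y' w2 * edge w2 x' u) *~ sg k.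
Proof.
move/relator_piB; rewrite piBD piBN piB_mulz -!edge_mul => /eqP.
by rewrite subr_eq0 => /eqP.
Qed.

Lemma sgK (V : zmodType) (z : V) (k : nat) : (z *~ sg k) *~ sg k = z.
Proof. by rewrite -mulrzA /sg -signr_odd; case: (odd k); rewrite ?expr0 ?expr1 ?mulrNN ?mulr1 mulr1z. Qed.

End Relations.

Local Opaque edge idem mulB piB pth reprB.

(** * Decoration edges past bridges and past each other *)

Section Decorations.
Variable n : nat.
Local Notation I := 'I_n.*2.
Implicit Types (L : link n) (l k : bool) (A B C : {set I}) (a b p q t : I) (v w u : vertex n).
Implicit Types (x y : label n).

Lemma bridge_nonempty (m : matching n) A : is_bridge m A -> exists a b, quad m A a b.
Proof.
move=> br; have [a aA] : exists a, a \in A.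
  by apply/set0Pn; rewrite -cards_eq0 (bridge_card br).
by have [b] := bridge_quad br aA; exists a, b.
Qed.

Lemma decoration_edgeE_tgt w t u :
  decoration_edge w (circ (lnk u) t) u =
  (lnk w == lnk u) && lower (linkeq (lnk u)) t (sgn w) (sgn u).
Proof.
have [E|N] := eqVneq (lnk w) (lnk u); first by rewrite -E decoration_edgeE E eqxx.
by rewrite /decoration_edge [lnk u == _]eq_sym (negPf N) !andbF.
Qed.

Lemma decoration_lnk v C w : decoration_edge v C w -> lnk w = lnk v.
Proof. by case/and4P => _ _ /eqP. Qed.
Lemma bridge_lnk v l A w : bridge_edge v l A w -> lnk w = surgL (lnk v) l A.
Proof. by case/and5P => _ /eqP. Qed.
Lemma bridge_is_bridge v l A w : bridge_edge v l A w -> is_bridge (half (lnk v) l) A.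
Proof. by case/and5P. Qed.

(** Naming the circle by a point t covers circles on the support too: multiplication and
    comultiplication are linear over the algebra, so X may act on any circle concerned, before or
    after. *)
Lemma dec_bridge_card t k l A v u :
  is_bridge (half (lnk v) l) A -> lnk u = surgL (lnk v) l A ->
  #|[set w | is_edge v (De k (circ (lnk v) t)) w && is_edge w (Br l A) u]| =
  #|[set w | is_edge v (Br l A) w && is_edge w (De k (circ (lnk u) t)) u]|.
Proof.
move=> br Eu; have [a [b q]] := bridge_nonempty br.
have S := link_surgery br q; rewrite -Eu in S.
have -> : [set w | is_edge v (De k (circ (lnk v) t)) w && is_edge w (Br l A) u] =
  [set w | (lnk w == lnk v) && (lower (linkeq (lnk v)) t (sgn v) (sgn w) &&
     edgeK (linkeq (lnk v)) (linkeq (lnk u)) a b (sgn w) (sgn u))].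
  apply/setP => w; rewrite !inE /is_edge /= decoration_edgeE -andbA.
  have [Ew|//] := eqVneq (lnk w) (lnk v); congr andb.
  by rewrite (bridge_edgeE _ (a := a) (b := b)) Ew // br Eu eqxx.
have -> : [set w | is_edge v (Br l A) w && is_edge w (De k (circ (lnk u) t)) u] =
  [set w | (lnk w == lnk u) && (edgeK (linkeq (lnk v)) (linkeq (lnk u)) a b (sgn v) (sgn w) &&
     lower (linkeq (lnk u)) t (sgn w) (sgn u))].
  apply/setP => w; rewrite !inE /is_edge /= decoration_edgeE_tgt (bridge_edgeE _ q) br -Eu /=.
  by have [->|] := eqVneq (lnk w) (lnk u); rewrite ?andbF.
rewrite (card_vertex _ (fun g => lower (linkeq (lnk v)) t (sgn v) g &&
  edgeK (linkeq (lnk v)) (linkeq (lnk u)) a b g (sgn u))).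
rewrite (card_vertex _ (fun g => edgeK (linkeq (lnk v)) (linkeq (lnk u)) a b (sgn v) g &&
  lower (linkeq (lnk u)) t g (sgn u))).
transitivity #|[set g | lower (linkeq (lnk v)) t (sgn v) g &&
    edgeK (linkeq (lnk v)) (linkeq (lnk u)) a b g (sgn u)]|.
  apply: eq_card => g; rewrite !inE; case: (boolP (edgeK _ _ _ _ _ _)); rewrite ?andbF //.
  by case/and4P => ->.
rewrite (lower_edge_card _ S); apply: eq_card => g; rewrite !inE.
by case: (boolP (edgeK _ _ _ _ _ _)); rewrite ?andbF //; case/and4P => _ ->.
Qed.

Lemma mem_supp L l A p : (p \in supp L (Br l A)) = [exists a in A, linkeq L a p].
Proof.
apply/bigcupP/exists_inP => [[a aA]|[a aA ap]]; first by rewrite mem_circ; exists a.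
by exists a; rewrite // mem_circ.
Qed.

Lemma circ_eq L p q : linkeq L p q -> circ L p = circ L q.
Proof. by move=> pq; apply/setP => z; rewrite !mem_circ (eqv_left (linkeq_eqv L) pq). Qed.

Lemma circ_off l A v u t : is_bridge (half (lnk v) l) A -> lnk u = surgL (lnk v) l A ->
  [forall a in A, ~~ linkeq (lnk v) a t] -> circ (lnk u) t = circ (lnk v) t.
Proof.
move=> br Eu /forall_inP H; have [a [b q]] := bridge_nonempty br.
have S := link_surgery br q; rewrite -Eu in S; have [aA _ bA _] := quad_mem q.
by apply/setP => z; rewrite !mem_circ (surgery_off S) ?H.
Qed.

Lemma dec_bridge_disjoint t k l A v w1 w2 u :
  is_edge v (De k (circ (lnk v) t)) w1 -> is_edge w1 (Br l A) u ->
  is_edge v (Br l A) w2 -> is_edge w2 (De k (circ (lnk u) t)) u ->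
  [forall a in A, ~~ linkeq (lnk v) a t] ->
  edge v (De k (circ (lnk v) t)) w1 * edge w1 (Br l A) u =
  (edge v (Br l A) w2 * edge w2 (De k (circ (lnk u) t)) u) *~ sg (k * l).
Proof.
move=> e1 e2 e3 e4 H.
have Ew1 := decoration_lnk e1; have Eu := bridge_lnk e2; have br := bridge_is_bridge e2.
rewrite Ew1 in Eu br; have EC := circ_off br Eu H; rewrite EC in e4 *.
have offC p : p \in circ (lnk v) t -> p \notin supp (lnk v) (Br l A).
  rewrite mem_circ mem_supp => tp; rewrite negb_exists_in; apply/forall_inP => a aA.
  by rewrite -(eqv_right (linkeq_eqv _) _ tp); have /forall_inP := H; apply.
apply/relator_swap/rel_disjoint_supports => //.
- by rewrite disjoints_subset; apply/subsetP => p pC; rewrite inE offC.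
- move=> p pC; have /and5P [_ _ /forallP/(_ p) + _ _] := e2.
  by rewrite /supp Ew1 in offC *; rewrite (offC p pC) => /eqP.
move=> p pA; have /and4P [_ _ _ /eqP ->] := e4; rewrite ffunE.
by case: (boolP (p \in circ (lnk v) t)) => // /offC; rewrite pA.
Qed.

(** Relation (R2) names the circles before and after by one point of A. On the side where a and b
    are joined either will do, so the other side decides. *)
Lemma touch_both l A v u t : is_bridge (half (lnk v) l) A -> lnk u = surgL (lnk v) l A ->
  [exists a in A, linkeq (lnk v) a t] ->
  exists2 a, a \in A & linkeq (lnk v) a t && linkeq (lnk u) a t.
Proof.
move=> br Eu /exists_inP [c cA ct]; have [a [b q]] := bridge_nonempty br.
have S := link_surgery br q; rewrite -Eu in S; have [aA _ bA _] := quad_mem q.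
have E := linkeq_eqv (lnk v); have E' := linkeq_eqv (lnk u).
have abt : linkeq (lnk v) a t || linkeq (lnk v) b t.
  by case/orP: (linkeq_quad q cA) => h; rewrite (eqv_left E h) ct ?orbT.
have abt' : linkeq (lnk u) a t || linkeq (lnk u) b t by rewrite -(surgery_union S).
case: (boolP (linkeq (lnk v) a b)) => ab.
  rewrite -(eqv_left E ab) orbb in abt.
  case/orP: abt' => h; [exists a|exists b] => //; rewrite ?abt //.
  by rewrite -(eqv_left E ab) abt.
have ab' : linkeq (lnk u) a b by have := surg_xor S; rewrite (negPf ab); case: (linkeq (lnk u) a b).
rewrite -(eqv_left E' ab') orbb in abt'.
case/orP: abt => h; [exists a|exists b] => //; rewrite ?h //.
by rewrite -(eqv_left E' ab').
Qed.

Lemma dec_bridge_touch t l A v w1 w2 u :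
  is_edge v (De false (circ (lnk v) t)) w1 -> is_edge w1 (Br l A) u ->
  is_edge v (Br l A) w2 -> is_edge w2 (De false (circ (lnk u) t)) u ->
  [exists a in A, linkeq (lnk v) a t] ->
  edge v (De false (circ (lnk v) t)) w1 * edge w1 (Br l A) u =
  edge v (Br l A) w2 * edge w2 (De false (circ (lnk u) t)) u.
Proof.
move=> e1 e2 e3 e4 H.
have Ew1 := decoration_lnk e1; have Eu := bridge_lnk e2; have br := bridge_is_bridge e2.
rewrite Ew1 in Eu br; have [a aA /andP [h h']] := touch_both br Eu H.
rewrite -(circ_eq h) -(circ_eq h') in e1 e4 *.
rewrite !edge_mul; apply/eqP; rewrite -subr_eq0 -piBN -piBD; apply/eqP/relator_piB.
exact: rel_right_decoration aA e1 e2 e3 e4.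
Qed.

Definition rdec t v w : BG n := edge v (De false (circ (lnk v) t)) w.

Lemma rdecE t w u : rdec t w u = edge w (De false (circ (lnk u) t)) u.
Proof.
rewrite /rdec; have [->//|N] := eqVneq (lnk w) (lnk u).
by rewrite !edge0 //; apply: contra N => e; rewrite (decoration_lnk e).
Qed.

Lemma dec_bridge_path v k C w l A u : is_edge v (De k C) w -> is_edge w (Br l A) u ->
  is_bridge (half (lnk v) l) A /\ lnk u = surgL (lnk v) l A.
Proof.
move=> e1 e2; rewrite -(decoration_lnk e1).
by split; [exact: bridge_is_bridge e2|exact: bridge_lnk e2].
Qed.
Lemma bridge_dec_path v k C w l A u : is_edge v (Br l A) w -> is_edge w (De k C) u ->
  is_bridge (half (lnk v) l) A /\ lnk u = surgL (lnk v) l A.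
Proof.
move=> e1 e2; rewrite (decoration_lnk e2).
by split; [exact: bridge_is_bridge e1|exact: bridge_lnk e1].
Qed.

Lemma rdec_bridge t l A v u :
  \sum_w rdec t v w * edge w (Br l A) u = \sum_w edge v (Br l A) w * rdec t w u.
Proof.
under [RHS]eq_bigr => w _ do rewrite rdecE.
have [[br Eu]|N] := pselect (is_bridge (half (lnk v) l) A /\ lnk u = surgL (lnk v) l A);
  last first.
  transitivity (0 : BG n); [|symmetry]; apply: big1 => w _; apply: edge_mul0.
    apply/negP => /andP [e1 e2]; apply: N; exact: dec_bridge_path e1 e2.
  apply/negP => /andP [e1 e2]; apply: N; exact: bridge_dec_path e1 e2.
apply: (eq_sum_card _ _ (dec_bridge_card t false br Eu)).
- by move=> w h; apply: edge_mul0.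
- by move=> w h; apply: edge_mul0.
move=> w1 w2 /andP [e1 e2] /andP [e3 e4].
case: (boolP [exists a in A, linkeq (lnk v) a t]) => H.
  exact: dec_bridge_touch.
rewrite negb_exists_in in H.
rewrite (dec_bridge_disjoint e1 e2 e3 e4 H); exact: mulz_sg0.
Qed.

Lemma dec_off_bridge t k l A v u : [forall a in A, ~~ linkeq (lnk v) a t] ->
  \sum_w edge v (De k (circ (lnk v) t)) w * edge w (Br l A) u =
  (\sum_w edge v (Br l A) w * edge w (De k (circ (lnk v) t)) u) *~ sg (k * l).
Proof.
move=> H; rewrite mulrz_suml.
have [[br Eu]|N] := pselect (is_bridge (half (lnk v) l) A /\ lnk u = surgL (lnk v) l A);
  last first.
  rewrite !big1 // => w _; rewrite edge_mul0 ?mul0rz //; apply/negP => /andP [e1 e2]; apply: N.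
    exact: bridge_dec_path e1 e2.
  exact: dec_bridge_path e1 e2.
rewrite -[in RHS](circ_off br Eu H).
apply: (eq_sum_card _ _ (dec_bridge_card t k br Eu)).
- by move=> w h; apply: edge_mul0.
- by move=> w h; rewrite edge_mul0 ?mul0rz.
move=> w1 w2 /andP [e1 e2] /andP [e3 e4].
by rewrite (dec_bridge_disjoint e1 e2 e3 e4).
Qed.

Lemma dec_dec_card (k k' : bool) C C' v u :
  #|[set w | is_edge v (De k C) w && is_edge w (De k' C') u]| =
  #|[set w | is_edge v (De k' C') w && is_edge w (De k C) u]|.
Proof.
suff H k1 k2 C1 C2 : (#|[set w | is_edge v (De k1 C1) w && is_edge w (De k2 C2) u]| <=
    #|[set w | is_edge v (De k2 C2) w && is_edge w (De k1 C1) u]|)%N.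
  by apply/eqP; rewrite eqn_leq !H.
have uniq_dec k3 C3 w w' : is_edge v (De k3 C3) w -> is_edge v (De k3 C3) w' -> w = w'.
  case/and4P=> _ _ /eqP h1 /eqP h2 /and4P [_ _ /eqP h3 /eqP h4].
  by apply: vertexP; rewrite ?h1 ?h2 ?h3 ?h4.
set X := [set w | _]; set Y := [set w | _].
have [->|[w wX]] := set_0Vmem X; first by rewrite cards0.
have -> : X = [set w].
  apply/setP => w'; rewrite inE; apply/idP/eqP => [|->//].
  move: wX; rewrite !inE => /andP [h1 _] /andP [h2 _]; exact: (uniq_dec _ _ _ _ h2 h1).
rewrite cards1 card_gt0; apply/set0Pn; move: wX; rewrite inE => /andP [].
rewrite /is_edge /= => /and4P [CL P1 /eqP L1 /eqP s1] /and4P [CL2 P2 /eqP L2 /eqP s2].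
rewrite L1 in CL2 L2; have /imsetP [t2 _ E2] := CL2; have /imsetP [t1 _ E1] := CL.
have E := linkeq_eqv (lnk v).
have nC p : p \in C1 -> p \in C2 -> False.
  by move=> p1 /(forall_inP P2); rewrite s1 ffunE p1.
have nC' p : p \in C2 -> (p \in C1) = false by move=> p2; apply/negP => /nC; apply.
have P2v p : p \in C2 -> sgn v p.
  by move=> p2; have := forall_inP P2 p p2; rewrite s1 ffunE => /andP [].
have [w' [Lw' sw']] : exists w', lnk w' = lnk v /\ sgn w' = [ffun p => (p \notin C2) && sgn v p].
  apply: vertex_exists; apply/constant_onP => p q pq; rewrite !ffunE E2 !mem_circ.
  by rewrite (eqv_right E _ pq) (sgn_eq pq).
exists w'; rewrite inE /is_edge /= /decoration_edge Lw' CL CL2 L2 sw' !eqxx /=.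
rewrite andbT; apply/and3P; split; first exact/forall_inP.
  apply/forall_inP => p p1; rewrite ffunE (forall_inP P1) // andbT.
  by apply/negP => /(nC _ p1).
by rewrite s2 s1; apply/eqP/ffunP => p; rewrite !ffunE andbCA.
Qed.

Lemma dec_dec_swap (k k' : bool) C C' v u :
  \sum_w edge v (De k C) w * edge w (De k' C') u =
  (\sum_w edge v (De k' C') w * edge w (De k C) u) *~ sg (k * k').
Proof.
rewrite mulrz_suml; apply: (eq_sum_card _ _ (dec_dec_card k k' C C' v u)).
- by move=> w h; apply: edge_mul0.
- by move=> w h; rewrite edge_mul0 ?mul0rz.
move=> w1 w2 /andP [e1 e2] /andP [e3 e4].
have dis p : p \in C -> p \in C' -> False.
  move: e1 e2 => /and4P [_ _ _ /eqP s1] /and4P [_ P2 _ _] pC pC'.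
  by have := forall_inP P2 p pC'; rewrite s1 ffunE pC.
apply/relator_swap/rel_disjoint_supports => //.
- rewrite disjoints_subset; apply/subsetP => p pC; rewrite inE; apply/negP; exact: dis.
- move=> p pC; have /and4P [_ _ _ /eqP ->] := e2; rewrite ffunE.
  by case: (boolP (p \in C')) => // /(dis _ pC).
move=> p pC; have /and4P [_ _ _ /eqP ->] := e4; rewrite ffunE.
by case: (boolP (p \in C)) => // /dis /(_ pC).
Qed.

Lemma dec_dec_zero (k k' : bool) C v u :
  \sum_w edge v (De k C) w * edge w (De k' C) u = 0.
Proof.
rewrite big1 // => w _; apply: edge_mul0; apply/negP.
rewrite /is_edge /= => /andP [/and4P [/imsetP [t _ EC] _ _ /eqP s1] /and4P [_ P2 _ _]].
have tC : t \in C by rewrite EC mem_circ (eqv_refl (linkeq_eqv _)).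
by have := forall_inP P2 t tC; rewrite s1 ffunE tC.
Qed.

Definition ldec v w : BG n := \sum_C edge v (De true C) w.
Definition lbridge v w : BG n := \sum_A edge v (Br true A) w.

Lemma mulr_sum_exch (F : {set I} -> vertex n -> BG n) (G : vertex n -> BG n) :
  \sum_w G w * (\sum_C F C w) = \sum_C \sum_w G w * F C w.
Proof. by rewrite exchange_big; apply: eq_bigr => w _; rewrite mulr_sumr. Qed.
Lemma mull_sum_exch (F : {set I} -> vertex n -> BG n) (G : vertex n -> BG n) :
  \sum_w (\sum_C F C w) * G w = \sum_C \sum_w F C w * G w.
Proof. by rewrite exchange_big; apply: eq_bigr => w _; rewrite mulr_suml. Qed.

Lemma ldec_ldec v u : \sum_w ldec v w * ldec w u = 0.
Proof.
rewrite mull_sum_exch; under eq_bigr => C _ do rewrite mulr_sum_exch.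
apply: (antisym_sum (F := fun C C' => \sum_w edge v (De true C) w * edge w (De true C') u)) => [C|C C'].
  exact: dec_dec_zero.
exact: (etrans (dec_dec_swap true true C C' v u) (mulz_sg1 _)).
Qed.

Lemma rdec_ldec t v u : \sum_w rdec t v w * ldec w u = \sum_w ldec v w * rdec t w u.
Proof.
apply: etrans (mulr_sum_exch (fun C w => edge w (De true C) u) (rdec t v)) _.
apply: etrans _ (esym (mull_sum_exch (fun C w => edge v (De true C) w) (rdec t ^~ u))).
apply: eq_bigr => C _; apply: etrans (dec_dec_swap false true (circ (lnk v) t) C v u) _.
apply: etrans (mulz_sg0 _) _; apply: eq_bigr => w _; rewrite /rdec.
case: (boolP (is_edge v (De true C) w)) => [/decoration_lnk -> //|/edge0 ->].
by rewrite !mul0r.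
Qed.

Lemma mem_cir_touch L A C (S := [set circ L a | a in A]) : C \in cir L ->
  (C \in S) = ~~ [forall a in A, a \notin C].
Proof.
case/imsetP => t _ ->; have E := linkeq_eqv L; rewrite negb_forall_in.
apply/imsetP/exists_inP => [[a aA ->]|[a aA]].
  by exists a; rewrite // negbK mem_circ (eqv_refl E).
by rewrite negbK mem_circ => ta; exists a; rewrite ?(circ_eq ta).
Qed.

(** Relation (R3) accounts for the circles through A; for the others the terms cancel one by one, by
    (R1). *)
Lemma ldec_bridge l A v u :
  \sum_w ldec v w * edge w (Br l A) u +
  (\sum_w edge v (Br l A) w * ldec w u) *~ sg (~~ l) = 0.
Proof.
have E1 := mulr_sum_exch (fun C w => edge w (De true C) u) (edge v (Br l A)).
have E2 := mull_sum_exch (fun C w => edge v (De true C) w) (fun w => edge w (Br l A) u).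
apply: etrans (congr2 (fun r s : BG n => r + s *~ sg (~~ l)) E2 E1) _; clear E1 E2.
pose Sv := [set circ (lnk v) a | a in A]; pose Su := [set circ (lnk u) a | a in A].
pose off C := [forall a in A, a \notin C].
pose T1 C := \sum_w edge v (De true C) w * edge w (Br l A) u.
pose T2 C := \sum_w edge v (Br l A) w * edge w (De true C) u.
have [[br Eu]|N] := pselect (is_bridge (half (lnk v) l) A /\ lnk u = surgL (lnk v) l A);
  last first.
  have Z1 C : T1 C = 0.
    apply: big1 => w _; apply: edge_mul0; apply/negP => /andP [e1 e2]; apply: N.
    exact: dec_bridge_path e1 e2.
  have Z2 C : T2 C = 0.
    apply: big1 => w _; apply: edge_mul0; apply/negP => /andP [e1 e2]; apply: N.
    exact: bridge_dec_path e1 e2.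
  have S1 : \sum_C T1 C = 0 by apply: big1 => C _; exact: Z1.
  have S2 : \sum_C T2 C = 0 by apply: big1 => C _; exact: Z2.
  apply: etrans (congr2 (fun r s : BG n => r + s *~ sg (~~ l)) S1 S2) _.
  by rewrite mul0rz addr0.
have E' := linkeq_eqv (lnk u).
apply: (@split_sum _ _ T1 T2 (mem Sv) (mem Su) off).
- have R := relator_piB (rel_left_decoration br Eu).
  rewrite piBD piB_mulz !piB_sum in R.
  apply: etrans R; congr (_ + _ *~ _); apply: eq_bigr => C _; rewrite piB_sum;
  by apply: eq_bigr => w _; rewrite edge_mul.
- move=> C nS nD; apply: big1 => w _; apply: edge_mul0; apply: contra nS => /andP [/and4P [CL _ _ _] _].
  by rewrite /= mem_cir_touch.
- move=> C nS nD; apply: big1 => w _; apply: edge_mul0; apply: contra nS => /andP [_ e].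
  by rewrite /= mem_cir_touch // (decoration_lnk e); case/and4P: e.
- move=> C D; apply/imsetP => -[a aA EC]; have := forall_inP D a aA.
  by rewrite EC mem_circ (eqv_refl (linkeq_eqv _)).
- move=> C D; apply/imsetP => -[a aA EC]; have := forall_inP D a aA.
  by rewrite EC mem_circ (eqv_refl (linkeq_eqv _)).
move=> C D.
have [[t H EC]|CL] : (exists2 t, [forall a in A, ~~ linkeq (lnk v) a t] & C = circ (lnk v) t) \/
    C \notin cir (lnk v).
  case: (boolP (C \in cir (lnk v))) => [/imsetP [t _ EC]|]; [left|by right].
  exists t => //; apply/forall_inP => a aA; have := forall_inP D a aA.
  by rewrite EC mem_circ (eqv_sym (linkeq_eqv _)).
  have -> : T1 C = T2 C *~ sg (true * l) by rewrite /T1 /T2 EC; exact: dec_off_bridge H.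
  case: (l).
    by apply: etrans (congr2 +%R (mulz_sg1 (T2 C)) (mulz_sg0 (T2 C))) _; exact: addNr.
  by apply: etrans (congr2 +%R (mulz_sg0 (T2 C)) (mulz_sg1 (T2 C))) _; exact: subrr.
(* Off A, both links have the same circles, so a set which is not a circle of v labels no edge after
   the bridge either. *)
have -> : T1 C = 0.
  by apply: big1 => w _; apply: edge_mul0; apply: contra CL => /andP [/and4P []].
have -> : T2 C = 0; last by rewrite mul0rz addr0.
apply: big1 => w _; apply: edge_mul0; apply/negP => /andP [e1 e2]; have Lw := decoration_lnk e2.
case/and4P: (e2) => /imsetP [t _ EC] _ _ _; case/negP: CL.
rewrite -Lw /= in EC; apply/imsetP; exists t => //; rewrite EC.
have H : [forall a in A, ~~ linkeq (lnk u) a t].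
  apply/forall_inP => a aA; have := forall_inP D a aA.
  by rewrite EC mem_circ (eqv_sym (linkeq_eqv _)).
have [a [b q]] := bridge_nonempty br; have S := link_surgery br q; rewrite -Eu in S.
have [aA _ bA _] := quad_mem q.
by apply/setP => z; rewrite !mem_circ -(surgery_off (surgery_sym S)) ?(forall_inP H).
Qed.
End Decorations.

(** * Products of two bridge edges *)

Section Bridges.
Variable n : nat.
Local Notation I := 'I_n.*2.
Implicit Types (L : link n) (l k : bool) (A B C : {set I}) (a b c d p q t : I) (v w u : vertex n).

Lemma bridge_bridge_card v u l k A B' a b c d :
  is_bridge (half (lnk v) l) A -> quad (half (lnk v) l) A a b ->
  is_bridge (half (surgL (lnk v) l A) k) B' -> quad (half (surgL (lnk v) l A) k) B' c d ->
  lnk u = surgL (surgL (lnk v) l A) k B' ->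
  #|[set w | is_edge v (Br l A) w && is_edge w (Br k B') u]| =
  #|[set g | edgeK (linkeq (lnk v)) (linkeq (surgL (lnk v) l A)) a b (sgn v) g &&
             edgeK (linkeq (surgL (lnk v) l A)) (linkeq (lnk u)) c d g (sgn u)]|.
Proof.
move=> br q br' q' Eu; set L := surgL (lnk v) l A in br' q' Eu *.
transitivity #|[set w | (lnk w == L) && (edgeK (linkeq (lnk v)) (linkeq L) a b (sgn v) (sgn w) &&
             edgeK (linkeq L) (linkeq (lnk u)) c d (sgn w) (sgn u))]|.
  apply: eq_card => w; rewrite !inE /is_edge /= (bridge_edgeE _ q) br /= -/L.
  have [Ew|//] := eqVneq (lnk w) L; rewrite (bridge_edgeE _ (a := c) (b := d)) Ew //.
  by rewrite br' Eu eqxx.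
rewrite (card_vertex L (fun g => edgeK (linkeq (lnk v)) (linkeq L) a b (sgn v) g &&
             edgeK (linkeq L) (linkeq (lnk u)) c d g (sgn u))).
apply: eq_card => g; rewrite !inE; case: (boolP (edgeK _ _ _ _ _ _)); rewrite ?andbF //.
by case/and4P => _ ->.
Qed.

(** Both orders use the same feet a, b and c, d, so [edge_square_card] counts the middle vertices;
    (R4) equates the products. *)
Lemma bridge_square v u l k A B A' B' a b c d :
  is_bridge (half (lnk v) l) A -> quad (half (lnk v) l) A a b ->
  is_bridge (half (surgL (lnk v) l A) k) B' -> quad (half (surgL (lnk v) l A) k) B' c d ->
  is_bridge (half (lnk v) k) B -> quad (half (lnk v) k) B c d ->
  is_bridge (half (surgL (lnk v) k B) l) A' -> quad (half (surgL (lnk v) k B) l) A' a b ->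
  surgL (surgL (lnk v) l A) k B' = surgL (surgL (lnk v) k B) l A' ->
  disjoint_arcs (lnk v) l A k B A' B' -> ~~ [&& l, k & same_side (lnk v).1 A B] ->
  \sum_w edge v (Br l A) w * edge w (Br k B') u =
  (\sum_w edge v (Br k B) w * edge w (Br l A') u) *~ sg (l * k).
Proof.
move=> br1 q1 br2 q2 br3 q3 br4 q4 E D nS; rewrite mulrz_suml.
have [Eu|N] := eqVneq (lnk u) (surgL (surgL (lnk v) l A) k B'); last first.
  transitivity (0 : BG n); [|symmetry]; apply: big1 => w _; rewrite edge_mul0 ?mul0rz //;
  apply: contra N => /andP [e1 e2]; last by rewrite E (bridge_lnk e2) (bridge_lnk e1).
  by rewrite (bridge_lnk e2) (bridge_lnk e1).
apply: (@eq_sum_card _ _ [pred w | is_edge v (Br l A) w && is_edge w (Br k B') u]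
                         [pred w | is_edge v (Br k B) w && is_edge w (Br l A') u]).
- by move=> w h; apply: edge_mul0.
- by move=> w h; rewrite edge_mul0 ?mul0rz.
- rewrite (bridge_bridge_card br1 q1 br2 q2 Eu).
  rewrite (bridge_bridge_card br3 q3 br4 q4) -?E //; apply: edge_square_card.
  + exact: link_surgery.
  + exact: link_surgery.
  + by rewrite Eu; apply: link_surgery.
  by rewrite Eu E; apply: link_surgery.
move=> w1 w2 /andP [e1 e2] /andP [e3 e4].
apply: relator_swap; exact: rel_disjoint_bridges e1 e2 e3 e4 D nS.
Qed.

Lemma two_step_swap l A B A' B' v u : let m := half (lnk v) l in
  is_bridge m A -> is_bridge (surg m A) B' -> is_bridge m B -> is_bridge (surg m B) A' ->
  surg (surg m A) B' = surg (surg m B) A' -> surg (surg m A) B' <> m -> A != B ->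
  ~~ (l && same_side (lnk v).1 A B) ->
  \sum_w edge v (Br l A) w * edge w (Br l B') u =
  (\sum_w edge v (Br l B) w * edge w (Br l A') u) *~ sg l.
Proof.
move=> m br1 br2 br3 br4 E nE nAB nS.
have [D [a [b [c [d [q1 q2 q3 q4]]]]]] := two_step_disjoint_arcs br1 br2 br3 br4 E nE nAB.
have -> : sg l = sg (l * l) by case: (l).
have E' : surgL (surgL (lnk v) l A) l B' = surgL (surgL (lnk v) l B) l A'.
  by rewrite /m /surgL in E *; case: (l) E => /= ->.
rewrite /m -half_surgL in br2 q4; rewrite /m -half_surgL in br4 q2.
apply: (@bridge_square v u l l A B A' B' a b c d br1 q1 br2 q4 br3 q3 br4 q2 E' D).
by case: (l) nS.
Qed.

Lemma left_right_swap A B v u :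
  \sum_w edge v (Br false B) w * edge w (Br true A) u =
  \sum_w edge v (Br true A) w * edge w (Br false B) u.
Proof.
case: (boolP (is_bridge (lnk v).1 A && is_bridge (lnk v).2 B)) => [/andP [b1 b2]|]; last first.
  rewrite negb_and => N; transitivity (0 : BG n); [|symmetry]; apply: big1 => w _;
  apply: edge_mul0; apply/negP => /andP [e1 e2].
    have := bridge_is_bridge e1; have := bridge_is_bridge e2.
    by rewrite (bridge_lnk e1) /half /surgL /= => h1 h2; rewrite h1 h2 in N.
  have := bridge_is_bridge e1; have := bridge_is_bridge e2.
  by rewrite (bridge_lnk e1) /half /surgL /= => h1 h2; rewrite h1 h2 in N.
have [a [b q1]] := bridge_nonempty b1; have [c [d q2]] := bridge_nonempty b2.
apply: etrans (mulz_sg0 _).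
by apply: (@bridge_square v u false true B A B A c d a b); rewrite // /disjoint_arcs /= !eqxx.
Qed.

(* The first bridge of a two-step path determines the second one; these paths
   cancel in pairs by (R4), in triples by (R5), or vanish by (R6). *)
Lemma two_step_sum v u (m := (lnk v).1) (mu := (lnk u).1) : m <> mu ->
  \sum_A \sum_w edge v (Br true A) w * edge w (Br true (second m mu A)) u = 0.
Proof.
move=> nEm; pose T A := \sum_w edge v (Br true A) w * edge w (Br true (second m mu A)) u.
have T2 A : ~~ two_step m mu A -> T A = 0.
  move=> N; apply: big1 => w _; apply: edge_mul0; apply: contra N => /andP [e1 e2].
  have b1 := bridge_is_bridge e1; have b2 := bridge_is_bridge e2; have E := bridge_lnk e2.
  rewrite (bridge_lnk e1) /= in b2 E; rewrite /two_step -/m in b1 b2 E *.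
  by rewrite b1 b2 {2}/mu E eqxx.
have restr (P : pred {set I}) : two_step m mu =1 P -> \sum_A T A = \sum_(A | P A) T A.
  move=> EP; rewrite (bigID P) /= [X in _ + X]big1 ?addr0 // => A nP.
  by apply: T2; rewrite EP.
case: (two_step_spec nEm) => [N|[A EA P]|[A [B [nAB EA nS]]]|[a [b [c [t SS EA]]]]].
- by apply: etrans (restr _ N) _; exact: big_pred0_eq.
- apply: etrans (restr _ EA) _; rewrite big_pred1_eq; apply: big1 => w _.
  case: (boolP (is_edge v (Br true A) w && is_edge w (Br true (second m mu A)) u)).
    by case/andP=> e1 e2; rewrite edge_mul; apply/relator_piB/rel_crossing_dual.
  exact: edge_mul0.
- have /and3P [b1 b2 /eqP E1] : two_step m mu A by rewrite EA /= eqxx.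
  have /and3P [b3 b4 /eqP E2] : two_step m mu B by rewrite EA /= eqxx orbT.
  apply: etrans (restr _ EA) _; rewrite (bigD1 A) /= ?eqxx // (big_pred1 B); last first.
    move=> A' /=; case: (A' =P A) => [->|]; rewrite ?andbT //=.
    by rewrite (negPf nAB).
  have -> : T A = T B *~ sg true.
    exact: (@two_step_swap true A B (second m mu B) (second m mu A) v u b1 b2 b3 b4
      (etrans E1 (esym E2)) (fun E => nEm (etrans (esym E) E1)) nAB nS).
  by apply: etrans (congr2 +%R (mulz_sg1 (T B)) (erefl (T B))) _; exact: addNr.
have ne x y z : tri m mu x y z -> arcs m x y != arcs m y z.
  move=> t'; apply/eqP => /setP/(_ x); have := tri_ne t'; rewrite /= => nn.
  by rewrite !inE !nn eqxx.
have t1 := tri_rot t; have t2 := tri_rot t1.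
have n1 := ne _ _ _ t; have n2 := ne _ _ _ t1; have n3 := ne _ _ _ t2.
have /and3P [b1 c1 /eqP E1] : two_step m mu (arcs m a b) by rewrite EA /= eqxx.
have /and3P [b2 c2 /eqP E2] : two_step m mu (arcs m b c) by rewrite EA /= eqxx !orbT.
have /and3P [b3 c3 /eqP E3] : two_step m mu (arcs m c a) by rewrite EA /= eqxx !orbT.
apply: etrans (restr _ EA) _.
rewrite (bigD1 (arcs m a b)) /= ?eqxx // (bigD1 (arcs m c a)) /=; last by rewrite eqxx !orbT.
rewrite (big_pred1 (arcs m b c)); last first.
  move=> A /=; case: (A =P arcs m a b) => [->|_]; first by rewrite (negPf n1).
  case: (A =P arcs m c a) => [->|_]; last by rewrite ?orbF ?andbT; case: (A == _).
  by rewrite eq_sym (negPf n2).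
(* The slid bridge of (R5) is the third pair of arcs. *)
have EC : arcs m b c = (arcs m a b :|: arcs m c a) :\: (arcs m a b :&: arcs m c a).
  have := tri_ne t; rewrite /= => nn; apply/setP => x; rewrite !inE.
  case: (x =P a) => [->|_]; first by rewrite !nn ?eqxx ?orbT ?andbF.
  case: (x =P m a) => [->|_]; first by rewrite !nn ?eqxx ?orbT ?andbF.
  case: (x =P b) => [->|_]; first by rewrite !nn ?eqxx ?orbT ?andbF.
  case: (x =P m b) => [->|_]; first by rewrite !nn ?eqxx ?orbT ?andbF.
  by case: (x =P c); case: (x =P m c).
have [d1 d2] := tri_carried t b1 b3; have [d3 d4] := tri_carried t1 b2 b1.
have [d5 d6] := tri_carried t2 b3 b2.
have f1 := tri_second_eq t b1; have f2 := tri_second_eq t1 b2; have f3 := tri_second_eq t2 b3.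
have cls A B D q : is_bridge (surg m A) D -> q \in A -> q \in B -> D = carried m A B q ->
    class_of m A B D.
  move=> br qA qB E; rewrite /class_of br; apply/exists_inP.
  by exists q; [rewrite inE qA | exact/eqP].
have M x y : [/\ x \in arcs m x y, m x \in arcs m x y, y \in arcs m x y & m y \in arcs m x y].
  by rewrite !inE !eqxx !orbT.
have [ab1 ab2 ab3 ab4] := M a b; have [bc1 bc2 bc3 bc4] := M b c; have [ca1 ca2 ca3 ca4] := M c a.
have K1 : class_of m (arcs m a b) (arcs m c a) (second m mu (arcs m a b)) &&
    class_of m (arcs m a b) (arcs m b c) (second m mu (arcs m a b)).
  apply/andP; split; [apply: (cls _ _ _ (m a) c1 ab2 ca4)|apply: (cls _ _ _ b c1 ab3 bc1)];
  by [rewrite f1 -d1 | rewrite f1 -d4].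
have K2 : class_of m (arcs m c a) (arcs m a b) (second m mu (arcs m c a)) &&
    class_of m (arcs m c a) (arcs m b c) (second m mu (arcs m c a)).
  apply/andP; split; [apply: (cls _ _ _ a c3 ca3 ab1)|apply: (cls _ _ _ (m c) c3 ca2 bc4)];
  by [rewrite f3 -d2 | rewrite f3 -d5].
have K3 : class_of m (arcs m b c) (arcs m c a) (second m mu (arcs m b c)) &&
    class_of m (arcs m b c) (arcs m a b) (second m mu (arcs m b c)).
  apply/andP; split; [apply: (cls _ _ _ c c2 bc3 ca1)|apply: (cls _ _ _ (m b) c2 bc2 ab4)];
  by [rewrite f2 -d6 | rewrite f2 -d3].
rewrite andbC in K3.
have R := relator_piB (@rel_sliding n v u _ _ _ _ _ _ b1 b3 SS EC K1 K2 K3).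
have TE A : piB (\sum_w pth v [:: (Br true A, w); (Br true (second m mu A), u)]) = T A.
  by apply: etrans (piB_sum _ _ _) _; apply: eq_bigr => w _; rewrite edge_mul.
apply: etrans (addrA _ _ _) _; apply: etrans _ R; apply: esym.
apply: etrans (piBD _ _) _; apply: congr2 (TE _).
by apply: etrans (piBD _ _) _; apply: congr2; exact: TE.
Qed.

Lemma lbridge_lbridge v u :
  \sum_w lbridge v w * lbridge w u =
  \sum_A \sum_w edge v (Br true A) w * edge w (Br true A) u.
Proof.
pose T A B := \sum_w edge v (Br true A) w * edge w (Br true B) u.
set m := (lnk v).1; set mu := (lnk u).1.
apply: (etrans (y := \sum_A \sum_B T A B)).
  apply: etrans (mull_sum_exch (fun A w => edge v (Br true A) w) (fun w => lbridge w u)) _.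
  apply: eq_bigr => A _.
  exact: (mulr_sum_exch (fun B w => edge w (Br true B) u) (edge v (Br true A))).
have Tpath A B : ~ [/\ is_bridge m A, is_bridge (surg m A) B & surg (surg m A) B = mu] -> T A B = 0.
  move=> N; apply: big1 => w _; apply: edge_mul0; apply/negP => /andP [e1 e2]; apply: N.
  have b1 := bridge_is_bridge e1; have b2 := bridge_is_bridge e2; have E := bridge_lnk e2.
  by rewrite (bridge_lnk e1) /= in b2 E; rewrite /mu E.
have Tsecond A B : B != second m mu A -> T A B = 0.
  by move=> N; apply: Tpath => -[b1 b2 E]; rewrite (second_eq b2 E) eqxx in N.
have S A : \sum_B T A B = T A (second m mu A).
  rewrite (bigD1 (second m mu A)) //=.
  by rewrite [X in _ + X]big1 ?addr0 // => B; exact: Tsecond.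
apply: etrans (eq_bigr _ (fun A _ => S A)) _.
(* If the matchings agree, the second bridge is the dual of the first. Otherwise no dual pair exists
   and the sum vanishes by [two_step_sum]. *)
have [Em|nEm] := pselect (m = mu).
  apply: eq_bigr => A _; case: (boolP (is_bridge m A)) => brA.
    have E : second m mu A = A by rewrite /second -Em diffmC surg_diff.
    exact: (congr1 (T A) E).
  have Z B : T A B = 0 by apply: Tpath => -[]; rewrite (negPf brA).
  exact: etrans (Z _) (esym (Z _)).
apply: etrans (two_step_sum nEm) (esym _); apply: big1 => A _.
by apply: Tpath => -[b1 _]; rewrite (proj2 (surgK b1)).
Qed.
End Bridges.

(** * Normal forms of products of right edges *)

Section RightPaths.
Variable n : nat.
Local Notation I := 'I_n.*2.
Implicit Types (L : link n) (l k : bool) (A B C D : {set I}) (a b c d p q t : I) (v w u : vertex n).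

Lemma cirE L C t : C \in cir L -> t \in C -> C = circ L t.
Proof. by case/imsetP => s _ ->; rewrite mem_circ => /circ_eq. Qed.
Lemma cir_nonempty L C : C \in cir L -> exists t, t \in C.
Proof. by case/imsetP => s _ ->; exists s; rewrite mem_circ (eqv_refl (linkeq_eqv L)). Qed.
Lemma cir_eq L C D t : C \in cir L -> D \in cir L -> t \in C -> t \in D -> C = D.
Proof. by move=> CL DL tC tD; rewrite (cirE CL tC) (cirE DL tD). Qed.

(** Gives back the label of a decoration edge from its end vertices. *)
Definition drop_set v u : {set I} := [set p | sgn v p && ~~ sgn u p].

Lemma dec_drop k v C u : is_edge v (De k C) u -> C = drop_set v u.
Proof.
case/and4P => _ /forall_inP P _ /eqP s; apply/setP => p; rewrite inE s ffunE.
by case: (boolP (p \in C)) => [/P ->|_] //=; case: (sgn v p).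
Qed.

Lemma dec_cir k v C u : is_edge v (De k C) u -> C \in cir (lnk v).
Proof. by case/and4P. Qed.

Lemma dec_dec_drop k k' v C w D u : is_edge v (De k C) w -> is_edge w (De k' D) u ->
  [/\ D \in cir (lnk v), drop_set v u = C :|: D & [disjoint C & D]].
Proof.
move=> e1 e2; have := dec_cir e2; rewrite (decoration_lnk e1) => DL.
case/and4P: e1 => _ /forall_inP P1 _ /eqP s1; case/and4P: e2 => _ /forall_inP P2 _ /eqP s2.
have dis p : p \in C -> p \in D -> False by move=> pC /P2; rewrite s1 ffunE pC.
split=> //; last by rewrite disjoints_subset; apply/subsetP => p pC; rewrite inE; apply/negP; exact: dis.
apply/setP => p; rewrite !inE s2 ffunE s1 ffunE.
case: (boolP (p \in C)) => [/P1 ->|pC] /=; first by rewrite andbF.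
case: (boolP (p \in D)) => [/P2|_] /=; last by case: (sgn v p).
by rewrite s1 ffunE => /andP [_ ->].
Qed.

Lemma bridge_target_merge l v A w w' a b : quad (half (lnk v) l) A a b ->
  ~~ linkeq (lnk v) a b -> is_edge v (Br l A) w -> is_edge v (Br l A) w' -> w = w'.
Proof.
move=> q nab e e'; have br := bridge_is_bridge e; have Ew := bridge_lnk e.
have Ew' := bridge_lnk e'; have S := link_surgery br q.
move: e e'; rewrite /is_edge /= !(bridge_edgeE _ q) => /and3P [_ _ /and4P [_ C1 /forallP O1 M1]].
case/and3P=> _ _ /and4P [_ C2 /forallP O2 M2].
move: M1 M2; rewrite /mult_rule (negPf nab) => /andP [_ /eqP M1] /andP [_ /eqP M2].
apply: vertexP; first by rewrite Ew Ew'.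
apply/ffunP => x; case: (boolP (linkeq (lnk v) a x || linkeq (lnk v) b x)); last first.
  by move/norP => [h1 h2]; have := O1 x; have := O2 x; rewrite h1 h2 /= => /eqP -> /eqP ->.
have ab' : linkeq (lnk w) a b.
  by rewrite Ew; have := surg_xor S; rewrite (negPf nab); case: (linkeq _ a b).
rewrite (surgery_union S) -Ew -(eqv_left (linkeq_eqv _) ab') orbb => ax.
by rewrite -(sgn_eq ax) M1 -M2; apply/sgn_eq; rewrite Ew' -Ew.
Qed.

(** A bridge edge fixes the signs off its feet and the number of + circles at its feet; lowering a
    further circle changes one of these. *)
Lemma bridge_dec_absurd l k v A w C u : is_edge v (Br l A) u -> is_edge v (Br l A) w ->
  is_edge w (De k C) u -> False.
Proof.
move=> e1 e2 e3; have [t tC] := cir_nonempty (dec_cir e3).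
have CL := dec_cir e3; case/and4P: (e3) => _ /forall_inP /= P _ /eqP /= s.
have br := bridge_is_bridge e1; have [a [b q]] := bridge_nonempty br.
have S := link_surgery br q; have Ew := bridge_lnk e2; rewrite -Ew in S.
case: (boolP (linkeq (lnk v) a b)) => ab; last first.
  have E := bridge_target_merge q ab e1 e2.
  by have := P t tC; rewrite -E s ffunE tC.
move: e1 e2; rewrite /is_edge /= !(bridge_edgeE _ q) => /and3P [_ _ /and4P [_ _ /forallP O1 M1]].
case/and3P=> _ _ /and4P [_ _ /forallP O2 M2].
case: (boolP (linkeq (lnk v) a t || linkeq (lnk v) b t)) => [|/norP [h1 h2]]; last first.
  have := P t tC; have := O1 t; have := O2 t; rewrite h1 h2 /= => /eqP -> /eqP.
  by rewrite s ffunE tC /= => <-.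
move: M1 M2; rewrite /mult_rule ab (surgery_union S) s !ffunE.
have CC x y : linkeq (lnk w) x y -> (y \in C) = (x \in C).
  have E := linkeq_eqv (lnk w); rewrite (cirE CL tC) !mem_circ => xy.
  by rewrite (eqv_right E _ xy).
have nab' : ~~ linkeq (lnk w) a b by have := surg_xor S; rewrite ab; case: (linkeq (lnk w) a b).
move=> + + /orP h; case: h => h; have hC := CC _ _ h; rewrite tC in hC.
  have nb : b \notin C.
    apply: contra nab' => bC; have E := linkeq_eqv (lnk w).
    by move: bC; rewrite (cirE CL (esym hC : a \in C)) mem_circ.
  rewrite -hC nb /= (P a) //; case: (sgn v a); case: (sgn w b) => //.
have na : a \notin C.
  apply: contra nab' => aC; have E := linkeq_eqv (lnk w).
  by move: aC; rewrite (cirE CL (esym hC : b \in C)) mem_circ (eqv_sym E).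
by rewrite -hC na /= (P b) //; case: (sgn v a); case: (sgn w a).
Qed.

Inductive rstep v w : BG n -> Prop :=
| RId of w = v : rstep v w (idem v)
| RDec C of is_edge v (De false C) w : rstep v w (edge v (De false C) w)
| RBr A of is_edge v (Br false A) w : rstep v w (edge v (Br false A) w).

(** The normal forms: a bridge precedes a decoration, and a bridge followed by its dual has become a
    decoration. Two bridges to a different link are treated separately. *)
Inductive rpath v u : BG n -> Prop :=
| PId of u = v : rpath v u (idem v)
| PDec C of is_edge v (De false C) u : rpath v u (edge v (De false C) u)
| PBr A of is_edge v (Br false A) u : rpath v u (edge v (Br false A) u)
| PBrDec A w C of is_edge v (Br false A) w & is_edge w (De false C) u :
    rpath v u (edge v (Br false A) w * edge w (De false C) u)
| PDecDec C w D of is_edge v (De false C) w & is_edge w (De false D) u :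
    rpath v u (edge v (De false C) w * edge w (De false D) u).

Lemma dec_bridge_exists l k v C w A u : is_edge v (De k C) w -> is_edge w (Br l A) u ->
  exists t w', [/\ C = circ (lnk v) t, is_edge v (Br l A) w' &
    is_edge w' (De k (circ (lnk u) t)) u].
Proof.
move=> e1 e2; have [t tC] := cir_nonempty (dec_cir e1).
have EC := cirE (dec_cir e1) tC; have [br Eu] := dec_bridge_path e1 e2.
have := dec_bridge_card t k br Eu; rewrite -EC => E.
have : #|[set w | is_edge v (De k C) w && is_edge w (Br l A) u]| != 0%N.
  by rewrite cards_eq0; apply/set0Pn; exists w; rewrite inE e1 e2.
by rewrite E cards_eq0 => /set0Pn [w']; rewrite inE => /andP [h1 h2]; exists t, w'.
Qed.

Lemma bridge_dec_exists l k v A w C u : is_edge v (Br l A) w -> is_edge w (De k C) u ->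
  exists t w', [/\ C = circ (lnk u) t, is_edge v (De k (circ (lnk v) t)) w' &
    is_edge w' (Br l A) u].
Proof.
move=> e1 e2; have [t tC] := cir_nonempty (dec_cir e2).
have EC := cirE (dec_cir e2) tC; rewrite -(decoration_lnk e2) in EC.
have [br Eu] := bridge_dec_path e1 e2.
have := dec_bridge_card t k br Eu; rewrite -EC => E.
have : #|[set w | is_edge v (Br l A) w && is_edge w (De k C) u]| != 0%N.
  by rewrite cards_eq0; apply/set0Pn; exists w; rewrite inE e1 e2.
by rewrite -E cards_eq0 => /set0Pn [w']; rewrite inE => /andP [h1 h2]; exists t, w'.
Qed.

Lemma dec_bridge_eq l t v w1 A u w2 :
  is_edge v (De false (circ (lnk v) t)) w1 -> is_edge w1 (Br l A) u ->
  is_edge v (Br l A) w2 -> is_edge w2 (De false (circ (lnk u) t)) u ->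
  edge v (De false (circ (lnk v) t)) w1 * edge w1 (Br l A) u =
  edge v (Br l A) w2 * edge w2 (De false (circ (lnk u) t)) u.
Proof.
move=> e1 e2 e3 e4.
case: (boolP [exists a in A, linkeq (lnk v) a t]) => H; first exact: dec_bridge_touch.
rewrite negb_exists_in in H.
apply: etrans (dec_bridge_disjoint e1 e2 e3 e4 H) _; exact: mulz_sg0.
Qed.

Lemma dual_drop l v w u A : is_edge v (Br l A) w -> is_edge w (Br l A) u ->
  exists C, is_edge v (De l C) u.
Proof.
move=> e1 e2; have br := bridge_is_bridge e1; have [a [b q]] := bridge_nonempty br.
have S := link_surgery br q; have Ew := bridge_lnk e1.
have Eu : lnk u = lnk v by rewrite (bridge_lnk e2) Ew surgLK.
have q' : quad (half (lnk w) l) A a b by rewrite Ew half_surgL; exact: quad_surg q.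
rewrite -Ew in S; move: e1 e2.
rewrite /is_edge /= (bridge_edgeE _ q) (bridge_edgeE _ q') => /and3P [_ _ K1] /and3P [_ _ K2].
rewrite Eu in K2; have [t /andP [_ h]] := edge_back S K1 K2.
by exists (circ (lnk v) t); rewrite decoration_edgeE Eu eqxx.
Qed.

Lemma dual_eq v w u A C : is_edge v (Br false A) w -> is_edge w (Br false A) u ->
  is_edge v (De false C) u ->
  edge v (Br false A) w * edge w (Br false A) u = edge v (De false C) u.
Proof.
move=> e1 e2 e3; have := relator_piB (rel_right_dual e1 e2 e3).
by rewrite piBD piBN -edge_mul => /eqP; rewrite subr_eq0 => /eqP.
Qed.

(** (R1) and (R2) move decorations behind bridges. Two bridges leading back to the same link are
    dual to each other, and (R7) applies. *)
Lemma rstep_rpath v w u x y : rstep v w x -> rstep w u y ->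
  rpath v u (x * y) \/
  exists A B, [/\ is_edge v (Br false A) w, is_edge w (Br false B) u, lnk u <> lnk v &
                 x * y = edge v (Br false A) w * edge w (Br false B) u].
Proof.
move=> [E|C e1|A e1] [E'|C' e2|A' e2].
- by left; rewrite E idem_idem; apply: PId; rewrite E' E.
- by left; rewrite E in e2 *; rewrite idem_edge; apply: PDec.
- by left; rewrite E in e2 *; rewrite idem_edge; apply: PBr.
- by left; rewrite -E' edge_idem; apply: PDec; rewrite E'.
- by left; apply: PDecDec.
- left; have [t [w' [EC e3 e4]]] := dec_bridge_exists e1 e2.
  rewrite EC in e1 *; rewrite (dec_bridge_eq e1 e2 e3 e4); exact: PBrDec.
- by left; rewrite -E' edge_idem; apply: PBr; rewrite E'.
- by left; apply: PBrDec.
have [E|N] := pselect (lnk u = lnk v); last by right; exists A, A'.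
left; have br : is_bridge _ A := bridge_is_bridge e1.
have br' : is_bridge _ A' := bridge_is_bridge e2.
have E1 := bridge_lnk e1; have E2 := bridge_lnk e2.
have EA : A' = A.
  have h1 : surg (half (lnk w) false) A' = half (lnk v) false by rewrite -E E2 half_surgL.
  rewrite (surg_bridge_diff br' h1) E1 half_surgL diffmC; exact: surg_diff.
rewrite EA in e2 *; have [C e3] := dual_drop e1 e2.
rewrite (dual_eq e1 e2 e3); exact: PDec.
Qed.

Lemma br_surg_neq m A : is_bridge m A -> surg m A <> m :> matching n.
Proof.
move=> br E; have := surg_diff br; rewrite E => EA.
have := bridge_card br; rewrite -EA => /eqP.
rewrite (_ : diffm m m = set0) ?cards0 //.
by apply/setP => i; rewrite !inE eqxx.
Qed.

(** One surgery moves four points of the matching; two surgeries move none, six or eight. *)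
Lemma two_steps_not_one m A B B' : is_bridge m A -> is_bridge m B ->
  is_bridge (surg m B) B' -> surg m A <> surg (surg m B) B' :> matching n.
Proof.
move=> brA brB brB' E; have EA := surg_diff brA; rewrite E in EA.
case: (two_step_cases brB brB') => [EB|D|[a [b [c [t _ _]]]]].
- by apply: (br_surg_neq brA); rewrite E EB (proj2 (surgK brB)).
- have sub1 : B \subset A.
    apply/subsetP => x xB; rewrite -EA inE [surg (surg m B) B' x]surg_off ?(disjointFr D) //.
    by rewrite eq_sym surg_neq.
  have EBA : B = A by apply/eqP; rewrite eqEcard sub1 (bridge_card brA) (bridge_card brB).
  have [x xB] : exists x, x \in B' by apply/set0Pn; rewrite -cards_eq0 (bridge_card brB').
  have : x \in A by rewrite -EA inE -(@surg_off _ m B x) ?(disjointFl D) // eq_sym surg_neq.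
  by rewrite -EBA (disjointFl D xB).
have [_ _ [u1 u2 u3] _] := t; have ne := tri_ne t; rewrite /= in ne.
have aA : a \in A by rewrite -EA inE u1 !ne.
have [y q] := bridge_quad brA aA; have [e1 _ _ _] := surg_quad brA q.
rewrite E u1 in e1; have Eb := mate_inj e1.
have cA : c \in A by rewrite -EA inE u3 !ne.
have [_ n2 n3 _] := tri_neq t; have [_ _ _ [_ k5 k6]] := tri_parity t.
case: (quad_in q cA) => h; [move: n3|move: k5|move: n2|move: k6]; by rewrite h ?Eb eqxx.
Qed.

Lemma drop_nonempty k v C u : is_edge v (De k C) u -> drop_set v u != set0.
Proof.
move=> e; rewrite -(dec_drop e); have [t tC] := cir_nonempty (dec_cir e).
by apply/set0Pn; exists t.
Qed.

Lemma drop_self v : drop_set v v = set0.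
Proof. by apply/setP => p; rewrite !inE andbN. Qed.

Lemma dec_dec_not_one k1 k2 k3 v C w D B u : is_edge v (De k1 C) w -> is_edge w (De k2 D) u ->
  is_edge v (De k3 B) u -> False.
Proof.
move=> e1 e2 e3; have [DL EU dis] := dec_dec_drop e1 e2; rewrite -(dec_drop e3) in EU.
have [t tC] := cir_nonempty (dec_cir e1); have [s sD] := cir_nonempty DL.
have tB : t \in B by rewrite EU inE tC.
have EB := cir_eq (dec_cir e1) (dec_cir e3) tC tB.
have : s \in C by rewrite EB EU inE sD orbT.
by rewrite (disjointFl dis sD).
Qed.

Lemma bridge_lnk_neq l v A w : is_edge v (Br l A) w -> lnk w <> lnk v.
Proof.
move=> e E; have br := bridge_is_bridge e; apply: (br_surg_neq br).
by rewrite -[in RHS]E (bridge_lnk e) half_surgL.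
Qed.

Lemma rpath_lnk v u x : rpath v u x -> lnk u = lnk v \/
  exists2 A, is_bridge (half (lnk v) false) A & lnk u = surgL (lnk v) false A.
Proof.
case=> [->|C e|A e|A w C e1 e2|C w D e1 e2]; first by left.
- by left; rewrite (decoration_lnk e).
- by right; exists A; [exact: bridge_is_bridge e|exact: bridge_lnk e].
- by right; exists A; [exact: bridge_is_bridge e1|rewrite (decoration_lnk e2); exact: bridge_lnk e1].
by left; rewrite (decoration_lnk e2) (decoration_lnk e1).
Qed.

Lemma surgL_inj L l A B : is_bridge (half L l) A -> is_bridge (half L l) B ->
  surgL L l A = surgL L l B -> A = B.
Proof.
by move=> b1 b2 E; apply: (surg_inj b1 b2); rewrite -!half_surgL E.
Qed.

(** For a merge the middle vertex is forced. The two divisions of a + circle become one path once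
    the decoration is moved in front of the bridge, as v and u determine the circle to be
    lowered. *)
Lemma brdec_unique v u A w C w' D :
  is_edge v (Br false A) w -> is_edge w (De false C) u ->
  is_edge v (Br false A) w' -> is_edge w' (De false D) u ->
  edge v (Br false A) w * edge w (De false C) u = edge v (Br false A) w' * edge w' (De false D) u.
Proof.
move=> e1 e2 e3 e4; have br := bridge_is_bridge e1; have [a [b q]] := bridge_nonempty br.
have Eu : lnk u = surgL (lnk v) false A by rewrite (decoration_lnk e2) (bridge_lnk e1).
have S := link_surgery br q; rewrite -Eu in S.
have [Ev Eu'] := (linkeq_eqv (lnk v), linkeq_eqv (lnk u)).
case: (boolP (linkeq (lnk v) a b)) => ab; last first.
  have Ew := bridge_target_merge q ab e1 e3; rewrite -Ew in e4 *.
  by rewrite (dec_drop e2) (dec_drop e4).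
have [t [w1 [EC f1 f2]]] := bridge_dec_exists e1 e2.
have [s [w2 [ED f3 f4]]] := bridge_dec_exists e3 e4.
rewrite EC ED in e2 e4 *.
rewrite -(dec_bridge_eq f1 f2 e1 e2) -(dec_bridge_eq f3 f4 e3 e4).
suff Ets : circ (lnk v) t = circ (lnk v) s.
  have Ew : w1 = w2.
    rewrite -Ets in f3; case/and4P: f1 => _ _ /eqP h1 /eqP h2; case/and4P: f3 => _ _ /eqP h3 /eqP h4.
    by apply: vertexP; rewrite ?h1 ?h2 ?h3 ?h4.
  by rewrite Ew Ets.
have key t1 w3 s1 w4 : is_edge v (De false (circ (lnk v) t1)) w3 -> is_edge w3 (Br false A) u ->
    is_edge v (De false (circ (lnk v) s1)) w4 -> is_edge w4 (Br false A) u ->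
    ~~ linkeq (lnk v) a t1 -> circ (lnk v) t1 = circ (lnk v) s1.
  move=> g1 g2 g3 g4 na; have nb : ~~ linkeq (lnk v) b t1 by rewrite -(eqv_left Ev ab).
  have off w5 : is_edge w5 (Br false A) u -> lnk w5 = lnk v -> sgn u t1 = sgn w5 t1.
    move=> + E5; rewrite /is_edge /= (bridge_edgeE _ (a := a) (b := b)) E5 //.
    by case/and3P=> _ _ /and4P [_ _ /forallP/(_ t1) + _]; rewrite na nb => /eqP.
  have tt : t1 \in circ (lnk v) t1 by rewrite mem_circ (eqv_refl Ev).
  have ut : sgn u t1 = false.
    by rewrite (off w3 g2 (decoration_lnk g1)); case/and4P: g1 => _ _ _ /eqP ->; rewrite ffunE tt.
  have vt : sgn v t1 by case/and4P: g1 => _ /forall_inP/(_ t1 tt).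
  have := off w4 g4 (decoration_lnk g3); rewrite ut; case/and4P: g3 => _ _ _ /eqP ->.
  rewrite ffunE vt andbT mem_circ => /esym/negbFE st; exact/esym/circ_eq.
case: (boolP (linkeq (lnk v) a t)) => at'; last exact: key f1 f2 f3 f4 at'.
case: (boolP (linkeq (lnk v) a s)) => as'; last exact/esym/(key _ _ _ _ f3 f4 f1 f2 as').
by rewrite -(circ_eq at') -(circ_eq as').
Qed.

(** The links of v and u and the circles that drop from + to - exclude all but one normal form and
    give back its labels; the order of two decorations is irrelevant by (R1). *)
Lemma rpath_unique v u x y : rpath v u x -> rpath v u y -> x = y.
Proof.
have lnkE z : lnk u = lnk v -> rpath v u z ->
    [\/ u = v /\ z = idem v, exists2 C, is_edge v (De false C) u & z = edge v (De false C) u |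
      exists C w D, [/\ is_edge v (De false C) w, is_edge w (De false D) u &
        z = edge v (De false C) w * edge w (De false D) u]].
  move=> E [E1|C e|A e|A w C e1 e2|C w D e1 e2].
  - by constructor 1.
  - by constructor 2; exists C.
  - by case: (bridge_lnk_neq e).
  - by case: (bridge_lnk_neq e1); rewrite -(decoration_lnk e2).
  by constructor 3; exists C, w, D.
move=> px py; case: (rpath_lnk px) => [E|[A br Eu]].
  have := lnkE _ E px; have := lnkE _ E py; have sv := drop_self v.
  case=> [[Ev ->]|[C e ->]|[C [w [D [e1 e2 ->]]]]]; case=> [[Ev' ->]|[C' e' ->]|[C' [w' [D' [e1' e2' ->]]]]].
  - exact: erefl.
  - by exfalso; have := drop_nonempty e'; rewrite Ev sv eqxx.
  - by exfalso; have [_ ED _] := dec_dec_drop e1' e2'; have := drop_nonempty e1'; rewrite -(dec_drop e1');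
       rewrite Ev sv in ED; move/esym/eqP: ED; rewrite setU_eq0 => /andP [/eqP ->]; rewrite eqxx.
  - by exfalso; have := drop_nonempty e; rewrite Ev' sv eqxx.
  - by rewrite (dec_drop e) (dec_drop e').
  - by case: (dec_dec_not_one e1' e2' e).
  - by exfalso; have [_ ED _] := dec_dec_drop e1 e2; have := drop_nonempty e1; rewrite -(dec_drop e1);
       rewrite Ev' sv in ED; move/esym/eqP: ED; rewrite setU_eq0 => /andP [/eqP ->]; rewrite eqxx.
  - by case: (dec_dec_not_one e1 e2 e').
  have [DL EU dis] := dec_dec_drop e1 e2; have [DL' EU' dis'] := dec_dec_drop e1' e2'.
  have dec_target C1 w1 w2 : is_edge v (De false C1) w1 -> is_edge v (De false C1) w2 -> w1 = w2.
    case/and4P=> _ _ /eqP h1 /eqP h2 /and4P [_ _ /eqP h3 /eqP h4].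
    by apply: vertexP; rewrite ?h1 ?h2 ?h3 ?h4.
  rewrite EU' in EU; have [t tC] := cir_nonempty (dec_cir e1).
  have : t \in C' :|: D' by rewrite EU inE tC.
  have diff (X Y Z : {set I}) : X :|: Y = X :|: Z -> [disjoint X & Y] -> [disjoint X & Z] -> Y = Z.
    move=> EX d1 d2; apply/setP => p; have := congr1 (fun s : {set I} => p \in s) EX; rewrite !inE.
    by case: (boolP (p \in X)) => //= pX; rewrite (disjointFr d1 pX) (disjointFr d2 pX).
  rewrite inE => /orP [tC'|tD'].
    have EC := cir_eq (dec_cir e1) (dec_cir e1') tC tC'; rewrite -EC in e1' EU dis' *.
    have Ew := dec_target _ _ _ e1 e1'; rewrite -Ew in e1' e2' *.
    by rewrite (diff _ _ _ EU dis' dis).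
  have EC := cir_eq (dec_cir e1) DL' tC tD'.
  rewrite -EC in e2' EU dis' *; rewrite setUC in EU; rewrite disjoint_sym in dis'.
  have ED := diff _ _ _ EU dis' dis; rewrite ED in e1' *.
  rewrite disjoint_sym ED in dis'.
  have sC : {in supp (lnk v) (De false C), sgn u =1 sgn w}.
    move=> p pC; case/and4P: e2 => _ _ _ /eqP ->; rewrite ffunE.
    by rewrite /= (disjointFr dis pC).
  have sD : {in supp (lnk v) (De false D), sgn u =1 sgn w'}.
    move=> p pD; case/and4P: e2' => _ _ _ /eqP ->; rewrite ffunE.
    by rewrite /= (disjointFl dis pD).
  apply: esym; apply: etrans (relator_swap (rel_disjoint_supports e1 e2 e1' e2' dis sC sD)) _.
  exact: mulz_sg0.
have nE : lnk u <> lnk v.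
  move=> E; apply: (br_surg_neq br); rewrite -[RHS](congr1 (fun L => half L false) E).
  by rewrite Eu half_surgL.
have brE z : rpath v u z -> (exists2 B, is_edge v (Br false B) u & z = edge v (Br false B) u) \/
    exists B w C, [/\ is_edge v (Br false B) w, is_edge w (De false C) u &
        z = edge v (Br false B) w * edge w (De false C) u].
  case=> [E1|C e|B e|B w C e1 e2|C w D e1 e2].
  - by case: nE; rewrite E1.
  - by case: nE; rewrite (decoration_lnk e).
  - by left; exists B.
  - by right; exists B, w, C.
  by case: nE; rewrite (decoration_lnk e2) (decoration_lnk e1).
have BA B w : is_edge v (Br false B) w -> lnk w = lnk u -> B = A.
  move=> e Ew; apply: (surgL_inj (bridge_is_bridge e) br).
  by rewrite -Eu -Ew; apply/esym; exact: bridge_lnk e.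
have := brE _ px; have := brE _ py.
case=> [[B e ->]|[B [w [C [e1 e2 ->]]]]]; case=> [[B' e' ->]|[B' [w' [C' [e1' e2' ->]]]]].
- by rewrite (BA _ _ e erefl) (BA _ _ e' erefl).
- exfalso; have E1 := BA _ _ e erefl; have E2 := BA _ _ e1' (esym (decoration_lnk e2')).
  by rewrite E1 in e; rewrite E2 in e1'; exact: bridge_dec_absurd e e1' e2'.
- exfalso; have E1 := BA _ _ e' erefl; have E2 := BA _ _ e1 (esym (decoration_lnk e2)).
  by rewrite E1 in e'; rewrite E2 in e1; exact: bridge_dec_absurd e' e1 e2.
have E1 := BA _ _ e1 (esym (decoration_lnk e2)); have E2 := BA _ _ e1' (esym (decoration_lnk e2')).
rewrite E1 in e1 *; rewrite E2 in e1' *; exact: brdec_unique e1' e2' e1 e2.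
Qed.

(** Except for two bridges, both products are normal forms with the same ends. The last hypothesis
    excludes that both paths start with one bridge and yet end at a different link, a case outside
    (R4). *)
Lemma right_square v w1 w2 u x1 y1 x2 y2 :
  rstep v w1 x1 -> rstep w1 u y1 -> rstep v w2 x2 -> rstep w2 u y2 ->
  (forall A B B', is_edge v (Br false A) w1 -> is_edge w1 (Br false B) u ->
     is_edge v (Br false A) w2 -> is_edge w2 (Br false B') u -> lnk u = lnk v) ->
  x1 * y1 = x2 * y2.
Proof.
move=> r1 s1 r2 s2 H.
have two A w B z : is_edge v (Br false A) w -> is_edge w (Br false B) u -> lnk u <> lnk v ->
    rpath v u z -> False.
  move=> e1 e2 nE pz; case: (rpath_lnk pz) => // -[C br Eu].
  have b1 : is_bridge _ A := bridge_is_bridge e1; have b2 : is_bridge _ B := bridge_is_bridge e2.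
  rewrite (bridge_lnk e1) half_surgL in b2.
  apply: (two_steps_not_one br b1 b2); rewrite -half_surgL -Eu (bridge_lnk e2) half_surgL.
  by rewrite (bridge_lnk e1) half_surgL.
have [p1|[A [B' [e1 e2 nE ->]]]] := rstep_rpath r1 s1; have [p2|[B [A' [e3 e4 nE' ->]]]] := rstep_rpath r2 s2.
- exact: rpath_unique p1 p2.
- by case: (two _ _ _ _ e3 e4 nE' p1).
- by case: (two _ _ _ _ e1 e2 nE p2).
have [EAB|nAB] := eqVneq A B.
  by case: nE; rewrite EAB in e1; exact: H e1 e2 e3 e4.
have b1 : is_bridge _ A := bridge_is_bridge e1; have b2 : is_bridge _ B' := bridge_is_bridge e2.
have b3 : is_bridge _ B := bridge_is_bridge e3; have b4 : is_bridge _ A' := bridge_is_bridge e4.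
have L1 : lnk u = surgL (lnk w1) false B' := bridge_lnk e2.
have L2 : lnk u = surgL (lnk w2) false A' := bridge_lnk e4.
have M1 : lnk w1 = surgL (lnk v) false A := bridge_lnk e1.
have M2 : lnk w2 = surgL (lnk v) false B := bridge_lnk e3.
rewrite M1 half_surgL in b2; rewrite M2 half_surgL in b4.
have h1 : half (lnk u) false = surg (surg (half (lnk v) false) A) B'.
  by rewrite L1 half_surgL M1 half_surgL.
have h2 : half (lnk u) false = surg (surg (half (lnk v) false) B) A'.
  by rewrite L2 half_surgL M2 half_surgL.
have EE := etrans (esym h1) h2.
have nE2 : surg (surg (half (lnk v) false) A) B' <> half (lnk v) false.
  rewrite -h1 => E2; apply: nE; rewrite [lnk u]surjective_pairing [lnk v]surjective_pairing.
  by congr pair => //; rewrite L1 M1.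
have [D _] := two_step_disjoint_arcs b1 b2 b3 b4 EE nE2 nAB.
have R := rel_disjoint_bridges e1 e2 e3 e4 D isT.
apply: etrans (relator_swap R) _; exact: mulz_sg0.
Qed.
End RightPaths.

(** * The coefficients of delta *)

Section Coefficients.
Variables (n : nat) (D : diagram n).
Notation c := (ncr D).
Notation E := (ends n c).

(* The unsigned coefficient at y of the terms of delta(x) for the crossing k. *)
Definition coef (x : state D) (k : 'I_c) (y : state D) : BG n :=
  (if active x k && in_D x k y then idem (bd x) * idem (bd y) else 0)
  + (if right_bridge x k && (resolves x k y && agree_free x y)
     then edge (bd x) (Br false (right_arcs x k)) (bd y) else 0)
  + (if active x k && in_dec x k y
     then edge (bd x) (De false (foot_circle x k)) (bd y) else 0).

Lemma coef0 x k y : ~~ (active x k && resolves x k y) -> coef x k y = 0.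
Proof.
rewrite /coef /in_D /in_dec /right_bridge => H.
have e1 (b1 b2 : bool) : [&& active x k, resolves x k y, b1 & b2] = false.
  by move: H; case: (active x k); case: (resolves x k y).
have e2 (b1 b2 : bool) : [&& active x k & b1] && (resolves x k y && b2) = false.
  by move: H; case: (active x k); case: (resolves x k y) => //; rewrite ?andbF.
by rewrite !e1 e2 !addr0.
Qed.

Section OneCrossing.
Variables (x y : state D) (k : 'I_c).
Hypotheses (act : active x k) (res : resolves x k y).
Notation p := (foot1 k).
Notation q := (foot2 k).

Lemma bd_same : lnk (bd y) = lnk (bd x) -> (bd y == bd x) = [forall i, sgn (bd y) i == sgn (bd x) i].
Proof.
move=> L; apply/eqP/forallP => [-> i //|H]; apply: vertexP => //.
by apply/ffunP => i; exact/eqP.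
Qed.

Lemma coef_free : free x p && free x q -> coef x k y =
  if [&& agree_strands x y k, mult_rule (same_strand x p q) (esign x p) (esign x q) (esign y p) (esign y q)
       & bd y == bd x] then idem (bd x) else 0.
Proof.
case/andP=> fp fq; have [a [a2 [d [d2 [ex [s1 s1'] [f1 f2] [f1' f2']]]]]] := res_bits act res.
have rm : rmatch y = rmatch x.
  apply: (res_rmatch res); rewrite s1' f1'.
  by move: fp; rewrite f1; case: (a); case: (a2); case: (d); case: (d2).
have L : lnk (bd y) = lnk (bd x) by rewrite !lnk_bd rm (res_lmatch res).
have aB : agree_boundary x y k = (bd y == bd x).
  rewrite (bd_same L); apply: eq_forallb => i.
  have off u : free x u -> same_circle x u (inl i) = false.
    move=> fu; rewrite [LHS](sc_free _ _ fu); apply/negbTE.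
    by move/forallP/(_ i): fu.
  by rewrite !off.
rewrite /coef act res /= /right_bridge fp /= !andbF /= addr0.
rewrite /in_dec res fp fq /= if_same !andbF addr0.
rewrite /in_D res fp fq (agree_off_split res) aB /= /mult_rule.
case: (same_strand x p q) => /=; case: eqP => [->|_]; rewrite ?andbF // idem_idem;
by rewrite !andbT.
Qed.

Lemma coef_bridge : right_bridge x k -> coef x k y =
  if agree_free x y then edge (bd x) (Br false (right_arcs x k)) (bd y) else 0.
Proof.
move=> rb; rewrite /coef rb act res /=; case/and4P: rb => _ nss /negPf np /negPf nq.
rewrite /in_D /in_dec np nq (negPf nss) /= !andbF /= addr0 add0r; done.
Qed.

(** * A foot on an arc, the other on a free circle before or after the change *)

Section Arc.
Variables (r r' : E) (t : 'I_n.*2).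
Hypothesis feet : r = p /\ r' = q \/ r = q /\ r' = p.
Hypothesis rt : same_strand x r (inl t).
Hypothesis fr' : if same_strand x p q then free y r' else free x r'.

Let nfr : ~~ free x r. Proof. exact: boundary_not_free rt. Qed.

(** The configurations left by [res_bits]: if the feet are joined before the change, [r'] becomes
    free, otherwise it was free and becomes joined to r. In both cases r keeps its end t. *)
Lemma arc_facts :
  [/\ same_strand x r r' = same_strand x p q,
      if same_strand x p q then [/\ ~~ free x r', free y r' & ~~ free y r]
      else [/\ free x r', ~~ free y r', ~~ free y r & same_strand y r r'],
      rmatch y = rmatch x & same_strand y r (inl t)].
Proof.
have SX := ss_eqv (smoothing x); have SY := ss_eqv (smoothing y).
have [a [a2 [d [d2 [ex [s1 s1'] [f1 f2] [f1' f2']]]]]] := res_bits act res.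
have E0 : same_strand x r r' = same_strand x p q.
  by case: feet => -[-> ->] //; exact: (eqv_sym SX).
have F : if same_strand x p q then [/\ ~~ free x r', free y r' & ~~ free y r]
      else [/\ free x r', ~~ free y r', ~~ free y r & same_strand y r r'].
  have E1 : same_strand y r r' = (a || a2).
    by rewrite -s1'; case: feet => -[-> ->] //; exact: (eqv_sym SY).
  rewrite E1; move: nfr fr' ex; case: feet => -[-> ->]; rewrite s1 f1 f2 f1' f2';
  by case: (a); case: (a2); case: (d); case: (d2).
have H : same_strand y r r' || free y r'.
  by move: F; case: (same_strand x p q) => -[] // *; apply/orP; [right|left].
split=> //.
  apply: (res_rmatch res); case: feet H => -[-> ->] /orP [] h; rewrite ?h ?orbT //.
  by have -> : same_strand y p q by exact: etrans (eqv_sym SY _ _) h.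
have U : same_strand y r (inl t) || same_strand y r' (inl t).
  have := res_union res (inl t).
  by case: feet rt => -[-> ->] -> /=; rewrite ?orbT => /esym; rewrite // orbC.
case/orP: U => // h; case/orP: H => [rr|/forallP/(_ t)]; last by rewrite h.
exact: etrans (eqv_left SY rr _) h.
Qed.

Let L : lnk (bd y) = lnk (bd x).
Proof. by have [_ _ rm _] := arc_facts; rewrite !lnk_bd rm (res_lmatch res). Qed.

Let circles i : same_circle x p (inl i) || same_circle x q (inl i) = linkeq (lnk (bd x)) t i.
Proof.
have SC := sc_eqv (smoothing x) (lmatch x).
have -> : same_circle x p (inl i) || same_circle x q (inl i) =
    same_circle x r (inl i) || same_circle x r' (inl i).
  by case: feet => -[-> ->] //; rewrite orbC.
have Er : same_circle x r (inl i) = linkeq (lnk (bd x)) t i.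
  by rewrite -circle_boundary; exact: (eqv_left SC (ss_sc _ rt)).
have [E0 F _ _] := arc_facts; move: F; rewrite -E0; case: ifP => [rr _|_ [f _ _ _]].
  have -> : same_circle x r' (inl i) = same_circle x r (inl i).
    by apply/esym; exact: (eqv_left SC (ss_sc _ rr)).
  by rewrite orbb.
have -> : same_circle x r' (inl i) = false; last by rewrite orbF.
by rewrite [LHS](sc_free _ _ f); apply/negbTE; move/forallP/(_ i): f.
Qed.

Let aBE : agree_boundary x y k = [forall i, linkeq (lnk (bd x)) t i || (sgn (bd y) i == sgn (bd x) i)].
Proof. by apply: eq_forallb => i; rewrite orbA circles. Qed.

Lemma arc_same : (bd y == bd x) = agree_boundary x y k && (sgn (bd y) t == sgn (bd x) t).
Proof.
rewrite (bd_same L) aBE; apply/forallP/andP => [H|[/forallP H /eqP Et] i].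
  by split; [apply/forallP => i; rewrite H orbT|exact: H].
have := H i; case: (boolP (linkeq _ t i)) => // ti _; have ti' := ti; rewrite -L in ti'.
by rewrite -(sgn_eq ti) -(sgn_eq ti') Et.
Qed.

Lemma arc_dec : is_edge (bd x) (De false (circ (lnk (bd x)) t)) (bd y) =
  [&& agree_boundary x y k, sgn (bd x) t & ~~ sgn (bd y) t].
Proof.
have LE := linkeq_eqv (lnk (bd x)).
rewrite /is_edge /= decoration_edgeE L eqxx /= /lower sgn_constant aBE /=.
apply/andP/and3P => [[xt /eqP Ey]|[/forallP H xt nyt]].
  split=> //; last by rewrite Ey ffunE (eqv_refl LE).
  by apply/forallP => i; rewrite Ey ffunE; case: (linkeq _ t i) => //=.
split=> //; apply/eqP/ffunP => i; rewrite [RHS]ffunE; have := H i.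
case: (boolP (linkeq _ t i)) => [ti _|_ /eqP -> //].
by have ti' := ti; rewrite -L in ti'; rewrite -(sgn_eq ti') (negPf nyt).
Qed.

Lemma arc_circle : foot_circle x k = circ (lnk (bd x)) t.
Proof.
have SC := sc_eqv (smoothing x) (lmatch x).
apply/setP => i; rewrite inE mem_circ.
set u := if _ then _ else _; suff ur : same_circle x r u.
  by rewrite -circle_boundary; exact: etrans (esym (eqv_left SC ur _)) (eqv_left SC (ss_sc _ rt) _).
rewrite /u; have [E0 F _ _] := arc_facts; move: F nfr; rewrite -E0; case: feet => -[-> ->].
  by move=> _ /negPf ->; exact: (eqv_refl SC).
case: ifP => [rr [/negPf -> _ _] _|_ [-> _ _ _] _]; last exact: (eqv_refl SC).
exact: ss_sc.
Qed.

(** An absorbed free circle multiplies by 1 or X; a new one receives X or 1 from the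
    comultiplication, leaving 1 or X to the arc. So the coefficient is an idempotent or a decoration
    edge. *)
Lemma coef_arc : coef x k y =
  if agree_strands x y k then
    if (if same_strand x p q then ~~ esign y r' else esign x r') then
      if bd y == bd x then idem (bd x) else 0
    else edge (bd x) (De false (circ (lnk (bd x)) t)) (bd y)
  else 0.
Proof.
have [E0 F _ yt] := arc_facts.
have xr : esign x r = sgn (bd x) t by rewrite sgn_bd; exact: esign_strand.
have yr : esign y r = sgn (bd y) t by rewrite sgn_bd; exact: esign_strand.
rewrite /coef act res -arc_circle.
have nr := nfr.
have -> : right_bridge x k = false.
  rewrite /right_bridge; move: F; case: (same_strand x p q); first by rewrite andbF.
  by case=> f _ _ _; case: feet f => -[_ ->] ->; rewrite ?andbF.
have inD : in_D x k y = [&& agree_strands x y k,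
    (if same_strand x p q then ~~ esign y r' else esign x r') & bd y == bd x].
  rewrite arc_same -xr -yr /in_D res (agree_off_split res) /=.
  case: (agree_strands x y k) => //=; case: (agree_boundary x y k) => /=; last by rewrite andbF.
  move: F nr; case: feet => -[-> ->]; case: (same_strand x p q) => /= -[f1 f2 f3] => [|_];
  by move=> f0; rewrite ?(negPf f0) ?f1 ?f2 ?(negPf f1) ?(negPf f2) ?(negPf f3).
have pq : same_strand x p q -> esign x p = esign x q by exact: esign_strand.
have inde : in_dec x k y = [&& agree_strands x y k,
    ~~ (if same_strand x p q then ~~ esign y r' else esign x r') &
    is_edge (bd x) (De false (circ (lnk (bd x)) t)) (bd y)].
  rewrite arc_dec -xr -yr /in_dec res (agree_off_split res) /=.
  case: (agree_strands x y k) => //=; case: (agree_boundary x y k) => /=; last by rewrite andbF.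
  move: F nr pq; case: feet => -[-> ->]; case: (same_strand x p q) => /= -[f1 f2 f3] => [|_];
  move=> f0; rewrite ?(negPf f0) ?f1 ?f2 ?(negPf f1) ?(negPf f2) ?(negPf f3) //=.
  - by move=> _; rewrite negbK andbCA.
  - by rewrite andbCA.
  - by move=> ->; rewrite // negbK andbCA.
  by rewrite andbCA.
rewrite inD inde !andTb addr0 arc_circle.
case: (agree_strands x y k); last by rewrite /= addr0.
move: (if same_strand x p q then ~~ esign y r' else esign x r') => u; case: u => /=; last first.
  apply: etrans (add0r _) _; by case: ifP => // /negbT /edge0 ->.
rewrite addr0; case: eqP => // ->; exact: idem_idem.
Qed.
End Arc.
End OneCrossing.
End Coefficients.

(** * Crossing changes follow the Frobenius rule *)

Section CrossingEdge.
Variables (n : nat) (D : diagram n).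
Notation c := (ncr D).
Notation E := (ends n c).

(** One rule on all circles, free or cleaved, in place of the separate cases of [in_D], [in_dec] and
    right bridges. *)
Definition crossing_edge (x : state D) (k : 'I_c) (y : state D) :=
  [&& active x k, resolves x k y &
      edgeK (same_circle x) (same_circle y) (foot1 k) (foot2 k) (esign x) (esign y)].

Section OneCrossing.
Variables (x y : state D) (k : 'I_c).
Hypotheses (act : active x k) (res : resolves x k y).
Notation p := (foot1 k).
Notation q := (foot2 k).

Lemma crossing_edgeE : crossing_edge x k y =
  [&& agree_strands x y k, agree_boundary x y k &
      mult_rule (same_circle x p q) (esign x p) (esign x q) (esign y p) (esign y q)].
Proof.
rewrite /crossing_edge act res /edgeK !esign_constant /= andbA -(agree_off_split res).
congr andb; apply: eq_forallb => t.
by case: (same_circle x p t); case: (same_circle x q t).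
Qed.

Lemma crossing_cases :
  [\/ free x p && free x q, right_bridge x k |
   exists r r' t, [/\ r = p /\ r' = q \/ r = q /\ r' = p, same_strand x r (inl t) &
                   if same_strand x p q then free y r' else free x r']].
Proof.
have [a [a2 [d [d2 [ex [s1 s1'] [f1 f2] [f1' f2']]]]]] := res_bits act res.
case: (boolP (free x p)) => fp.
  case: (boolP (free x q)) => fq; first by constructor 1.
  constructor 3; have [t qt] := not_free fq; exists q, p, t; split=> //; first by right.
  move: ex fp fq; rewrite s1 f1 f2 f1'.
  by case: (a); case: (a2); case: (d); case: (d2).
have [t pt] := not_free fp.
case: (boolP (free x q)) => fq.
  constructor 3; exists p, q, t; split=> //; first by left.
  move: ex fp fq; rewrite s1 f1 f2 f2'.
  by case: (a); case: (a2); case: (d); case: (d2).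
case: (boolP (same_strand x p q)) => pq; last by constructor 2; rewrite /right_bridge act pq fp fq.
constructor 3; case: (boolP (free y q)) => fq'.
  by exists p, q, t; split=> //; left.
have [u qu] := not_free fq.
exists q, p, u; split=> //; first by right.
move: ex fp fq pq fq'; rewrite s1 f1 f2 f1' f2'.
by case: (a); case: (a2); case: (d); case: (d2).
Qed.

Lemma free_same : free x p && free x q -> agree_boundary x y k = (bd y == bd x).
Proof.
case/andP=> fp fq; have [a [a2 [d [d2 [ex [s1 s1'] [f1 f2] [f1' f2']]]]]] := res_bits act res.
have rm : rmatch y = rmatch x.
  apply: (res_rmatch res); rewrite s1' f1'.
  by move: fp; rewrite f1; case: (a); case: (a2); case: (d); case: (d2).
have L : lnk (bd y) = lnk (bd x) by rewrite !lnk_bd rm (res_lmatch res).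
rewrite (bd_same L); apply: eq_forallb => i.
have off u : free x u -> same_circle x u (inl i) = false.
  move=> fu; rewrite [LHS](sc_free _ _ fu); apply/negbTE.
  by move/forallP/(_ i): fu.
by rewrite !off.
Qed.

Lemma bridge_boundary : right_bridge x k ->
  [/\ agree_strands x y k = agree_free x y, is_bridge (rmatch x) (right_arcs x k),
      surg (rmatch x) (right_arcs x k) = rmatch y &
      is_edge (bd x) (Br false (right_arcs x k)) (bd y) =
      agree_boundary x y k &&
      mult_rule (same_circle x p q) (esign x p) (esign x q) (esign y p) (esign y q)].
Proof.
case/and4P=> _ nss np nq; have [a [a2 [d [d2 [ex [s1 s1'] [f1 f2] [f1' f2']]]]]] := res_bits act res.
have SC := sc_eqv (smoothing x) (lmatch x); have SE := ss_eqv (smoothing x).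
have [n1 n2 n3] : [/\ ~~ same_strand y p q, ~~ free y p & ~~ free y q].
  move: nss np nq; rewrite s1 f1 f2 s1' f1' f2'.
  by case: (a); case: (a2); case: (d); case: (d2).
have [u [v [br sg qd /andP [pu pu'] /andP [qv qv']]]] := res_surg act res n1 n2 n3.
split=> //.
  rewrite /agree_free (res_lsign res) eqxx; apply: eq_forallb => t.
  case: (boolP (free x t)) => [ft|_]; last by rewrite !implybT.
  have off w : ~~ free x w -> same_strand x w t = false.
    move=> nw; apply/negbTE; apply: contra nw => wt.
    by apply: etrans ft; exact: free_eq.
  by rewrite !off.
have Eu i : same_circle x p (inl i) = linkeq (lnk (bd x)) u i.
  by rewrite -circle_boundary; exact: (eqv_left SC (ss_sc _ pu)).
have Ev i : same_circle x q (inl i) = linkeq (lnk (bd x)) v i.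
  by rewrite -circle_boundary; exact: (eqv_left SC (ss_sc _ qv)).
have Epq : same_circle x p q = linkeq (lnk (bd x)) u v.
  by rewrite -Eu; exact: (eqv_right SC _ (ss_sc _ qv)).
have EL : lnk (bd y) == surgL (lnk (bd x)) false (right_arcs x k).
  by rewrite /surgL !lnk_bd /= sg (res_lmatch res).
have qd' : quad (half (lnk (bd x)) false) (right_arcs x k) u v by [].
rewrite /is_edge -[if _ then _ else _]/(bridge_edge (bd x) false (right_arcs x k) (bd y)).
rewrite (bridge_edgeE _ qd') EL br /edgeK !sgn_constant /= Epq.
rewrite (esign_strand pu) (esign_strand qv) (esign_strand pu') (esign_strand qv') -!sgn_bd.
congr andb; apply: eq_forallb => i; rewrite Eu Ev.
by case: (linkeq _ u i); case: (linkeq _ v i).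
Qed.

Lemma arc_edge r r' t : r = p /\ r' = q \/ r = q /\ r' = p -> same_strand x r (inl t) ->
  (if same_strand x p q then free y r' else free x r') ->
  crossing_edge x k y = agree_strands x y k &&
    (if (if same_strand x p q then ~~ esign y r' else esign x r') then bd y == bd x
     else is_edge (bd x) (De false (circ (lnk (bd x)) t)) (bd y)).
Proof.
move=> feet rt f; rewrite crossing_edgeE (arc_same act res feet rt f) (arc_dec act res feet rt f).
congr andb; case: (agree_boundary x y k); last by rewrite /= if_same.
have [E0 F _ yt] := arc_facts act res feet rt f.
have xr : esign x r = sgn (bd x) t by rewrite sgn_bd; exact: esign_strand.
have yr : esign y r = sgn (bd y) t by rewrite sgn_bd; exact: esign_strand.
rewrite -xr -yr /=.
have pq : same_circle x p q = same_strand x p q.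
  apply/idP/idP; last exact: ss_sc.
  have SC := sc_eqv (smoothing x) (lmatch x); have SE := ss_eqv (smoothing x).
  move: F; case: ifP => // npq [fr' _ _ _] H; rewrite -npq.
  case: feet fr' => -[_ ->] fr'; last by rewrite -[same_strand _ _ _](sc_free (lmatch x) _ fr').
  apply: etrans (eqv_sym SE _ _) _; rewrite -[ss _ _ _](sc_free (lmatch x) _ fr').
  by apply: etrans (eqv_sym SC _ _) H.
rewrite pq /mult_rule; move: F; case: (boolP (same_strand x p q)) => ss1 /=.
  move=> _; have := esign_strand ss1; case: feet => -[-> ->] => ->.
    by case: (esign x q); case: (esign y p); case: (esign y q).
  by case: (esign x q); case: (esign y p); case: (esign y q).
case=> _ _ _ /esign_strand; case: feet => -[-> ->] => ->.
  by case: (esign x p); case: (esign x q); case: (esign y p); case: (esign y q).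
by case: (esign x p); case: (esign x q); case: (esign y p); case: (esign y q).
Qed.
End OneCrossing.

(** In each kind of crossing, the part of the rule concerning free circles decides whether the term
    occurs, and the part concerning cleaved circles is a path of length at most one in Gamma. *)
Lemma coef_edge x k y : if crossing_edge x k y then rstep (bd x) (bd y) (coef x k y)
  else coef x k y = 0.
Proof.
case: (boolP (active x k && resolves x k y)) => [/andP [act res]|n1]; last first.
  have -> : crossing_edge x k y = false by rewrite /crossing_edge andbA (negPf n1).
  exact: coef0.
have [f|rb|[r [r' [t [feet rt f]]]]] := crossing_cases act res.
- rewrite (coef_free act res f) (crossing_edgeE act res) (free_same act res f).
  have -> : same_circle x (foot1 k) (foot2 k) = same_strand x (foot1 k) (foot2 k).
    by case/andP: f => f _; exact: (sc_free _ _ f).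
  rewrite [(bd y == _) && _]andbC; 
  case: (boolP [&& agree_strands x y k, _ & bd y == bd x]) => [/and3P [_ _ /eqP h]|_ //].
  exact: RId.
- have [e1 br sg e2] := bridge_boundary act res rb.
  rewrite (coef_bridge act res rb) (crossing_edgeE act res) -e2 e1.
  case: (agree_free x y) => //=; case: ifP => [|/negbT /edge0 //]; exact: RBr.
rewrite (arc_edge act res feet rt f) (coef_arc act res feet rt f).
case: (agree_strands x y k) => //=.
move: (if same_strand x (foot1 k) (foot2 k) then ~~ esign y r' else esign x r') => u; case: u => /=; last by case: ifP => [|/negbT /edge0 //]; exact: RDec.
by case: eqP => // h; exact: RId.
Qed.
End CrossingEdge.

(** * Two crossings anticommute *)

Section TwoCrossings.
Variables (n : nat) (D : diagram n).
Notation c := (ncr D).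
Notation E := (ends n c).
Implicit Types (x y z : state D) (k l : 'I_c).

Lemma rmatch_step x k y : active x k -> resolves x k y ->
  if right_bridge x k then is_bridge (rmatch x) (right_arcs x k) /\
    rmatch y = surg (rmatch x) (right_arcs x k)
  else rmatch y = rmatch x.
Proof.
move=> act res; case: ifP => [rb|nrb].
  by have [_ br -> _] := bridge_boundary act res rb.
have [a [a2 [d [d2 [ex [s1 s1'] [f1 f2] [f1' f2']]]]]] := res_bits act res.
apply: (res_rmatch res); move: nrb ex; rewrite /right_bridge act s1 f1 f2 s1' f1' f2'.
by case: (a); case: (a2); case: (d); case: (d2).
Qed.

Lemma bridge_step x k y A : active x k -> resolves x k y ->
  is_edge (bd x) (Br false A) (bd y) -> A = right_arcs x k.
Proof.
move=> act res e; have br : is_bridge (rmatch x) A := bridge_is_bridge e.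
have Er : rmatch y = surg (rmatch x) A by case: (bridge_lnk e).
have := rmatch_step act res; case: ifP => [_ [br' Er']|_ Er'].
  by rewrite -(surg_diff br) -Er Er' (surg_diff br').
by case: (br_surg_neq br); rewrite -Er.
Qed.

Lemma resolved_twice x k y l z : active x k -> resolves x k y -> active y l -> resolves y l z ->
  [/\ k != l, active x l & smoothing z = [ffun i => [|| i == l, i == k | smoothing x i]]].
Proof.
move=> ax /and3P [/eqP Ey _ _] ay /and3P [/eqP Ez _ _].
move: ay; rewrite /active Ey ffunE negb_or => /andP [lk al]; split=> //; first by rewrite eq_sym.
by rewrite Ez; apply/ffunP => i; rewrite !ffunE Ey ffunE.
Qed.

(** Strands away from k survive its change, so the arcs at l in y lie among those at l in x, which
    form A. Hence the second bridge is dual to the first. *)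
Lemma two_bridges x k l y y' z A B :
  active x k -> resolves x k y -> active y l -> resolves y l z ->
  active x l -> resolves x l y' ->
  is_edge (bd x) (Br false A) (bd y) -> is_edge (bd y) (Br false B) (bd z) ->
  is_edge (bd x) (Br false A) (bd y') -> lnk (bd z) = lnk (bd x).
Proof.
move=> ax rx ay ry ax' rx' e1 e2 e3.
have Ak := bridge_step ax rx e1; have Al := bridge_step ax' rx' e3.
have Bl := bridge_step ay ry e2; have brA : is_bridge (rmatch x) A := bridge_is_bridge e1.
have brB : is_bridge (rmatch y) B := bridge_is_bridge e2.
have E1 : rmatch y = surg (rmatch x) A by case: (bridge_lnk e1).
have E2 : rmatch z = surg (rmatch y) B by case: (bridge_lnk e2).
have BA : B = A.
  apply/eqP; rewrite eqEcard (bridge_card brA) (bridge_card brB) leqnn andbT.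
  apply/subsetP => i; rewrite Bl inE => iB; apply: contraT => iA.
  have off : ~~ (same_strand x (foot1 k) (inl i) || same_strand x (foot2 k) (inl i)).
    by move: iA; rewrite Ak inE.
  have SX := ss_eqv (smoothing x); have SY := ss_eqv (smoothing y).
  have tr u : same_strand y u (inl i) = same_strand x u (inl i).
    apply: etrans (eqv_sym SY _ _) _; apply: etrans (eqv_sym SX _ _).
    by rewrite -[LHS](res_strand_off rx u off).
  by case/negP: iA; rewrite Al inE -!tr.
rewrite !lnk_bd E2 E1 BA (proj2 (surgK brA)).
by rewrite (res_lmatch ry) (res_lmatch rx).
Qed.

Definition resolve (rho : {ffun 'I_c -> bool}) k := [ffun l => (l == k) || rho l].

(** Smoothings and matchings of the middle state are prescribed, so only its decoration is
    counted. *)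
Lemma step_card x k l z : k != l -> active x k -> active x l ->
  smoothing z = resolve (resolve (smoothing x) k) l -> lmatch z = lmatch x -> lsign z = lsign x ->
  #|[set y | crossing_edge x k y && crossing_edge y l z]| =
  #|[set g | edgeK (sc (smoothing x) (lmatch x)) (sc (resolve (smoothing x) k) (lmatch x))
               (foot1 k) (foot2 k) (esign x) g &&
             edgeK (sc (resolve (smoothing x) k) (lmatch x)) (sc (smoothing z) (lmatch x))
               (foot1 l) (foot2 l) g (esign z)]|.
Proof.
move=> kl ax al Ez Em Es; pose P := [set y | crossing_edge x k y && crossing_edge y l z].
have <- : #|[set esign (state_val y) | y in P]| = #|P|; last first.
  apply: eq_card => g; rewrite inE; apply/imsetP/idP => [[y]|/andP [K1 K2]].
    rewrite inE => /andP [/and3P [_ /and3P [/eqP Ey /eqP Ey' _] K1] /and3P [_ _ K2]] ->.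
    by move: K1 K2; rewrite /same_circle -/(sc _ _) -!/(sc _ _) Ey Ey' Em => -> ->.
  have C : constant_on (sc (resolve (smoothing x) k) (lmatch x)) g by case/and4P: K1.
  have [y [E1 E2 E3 E4]] := state_exists (lsign x) C; exists y => //.
  rewrite inE /crossing_edge ax /resolves /active E1 E2 E4 Em Es /same_circle -!/(sc _ _) E1 E2 E3 Em.
  have e5 : smoothing z == [ffun j => (j == l) || resolve (smoothing x) k j] by rewrite Ez.
  move: al; rewrite /active e5 !eqxx K1 K2 ffunE (eq_sym l) (negPf kl) /= => ->.
  by rewrite ?andbT.
apply: card_in_imset => y y'; rewrite !inE => /andP [/and3P [_ /and3P [/eqP e1 /eqP e2 /eqP e3] _] _].
move=> /andP [/and3P [_ /and3P [/eqP e1' /eqP e2' /eqP e3'] _] _] E1.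
by apply: stateP => //; rewrite ?e1 ?e2 ?e3.
Qed.

Lemma crossings_commute x k l z : k != l ->
  \sum_y coef x k y * coef y l z = \sum_y coef x l y * coef y k z.
Proof.
move=> kl; have zero k' l' y : ~~ (crossing_edge x k' y && crossing_edge y l' z) ->
    coef x k' y * coef y l' z = 0.
  have := coef_edge x k' y; case: ifP => [_ _|_ -> _]; last exact: mul0r.
  by have := coef_edge y l' z; case: ifP => // _ -> _; exact: mulr0.
apply: (@eq_sum_card _ _ (fun y => crossing_edge x k y && crossing_edge y l z)
   (fun y => crossing_edge x l y && crossing_edge y k z)); try exact: zero.
- have good k' l' y : crossing_edge x k' y -> crossing_edge y l' z ->
      [/\ active x k', active x l', smoothing z = resolve (resolve (smoothing x) k') l',
        lmatch z = lmatch x & lsign z = lsign x].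
    case/and3P=> a1 r1 _ /and3P [a2 r2 _]; have [_ a3 Ez] := resolved_twice a1 r1 a2 r2.
    split=> //; last by rewrite (res_lsign r2) (res_lsign r1).
      by rewrite Ez; apply/ffunP => i; rewrite !ffunE.
    by rewrite (res_lmatch r2) (res_lmatch r1).
  have comm : resolve (resolve (smoothing x) l) k = resolve (resolve (smoothing x) k) l.
    by apply/ffunP => i; rewrite !ffunE orbCA.
  case: (boolP [&& active x k, active x l, smoothing z == resolve (resolve (smoothing x) k) l,
      lmatch z == lmatch x & lsign z == lsign x]) => [/and5P [ak al /eqP Ez /eqP Em /eqP Es]|N].
    rewrite (step_card kl ak al Ez Em Es) step_card // 1?eq_sym // 1?comm //.
    have sg (r r' : {ffun 'I_c -> bool}) j : r' = resolve r j -> ~~ r j ->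
        surgery (sc r (lmatch x)) (sc r' (lmatch x)) (foot1 j) (foot2 j).
      move=> -> nj; rewrite foot2E; apply: closed_surgery; last by rewrite ffunE eqxx nj.
      by move=> i ij; rewrite ffunE (negPf ij).
    apply: edge_square_card; apply: sg => //.
    + by rewrite ffunE (eq_sym l) (negPf kl).
    + by rewrite Ez -comm.
    by rewrite ffunE (negPf kl).
  rewrite !(@eq_card0 _ _) // => y; rewrite inE; apply/negP => /andP [e1 e2]; case/negP: N.
    by have [-> -> -> -> ->] := good _ _ _ e1 e2; rewrite comm !eqxx.
  by have [-> -> -> -> ->] := good _ _ _ e1 e2; rewrite !eqxx.
move=> y y' /andP [e1 e2] /andP [e3 e4].
have := coef_edge x k y; rewrite e1 => s1; have := coef_edge y l z; rewrite e2 => s2.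
have := coef_edge x l y'; rewrite e3 => s3; have := coef_edge y' k z; rewrite e4 => s4.
apply: right_square s1 s2 s3 s4 _ => A B B' b1 b2 b3 b4.
case/and3P: e1 => a1 r1 _; case/and3P: e2 => a2 r2 _; case/and3P: e3 => a3 r3 _.
exact: two_bridges a1 r1 a2 r2 a3 r3 b1 b2 b3.
Qed.

Lemma later_step x k y l : active x k -> resolves x k y -> l != k ->
  later y l = ((l < k) + later x l)%N.
Proof.
move=> ax /and3P [/eqP Ey _ _] lk; rewrite /later Ey.
have -> : [set j : 'I_c | (l < j)%N && [ffun i => (i == k) || smoothing x i] j] =
    [set j in [set k] | (l < j)%N] :|: [set j : 'I_c | (l < j)%N && smoothing x j].
  by apply/setP => j; rewrite !inE ffunE; case: (j == k); case: (l < j)%N.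
rewrite cardsU (_ : _ :&: _ = set0) ?cards0 ?subn0; last first.
  apply/setP => j; rewrite !inE; case: eqP => // ->; move: ax; rewrite /active => /negPf ->.
  by rewrite !andbF.
congr (_ + _)%N; case: (boolP (l < k)%N) => lt.
  by rewrite (_ : [set j in [set k] | _] = [set k]) ?cards1 //; apply/setP => j; rewrite !inE; case: eqP => // ->.
by rewrite (_ : [set j in [set k] | _] = set0) ?cards0 //; apply/setP => j; rewrite !inE; case: eqP => // ->; apply/negbTE.
Qed.

Lemma opposite_signs (V : zmodType) (a b : V) i j : a = b -> odd i = ~~ odd j ->
  a *~ sg i = - (b *~ sg j).
Proof.
move=> -> Eij; rewrite /sg -signr_odd Eij -[in RHS]signr_odd.
by case: (odd j); rewrite /= ?expr0 ?expr1 ?mulrN1z ?mulr1z ?opprK.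
Qed.

Definition right_coef x y : BG n := \sum_k coef x k y *~ sg (later x k).

Lemma right_right x z : \sum_y right_coef x y * right_coef y z = 0.
Proof.
pose F k l := (\sum_y coef x k y * coef y l z) *~ sg ((l < k) + later x l + later x k).
have E1 y k l : (coef x k y *~ sg (later x k)) * (coef y l z *~ sg (later y l)) =
    (coef x k y * coef y l z) *~ sg ((l < k) + later x l + later x k).
  have := coef_edge x k y; case: ifP => [/and3P [ax rx _] _|_ ->]; last first.
    by rewrite mul0rz !mul0r mul0rz.
  have := coef_edge y l z; case: ifP => [/and3P [ay ry _] _|_ ->]; last first.
    by rewrite mul0rz !mulr0 mul0rz.
  have [kl _ _] := resolved_twice ax rx ay ry.
  rewrite -(later_step ax rx) 1?eq_sym // -mulz_sgD.
  by rewrite mulrzAl mulrzAr.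
have F0 k : F k k = 0.
  suff Z : \sum_y coef x k y * coef y k z = 0 by rewrite /F Z mul0rz.
  apply: big1 => y _; have := coef_edge x k y; case: ifP => [/and3P [ax rx _] _|_ ->]; last exact: mul0r.
  have := coef_edge y k z; case: ifP => [/and3P [ay ry _] _|_ ->]; last exact: mulr0.
  by have [] := resolved_twice ax rx ay ry; rewrite eqxx.
apply: etrans (antisym_sum F0 _).
  have T1 y : right_coef x y * right_coef y z =
      \sum_k \sum_l (coef x k y * coef y l z) *~ sg ((l < k) + later x l + later x k).
    apply: etrans (mulr_suml _ _ _ _) _; apply: eq_bigr => k _.
    apply: etrans (mulr_sumr _ _ _ _) _; apply: eq_bigr => l _; exact: E1.
  apply: etrans (eq_bigr _ (fun y _ => T1 y)) _.
  apply: etrans (exchange_big _ _ _ _ _ _) _; apply: eq_bigr => k _.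
  apply: etrans (exchange_big _ _ _ _ _ _) _; apply: eq_bigr => l _.
  exact/esym/mulrz_suml.
move=> k l; have [->|kl] := eqVneq k l; first by rewrite F0; exact/esym/oppr0.
(* Exactly one of l < k and k < l holds, and the rest of the exponent is symmetric in k and l. *)
apply: (opposite_signs (crossings_commute x z kl)); move: kl; rewrite -val_eqE /= !oddD /= !oddb.
by case: (ltngtP k l) => //= _ _; case: (odd (later x k)); case: (odd (later x l)).
Qed.
End TwoCrossings.

Lemma sum_add (V : zmodType) (T : finType) (F G : T -> V) :
  \sum_t (F t + G t) = \sum_t F t + \sum_t G t.
Proof. by rewrite big_split. Qed.

Lemma sum_single (V : zmodType) (T : finType) (F : T -> V) i :
  (forall j, j != i -> F j = 0) -> \sum_j F j = F i.
Proof. by move=> H; rewrite (bigD1 i) //= big1 ?addr0. Qed.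

(** * Matrices commuting with the left edges *)

Section LeftSteps.
Variable n : nat.
Implicit Types v w u : vertex n.

Definition left_step v w : BG n := lbridge v w + ldec v w.

(** Commutation of matrices indexed by vertices. States do not occur here; [coef_factor] shows that
    crossings act through such matrices. *)
Definition commutes (f : vertex n -> vertex n -> BG n) := forall v u,
  \sum_w f v w * left_step w u = \sum_w left_step v w * f w u.

Lemma bridge_exch (f : vertex n -> vertex n -> BG n) v u :
  (forall A, \sum_w f v w * edge w (Br true A) u = \sum_w edge v (Br true A) w * f w u) ->
  \sum_w f v w * lbridge w u = \sum_w lbridge v w * f w u.
Proof.
move=> H; apply: etrans (mulr_sum_exch (fun A w => edge w (Br true A) u) (f v)) _.
apply: etrans _ (esym (mull_sum_exch (fun A w => edge v (Br true A) w) (f ^~ u))).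
by apply: eq_bigr => A _; exact: H.
Qed.

Lemma commutes_split (f : vertex n -> vertex n -> BG n) :
  (forall v u, \sum_w f v w * lbridge w u = \sum_w lbridge v w * f w u) ->
  (forall v u, \sum_w f v w * ldec w u = \sum_w ldec v w * f w u) -> commutes f.
Proof.
move=> E1 E2 v u.
have L : \sum_w f v w * left_step w u = \sum_w f v w * lbridge w u + \sum_w f v w * ldec w u.
  by apply: etrans _ (sum_add _ _); apply: eq_bigr => w _; exact: mulrDr.
have R : \sum_w left_step v w * f w u = \sum_w lbridge v w * f w u + \sum_w ldec v w * f w u.
  by apply: etrans _ (sum_add _ _); apply: eq_bigr => w _; exact: mulrDl.
apply: etrans L _; apply: etrans _ (esym R); exact: congr2 (E1 v u) (E2 v u).
Qed.

Lemma commutes0 : commutes (fun _ _ => 0).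
Proof.
move=> v u; apply: (@etrans _ _ 0); first by apply: big1 => w _; exact: mul0r.
by apply: esym; apply: big1 => w _; exact: mulr0.
Qed.

Lemma commutes_idem : commutes (fun v w => if w == v then idem v else 0).
Proof.
have idl v w : idem v * left_step v w = left_step v w.
  rewrite /left_step /lbridge /ldec mulrDr; congr (_ + _).
    by apply: etrans (mulr_sumr _ _ _ _) _; apply: eq_bigr => A _; exact: idem_edge.
  by apply: etrans (mulr_sumr _ _ _ _) _; apply: eq_bigr => A _; exact: idem_edge.
have idr v w : left_step v w * idem w = left_step v w.
  rewrite /left_step /lbridge /ldec mulrDl; congr (_ + _).
    by apply: etrans (mulr_suml _ _ _ _) _; apply: eq_bigr => A _; exact: edge_idem.
  by apply: etrans (mulr_suml _ _ _ _) _; apply: eq_bigr => A _; exact: edge_idem.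
move=> v u; pose F w := (if w == v then idem v else 0) * left_step w u.
pose G w := left_step v w * (if u == w then idem w else 0).
have EF : \sum_w F w = left_step v u.
  rewrite (@sum_single _ _ F v) /F ?eqxx // => w /negPf ->; exact: mul0r.
have EG : \sum_w G w = left_step v u.
  rewrite (@sum_single _ _ G u) /G ?eqxx // => w; rewrite eq_sym => /negPf ->; exact: mulr0.
exact: etrans EF (esym EG).
Qed.

Lemma commutes_rdec t : commutes (rdec t).
Proof.
apply: commutes_split => v u; last exact: rdec_ldec.
by apply: bridge_exch => A; exact: rdec_bridge.
Qed.

Lemma commutes_bridge B : commutes (fun v w => edge v (Br false B) w).
Proof.
apply: commutes_split => v u; first by apply: (@bridge_exch (fun v w => edge v (Br false B) w)) => A; exact: left_right_swap.
have := ldec_bridge false B v u; rewrite /= mulz_sg1 => /eqP; rewrite subr_eq0 => /eqP H.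
exact: esym H.
Qed.

Lemma left_step_right v w : left_step v w <> 0 -> (lnk w).2 = (lnk v).2.
Proof.
move=> N; apply: contrapT => nE; apply: N; rewrite /left_step /lbridge /ldec.
apply: etrans _ (addr0 0); congr (_ + _); apply: big1 => A _; apply: edge0; apply/negP => e.
  by apply: nE; rewrite (bridge_lnk e).
by apply: nE; rewrite (decoration_lnk e).
Qed.
End LeftSteps.

(** * States with fixed right-hand data *)

Section RightData.
Variables (n : nat) (D : diagram n).
Notation c := (ncr D).
Notation E := (ends n c).
Implicit Types (x y z : state D) (k l : 'I_c).

Definition same_right x y := (smoothing y == smoothing x) && agree_free x y.

Lemma same_rightP x y : reflect
  [/\ smoothing y = smoothing x, lsign y = lsign x & forall p, free x p -> esign y p = esign x p]
  (same_right x y).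
Proof.
apply: (iffP and3P) => [[/eqP e1 /eqP e2 /forallP H]|[e1 e2 H]].
  by split=> // p fp; have := H p; rewrite fp => /eqP.
split; rewrite ?e1 ?e2 //; apply/forallP => p; apply/implyP => /H ->; exact: eqxx.
Qed.

Lemma free_smoothing x y p : smoothing y = smoothing x -> free y p = free x p.
Proof. by move=> e; rewrite /free /same_strand e. Qed.

Lemma same_right_refl x : same_right x x.
Proof. by apply/same_rightP. Qed.
Lemma same_right_sym x y : same_right x y -> same_right y x.
Proof.
case/same_rightP=> e1 e2 H; apply/same_rightP; split=> // p.
by rewrite (free_smoothing _ e1) => /H.
Qed.

Lemma same_right_state x (w : vertex n) : (lnk w).2 = rmatch x ->
  exists2 y, same_right x y & bd y = w.
Proof.
(* A point on an arc takes its sign from w at a boundary point of the arc; the default p is only met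
   on free circles. *)
move=> Ew; pose base p := odflt p [pick q | same_strand x p q & if q is inl _ then true else false].
have baseP p : ~~ free x p -> exists2 i, base p = inl i & same_strand x p (inl i).
  case/not_free=> i pi; rewrite /base; case: pickP => [[j|j] /andP [pj tj] //|H].
    by exists j.
  by have := H (inl i); rewrite pi.
pose g : {ffun E -> bool} :=
  [ffun p => if free x p then esign x p else if base p is inl i then sgn w i else true].
have C : constant_on (sc (smoothing x) (lnk w).1) g.
  have SC := sc_eqv (smoothing x) (lnk w).1; have SE := ss_eqv (smoothing x).
  apply/constant_onP => p q pq; rewrite !ffunE; case: (boolP (free x p)) => fp.
    have pq' : same_strand x p q by rewrite -[same_strand _ _ _](sc_free (lnk w).1 _ fp).
    have -> : free x q by apply: etrans fp; apply/esym; exact: free_eq.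
    exact: esign_strand.
  case: (boolP (free x q)) => fq; first by case/negP: (sc_notfree (lnk w).1 fp fq).
  have [i -> pi] := baseP _ fp; have [j -> qj] := baseP _ fq.
  apply: sgn_eq; rewrite [lnk w]surjective_pairing Ew -(sc_boundary _ (rmatch_strand x)).
  rewrite -(eqv_left SC (ss_sc _ pi)) -(eqv_right SC _ (ss_sc _ qj)); exact: pq.
have [y [e1 e2 e3 e4]] := state_exists (lsign x) C.
exists y.
  by apply/same_rightP; split=> // p fp; rewrite e3 ffunE fp.
have Er : rmatch y = rmatch x by exact: rmatch_unique.
apply: vertexP; first by rewrite lnk_bd e2 Er -Ew -surjective_pairing.
apply/ffunP => i; rewrite sgn_bd e3 ffunE.
have nf : ~~ free x (inl i) by apply: (boundary_not_free (p := i)); exact: connect0.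
rewrite (negPf nf); have [j -> ij] := baseP _ nf.
apply: sgn_eq; rewrite [lnk w]surjective_pairing Ew.
by rewrite -(sc_boundary _ (rmatch_strand x)) (eqv_sym (sc_eqv _ _)); exact: ss_sc.
Qed.

Lemma same_right_inj x y y' : same_right x y -> same_right x y' -> bd y = bd y' -> y = y'.
Proof.
case/same_rightP=> e1 e2 e3 /same_rightP [e1' e2' e3'] Eb.
have Es : smoothing y = smoothing y' by rewrite e1 e1'.
apply: stateP; rewrite ?e2 ?e2' //; first by have := congr1 (fun v => (lnk v).1) Eb.
apply/ffunP => p; case: (boolP (free x p)) => fp; first by rewrite e3 ?e3'.
have [i pi] := not_free fp.
have yi : same_strand y p (inl i) by rewrite /same_strand e1.
have yi' : same_strand y' p (inl i) by rewrite /same_strand e1'.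
by rewrite (esign_strand yi) (esign_strand yi') -!sgn_bd Eb.
Qed.

(* Once the smoothing and the decorations of the free circles are fixed, states
   are the vertices with the given right matching. *)
Lemma transfer x (g : vertex n -> BG n) :
  \sum_(y | same_right x y) g (bd y) = \sum_(w | (lnk w).2 == rmatch x) g w.
Proof.
have inj : {in [pred y | same_right x y] &, injective (@bd n D)}.
  by move=> y y'; rewrite !inE => h h' /(same_right_inj h h').
apply: etrans (esym (big_imset _ inj)) _; apply: eq_bigl => w; apply/imsetP/eqP.
  by case=> y /andP [/eqP e _] ->; rewrite lnk_bd; exact: rmatch_unique.
by case/same_right_state => y h <-; exists y.
Qed.

Definition left_coef x y : BG n := if same_right x y then left_step (bd x) (bd y) else 0.
End RightData.

(** * Crossings commute with left edges, up to sign *)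

Section CrossingLeft.
Variables (n : nat) (D : diagram n).
Notation c := (ncr D).
Notation E := (ends n c).
Implicit Types (x y z : state D) (k l : 'I_c).

Lemma strand_smoothing x y : smoothing y = smoothing x -> same_strand y = same_strand x.
Proof. by rewrite /same_strand => ->. Qed.

Lemma agree_strands_right x x' y y' k : active x k -> resolves x k y ->
  same_right x x' -> same_right y y' -> agree_strands x' y' k = agree_strands x y k.
Proof.
move=> act res /same_rightP [e1 _ e2] /same_rightP [e3 _ e4].
apply: eq_forallb => t; rewrite (strand_smoothing e1) (free_smoothing t e1).
case: (boolP (same_strand x (foot1 k) t || same_strand x (foot2 k) t)) => //= off.
case: (boolP (free x t)) => //= ft; rewrite e2 // e4 //.
by rewrite -(res_free res off).
Qed.

(** The kind of the crossing and the conditions on free circles depend on the right-hand data only,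
    so one matrix serves for all states sharing them. *)
Lemma coef_factor x z k : exists2 f, commutes f &
  forall x' y', same_right x x' -> same_right z y' -> coef x' k y' = f (bd x') (bd y').
Proof.
case: (boolP [&& active x k, smoothing z == [ffun l => (l == k) || smoothing x l] & lsign z == lsign x]) => [/and3P [act /eqP Es /eqP El]|N]; last first.
  exists (fun _ _ => 0); first exact: commutes0.
  move=> x' y' /same_rightP [e1 e2 _] /same_rightP [e3 e4 _]; apply: coef0; apply: contra N.
  by rewrite /active /resolves e1 e2 e3 e4 => /andP [-> /and3P [-> _ ->]].
(* z may have another left matching than x. It is replaced by a state y with the left matching of x,
   arbitrarily decorated on cleaved circles, so that the crossing leads from x to y. *)
have [w [Lw _]] : exists w : vertex n, lnk w = (lmatch x, rmatch z) /\ sgn w = [ffun=> true].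
  by apply: vertex_exists; apply/constant_onP => i j _; rewrite !ffunE.
have [y zy Ey] := @same_right_state n D z w (congr1 snd Lw).
have [y1 y2 _] := same_rightP _ _ zy.
have res : resolves x k y.
  rewrite /resolves y1 y2 Es El !eqxx andbT /=.
  by rewrite -[lmatch y]/(lnk (bd y)).1 Ey Lw eqxx.
(* If the left matchings of [x'] and [y'] differ, both sides vanish; otherwise the crossing leads
   from [x'] to [y']. *)
have lm f : (forall v u : vertex n, (lnk u).1 <> (lnk v).1 -> f v u = 0) ->
    (forall x' y', same_right x x' -> same_right y y' -> active x' k -> resolves x' k y' ->
      coef x' k y' = f (bd x') (bd y')) ->
    forall x' y', same_right x x' -> same_right z y' -> coef x' k y' = f (bd x') (bd y').
  move=> f0 H x' y' xx' zy'.
  have yy' : same_right y y'.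
    have [a1 a2 a3] := same_rightP _ _ zy'; have [b1 b2 b3] := same_rightP _ _ (same_right_sym zy).
    apply/same_rightP; split; rewrite ?a1 ?a2 ?b1 ?b2 // => p fp; rewrite a3 ?b3 //.
    by rewrite (free_smoothing p b1).
  have [e1 e2 _] := same_rightP _ _ xx'; have [e3 e4 _] := same_rightP _ _ zy'.
  have act' : active x' k by rewrite /active e1.
  have [Em|/eqP Nm] := eqVneq (lmatch y') (lmatch x').
    by apply: H => //; rewrite /resolves e1 e2 e3 e4 Es El Em !eqxx.
  rewrite f0 //; apply: coef0; rewrite act' /=; apply/negP => /res_lmatch; exact: Nm.
have idem0 v u : (lnk u).1 <> (lnk v).1 -> (if u == v then idem v else 0) = 0 :> BG n.
  by case: eqP => // ->.
have [f|rb|[r [r' [t [feet rt f]]]]] := crossing_cases act res.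
- have [fy1 fy2] : free y (foot1 k) /\ free y (foot2 k).
    have [a [a2 [d [d2 [ex _ [f1 f2] [f1' f2']]]]]] := res_bits act res.
    move: f ex; rewrite f1 f2 f1' f2'.
    by case: (a); case: (a2); case: (d); case: (d2).
  pose C := agree_strands x y k && mult_rule (same_strand x (foot1 k) (foot2 k))
     (esign x (foot1 k)) (esign x (foot2 k)) (esign y (foot1 k)) (esign y (foot2 k)).
  have fre x' y' : same_right x x' -> same_right y y' -> active x' k -> resolves x' k y' ->
      coef x' k y' = if C then if bd y' == bd x' then idem (bd x') else 0 else 0.
    move=> xx' yy' act' res'; have [e1 e2 e3] := same_rightP _ _ xx'.
    have [e4 e5 e6] := same_rightP _ _ yy'.
    have f' : free x' (foot1 k) && free x' (foot2 k) by rewrite !(free_smoothing _ e1).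
    rewrite (coef_free act' res' f') (agree_strands_right act res xx' yy').
    case/andP: f => f1 f2; rewrite (strand_smoothing e1) !e3 // !e6 // andbA -/C.
    by case: (C).
  case: (boolP C) => HC.
    exists (fun v w => if w == v then idem v else 0); first exact: commutes_idem.
    by apply: (lm (fun v w => if w == v then idem v else 0)) => // x' y' h1 h2 h3 h4; rewrite fre // HC.
  exists (fun _ _ => 0); first exact: commutes0.
  by apply: (lm (fun _ _ => 0)) => [//|x' y' h1 h2 h3 h4]; rewrite fre // (negPf HC).
- have [eS br sg _] := bridge_boundary act res rb.
  have brdg x' y' : same_right x x' -> same_right y y' -> active x' k -> resolves x' k y' ->
      coef x' k y' = if agree_free x y then edge (bd x') (Br false (right_arcs x k)) (bd y') else 0.
    move=> xx' yy' act' res'; have [e1 e2 e3] := same_rightP _ _ xx'.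
    have rb' : right_bridge x' k.
      by move: rb; rewrite /right_bridge act act' (strand_smoothing e1) !(free_smoothing _ e1).
    have [eS' _ _ _] := bridge_boundary act' res' rb'.
    rewrite (coef_bridge act' res' rb') -eS' (agree_strands_right act res xx' yy') eS.
    by rewrite {1}/right_arcs (strand_smoothing e1).
  case: (boolP (agree_free x y)) => C.
    exists (fun v w => edge v (Br false (right_arcs x k)) w); first exact: commutes_bridge.
    apply: (lm (fun v w => edge v (Br false (right_arcs x k)) w)) => [v u N|x' y' h1 h2 h3 h4]; last by rewrite brdg // C.
    by apply: edge0; apply/negP => /bridge_lnk Eu; apply: N; rewrite Eu.
  exists (fun _ _ => 0); first exact: commutes0.
  by apply: (lm (fun _ _ => 0)) => [//|x' y' h1 h2 h3 h4]; rewrite brdg // (negPf C).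
pose u := if same_strand x (foot1 k) (foot2 k) then ~~ esign y r' else esign x r'.
have arc x' y' : same_right x x' -> same_right y y' -> active x' k -> resolves x' k y' ->
    coef x' k y' = if agree_strands x y k then
      if u then if bd y' == bd x' then idem (bd x') else 0
      else edge (bd x') (De false (circ (lnk (bd x')) t)) (bd y') else 0.
  move=> xx' yy' act' res'; have [e1 e2 e3] := same_rightP _ _ xx'.
  have [e4 e5 e6] := same_rightP _ _ yy'.
  have rt' : same_strand x' r (inl t) by rewrite (strand_smoothing e1).
  have f' : if same_strand x' (foot1 k) (foot2 k) then free y' r' else free x' r'.
    by rewrite (strand_smoothing e1) !(free_smoothing _ e1) !(free_smoothing _ e4).
  rewrite (coef_arc act' res' feet rt' f') (agree_strands_right act res xx' yy').
  rewrite (strand_smoothing e1) /u; case: (same_strand x (foot1 k) (foot2 k)) f => f.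
    by rewrite e6.
  by rewrite e3.
case: (boolP (agree_strands x y k)) => C; last first.
  exists (fun _ _ => 0); first exact: commutes0.
  by apply: (lm (fun _ _ => 0)) => [//|x' y' h1 h2 h3 h4]; rewrite arc // (negPf C).
case: (boolP u) => U.
  exists (fun v w => if w == v then idem v else 0); first exact: commutes_idem.
  by apply: (lm (fun v w => if w == v then idem v else 0)) => // x' y' h1 h2 h3 h4; rewrite arc // C U.
exists (rdec t); first exact: commutes_rdec.
apply: (lm (rdec t)) => [v w' N|x' y' h1 h2 h3 h4]; last by rewrite arc // C (negPf U).
by apply: edge0; apply/negP => /decoration_lnk Eu; apply: N; rewrite Eu.
Qed.

Lemma crossing_left x k z :
  \sum_y coef x k y * left_coef y z = \sum_y left_coef x y * coef y k z.
Proof.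
have [f cf H] := coef_factor x z k.
have Er y : same_right z y = same_right y z by apply/idP/idP; exact: same_right_sym.
pose g w := f (bd x) w * left_step w (bd z).
pose h w := left_step (bd x) w * f w (bd z).
have L : \sum_y coef x k y * left_coef y z = \sum_w g w.
  apply: (@etrans _ _ (\sum_(y | same_right z y) g (bd y))).
    apply: esym; apply: etrans (big_mkcond _ _) _; apply: eq_bigr => y _; rewrite /left_coef -Er.
    case: ifP => [zy|_]; last exact/esym/mulr0.
    by rewrite (H x y (same_right_refl x) zy).
  apply: etrans (transfer z g) _; apply: etrans (big_mkcond _ _) _; apply: eq_bigr => w _.
  case: eqP => // N; apply: esym; rewrite /g; apply: etrans (congr1 _ _) (mulr0 _).
  by apply: contrapT => /left_step_right; rewrite lnk_bd => /esym.
have R : \sum_y left_coef x y * coef y k z = \sum_w h w.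
  apply: (@etrans _ _ (\sum_(y | same_right x y) h (bd y))).
    apply: esym; apply: etrans (big_mkcond _ _) _; apply: eq_bigr => y _; rewrite /left_coef.
    case: ifP => [xy|_]; last exact/esym/mul0r.
    by rewrite (H y z xy (same_right_refl z)).
  apply: etrans (transfer x h) _; apply: etrans (big_mkcond _ _) _; apply: eq_bigr => w _.
  case: eqP => // N; apply: esym; rewrite /h; apply: etrans (congr1 (fun a => a * _) _) (mul0r _).
  by apply: contrapT => /left_step_right; rewrite lnk_bd.
exact: etrans L (etrans (cf _ _) (esym R)).
Qed.
End CrossingLeft.

Lemma four_sum (V : zmodType) (a b b' z d : V) :
  a = d -> b + b' = 0 -> z = 0 -> a + b + (b' + z) = d.
Proof. by move=> -> E ->; rewrite addr0 -addrA E addr0. Qed.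

(** * The square of the left part and the differential of Gamma *)

Section LeftSquare.
Variable n : nat.
Implicit Types v w u : vertex n.

Definition dual_sum v u : BG n := \sum_A \sum_w edge v (Br true A) w * edge w (Br true A) u.

Lemma lbridge_ldec v u : \sum_w lbridge v w * ldec w u + \sum_w ldec v w * lbridge w u = 0.
Proof.
have E1 := mull_sum_exch (fun A w => edge v (Br true A) w) (fun w => ldec w u).
have E2 := mulr_sum_exch (fun A w => edge w (Br true A) u) (ldec v).
apply: etrans (congr2 +%R E1 E2) _; apply: etrans (esym (sum_add _ _)) _.
apply: big1 => A _; have := ldec_bridge true A v u; rewrite /= mulz_sg0 => H.
by apply: etrans (addrC _ _) H.
Qed.

Lemma left_step_square v u : \sum_w left_step v w * left_step w u = dual_sum v u.
Proof.
have E w : left_step v w * left_step w u =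
    (lbridge v w * lbridge w u + lbridge v w * ldec w u) + (ldec v w * lbridge w u + ldec v w * ldec w u).
  by rewrite /left_step mulrDl !mulrDr.
apply: etrans (eq_bigr _ (fun w _ => E w)) _; apply: etrans (sum_add _ _) _.
apply: etrans (congr2 +%R (sum_add _ _) (sum_add _ _)) _.
exact: four_sum (lbridge_lbridge v u) (lbridge_ldec v u) (ldec_ldec v u).
Qed.

Lemma dual_sum_edge v u : dual_sum v u <> 0 -> exists C, is_edge v (De true C) u.
Proof.
move=> N; apply: contrapT => nC; apply: N; apply: big1 => A _; apply: big1 => w _.
apply: edge_mul0; apply/negP => /andP [e1 e2]; apply: nC; exact: dual_drop e1 e2.
Qed.

Variable dG : BG n -> BG n.
Hypothesis HdG : is_dGamma dG.

Lemma dGD a b : dG (a + b) = dG a + dG b. Proof. by case: HdG. Qed.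
Lemma dG0 : dG 0 = 0.
Proof. by apply: (addrI (dG 0)); rewrite -dGD !addr0. Qed.
Lemma dGN a : dG (- a) = - dG a.
Proof. by apply: (addrI (dG a)); rewrite -dGD !subrr dG0. Qed.
Lemma dG_sum (T : finType) (F : T -> BG n) : dG (\sum_t F t) = \sum_t dG (F t).
Proof. exact: (big_morph dG dGD dG0). Qed.
Lemma dG_mulz a (z : int) : dG (a *~ z) = dG a *~ z.
Proof.
have N (k : nat) : dG (a *+ k) = dG a *+ k.
  by elim: k => [|k IH]; rewrite ?mulr0n ?dG0 // !mulrS dGD IH.
by case: z => k; rewrite ?NegzE ?mulrNz -!pmulrn ?dGN N.
Qed.

(** The ends of a decoration edge determine its circle, so at most one term of [ldec] exists, and
    its differential is minus the whole dual sum. Without such an edge, [dual_drop] makes the dual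
    sum empty. *)
Lemma dG_left_step v u : dG (left_step v u) = - dual_sum v u.
Proof.
case: (HdG) => _ _ dBr dDe _; rewrite /left_step dGD /lbridge /ldec !dG_sum.
have -> : \sum_A dG (edge v (Br true A) u) = 0 by apply: big1 => A _; case: (dBr v true A u).
rewrite add0r; case: (pselect (exists C, is_edge v (De true C) u)) => [[C e]|nC].
  rewrite (@sum_single _ _ (fun B => dG (edge v (De true B) u)) C); first exact: dDe.
  move=> B BC; rewrite edge0 ?dG0 //; apply: contra BC => e'.
  by rewrite (dec_drop e) (dec_drop e').
have -> : dual_sum v u = 0 by apply: contrapT => /dual_sum_edge.
rewrite oppr0; apply: big1 => C _; rewrite edge0 ?dG0 //; apply/negP => e; apply: nC.
by exists C.
Qed.
End LeftSquare.

Section PointSums.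
Variables (T I : finType) (V : zmodType).

Lemma ffun_mulz (F : {ffun T -> V}) (s : int) t : (F *~ s) t = F t *~ s.
Proof. by case: s => k; rewrite ?NegzE ?mulrNz ?ffunE -!pmulrn ffunMnE. Qed.

Lemma point_sum (Q : pred I) (P : I -> pred T) (F : I -> T -> {ffun T -> V})
    (h : I -> T -> V) (s : I -> int) z :
  (forall i y, F i y z = if z == y then h i z else 0) ->
  (\sum_(i | Q i) \sum_(y | P i y) F i y *~ s i) z =
  \sum_i (if Q i && P i z then h i z else 0) *~ s i.
Proof.
move=> HF; rewrite sum_ffunE [LHS]big_mkcond; apply: eq_bigr => i _.
case: (Q i) => /=; last by rewrite mul0rz.
rewrite sum_ffunE big_mkcond /= (@sum_single _ _ _ z).
  by rewrite ffun_mulz HF eqxx; case: (P i z); rewrite ?mul0rz.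
by move=> y yz; rewrite ffun_mulz HF eq_sym (negPf yz) mul0rz if_same.
Qed.

Lemma five_sum (p1 p2 p3 p4 p5 r l : V) : p1 + p2 + p4 = r -> p3 + p5 = l ->
  p1 + p2 + p3 + p4 + p5 = r + l.
Proof. by move=> <- <-; rewrite -!addrA; congr (_ + (_ + _)); rewrite addrCA. Qed.
Lemma opposite_sum (a b : V) i j : a = b -> odd i = ~~ odd j -> a *~ sg i + b *~ sg j = 0.
Proof. by move=> E1 E2; rewrite (opposite_signs E1 E2) addNr. Qed.
Lemma square_sum (a b c d e : V) : a = 0 -> b + c = 0 -> d = e -> a + b + (c + d) = e.
Proof. by move=> -> E ->; rewrite add0r addrA E add0r. Qed.
End PointSums.

Lemma expand_product (R : pzRingType) (a b c d : R) :
  (a + b) * (c + d) = (a * c + a * d) + (b * c + b * d).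
Proof. by rewrite mulrDl !mulrDr. Qed.

(** * Assembling the structure equation *)

Section Delta.
Variables (n : nat) (D : diagram n).
Notation c := (ncr D).
Implicit Types (x y z : state D) (k l : 'I_c).

Lemma tensE (a : BG n) y z : tens a y z = if z == y then a * idem (bd y) else 0.
Proof. exact: (ffunE (fun z => if z == y then a * idem (bd y) else 0) z). Qed.

Lemma tens_at (h : state D -> BG n) y z :
  tens (h y) y z = if z == y then h z * idem (bd z) else 0.
Proof. by rewrite tensE; case: eqP => [->|_]; exact: erefl. Qed.

Lemma BstatesD (F G : Bstates D) z : (F + G) z = F z + G z.
Proof. exact: ffunE. Qed.

Lemma delta_genE x z : delta_gen x z = right_coef x z + left_coef x z *~ sg (hdeg x).
Proof.
pose P1 : Bstates D := \sum_(k | active x k) \sum_(y | in_D x k y) tens (idem (bd x)) y *~ sg (later x k).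
pose P2 : Bstates D := \sum_(k | right_bridge x k) \sum_(y | resolves x k y && agree_free x y)
     tens (edge (bd x) (Br false (right_arcs x k)) (bd y)) y *~ sg (later x k).
pose P3 : Bstates D := \sum_(A | is_bridge (lmatch x) A)
    \sum_(y : state D | [&& smoothing y == smoothing x, lmatch y == surg (lmatch x) A &
                  agree_free x y])
     tens (edge (bd x) (Br true A) (bd y)) y *~ sg (hdeg x).
pose P4 : Bstates D := \sum_(k | active x k) \sum_(y : state D | in_dec x k y)
     tens (edge (bd x) (De false (foot_circle x k)) (bd y)) y *~ sg (later x k).
pose P5 : Bstates D := \sum_(C in cir (lnk (bd x)) | [forall p in C, sgn (bd x) p])
    \sum_(y : state D | [&& smoothing y == smoothing x, lmatch y == lmatch x,
                  agree_free x y &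
                  sgn (bd y) == [ffun p => (p \notin C) && sgn (bd x) p]])
     tens (edge (bd x) (De true C) (bd y)) y *~ sg (hdeg x).
have -> : delta_gen x = P1 + P2 + P3 + P4 + P5 by [].
rewrite !BstatesD.
(* The first, second and fourth sums run over crossings, the third and fifth over left labels. *)
apply: five_sum.
  pose h1 (k : 'I_c) (w : state D) := idem (bd x) * idem (bd w).
  pose h2 (k : 'I_c) (w : state D) := edge (bd x) (Br false (right_arcs x k)) (bd w) * idem (bd w).
  pose h3 (k : 'I_c) (w : state D) := edge (bd x) (De false (foot_circle x k)) (bd w) * idem (bd w).
  have E1 := @point_sum _ _ _ (active x) (fun k => in_D x k) (fun k y => tens (idem (bd x)) y) h1 (fun k => sg (later x k)) z.
  have E2 := @point_sum _ _ _ (right_bridge x) (fun k y => resolves x k y && agree_free x y) (fun k y => tens (edge (bd x) (Br false (right_arcs x k)) (bd y)) y) h2 (fun k => sg (later x k)) z.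
  have E3 := @point_sum _ _ _ (active x) (fun k => in_dec x k) (fun k y => tens (edge (bd x) (De false (foot_circle x k)) (bd y)) y) h3 (fun k => sg (later x k)) z.
    apply: etrans (congr2 +%R (congr2 +%R (E1 _) (E2 _)) (E3 _)) _.
  - by move=> k y; exact: (tens_at (fun _ => idem (bd x))).
  - by move=> k y; exact: (tens_at (fun w => edge (bd x) (Br false (right_arcs x k)) (bd w))).
  - by move=> k y; exact: (tens_at (fun w => edge (bd x) (De false (foot_circle x k)) (bd w))).
  apply: etrans (congr2 +%R (esym (sum_add _ _)) erefl) _; apply: etrans (esym (sum_add _ _)) _.
  apply: eq_bigr => k _; rewrite -!mulrzDl; congr (_ *~ _).
  by rewrite /coef /h1 /h2 /h3 !edge_idem.
pose h1 (A : {set 'I_n.*2}) (w : state D) := edge (bd x) (Br true A) (bd w) * idem (bd w).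
pose h2 (C : {set 'I_n.*2}) (w : state D) := edge (bd x) (De true C) (bd w) * idem (bd w).
have E1 := @point_sum _ _ _ (is_bridge (lmatch x))
  (fun A y => [&& smoothing y == smoothing x, lmatch y == surg (lmatch x) A & agree_free x y])
  (fun A y => tens (edge (bd x) (Br true A) (bd y)) y) h1 (fun A => sg (hdeg x)) z.
have E2 := @point_sum _ _ _ (fun C => (C \in cir (lnk (bd x))) && [forall p in C, sgn (bd x) p])
  (fun C y => [&& smoothing y == smoothing x, lmatch y == lmatch x, agree_free x y &
                  sgn (bd y) == [ffun p => (p \notin C) && sgn (bd x) p]])
  (fun C y => tens (edge (bd x) (De true C) (bd y)) y) h2 (fun A => sg (hdeg x)) z.
apply: etrans (congr2 +%R (E1 _) (E2 _)) _.
- by move=> A y; exact: (tens_at (fun w => edge (bd x) (Br true A) (bd w))).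
- by move=> C y; exact: (tens_at (fun w => edge (bd x) (De true C) (bd w))).
apply: etrans (esym (congr2 +%R (mulrz_suml _ _ _ _) (mulrz_suml _ _ _ _))) _.
apply: etrans (esym (mulrzDl _ _ _)) _; congr (_ *~ _).
rewrite /left_coef /same_right /left_step /lbridge /ldec; case: ifP => [/andP [/eqP e1 e2]|N]; last first.
  have N' (b1 : bool) : [&& smoothing z == smoothing x, b1 & agree_free x z] = false.
    by move: N; case: (smoothing z == smoothing x) => //= ->; rewrite andbF.
  have N2 (b1 b2 : bool) : [&& smoothing z == smoothing x, b1, agree_free x z & b2] = false.
    by move: N; case: (smoothing z == smoothing x) => //= ->; rewrite andbF.
  apply: etrans _ (addr0 0); congr (_ + _); apply: big1 => A _; by rewrite ?N' ?N2 andbF.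
(* [left_step] sums over all labels; those excluded by the conditions of [delta_gen] carry no edge
   to z. *)
congr (_ + _); apply: eq_bigr => A _; rewrite /h1 /h2 edge_idem e1 eqxx e2 /=.
  case: ifP => // /negbT N; apply: esym; apply: edge0; apply: contra N => e.
  have br : is_bridge (lmatch x) A := bridge_is_bridge e; rewrite br andbT.
  by rewrite -[lmatch z]/(lnk (bd z)).1 (bridge_lnk e) eqxx.
case: ifP => // /negbT N; apply: esym; apply: edge0; apply: contra N.
case/and4P=> -> -> /eqP L ->; rewrite andbT /=.
by rewrite -[lmatch z]/(lnk (bd z)).1 L eqxx.
Qed.

Lemma hdeg_step x k y : active x k -> resolves x k y -> hdeg y = (hdeg x).+1.
Proof.
move=> ax /and3P [/eqP Ey _ _]; rewrite /hdeg Ey.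
rewrite (_ : [set l | _] = k |: [set l | smoothing x l]); last first.
  by apply/setP => l; rewrite !inE ffunE.
by rewrite cardsU1 inE; move: ax; rewrite /active => ->.
Qed.

Lemma same_right_hdeg x y : same_right x y -> hdeg y = hdeg x.
Proof. by case/same_rightP => e _ _; rewrite /hdeg e. Qed.
Lemma same_right_later x y k : same_right x y -> later y k = later x k.
Proof. by case/same_rightP => e _ _; rewrite /later e. Qed.

(** A crossing raises the degree h by one, so the sign of the left part turns commutation into
    cancellation. *)
Lemma right_left x z :
  \sum_y right_coef x y * (left_coef y z *~ sg (hdeg y)) +
  \sum_y left_coef x y *~ sg (hdeg x) * right_coef y z = 0.
Proof.
pose G k := \sum_y coef x k y * left_coef y z.
pose H k := \sum_y left_coef x y * coef y k z.
have E1 : \sum_y right_coef x y * (left_coef y z *~ sg (hdeg y)) =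
    \sum_k G k *~ sg (later x k + (hdeg x).+1).
  apply: (@etrans _ _ (\sum_k \sum_y (coef x k y * left_coef y z) *~ sg (later x k + (hdeg x).+1))); last first.
    by apply: eq_bigr => k _; exact/esym/mulrz_suml.
  apply: etrans _ (exchange_big _ _ _ _ _ _); apply: eq_bigr => y _.
  apply: etrans (mulr_suml _ _ _ _) _; apply: eq_bigr => k _.
  have := coef_edge x k y; case: ifP => [/and3P [ax rx _] _|_ ->].
    by rewrite (hdeg_step ax rx) mulrzAl mulrzAr mulz_sgD addnC.
  by rewrite mul0rz !mul0r mul0rz.
have E2 : \sum_y left_coef x y *~ sg (hdeg x) * right_coef y z =
    \sum_k H k *~ sg (later x k + hdeg x).
  apply: (@etrans _ _ (\sum_k \sum_y (left_coef x y * coef y k z) *~ sg (later x k + hdeg x))); last first.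
    by apply: eq_bigr => k _; exact/esym/mulrz_suml.
  apply: etrans _ (exchange_big _ _ _ _ _ _); apply: eq_bigr => y _.
  apply: etrans (mulr_sumr _ _ _ _) _; apply: eq_bigr => k _.
  rewrite mulrzAl mulrzAr mulz_sgD; case: (boolP (same_right x y)) => [xy|N].
    by rewrite (same_right_later k xy).
  by rewrite /left_coef (negPf N) mul0r !mul0rz.
apply: etrans (congr2 +%R E1 E2) _; apply: etrans (esym (sum_add _ _)) _; apply: big1 => k _.
by apply: opposite_sum (crossing_left x k z) _; rewrite addnS.
Qed.

Lemma left_left x z : \sum_y left_coef x y *~ sg (hdeg x) * (left_coef y z *~ sg (hdeg y)) =
  if same_right x z then dual_sum (bd x) (bd z) else 0.
Proof.
pose g w := left_step (bd x) w * left_step w (bd z).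
apply: (@etrans _ _ (\sum_(y | same_right x y) (if same_right x z then g (bd y) else 0))).
  apply: esym; apply: etrans (big_mkcond _ _) _; apply: eq_bigr => y _; rewrite /left_coef.
  case: (boolP (same_right x y)) => xy; last by rewrite mul0rz mul0r.
  (* Left edges preserve h, so both factors carry the same sign. *)
  rewrite (same_right_hdeg xy) mulrzAl mulrzAr sgK.
  have -> : same_right y z = same_right x z.
    have [a1 a2 a3] := same_rightP _ _ xy.
    apply/same_rightP/same_rightP => -[b1 b2 b3]; split; rewrite ?b1 ?b2 ?a1 ?a2 // => p fp.
      by rewrite b3 ?a3 // (free_smoothing p a1).
    by rewrite (free_smoothing p a1) in fp; rewrite b3 ?a3.
  by rewrite /g; case: (same_right x z); rewrite ?mulr0.
case: ifP => [xz|_]; last by apply: big1.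
apply: etrans (transfer x g) _; apply: etrans _ (left_step_square _ _).
apply: etrans (big_mkcond _ _) _; apply: eq_bigr => w _.
case: eqP => // N; apply: esym; rewrite /g; apply: etrans (congr1 (fun a => a * _) _) (mul0r _).
by apply: contrapT => /left_step_right; rewrite lnk_bd.
Qed.

Variable dG : BG n -> BG n.
Hypothesis HdG : is_dGamma dG.

Lemma dG_right_coef x z : dG (right_coef x z) = 0.
Proof.
rewrite /right_coef (dG_sum HdG); apply: big1 => k _; rewrite (dG_mulz HdG).
have -> : dG (coef x k z) = 0; last exact: mul0rz.
case: HdG => _ did dBr _ _.
have := coef_edge x k z; case: ifP => _; last by move=> ->; exact: dG0 HdG.
case=> [_|C _|A _]; first exact: did.
  by have [] := dBr (bd x) false C (bd z).
by have [] := dBr (bd x) false A (bd z).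
Qed.

Lemma delta_gen_square x z :
  \sum_y delta_gen x y * delta_gen y z + dG (delta_gen x z) *~ sg (hdeg z) = 0.
Proof.
pose L x z := left_coef x z *~ sg (hdeg x).
have E y : delta_gen x y * delta_gen y z =
    (right_coef x y * right_coef y z + right_coef x y * L y z) + (L x y * right_coef y z + L x y * L y z).
  apply: etrans (congr2 *%R (delta_genE x y) (delta_genE y z)) _; exact: expand_product.
have -> : \sum_y delta_gen x y * delta_gen y z = if same_right x z then dual_sum (bd x) (bd z) else 0.
  apply: etrans (eq_bigr _ (fun y _ => E y)) _; apply: etrans (sum_add _ _) _.
  apply: etrans (congr2 +%R (sum_add _ _) (sum_add _ _)) _.
  exact: square_sum (right_right x z) (right_left x z) (left_left x z).
rewrite delta_genE (dGD HdG) dG_right_coef add0r (dG_mulz HdG) /left_coef.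
case: (boolP (same_right x z)) => xz; last by rewrite (dG0 HdG) !mul0rz addr0.
by rewrite (same_right_hdeg xz) sgK (dG_left_step HdG) subrr.
Qed.

Lemma delta_square (f : states D) : mu_delta (delta f) + d_sgn dG (delta f) = 0.
Proof.
have evD (y : state D) : delta f y = \sum_x delta_gen x y *~ f x.
  by rewrite /delta sum_ffunE; apply: eq_bigr => x _; exact: ffun_mulz.
apply/ffunP => z; rewrite !ffunE /mu_delta sum_ffunE.
apply: etrans (congr2 +%R _ _) (_ : \sum_x (\sum_y delta_gen x y * delta_gen y z) *~ f x + \sum_x (dG (delta_gen x z) *~ sg (hdeg z)) *~ f x = 0).
- apply: (@etrans _ _ (\sum_x \sum_y (delta_gen x y * delta_gen y z) *~ f x)); last first.
    by apply: eq_bigr => x _; exact/esym/mulrz_suml.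
  apply: etrans _ (exchange_big _ _ _ _ _ _); apply: eq_bigr => y _.
  rewrite ffunE evD; apply: etrans (mulr_suml _ _ _ _) _; apply: eq_bigr => x _; exact: mulrzAl.
- rewrite evD (dG_sum HdG); apply: etrans (mulrz_suml _ _ _ _) _; apply: eq_bigr => x _.
  by rewrite (dG_mulz HdG) -!mulrzA mulrC.
apply: etrans (esym (sum_add _ _)) _; apply: big1 => x _.
by rewrite -mulrzDl delta_gen_square mul0rz.
Qed.
End Delta.

Theorem theorem43 (n : nat) (T : diagram n) (dG : BG n -> BG n)
    (HdG : is_dGamma dG) (f : states T) :
  mu_delta (delta f) + d_sgn dG (delta f) = 0.
Proof. exact: delta_square. Qed.
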